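(* Let $\Theta=(a,b)\subset\mathbb{R}$ be a bounded open interval, let $S(\vartheta,t,x)$ and $\sigma(t,x)$ be known functions satisfying conditions $\mathcal{C}1$, $\mathcal{C}2$, $\mathcal{C}3$, $\mathcal{C}4$ written out in the context, and let the null hypothesis $\mathscr{H}_0$ be that the observed process $X^\varepsilon=(X_t,\,0\le t\le T)$ satisfies, for some $\vartheta\in\Theta$, $$\mathrm{d}X_t=S(\vartheta,t,X_t)\,\mathrm{d}t+\varepsilon\,\sigma(t,X_t)\,\mathrm{d}W_t,\qquad X_0=x_0,\ 0\le t\le T .$$ Let $\delta_\varepsilon$ be the statistic (a function of $X^\varepsilon$) defined in the context, let $\alpha\in(0,1)$, let $\delta=\int_0^1B(s)^2\,\mathrm{d}s$ with $B$ a standard Brownian bridge on $[0,1]$, and let $c_\alpha$ be defined by $\mathbf{P}\{\delta>c_\alpha\}=\alpha$. Then the test $\hat\psi_\varepsilon=\mathbf{1}_{\{\delta_\varepsilon>c_\alpha\}}$ is asymptotically distribution-free (the limit distribution of $\delta_\varepsilon$ under $\mathscr{H}_0$ as $\varepsilon\to0$ exists and does not depend on $S$, $\sigma$ and $\vartheta$) and has asymptotic size $\alpha$, i.e. $$\lim_{\varepsilon\to0}\mathbf{E}_\vartheta\hat\psi_\varepsilon=\alpha\qquad\text{for all }\vartheta\in\Theta .$$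
   Context: Setting. $T>0$ and $x_0\in\mathbb{R}$ are fixed and deterministic, $W$ is a standard Wiener process, $\varepsilon\in(0,1)$ and the asymptotics is $\varepsilon\to0$. $\mathbf{E}_\vartheta$ is expectation when $X^\varepsilon$ solves the equation with parameter $\vartheta$. The functions $S(\vartheta,t,x)$ and $\sigma(t,x)$ are strictly positive and smooth (in the sense of the conditions below). A prime denotes the derivative in $x$, a prime with subscript $t$ or $s$ the derivative in the time argument, a dot the derivative in $\vartheta$. For $\vartheta\in\Theta$, $x_t=x_t(\vartheta)$ is the solution of $\frac{\mathrm{d}x_t}{\mathrm{d}t}=S(\vartheta,t,x_t)$, $0\le t\le T$, with initial value $x_0$. Conditions. - $\mathcal{C}1$: there is a constant $L$ with $|S(\vartheta,t,x)-S(\vartheta,t,y)|+|\sigma(t,x)-\sigma(t,y)|\le L|x-y|$ and $|S(\vartheta,t,x)|+|\sigma(t,x)|\le L(1+|x|)$. - $\mathcal{C}2$: $\inf_{0\le t\le T,\,x}\sigma(t,x)^2>0$. - $\mathcal{C}3$: $S(\vartheta,t,x)$ and $\sigma(t,x)$ have two continuous bounded derivatives w.r.t. $x$, and $S(\vartheta,t,x)$ has two continuous bounded derivatives w.r.t. $\vartheta$; for every $\nu>0$, with $x_t=x_t(\vartheta_0)$, $$\inf_{\vartheta_0\in\Theta}\ \inf_{|\vartheta-\vartheta_0|>\nu}\int_0^T\Big(\frac{S(\vartheta,t,x_t)-S(\vartheta_0,t,x_t)}{\sigma(t,x_t)}\Big)^2\mathrm{d}t>0;$$ and the Fisher information $\mathrm{I}(\vartheta)=\int_0^T\frac{\dot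 S(\vartheta,t,x_t(\vartheta))^2}{\sigma(t,x_t(\vartheta))^2}\,\mathrm{d}t$ satisfies $\inf_{\vartheta\in\Theta}\mathrm{I}(\vartheta)>0$. - $\mathcal{C}4$: $S(\vartheta,t,x)$, $\dot S(\vartheta,t,x)$ and $\sigma(t,x)$ have continuous bounded derivatives w.r.t. $t\in[0,T]$. Maximum likelihood estimator. $\hat\vartheta_\varepsilon$ is defined by $L(\hat\vartheta_\varepsilon,X^\varepsilon)=\sup_{\vartheta\in\Theta}L(\vartheta,X^\varepsilon)$, where $$L(\vartheta,X^\varepsilon)=\exp\Big\{\int_0^T\frac{S(\vartheta,t,X_t)}{\varepsilon^2\sigma(t,X_t)^2}\,\mathrm{d}X_t-\int_0^T\frac{S(\vartheta,t,X_t)^2}{2\varepsilon^2\sigma(t,X_t)^2}\,\mathrm{d}t\Big\}.$$ Test statistic. Put $$D(\vartheta,s,X_s)=S(\vartheta,s,x_s(\vartheta))+S'(\vartheta,s,X_s)\,(X_s-x_s(\vartheta)),$$ $$R(\vartheta,t,X^t)=\int_{x_0}^{X_t}\frac{\dot S(\vartheta,t,y)}{\sqrt{\mathrm{I}(\vartheta)}\,\sigma(t,y)^2}\,\mathrm{d}y-\int_0^t\int_{x_0}^{X_s}\frac{\dot S'_s(\vartheta,s,y)\,\sigma(s,y)-2\dot S(\vartheta,s,y)\,\sigma'_s(s,y)}{\sqrt{\mathrm{I}(\vartheta)}\,\sigma(s,y)^3}\,\mathrm{d}y\,\mathrm{d}s,$$ $$Q(\vartheta,t,X^t)=\int_0^t\frac{\dot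 S(\vartheta,s,X_s)\,D(\vartheta,s,X_s)}{\sqrt{\mathrm{I}(\vartheta)}\,\sigma(s,X_s)^2}\,\mathrm{d}s,$$ $$K_\varepsilon(\vartheta,t)=\varepsilon^{-1}\big[R(\vartheta,t,X^t)-Q(\vartheta,t,X^t)\big],\qquad h_\varepsilon(\vartheta,t)=\frac{\dot S(\vartheta,t,X_t)}{\sqrt{\mathrm{I}(\vartheta)}\,\sigma(t,X_t)},$$ $$\delta_\varepsilon=\int_0^TK_\varepsilon(\hat\vartheta_\varepsilon,t)^2\,h_\varepsilon(\hat\vartheta_\varepsilon,t)^2\,\mathrm{d}t .$$ *)

(* Defs.v *)
From HB Require Import structures.
From mathcomp Require Export all_boot all_order all_algebra.
From mathcomp Require Export all_classical all_reals all_analysis.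
Set Implicit Arguments.
Unset Strict Implicit.
Unset Printing Implicit Defensive.
Export Order.TTheory GRing.Theory Num.Theory.
Export numFieldNormedType.Exports.

Local Open Scope classical_set_scope.
Local Open Scope ring_scope.

Section Calculus.
Context {R : realType}.
Implicit Types (T t x : R) (f : R -> R) (g : R -> R -> R -> R).

(* The integral from u to v for either order of the bounds. *)
Definition oriented_integral (u v : R) f : R :=
  if u <= v then \int[lebesgue_measure]_(y in `[u, v]) f y
  else - \int[lebesgue_measure]_(y in `[v, u]) f y.

(* Derivative relative to [0, T], hence one-sided at the endpoints. *)
Definition slope f t : R -> R := fun s => (f s - f t) / (s - t).
Definition rel_nbhs T t : set_system R := within `[0, T] t^'.
Definition rel_derivable T f t : Prop := cvg (slope f t @ rel_nbhs T t).
Definition rel_derive T f t : R := lim (slope f t @ rel_nbhs T t).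

Definition d_x g : R -> R -> R -> R :=
  fun theta t x => derive1 (g theta t) x.
Definition d_theta g : R -> R -> R -> R :=
  fun theta t x => derive1 (fun u => g u t x) theta.
Definition d_t T g : R -> R -> R -> R :=
  fun theta t x => rel_derive T (fun s => g theta s x) t.

End Calculus.

Section Conditions.
Context {R : realType}.
Variables (T : R) (Theta : set R).
Implicit Types (g S : R -> R -> R -> R) (sigma : R -> R -> R).

(* Continuity is joint in (theta, t, x). *)
Definition cont_bounded g : Prop :=
  {within [set p : R * R * R | Theta p.1.1 /\ 0 <= p.1.2 <= T],
     continuous (fun p : R * R * R => g p.1.1 p.1.2 p.2)} /\
  exists M : R, forall theta t x : R, Theta theta -> 0 <= t <= T ->
    `|g theta t x| <= M.

Definition smooth_x g : Prop :=
  (forall theta t x : R, Theta theta -> 0 <= t <= T ->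
     derivable (g theta t) x 1) /\
  cont_bounded (d_x g).

Definition smooth_theta g : Prop :=
  (forall theta t x : R, Theta theta -> 0 <= t <= T ->
     derivable (fun u => g u t x) theta 1) /\
  cont_bounded (d_theta g).

Definition smooth_t g : Prop :=
  (forall theta t x : R, Theta theta -> 0 <= t <= T ->
     rel_derivable T (fun s => g theta s x) t) /\
  cont_bounded (d_t T g).

Definition ode_solution (x0 : R) (v : R -> R -> R) (x : R -> R) : Prop :=
  x 0 = x0 /\
  forall t : R, 0 <= t <= T -> slope x t @ rel_nbhs T t --> v t (x t).

Definition fisher S sigma (xs : R -> R -> R) (theta : R) : R :=
  \int[lebesgue_measure]_(t in `[0, T])
    (d_theta S theta t (xs theta t) ^+ 2 / sigma t (xs theta t) ^+ 2).

Definition condC1 S sigma : Prop := exists L : R,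
  (forall theta t x y : R, Theta theta -> 0 <= t <= T ->
     `|S theta t x - S theta t y| + `|sigma t x - sigma t y|
       <= L * `|x - y|) /\
  (forall theta t x : R, Theta theta -> 0 <= t <= T ->
     `|S theta t x| + `|sigma t x| <= L * (1 + `|x|)).

Definition condC2 sigma : Prop :=
  (0 < ereal_inf [set (sigma p.1 p.2 ^+ 2)%:E |
                   p in [set p : R * R | (0 <= p.1 <= T)%R]])%E.

(* The infima are taken in the extended reals, so that the infimum over an
   empty set of theta (large nu) is +oo. *)
Definition identifiable S sigma (xs : R -> R -> R) : Prop :=
  forall nu : R, 0 < nu ->
  (0 < ereal_inf [set
     ereal_inf [set
       (\int[lebesgue_measure]_(t in `[0, T])
          ((S theta t (xs theta0 t) - S theta0 t (xs theta0 t))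
             / sigma t (xs theta0 t)) ^+ 2)%R%:E
     | theta in [set theta | Theta theta /\ (nu < `|theta - theta0|)%R]]
   | theta0 in Theta])%E.

Definition condC3 S sigma (xs : R -> R -> R) : Prop :=
  [/\ smooth_x S /\ smooth_x (d_x S),
      smooth_x (fun=> sigma) /\ smooth_x (d_x (fun=> sigma)),
      smooth_theta S /\ smooth_theta (d_theta S),
      identifiable S sigma xs &
      (0 < ereal_inf [set (fisher S sigma xs theta)%:E | theta in Theta])%E].

Definition condC4 S sigma : Prop :=
  [/\ smooth_t S, smooth_t (d_theta S) & smooth_t (fun=> sigma)].

End Conditions.

Section StochasticIntegral.
Context {R : realType} {d : measure_display} {Omega : measurableType d}.
Variables (P : probability Omega R) (F : R -> set (set Omega)).

Definition filtration (T : R) : Prop :=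
  [/\ forall t : R, 0 <= t <= T -> sigma_algebra setT (F t),
      forall t : R, 0 <= t <= T -> F t `<=` measurable &
      forall s t : R, 0 <= s -> s <= t -> t <= T -> F s `<=` F t].

Definition measurable_at (t : R) (Y : Omega -> R) : Prop :=
  forall A : set R, measurable A -> F t (Y @^-1` A).

Definition wiener (T : R) (W : R -> Omega -> R) : Prop :=
  [/\ forall t : R, 0 <= t <= T -> measurable_at t (W t),
      forall w, {within `[0, T], continuous (fun t => W t w)},
      forall w, W 0 w = 0,
      forall s t : R, 0 <= s -> s < t -> t <= T -> forall A : set R, measurable A ->
        P ((fun w => W t w - W s w) @^-1` A)
          = normal_prob 0 (Num.sqrt (t - s)) A &
      forall s t : R, 0 <= s -> s < t -> t <= T ->
        forall (E : set Omega) (A : set R), F s E -> measurable A ->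
        P (E `&` (fun w => W t w - W s w) @^-1` A)
          = (P E * P ((fun w => W t w - W s w)%R @^-1` A))%E].

Record simple_process := SimpleProcess {
  sp_size : nat;
  sp_time : nat -> R;
  sp_coef : nat -> Omega -> R }.

(* The simple predictable process
   \sum_i xi_i 1_{]t_i, t_{i+1}]} on ]0, tau], with xi_i known at time t_i. *)
Definition sp_admissible (tau : R) (H : simple_process) : Prop :=
  [/\ sp_time H 0%N = 0, sp_time H (sp_size H) = tau,
      forall i, (i < sp_size H)%N -> sp_time H i <= sp_time H i.+1 &
      forall i, (i < sp_size H)%N -> measurable_at (sp_time H i) (sp_coef H i)].

Definition sp_value (H : simple_process) (s : R) (w : Omega) : R :=
  \sum_(i < sp_size H | sp_time H i < s <= sp_time H i.+1) sp_coef H i w.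

Definition sp_integral (H : simple_process) (Y : R -> Omega -> R)
    (w : Omega) : R :=
  \sum_(i < sp_size H)
    sp_coef H i w * (Y (sp_time H i.+1) w - Y (sp_time H i) w).

(* I = \int_0^tau H dY for a continuous adapted integrand H and a continuous
   semimartingale Y: the extension by continuity of the elementary integral,
   for uniform convergence in probability of the integrands on ]0, tau]. *)
Definition stoch_integral (tau : R) (H Y : R -> Omega -> R)
    (I : Omega -> R) : Prop :=
  measurable_fun setT I /\
  forall Hn : nat -> simple_process,
    (forall n, sp_admissible tau (Hn n)) ->
    (forall e : R, 0 < e ->
       P [set w | exists s : R, 0 < s <= tau /\ e < `|sp_value (Hn n) s w - H s w| ]
         @[n --> \oo] --> 0%E) ->
    forall e : R, 0 < e ->
      P [set w | e < `|sp_integral (Hn n) Y w - I w| ] @[n --> \oo] --> 0%E.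

Definition sde_solution (T x0 : R) (v sigma : R -> R -> R) (eps : R)
    (W X : R -> Omega -> R) : Prop :=
  [/\ forall t : R, 0 <= t <= T -> measurable_at t (X t),
      forall w, {within `[0, T], continuous (fun t => X t w)} &
      forall t : R, 0 <= t <= T -> exists I : Omega -> R,
        stoch_integral t (fun s w => sigma s (X s w)) W I /\
        {ae P, forall w, X t w =
           x0 + \int[lebesgue_measure]_(s in `[0, t]) v s (X s w)
              + eps * I w}].

End StochasticIntegral.

Section MaximumLikelihood.
Context {R : realType} {d : measure_display} {Omega : measurableType d}.
Variables (P : probability Omega R) (F : R -> set (set Omega)).
Variables (T : R) (Theta : set R).
Variables (S : R -> R -> R -> R) (sigma : R -> R -> R) (eps : R).
Variable X : R -> Omega -> R.

(* The stochastic integral in the likelihood is defined up to a null set for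
   each theta; the supremum over theta refers to its version J that is
   continuous in theta. *)
Definition likelihood_integral (J : R -> Omega -> R) : Prop :=
  (forall theta : R, Theta theta ->
     stoch_integral P F T
       (fun t w => S theta t (X t w) / (eps ^+ 2 * sigma t (X t w) ^+ 2))
       X (J theta)) /\
  forall w, {within Theta, continuous (fun theta => J theta w)}.

Definition likelihood (J : R -> Omega -> R) (theta : R) (w : Omega) : R :=
  expR (J theta w - \int[lebesgue_measure]_(t in `[0, T])
    (S theta t (X t w) ^+ 2 / (2 * eps ^+ 2 * sigma t (X t w) ^+ 2))).

(* Theta being open, the supremum may fail to be attained; on that event the
   estimator is an arbitrary point of Theta. *)
Definition mle (J : R -> Omega -> R) (theta_hat : Omega -> R) : Prop :=
  [/\ measurable_fun setT theta_hat,
      forall w, Theta (theta_hat w) &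
      {ae P, forall w,
        (exists2 theta, Theta theta & forall theta', Theta theta' ->
           likelihood J theta' w <= likelihood J theta w) ->
        likelihood J (theta_hat w) w
          = sup [set likelihood J theta w | theta in Theta]}].

End MaximumLikelihood.

Section TestStatistic.
Context {R : realType}.
Variables (T x0 : R) (S : R -> R -> R -> R) (sigma : R -> R -> R).
Variable xs : R -> R -> R.
Implicit Types (eps theta t s : R) (X : R -> R).

Let sqrtI theta : R := Num.sqrt (fisher T S sigma xs theta).
Let Sdot := d_theta S.
Let Sdot_t := d_t T (d_theta S).
Let sigma_t s y := d_t T (fun=> sigma) 0 s y.

Definition stat_D theta s (y : R) : R :=
  S theta s (xs theta s) + d_x S theta s y * (y - xs theta s).

Definition stat_R theta t X : R :=
  oriented_integral x0 (X t)
    (fun y => Sdot theta t y / (sqrtI theta * sigma t y ^+ 2))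
  - \int[lebesgue_measure]_(s in `[0, t])
      oriented_integral x0 (X s)
        (fun y => (Sdot_t theta s y * sigma s y
                     - 2 * Sdot theta s y * sigma_t s y)
                  / (sqrtI theta * sigma s y ^+ 3)).

Definition stat_Q theta t X : R :=
  \int[lebesgue_measure]_(s in `[0, t])
    (Sdot theta s (X s) * stat_D theta s (X s)
       / (sqrtI theta * sigma s (X s) ^+ 2)).

Definition stat_K eps theta t X : R :=
  eps^-1 * (stat_R theta t X - stat_Q theta t X).

Definition stat_h theta t X : R :=
  Sdot theta t (X t) / (sqrtI theta * sigma t (X t)).

Definition stat_delta eps theta X : R :=
  \int[lebesgue_measure]_(t in `[0, T])
    (stat_K eps theta t X ^+ 2 * stat_h theta t X ^+ 2).

End TestStatistic.

Section LimitLaw.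
Context {R : realType}.

(* normal_prob with zero deviation is not the Dirac mass. *)
Definition centered_gaussian (v : R) (A : set R) : \bar R :=
  if v == 0 then \d_(0 : R) A else normal_prob 0 (Num.sqrt v) A.

Definition brownian_bridge {d : measure_display} {Omega : measurableType d}
    (P : probability Omega R) (B : R -> Omega -> R) : Prop :=
  [/\ forall s : R, 0 <= s <= 1 -> measurable_fun setT (B s),
      forall w, {within `[0, 1], continuous (fun s => B s w)} &
      forall (n : nat) (s c : 'I_n -> R), (forall i, 0 <= s i <= 1) ->
      forall A : set R, measurable A ->
        P ((fun w => \sum_(i < n) c i * B (s i) w) @^-1` A)
          = centered_gaussian
              (\sum_(i < n) \sum_(j < n)
                 c i * c j * (Num.min (s i) (s j) - s i * s j)) A].

Definition bridge_functional {Omega : Type} (B : R -> Omega -> R)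
    (w : Omega) : R :=
  \int[lebesgue_measure]_(s in `[0, 1]) (B s w ^+ 2).

Definition cvg_law {d : measure_display} {Omega : measurableType d}
    (P : probability Omega R) (Y : R -> Omega -> R)
    (mu : probability (measurableTypeR R) R) : Prop :=
  forall f : R -> R, continuous f -> (exists M : R, forall x, `|f x| <= M) ->
    ('E_P[fun w => f (Y eps w)])%E @[eps --> (0 : R)^'+]
      --> (\int[mu]_x (f x)%:E)%E.

End LimitLaw.

(* Main.v *)
From HB Require Import structures.
Require Import Defs.
From mathcomp Require Import ring lra measurable_realfun.
Local Open Scope classical_set_scope.
Local Open Scope ring_scope.
Set Implicit Arguments.
Unset Strict Implicit.
Unset Printing Implicit Defensive.

                                                                        
                                                                           
                                                                              
                                                                              
                                                                      
                                                                             
                                                                       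
                                                                               
                                                                      
                                                 

(** Fix the true parameter [th0] and put u = (theta_hat - th0)/eps, G = Sdot/sigma^2, f = Sdot/sigma
    along the limit path, I_t = int_0^t f^2 and score_t = int_0^t f dW. The functional R is the
    stochastic integral of G against dX rewritten, up to order eps^2, without stochastic
    integration, and along the observed path D equals S(th0) + (theta_hat - th0) Sdot up to order
    eps^2. Hence sqrt(I_T) K_t is close to score_t - u I_t. The maximum likelihood estimator
    satisfies u = score_T/I_T + o(1) in probability, so that K_t is close to (score_t - (I_t/I_T)
    score_T)/sqrt(I_T). In the clock I_t/I_T this Gaussian process is a Brownian bridge, and h^2 dt
    is the differential of the same clock, so the statistic tends to int_0^1 B^2.

    The argument is carried out on a grid with about eps^-2 cells, where both the drift and the
    noise move X by about eps^2 in a cell. Stochastic integrals are limits in probability of grid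
    sums, and second moments pass to such limits ([isometry], [fatou_in_probability],
    [integral_sum_bound]). A discrete Gronwall barrier and a stopped sum keep X within O(eps) of the
    limit path ([exit_bound]). The cellwise expansion of R - Q is a statement about one fixed path
    ([path_stat_expansion]). The conditions give no x-derivative of Sdot, so G is not Lipschitz in
    x; a modulus adapted to the scale eps is obtained by interpolation between the Lipschitz
    theta-derivative and the continuity of S' in theta ([Sd_modulus]). As theta_hat anticipates the
    path, G is linearised in theta, which takes the random parameter out of the stochastic sums
    ([pathwise], [statistic_limit]).

    For the estimator, the log-likelihood ratio at th = th0 + eps v is exactly v Y - v^2 Phi/2,
    where Y is a stochastic integral of the slope (S(th) - S(th0))/(th - th0) ([ll_diff]). The
    second moments of the increments of Y in th are quadratic, and [dyadic_sobolev] turns this into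
    a uniform modulus: Y is bounded on all of Theta and close to the score near th0. Identifiability
    bounds Phi from below, so the maximum is attained within O(eps) of th0 and is nearly that of a
    parabola ([mle_maximizes], [mle_score]).

    What remains is a quadratic form in Wiener increments. Its coefficients reproduce the bridge
    covariance exactly ([bridge_covariance]), so for every eps it has the law of a Riemann sum of
    B^2 ([score_same_law]). Equality of these laws is reduced to cosines of linear combinations:
    products of cosines give Laplace transforms, polynomials in exp(-q) give all bounded continuous
    functions ([quadratic_same_law]). The Riemann sums converge to the bridge functional uniformly
    over partitions ([functional_partition]).

    To pass from the limit law to the size of the test, int B^2 must have no atom at the critical
    value. Rotating two independent bridges by N angles gives N copies of the functional; for a
    given pair of paths at most two of them equal c, unless both unrotated functionals do, so that p
    = P(int B^2 = c) satisfies N p <= 2 + N p^2 for all N ([bridge_no_atom]). Sandwiching the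
    indicator between steep ramps concludes ([indicator_cvg]). *)

Notation mrv := (measurable_fun setT) (only parsing).
Notation cont2 g := (continuous (fun p : _ * _=> g p.1 p.2)) (only parsing).

Ltac pos := first
 [ assumption | done
 | match goal with
  | |- is_true (_ && _)=> apply/andP; split; pos
  | |- is_true (_ != 0)=> rewrite gt_eqF; [done | pos]
  | |- is_true (0 < _ + _)=> first [apply: addr_gt0; pos | apply: ltr_wpDl; pos | apply: ltr_wpDr; pos]
  | |- is_true (0 < _*_)=> apply: mulr_gt0; pos
  | |- is_true (0 < _ ^-1)=> rewrite invr_gt0; pos
  | |- is_true (0 < _^+_)=> apply: exprn_gt0; pos
  | |- is_true (0 < Num.min _ _)=> rewrite lt_min; pos
  | |- is_true (0 < Num.sqrt _)=> rewrite sqrtr_gt0; pos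
  | |- is_true (0 < expR _)=> exact: expR_gt0
  | |- is_true (0 < _ - _)=> rewrite subr_gt0; pos
  | |- is_true (0 <= _^+_)=> first [exact: sqr_ge0 | apply: exprn_ge0; pos]
  | |- is_true (0 <= _ + _)=> apply: addr_ge0; pos
  | |- is_true (0 <= _*_)=> apply: mulr_ge0; pos
  | |- is_true (0 <= _ ^-1)=> rewrite invr_ge0; pos
  | |- is_true (0 <= _ - _)=> rewrite subr_ge0; pos
  end
 | apply: ltW; pos ].

(** * Continuity and integrals of functions of a real variable *)

Section Continuity.
Context {R : realType} {U : topologicalType}.
Implicit Types f g : U -> R.

Lemma contD f g : continuous f -> continuous g -> continuous (fun x=> f x+g x).
by move=> cf cg x; exact: (continuousD (cf x) (cg x)). Qed.

Lemma contB f g : continuous f -> continuous g -> continuous (fun x=> f x-g x).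
by move=> cf cg x; exact: (continuousB (cf x) (cg x)). Qed.

Lemma contM f g : continuous f -> continuous g -> continuous (fun x=> f x*g x).
by move=> cf cg x; exact: (continuousM (cf x) (cg x)). Qed.

Lemma contN f : continuous f -> continuous (fun x=> - f x).
by move=> cf x; exact: (continuousN (cf x)). Qed.

Lemma contV f : (forall x, f x != 0) -> continuous f -> continuous (fun x=> (f x)^-1).
by move=> f0 cf x; exact: (continuousV (f0 x) (cf x)). Qed.

Lemma contX f n : continuous f -> continuous (fun x=> f x^+n).
move=> cf; elim: n=> [|n IH].
 by under eq_fun do rewrite expr0; exact: cst_continuous.
by under eq_fun do rewrite exprS; exact: contM.
Qed.

Lemma contA f : continuous f -> continuous (fun x=> `|f x|).
by move=> cf x; exact: (continuous_comp (cf x) (@norm_continuous _ _ _)). Qed.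

Lemma cont_comp {V : topologicalType} (f : U -> V) (g : V -> R) :
 continuous f -> continuous g -> continuous (fun x=> g (f x)).
by move=> cf cg x; exact: (continuous_comp (cf x) (cg (f x))). Qed.
Lemma cont_pair (V : topologicalType) (f : U -> V) (g : U -> R) :
 continuous f -> continuous g -> continuous (fun x=> (f x, g x)).
by move=> cf cg x; exact: (cvg_pair (cf x) (cg x)). Qed.

End Continuity.

Section Interval_integral.
Context {R : realType}.
Implicit Types (a b c : R) (f g : R -> R).

Definition Int a b f : R := \int[lebesgue_measure]_(y in `[a, b]) f y.

Lemma cont_integrable a b f : continuous f ->
 lebesgue_measure.-integrable `[a, b] (EFin \o f).
move=> cf; apply: (@continuous_compact_integrable R f); first exact: segment_compact.
exact: continuous_subspaceT.
Qed.

Lemma eq_Int a b f g : (forall x, a <= x <= b -> f x = g x) -> Int a b f = Int a b g.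
move=> fg; apply: eq_Rintegral=> x; rewrite inE /= in_itv /= => h; exact: fg.
Qed.

Lemma IntD a b f g : continuous f -> continuous g ->
 Int a b (fun x=> f x+g x) = Int a b f+Int a b g.
by move=> cf cg; rewrite /Int RintegralD//; exact: cont_integrable. Qed.

Lemma IntB a b f g : continuous f -> continuous g ->
 Int a b (fun x=> f x-g x) = Int a b f-Int a b g.
by move=> cf cg; rewrite /Int RintegralB//; exact: cont_integrable. Qed.

Lemma IntZ a b f r : continuous f -> Int a b (fun x=> r*f x) = r*Int a b f.
by move=> cf; rewrite /Int RintegralZl//; exact: cont_integrable. Qed.

Lemma Int_le a b f g : continuous f -> continuous g ->
 (forall x, a <= x <= b -> f x <= g x) -> Int a b f <= Int a b g.
move=> cf cg fg; apply: le_Rintegral=> //; try exact: cont_integrable.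
Qed.

Lemma Int_ge0 a b f : (forall x, a <= x <= b -> 0 <= f x) -> 0 <= Int a b f.
by move=> f0; apply: Rintegral_ge0=> x /=; rewrite in_itv; exact: f0. Qed.

Lemma Int_cst r a b : a <= b -> Int a b (fun=> r) = r*(b-a).
move=> ab; rewrite /Int Rintegral_cst//= lebesgue_measure_itv /= lte_fin.
case: ltP=> [//|ba]; have -> : a = b by apply/eqP; rewrite eq_le ab ba.
by rewrite subrr.
Qed.

Lemma Int_abs_le a b f g : continuous f -> continuous g ->
 (forall x, a <= x <= b -> `|f x| <= g x) -> `|Int a b f| <= Int a b g.
move=> cf cg fg; apply: le_trans (le_normr_Rintegral _ _) _=> //; first exact: cont_integrable.
by apply: Int_le=> //; exact: contA.
Qed.

Lemma Int_bound a b f (M : R) : continuous f -> a <= b ->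
 (forall x, a <= x <= b -> `|f x| <= M) -> `|Int a b f| <= M*(b-a).
move=> cf ab fM; rewrite -(Int_cst M ab); apply: Int_abs_le=> //; exact: cst_continuous.
Qed.

Lemma Int_xx a f : Int a a f = 0.
by rewrite /Int set_itv1 Rintegral_set1. Qed.

Lemma Int_split a b c f : continuous f -> a <= b -> b <= c ->
 Int a c f = Int a b f+Int b c f.
move=> cf ab bc; have := @Rintegral_itvB R f (BLeft a) (BRight c) b.
rewrite /= !bnd_simp=> /(_ (@cont_integrable a c f cf) ab bc).
rewrite -/(Int a c f) -/(Int a b f)=> e.
rewrite -[LHS](subrK (Int a b f)) addrC; congr (_ + _).
rewrite e Rintegral_itv_obnd_cbnd //.
apply: integrableS (@cont_integrable b c f cf)=> //=.
by move=> x /=; rewrite !in_itv /= => /andP[/ltW -> ->].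
Qed.

Lemma Int_telescope f (t : nat -> R) k : continuous f -> (forall j, t j <= t j.+1) ->
 \sum_(j < k) Int (t j) (t j.+1) f = Int (t 0%N) (t k) f.
move=> cf ht; elim: k=> [|k IH]; first by rewrite big_ord0 Int_xx.
rewrite big_ord_recr /= IH -Int_split//.
elim: k {IH} => [//|k IH]; exact: le_trans IH (ht k).
Qed.

(** Cutting the interval into equal short pieces bounds the total by an arbitrarily small multiple
    of the length. This is the common core of the fundamental theorem of calculus ([rel_ftc]) and of
    differentiation under the integral sign ([oi_time]). *)
Lemma additive_small_zero (D : R -> R -> R) a b : a <= b ->
 (forall u v w, a <= u -> u <= v -> v <= w -> w <= b -> D u w = D u v+D v w) ->
 (forall e, 0 < e -> exists2 r, 0 < r & forall u v, a <= u -> u <= v -> v <= b ->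
   v-u <= r -> `|D u v| <= e*(v-u)) ->
 D a b = 0.
move=> ab Dadd Dsm; apply/eqP; rewrite -normr_eq0; apply/eqP/le_anti.
rewrite normr_ge0 andbT; apply/ler_addgt0Pl=> e e0; rewrite addr0.
(* The summand 1 keeps the divisor positive when a = b. *)
pose e' := e/(b-a+1).
have ba1 : 0 < b-a+1 by pos.
have e'0 : 0 < e' by rewrite divr_gt0.
have [r r0 hr] := Dsm _ e'0.
have [n hn] : exists n : nat, (b-a)/r < n%:R.
 by exists (Num.truncn ((b-a)/r)).+1; exact: truncnS_gt.
have n0 : 0 < n%:R :> R by apply: le_lt_trans hn; rewrite divr_ge0 ?subr_ge0// ltW.
pose t k := a+k%:R*((b-a)/n%:R).
have t0 : t 0%N = a by rewrite /t mul0r addr0.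
have tS k : t k.+1-t k = (b-a)/n%:R by rewrite /t -natr1; lra.
have st0 : 0 <= (b-a)/n%:R by pos.
have tm k : t k <= t k.+1 by rewrite -subr_ge0 tS.
have ta k : a <= t k by elim: k=> [|k IH]; rewrite ?t0//; exact: le_trans IH (tm k).
have tn : t n = b by rewrite /t mulrC divfK ?gt_eqF// addrC subrK.
have tb k : (k <= n)%N -> t k <= b.
 by move=> kn; rewrite -tn lerD2l ler_wpM2r// ler_nat.
have key k : (k <= n)%N -> `|D a (t k)| <= e'*(t k-a).
 elim: k=> [_|k IH kn].
  (* [D a a] vanishes because the smallness bound applies to an interval of length zero. *)
  have [r1 r10 h1] := Dsm 1 ltr01.
  by have := h1 a a (lexx _) (lexx _) ab; rewrite t0 !subrr !mulr0=> /(_ (ltW r10)).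
 rewrite (Dadd a (t k) (t k.+1)) ?ta ?tm ?tb//.
 apply: le_trans (ler_normD _ _) _.
 have := IH (ltnW kn); have := hr (t k) (t k.+1) (ta k) (tm k) (tb _ kn).
 rewrite tS=> /(_ _); rewrite -(tS k).
 have : (b-a)/n%:R <= r by rewrite ler_pdivrMr// -ler_pdivrMl// mulrC ltW.
 by rewrite -(tS k)=> hle /(_ hle); lra.
have := key n (leqnn _); rewrite tn=> /le_trans; apply.
rewrite /e' -mulrA ler_piMr ?(ltW e0)// mulrC ler_pdivrMr// mul1r lerDl ler01 //.
Qed.

End Interval_integral.

Section Clamp.
Context {R : realType}.
Variable T : R.
Hypothesis T0 : 0 <= T.

(** Projection of time onto [0, T]. The conditions speak only of times in [0, T]; composing with
    this map yields functions that are continuous at all times, so that no domain has to be carried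
    along. *)
Definition clamp (T t : R) : R := Num.max 0 (Num.min t T).

Lemma clamp_itv t : 0 <= clamp T t <= T.
by rewrite /clamp le_max lexx /= ge_max T0 /= ge_min lexx orbT. Qed.

Lemma clamp_id t : 0 <= t <= T -> clamp T t = t.
by case/andP=> t0 tT; rewrite /clamp min_l// max_r. Qed.

Lemma clamp_lip s t : `|clamp T s-clamp T t| <= `|s-t|.
wlog ts : s t/t <= s.
 move=> H; case: (leP t s)=> [/H//|/ltW /H]; by rewrite distrC (distrC s).
rewrite [leRHS]ger0_norm ?subr_ge0// ler_norml /clamp /Num.max /Num.min.
by do !case: ifPn; rewrite -?leNgt; move=> *; lra.
Qed.
Lemma within_continuousP {U : pseudoMetricType R} (A : set U) (f : U -> R) :
 {within A, continuous f} <->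
 forall x, A x -> forall e, 0 < e -> exists2 r, 0 < r &
  forall y, A y -> ball x r y -> `|f x-f y| < e.
split=> [/subspace_continuousP cf x Ax e e0|H].
 have /(@cvgrPdist_lt _ R)/(_ e e0) := cf x Ax.
 rewrite /within /= => /nbhs_ballP[r /= r0 hr].
 by exists r=> // y Ay xy; exact: hr.
apply/subspace_continuousP=> x Ax; apply/(@cvgrPdist_lt _ R)=> e e0.
have [r r0 hr] := H x Ax e e0.
by rewrite /within /=; apply/nbhs_ballP; exists r=> //= y xy Ay; exact: hr.
Qed.

Lemma continuous_clamp (f : R -> R) :
 {within `[0, T], continuous f} -> continuous (fun t=> f (clamp T t)).
move=> /within_continuousP cf t; apply/(@cvgrPdist_lt _ R)=> e e0.
have tT : (`[0, T]%classic : set R) (clamp T t) by rewrite /= in_itv; exact: clamp_itv.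
have [r r0 hr] := cf (clamp T t) tT e e0.
near=> s; apply: hr; first by rewrite /= in_itv; exact: clamp_itv.
apply: le_lt_trans (clamp_lip t s) _; near: s.
by apply: (@cvgr_dist_lt _ R _ _ _ id t)=> //; exact: cvg_id.
Unshelve. all: by end_near. Qed.

End Clamp.

(** * Small exceptional sets and localised first moments *)

Section Up_to.
Context {R : realType} {d : measure_display} {Omega : measurableType d}.
Variable P : probability Omega R.
Implicit Types (e : R) (Q : Omega -> Prop) (A N : set Omega).

(** Only the exceptional set is measurable, not [Q] itself; this allows statements quantified over
    all times or all parameters. *)
Definition up_to e Q : Prop := exists N : set Omega,
 [/\ measurable N, (P N <= e%:E)%E & forall w, ~ N w -> Q w].

Lemma up_to_mono e e' Q Q' : e <= e' -> (forall w, Q w -> Q' w) ->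
 up_to e Q -> up_to e' Q'.
move=> ee' QQ' [N [mN PN NQ]]; exists N; split=> //.
 by apply: le_trans PN _; rewrite lee_fin.
by move=> w /NQ /QQ'.
Qed.

Lemma up_to_and e e' Q Q' : up_to e Q -> up_to e' Q' ->
 up_to (e+e') (fun w=> Q w /\ Q' w).
move=> [N [mN PN NQ]] [N' [mN' PN' NQ']]; exists (N `|` N'); split.
- exact: measurableU.
- by apply: le_trans (measureU2 _ mN mN') _; rewrite EFinD leeD.
- by move=> w /= /not_orP[/NQ ? /NQ' ?].
Qed.

Lemma up_to_all e Q : 0 <= e -> (forall w, Q w) -> up_to e Q.
by move=> e0 h; exists set0; split=> //; rewrite measure0 lee_fin. Qed.

Lemma up_to_ae e Q : 0 <= e -> {ae P, forall w, Q w} -> up_to e Q.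
move=> e0 [N [mN PN NQ]]; exists N; split=> //; first by rewrite PN lee_fin.
by move=> w Nw; apply: contrapT=> /NQ.
Qed.
Lemma up_to_setC e A Q : measurable A -> (P (~` A) <= e%:E)%E ->
 (forall w, A w -> Q w) -> up_to e Q.
move=> mA PA AQ; exists (~` A); split=> //; first exact: measurableC.
by move=> w /contrapT /AQ.
Qed.

End Up_to.

Ltac nneg := repeat first
 [ assumption
 | by []
 | match goal with
  | |- is_true (0 <= _^+2)=> apply: sqr_ge0
  | |- is_true (0 <= `|_|)=> apply: normr_ge0
  | |- is_true (0 <= \1__ _)=> rewrite indicE; apply: ler0n
  | |- is_true (0 <= _ + _)=> apply: addr_ge0
  | |- is_true (0 <= _*_)=> apply: mulr_ge0
  | |- is_true (0 <= _ ^-1)=> rewrite invr_ge0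
  | |- is_true (0 <= _^+_)=> apply: exprn_ge0
  | |- is_true (0 <= \sum_(_ < _) _)=> apply: sumr_ge0=> ? _
  | |- is_true (0 <= Num.sqrt _)=> apply: sqrtr_ge0
  end
 | by apply: ltW ].

Ltac mfun := repeat first
 [ assumption
 | match goal with
  | |- measurable_fun _ (fun _=> _ + _)=> apply: measurable_funD
  | |- measurable_fun _ (fun _=> _*_)=> apply: measurable_funM
  | |- measurable_fun _ (fun _=> - _)=> apply: measurableT_comp
  | |- measurable_fun _ (fun _=> _^+_)=> apply: measurable_funX
  | |- measurable_fun _ (fun _=> `|_|)=> apply: measurableT_comp
  | |- measurable_fun _ (fun _=> \sum_(_ < _) _)=> apply: measurable_sum=> ?
  | |- measurable_fun _ (fun _=> _%:E)=> apply/measurable_EFinP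
  | |- measurable_fun _ (fun _=> Num.min _ _)=> apply: measurable_minr
  | |- measurable_fun _ (fun _=> Num.max _ _)=> apply: measurable_maxr
  | |- measurable_fun _ (fun _=> \1__ _)=> apply: measurable_indic
  end
 | by []
 | by apply: measurable_cst
 | by apply: measurable_funTS; mfun ].

Section First_moment.
Context {R : realType} {d : measure_display} {Omega : measurableType d}.
Variable P : probability Omega R.
Implicit Types (A : set Omega) (Z Y : Omega -> R) (B C : R).

(** First moment restricted to an event, in the extended reals, so that for nonnegative [Z] no
    integrability has to be known beforehand. *)
Definition L1b A Z B : Prop := (\int[P]_(w in A) (Z w)%:E <= B%:E)%E.

Lemma measurable_gt Z (c : R) : mrv Z -> measurable [set w | c < Z w].
move=> mZ; rewrite -[X in measurable X]setTI.
have -> : [set w | c < Z w] = Z @^-1` `]c, +oo[.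
 by apply/seteqP; split=> w /=; rewrite in_itv /= andbT.
exact: mZ.
Qed.

Lemma L1b_mono A Z B B' : B <= B' -> L1b A Z B -> L1b A Z B'.
by move=> BB' h; apply: le_trans h _; rewrite lee_fin. Qed.

Lemma L1b_le A Z Y B : measurable A -> mrv Z -> mrv Y ->
 (forall w, A w -> 0 <= Z w) -> (forall w, A w -> Z w <= Y w) -> L1b A Y B -> L1b A Z B.
move=> mA mZ mY Z0 ZY; apply: le_trans; apply: ge0_le_integral=> //; by mfun.
Qed.

Lemma L1bD A Z Y B C : measurable A -> mrv Z -> mrv Y ->
 (forall w, 0 <= Z w) -> (forall w, 0 <= Y w) -> L1b A Z B -> L1b A Y C ->
 L1b A (fun w=> Z w+Y w) (B+C).
move=> mA mZ mY Z0 Y0 hB hC; rewrite /L1b.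
under eq_integral do rewrite EFinD.
rewrite ge0_integralD//; first by rewrite EFinD leeD.
all: try by move=> w _; rewrite lee_fin.
all: by mfun.
Qed.

Lemma L1bZ A Z B (k : R) : measurable A -> mrv Z -> 0 <= k ->
 (forall w, 0 <= Z w) -> L1b A Z B -> L1b A (fun w=> k*Z w) (k*B).
move=> mA mZ k0 Z0 hB; rewrite /L1b.
under eq_integral do rewrite EFinM.
rewrite ge0_integralZl_EFin//; first by rewrite EFinM lee_wpmul2l ?lee_fin.
all: try by move=> w _; rewrite lee_fin.
by mfun.
Qed.

Lemma L1b_cst A (k : R) : measurable A -> 0 <= k -> L1b A (fun=> k) k.
move=> mA k0; rewrite /L1b integral_cst// -[leRHS]mule1 lee_wpmul2l//.
exact: probability_le1.
Qed.

Lemma L1b_sum A n (Z : nat -> Omega -> R) (B : nat -> R) : measurable A ->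
 (forall i, mrv (Z i)) -> (forall i w, 0 <= Z i w) ->
 (forall i, (i < n)%N -> L1b A (Z i) (B i)) ->
 L1b A (fun w=> \sum_(i < n) Z i w) (\sum_(i < n) B i).
move=> mA mZ Z0; elim: n=> [|n IH] h.
 under eq_fun do rewrite big_ord0; rewrite big_ord0; exact: L1b_cst.
under eq_fun do rewrite big_ord_recr /=; rewrite big_ord_recr /=.
apply: L1bD=> //; [exact: measurable_sum|by move=> w; apply: sumr_ge0| |exact: h].
by apply: IH=> i /ltnW; exact: h.
Qed.

Lemma L1b_subset A A' Z B : measurable A -> measurable A' -> A `<=` A' ->
 mrv Z -> (forall w, 0 <= Z w) -> L1b A' Z B -> L1b A Z B.
move=> mA mA' AA' mZ Z0; apply: le_trans; apply: ge0_subset_integral=> //.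
- by mfun.
- by move=> w _; rewrite lee_fin.
Qed.

Lemma L1b_indic A D (k : R) : measurable A -> measurable D -> 0 <= k ->
 L1b A (fun w=> k*\1_D w) (k*fine (P D)).
move=> mA mD k0; apply: L1bZ=> //; rewrite /L1b integral_indic// fineK ?fin_num_measure//.
by apply: le_measure; rewrite ?inE//; exact: measurableI.
Qed.

(** Markov's inequality inside [A]; the complement of [A] is simply added to the exceptional set. *)
Lemma L1b_markov A Z B (lam e : R) : measurable A -> mrv Z ->
 (forall w, 0 <= Z w) -> 0 < lam -> L1b A Z B -> (P (~` A) <= e%:E)%E ->
 up_to P (e+B/lam) (fun w=> A w /\ Z w <= lam).
move=> mA mZ Z0 lam0 hB PA.
exists (~` A `|` (A `&` [set w | lam < Z w])).
have mD : measurable (A `&` [set w | lam < Z w]).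
 by apply: measurableI=> //; exact: measurable_gt.
split.
- by apply: measurableU=> //; exact: measurableC.
- apply: le_trans (measureU2 _ (measurableC mA) mD) _; rewrite EFinD leeD//.
 rewrite mulrC EFinM -lee_pdivrMl ?invr_gt0// invrK.
 apply: le_trans hB; rewrite -integral_cst//.
 have h1 : (\int[P]_(x in A `&` [set w | (lam < Z w)%R]) cst lam%:E x <=
   \int[P]_(w in A `&` [set w | (lam < Z w)%R]) (Z w)%:E)%E.
  apply: ge0_le_integral=> //.
  + by move=> w _; rewrite lee_fin ltW.
  + by mfun.
  + by move=> w [_ /= h]; rewrite lee_fin ltW.
 apply: (le_trans h1); apply: ge0_subset_integral=> //; try by mfun.
 by move=> w _; rewrite lee_fin.
- move=> w /= /not_orP[/contrapT Aw]; rewrite not_andP=> -[//|].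
 by move/negP; rewrite -leNgt.
Qed.

Lemma L1b_limit A Z B (C : R) : 0 <= C -> (forall e, 0 < e -> L1b A Z (B+C*e)) -> L1b A Z B.
move=> C0 h; apply/lee_addgt0Pr=> e e0; rewrite -EFinD.
have C1 : 0 < C+1 by rewrite ltr_pwDr.
apply: le_trans (h (e/(C+1)) _) _; first by rewrite divr_gt0.
by rewrite lee_fin lerD2l mulrCA ler_piMr ?(ltW e0)// ler_pdivrMr// mul1r lerDl.
Qed.

(** Convergence in probability, with one number bounding both the error and the probability of
    exceeding it. *)
Definition cvgU (Z : nat -> Omega -> R) (Y : Omega -> R) : Prop :=
 forall e, 0 < e -> exists q0, forall q, (q0 <= q)%N ->
  up_to P e (fun w=> `|Z q w-Y w| <= e).

(** Truncate the limit at M: off a set of probability e1 it differs from [Zq] by at most e1, and on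
    that set the truncation costs at most M e1. Letting e1 tend to 0 and then M to infinity, by
    monotone convergence, gives the bound without extracting an almost surely convergent
    subsequence. *)
Lemma fatou_in_probability A (Zq : nat -> Omega -> R) Z B : measurable A ->
 (forall q, mrv (Zq q)) -> mrv Z -> cvgU Zq Z -> 0 <= B ->
 (forall q, L1b A (fun w=> Zq q w^+2) B) -> L1b A (fun w=> Z w^+2) B.
move=> mA mZq mZ cZ B0 hB.
have key (M : nat) : L1b A (fun w=> Num.min (Z w^+2) M%:R) B.
 apply: (@L1b_limit _ _ _ (B+M%:R+2)).
  by pos.
 move=> e e0; pose e1 := Num.min e 1.
 have e10 : 0 < e1 by rewrite lt_min e0 ltr01.
 have e11 : e1 <= 1 by rewrite ge_min lexx orbT.
 have e1e : e1 <= e by rewrite ge_min lexx.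
 have [q0 /(_ q0 (leqnn _)) [N [mN PN hN]]] := cZ e1 e10.
 have mN' : mrv (fun w=> M%:R*\1_N w : R).
  by mfun.
 (* From |Z| <= |Zq| + e1 and 2|x| <= 1 + x^2 one gets Z^2 <= (1 + e1) Zq^2 + e1 + e1^2 off [N]; on
    [N] the truncation level dominates. *)
 apply: (@L1b_le _ _ (fun w=> ((1+e1)*Zq q0 w^+2+M%:R*\1_N w)+(e1+e1^+2)))=> //.
 - by mfun.
 - by mfun.
 - by move=> w _; rewrite le_min sqr_ge0 ler0n.
 - move=> w Aw; rewrite indicE; case: (boolP (w \in N))=> wN.
   rewrite mulr1; apply: (@le_trans _ _ M%:R); first by rewrite ge_min lexx orbT.
   rewrite -addrA addrCA lerDl; have := sqr_ge0 e1; have := sqr_ge0 (Zq q0 w).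
   by move: (Zq q0 w^+2) (e1^+2)=> z1 z2 *; nra.
  rewrite mulr0 addr0 ge_min; apply/orP; left.
  have := hN w (fun h=> negP wN (mem_set h)).
  set x := Zq q0 w; set y := Z w=> h.
  have : `|y| <= `|x| + e1.
   by have := ler_normD (y-x) x; rewrite subrK (distrC y); lra.
  rewrite -(real_normK (num_real y)) -(real_normK (num_real x)).
  have := normr_ge0 x; have := normr_ge0 y; set a := `|x|; set b := `|y| => b0 a0 ab.
  have := mulr_ge0 (ltW e10) (sqr_ge0 (a-1)); nra.
 - apply: (@L1b_mono _ _ ((1+e1)*B+M%:R*e1+(e1+e1^+2))).
   by have : (0 : R) <= M%:R by []; nra.
  have e2 : 0 <= 1+e1 by pos.
  apply: L1bD=> //; first by mfun.
  + by move=> w; nneg.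
  + by move=> w; rewrite addr_ge0 ?sqr_ge0// ltW.
  + apply: L1bD=> //.
   * by mfun.
   * by move=> w; rewrite mulr_ge0 ?sqr_ge0.
   * apply: L1bZ=> //; first exact: measurable_funX.
    by move=> w; exact: sqr_ge0.
   * apply: L1b_mono (L1b_indic mA mN _)=> //.
    by rewrite ler_wpM2l// -lee_fin fineK ?fin_num_measure.
  + by apply: L1b_cst=> //; rewrite addr_ge0 ?sqr_ge0// ltW.
rewrite /L1b.
have -> : (\int[P]_(w in A) (Z w^+2)%:E =
  \int[P]_(w in A) limn (fun M=> (Num.min (Z w^+2) M%:R)%:E))%E.
 apply: eq_integral=> w _; apply/esym/cvg_lim=> //; apply: cvg_near_cst.
 near=> M; congr (_%:E); apply/min_idPl; rewrite ltW//.
 by near: M; exact: nbhs_infty_gtr.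
rewrite monotone_convergence//.
- apply: lime_le; last by near=> M; exact: key.
 apply: ereal_nondecreasing_is_cvgn=> m n mn.
 apply: ge0_le_integral=> //; try by mfun.
 + by move=> w _; rewrite lee_fin le_min sqr_ge0 ler0n.
 + move=> w _; rewrite lee_fin le_min ge_min lexx /= ge_min.
  by rewrite ler_nat mn orbT.
- by move=> n; mfun.
- by move=> n w _; rewrite lee_fin le_min sqr_ge0 ler0n.
- move=> w _ m n mn; rewrite lee_fin le_min ge_min lexx /= ge_min.
 by rewrite ler_nat mn orbT.
Unshelve. all: by end_near. Qed.

Implicit Types (Zq Yq : nat -> Omega -> R).

Lemma cvgU_ext Zq Zq' Z Z' : cvgU Zq Z ->
 (forall q, {ae P, forall w, Zq q w = Zq' q w}) -> {ae P, forall w, Z w = Z' w} ->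
 cvgU Zq' Z'.
move=> h a b e e0; have e2 : 0 < e/3 by rewrite divr_gt0.
have [q0 hq] := h _ e2; exists q0=> q qq.
have := up_to_and (hq q qq) (up_to_and (up_to_ae (ltW e2) (a q)) (up_to_ae (ltW e2) b)).
apply: up_to_mono; first lra.
by move=> w [+ [<- <-]]=> /le_trans; apply; rewrite ler_pdivrMr// ler_pMr//; lra.
Qed.

Lemma cvgU_cst Z : cvgU (fun=> Z) Z.
move=> e e0; exists 0%N=> q _; apply: up_to_all; first exact: ltW.
by move=> w; rewrite subrr normr0 ltW.
Qed.

Lemma cvgUD Zq Yq Z Y : cvgU Zq Z -> cvgU Yq Y ->
 cvgU (fun q w=> Zq q w+Yq q w) (fun w=> Z w+Y w).
move=> h g e e0; have e2 : 0 < e/2 by rewrite divr_gt0.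
have [q0 hq] := h _ e2; have [q1 gq] := g _ e2.
exists (maxn q0 q1)=> q; rewrite geq_max=> /andP[/hq a /gq b].
apply: up_to_mono (up_to_and a b); first by lra.
move=> w [ha hb]; rewrite opprD addrACA (le_trans (ler_normD _ _))//; lra.
Qed.

Lemma cvgUM Zq Z (c : Omega -> R) (C : R) : cvgU Zq Z -> (forall w, `|c w| <= C) ->
 cvgU (fun q w=> c w*Zq q w) (fun w=> c w*Z w).
move=> h hc e e0; pose K := `|C| + 1.
have K1 : 1 <= K by rewrite lerDr.
have K0 : 0 < K by apply: lt_le_trans K1.
have e2 : 0 < e/K by rewrite divr_gt0.
have [q0 hq] := h _ e2; exists q0=> q /hq; apply: up_to_mono.
 by rewrite ler_pdivrMr// ler_pMr.
move=> w hw; rewrite -mulrBr normrM.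
have cK : `|c w| <= K by rewrite (le_trans (hc w))// (le_trans (ler_norm C))// lerDl.
by rewrite (le_trans (ler_pM _ _ cK hw))// mulrC divfK// gt_eqF.
Qed.

Lemma cvgUZ Zq Z (c : R) : cvgU Zq Z -> cvgU (fun q w=> c*Zq q w) (fun w=> c*Z w).
by move=> h; apply: (cvgUM (c := fun=> c)) h (fun=> lexx _). Qed.

Lemma cvgUB Zq Yq Z Y : cvgU Zq Z -> cvgU Yq Y ->
 cvgU (fun q w=> Zq q w-Yq q w) (fun w=> Z w-Y w).
move=> h /(cvgUZ (-1)) g; have := cvgUD h g.
by under eq_fun do under eq_fun do rewrite mulN1r; under [X in cvgU _ X]eq_fun do rewrite mulN1r.
Qed.

Lemma cvgU_sum n (Zq : nat -> nat -> Omega -> R) (Z : nat -> Omega -> R) :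
 (forall i, (i < n)%N -> cvgU (Zq i) (Z i)) ->
 cvgU (fun q w=> \sum_(i < n) Zq i q w) (fun w=> \sum_(i < n) Z i w).
move=> h; elim: n h=> [|n IH] h.
 rewrite (_ : (fun q w=> _) = (fun q w=> 0)); last first.
  by apply/funext=> q; apply/funext=> w; rewrite big_ord0.
 rewrite (_ : (fun w=> _) = (fun w=> 0)); last by apply/funext=> w; rewrite big_ord0.
 exact: cvgU_cst.
rewrite (_ : (fun q w=> _) = (fun q w=> \sum_(i < n) Zq i q w+Zq n q w)); last first.
 by apply/funext=> q; apply/funext=> w; rewrite big_ord_recr.
rewrite (_ : (fun w=> _) = (fun w=> \sum_(i < n) Z i w+Z n w)); last first.
 by apply/funext=> w; rewrite big_ord_recr.
by apply: cvgUD; [apply: IH=> i /ltnW; exact: h|exact: h].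
Qed.

(** The tail unions decrease to the empty set, so continuity from above applies. *)
Lemma measure_eventually0 (E : nat -> set Omega) : (forall q, measurable (E q)) ->
 (forall w, exists q0, forall q, (q0 <= q)%N -> ~ E q w) ->
 (fun q=> P (E q)) @ \oo --> 0%E.
move=> mE hE; pose G q := \bigcup_(k in [set k | (q <= k)%N]) E k.
have mG q : measurable (G q) by apply: bigcup_measurable=> k _.
have G0 : \bigcap_q G q = set0.
 apply/seteqP; split=> // w hw; have [q0 h] := hE w.
 by have [k /= qk] := hw q0 I; exact: h.
have : (fun q=> P (G q)) @ \oo --> P (\bigcap_q G q).
 apply: nonincreasing_cvg_mu=> //.
 - by rewrite (le_lt_trans (probability_le1 _ (mG 0%N)))// ltry.
 - exact: bigcap_measurable.
 - move=> m n mn; apply/subsetPset=> w [k /= nk Ek].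
  by exists k=> //=; exact: leq_trans mn nk.
rewrite G0 measure0=> cG; apply: (@squeeze_cvge _ _ _ _ (fun=> 0%E) _ (fun q=> P (G q)))=> //.
- near=> q; rewrite measure_ge0 /=; apply: le_measure; rewrite ?inE//.
 by move=> w Ew; exists q=> /=.
- exact: cvg_cst.
Unshelve. all: by end_near. Qed.

Lemma cvg0_le (u : nat -> \bar R) e : u @ \oo --> 0%E -> 0 < e ->
 exists q0, forall q, (q0 <= q)%N -> (u q <= e%:E)%E.
move=> /fine_cvgP[uf uc] e0.
have /cvgrPdist_le/(_ e e0)[q1 _ h1] := uc.
have [q2 _ h2] := uf.
exists (maxn q1 q2)=> q; rewrite geq_max=> /andP[/h1 /= a /h2 b].
by rewrite -(fineK b) lee_fin (le_trans (ler_norm _))// -normrN -sub0r.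
Qed.

Lemma cvgU_pointwise Zq Z : (forall q, mrv (Zq q)) -> mrv Z ->
 (forall w e, 0 < e -> exists q0, forall q, (q0 <= q)%N -> `|Zq q w-Z w| <= e) -> cvgU Zq Z.
move=> mZq mZ h e e0; pose E q := [set w | e < `|Zq q w-Z w|].
have mE q : measurable (E q) by apply: measurable_gt; mfun.
have hE w : exists q0, forall q, (q0 <= q)%N -> ~ E q w.
 by have [q0 hq] := h w e e0; exists q0=> q /hq; rewrite leNgt=> /negP.
have [q0 hq] := cvg0_le (measure_eventually0 mE hE) e0.
exists q0=> q /hq PE; exists (E q); split=> // w /negP.
by rewrite -leNgt.
Qed.

End First_moment.

(** * Second moments of sums of Wiener increments *)

Section Normal_moments.
Context {R : realType}.
Notation mu := (@lebesgue_measure R).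

Lemma normal_densityE (s : R) (f : R -> \bar R) : (forall x, (0 <= f x)%E) ->
 mrv f ->
 (\int[normal_prob 0 s]_x f x = \int[mu]_x (f x*(normal_pdf 0 s x)%:E))%E.
move=> f0 mf.
rewrite -(Radon_Nikodym_SigmaFinite.change_of_variables (normal_prob_dominates 0 s) f0)//.
apply: ae_eq_integral=> //.
- apply: emeasurable_funM=> //.
 apply: measurable_int (Radon_Nikodym_SigmaFinite.f_integrable _).
 exact: normal_prob_dominates.
- apply: emeasurable_funM=> //; apply/measurable_EFinP; exact: measurable_normal_pdf.
- apply: ae_eqe_mul2l; apply: integral_ae_eq=> //.
 + exact: Radon_Nikodym_SigmaFinite.f_integrable (normal_prob_dominates 0 s).
 + apply/measurable_EFinP; exact: measurable_normal_pdf.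
 + move=> A _ mA; rewrite -Radon_Nikodym_SigmaFinite.f_integral//.
  exact: normal_prob_dominates.
Qed.

                                                                            
                                              
(** With y = x^2/(4 s^2), the inequality y exp(-y) <= 1 dominates x^2 times the density of variance
    s^2 by 8 s^2 times the density of variance 2 s^2, whose mass is 1. The factor 8 is crude, but
    only orders of magnitude enter later. *)
Lemma normal_second_moment (s : R) : 0 < s ->
 (\int[normal_prob 0 s]_x (x^+2)%:E <= (8*s^+2)%:E)%E.
move=> s0; have s20 : 0 < s^+2 by rewrite exprn_gt0.
pose r : R := Num.sqrt 2*s.
have r0 : 0 < r by rewrite mulr_gt0// sqrtr_gt0.
have r2 : r^+2 = 2*s^+2 by rewrite exprMn sqr_sqrtr.
rewrite normal_densityE//=; last 2 first.
- by move=> x; rewrite lee_fin sqr_ge0.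
- by apply/measurable_EFinP; apply: measurable_funX.
apply: (@le_trans _ _ (\int[mu]_x ((8*s^+2)%:E*(normal_pdf 0 r x)%:E))%E); last first.
 rewrite ge0_integralZl_EFin//.
 - by rewrite integral_normal_pdf mule1.
 - by move=> x _; rewrite lee_fin normal_pdf_ge0.
 - apply/measurable_EFinP; exact: measurable_normal_pdf.
 - by nneg.
apply: ge0_le_integral=> //=.
- by move=> x _; rewrite mule_ge0// lee_fin ?sqr_ge0 ?normal_pdf_ge0.
- apply: emeasurable_funM; apply/measurable_EFinP; [exact: measurable_funX|exact: measurable_normal_pdf].
- apply: emeasurable_funM; apply/measurable_EFinP; [exact: measurable_cst|exact: measurable_normal_pdf].
move=> x _; rewrite -!EFinM lee_fin !normal_pdfE ?gt_eqF//.
have peak : normal_peak s <= 2*normal_peak r.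
 rewrite /normal_peak r2; set D := s^+2 * pi *+ 2.
 have D0 : 0 < D by rewrite /D pmulrn_lgt0// mulr_gt0// pi_gt0.
 have -> : 2*s^+2 * pi *+ 2 = 2*D by rewrite /D -!mulrnAr mulrA.
 have q0 : 0 < Num.sqrt (2*D) by rewrite sqrtr_gt0 mulr_gt0.
 have p0 : 0 < Num.sqrt D by rewrite sqrtr_gt0.
 rewrite -[2*_]invrK -[leLHS]invrK lef_pV2 ?posrE ?invr_gt0// ?mulr_gt0// ?invr_gt0//.
 rewrite invfM invrK invrK ler_pdivrMl//.
 have -> : 2*Num.sqrt D = Num.sqrt (2^+2*D).
  by rewrite sqrtrM// sqrtr_sqr ger0_norm.
 by apply: ler_wsqrtr; nra.
rewrite /normal_fun !subr0 r2.
pose y := x^+2/(4*s^+2).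
have -> : - x^+2/(s^+2 *+ 2) = - y-y by rewrite /y; field; rewrite gt_eqF.
have -> : - x^+2/(2*s^+2 *+ 2) = - y by rewrite /y; field; rewrite gt_eqF.
have {1}-> : x^+2 = 4*s^+2*y by rewrite /y; field; rewrite gt_eqF.
have y0 : 0 <= y by rewrite divr_ge0 ?sqr_ge0 ?mulr_ge0// ltW.
have yE : y*expR (- y) <= 1.
 by rewrite expRN ler_pdivrMr ?expR_gt0// mul1r (le_trans _ (expR_ge1Dx y))// lerDr.
rewrite expRD; have E0 := expR_gt0 (- y); set E := expR (- y) in yE E0 *.
have pr : 0 <= normal_peak r by apply: normal_peak_ge0.
have ps : 0 <= normal_peak s by apply: normal_peak_ge0.
have -> : 4*s^+2*y*(normal_peak s*(E*E)) =
 (4*s^+2*E)*(normal_peak s*(y*E)) by ring.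
have -> : 8*s^+2*(normal_peak r*E) = (4*s^+2*E)*(2*normal_peak r*1) by ring.
rewrite ler_wpM2l//; first by nneg.
by apply: ler_pM=> //; nneg.
Qed.

End Normal_moments.

Section Adapted.
Context {R : realType} {d : measure_display} {Omega : measurableType d}.
Variables (F : R -> set (set Omega)) (T : R).
Hypothesis hF : filtration F T.

(** Measurability for the sigma-algebra generated by [F t], which is [F t] again ([F_measurableE]).
    In this form the closure properties of measurable functions apply to adaptedness. *)
Definition adapted t (Y : Omega -> R) : Prop :=
 mrv (Y : g_sigma_algebraType (F t) -> R).

Lemma F_measurableE t (A : set Omega) : 0 <= t <= T ->
 measurable (A : set (g_sigma_algebraType (F t))) <-> F t A.
move=> tT; have [sF _ _] := hF; split; last exact: sub_sigma_algebra.
by apply: smallest_sub; [exact: sF|].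
Qed.

Lemma adaptedP t Y : 0 <= t <= T -> measurable_at F t Y <-> adapted t Y.
move=> tT; split=> h.
 by move=> _ A mA; rewrite setTI; apply/F_measurableE=> //; exact: h.
by move=> A mA; apply/F_measurableE=> //; rewrite -[X in measurable X]setTI; exact: h.
Qed.

Lemma adapted_mono s t Y : 0 <= s -> s <= t -> t <= T -> adapted s Y -> adapted t Y.
move=> s0 st tT; have t0 := le_trans s0 st; have sT := le_trans st tT.
move=> /adaptedP h; apply/adaptedP; first by rewrite t0.
move=> A mA; have [_ _ hm] := hF; apply: (hm _ _ s0 st tT); apply: h=> //.
by rewrite s0.
Qed.

Lemma adapted_measurable t Y : 0 <= t <= T -> adapted t Y -> mrv Y.
move=> tT /adaptedP h _ A mA; rewrite setTI; have [_ hm _] := hF.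
by apply: (hm t)=> //; exact: h.
Qed.

End Adapted.

Section Wiener_increments.
Context {R : realType} {d : measure_display} {Omega : measurableType d}.
Variables (P : probability Omega R) (F : R -> set (set Omega)) (T : R).
Variable W : R -> Omega -> R.
Hypotheses (hF : filtration F T) (hW : wiener P F T W).
(** Symmetry of the normal law is carried as a hypothesis up to the main theorem, where
    [bridge_normal_sym] provides it from the law of the bridge at time 1/2. *)
Hypothesis normal_sym : forall s : R, 0 < s -> forall A : set R, measurable A ->
 normal_prob 0 s (-%R @^-1` A) = normal_prob 0 s A.

Lemma wiener_adapted t : 0 <= t <= T -> adapted F t (W t).
by move=> tT; have [h _ _ _ _] := hW; apply/(adaptedP hF)=> //; exact: h. Qed.

Lemma wiener_measurable t : 0 <= t <= T -> mrv (W t).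
by move=> tT; apply: (adapted_measurable hF tT); exact: wiener_adapted. Qed.

Lemma normal_symE (s : R) (f : R -> \bar R) : 0 < s -> (forall x, (0 <= f x)%E) ->
 mrv f ->
 (\int[normal_prob 0 s]_x f (- x)%R = \int[normal_prob 0 s]_x f x)%E.
move=> s0 f0 mf.
have mN : mrv (-%R : measurableTypeR R -> measurableTypeR R).
 exact: oppr_measurable.
pose N : {mfun measurableTypeR R >-> measurableTypeR R} :=
 HB.pack (-%R : measurableTypeR R -> measurableTypeR R)
  (isMeasurableFun.Build _ _ _ _ (-%R : measurableTypeR R -> measurableTypeR R) mN).
transitivity (\int[distribution (normal_prob 0 s) N]_x f x)%E.
 by rewrite ge0_integral_distribution.
by apply: eq_measure_integral=> A mA _; rewrite /distribution /pushforward; exact: normal_sym.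
Qed.

Section Freezing.
Notation RT := (measurableTypeR R).
Variables s t : R.
Hypotheses (s0 : 0 <= s) (st : s < t) (tT : t <= T).
Let sT : 0 <= s <= T. by rewrite s0 (ltW (lt_le_trans st tT)). Qed.
Let tT' : 0 <= t <= T. by rewrite (le_trans s0 (ltW st)). Qed.
Let sd : R := Num.sqrt (t-s).
Let sd0 : 0 < sd. by rewrite sqrtr_gt0 subr_gt0. Qed.
Let mD : mrv (fun w=> W t w-W s w).
by apply: measurable_funB; exact: wiener_measurable. Qed.
Let mD' : mrv (fun w=> (W t w-W s w) : RT).
exact: mD. Qed.

Let FS := g_sigma_algebraType (F s).
Let idF : Omega -> FS := fun w=> w.
Let m_idF : mrv idF.
move=> _ A mA; rewrite setTI; have [_ hm _] := hF.
by apply: (hm s)=> //; apply/(F_measurableE hF).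
Qed.
Let X1 : {mfun Omega >-> FS} := HB.pack idF (isMeasurableFun.Build _ _ _ _ idF m_idF).
Let pr : Omega -> FS*RT := fun w=> (idF w, W t w-W s w).
Let m_pr : mrv pr.
by apply/measurable_fun_pair. Qed.
Let X2 : {mfun Omega >-> (FS*RT)%type} :=
 HB.pack pr (isMeasurableFun.Build _ _ _ _ pr m_pr).

(** The pair (point seen through [F s], increment after s) has a product law: on rectangles this is
    the independence clause of [wiener], and rectangles determine a product measure. Fubini-Tonelli
    then integrates the increment first, with the past frozen. *)
Lemma freezing (phi : FS*RT -> \bar R) : (forall x, (0 <= phi x)%E) ->
 mrv phi ->
 (\int[P]_w phi (w, W t w-W s w)%R = \int[P]_w \int[normal_prob 0 sd]_z phi (w, z))%E.
move=> phi0 mphi.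
transitivity (\int[distribution P X2]_x phi x)%E.
 by rewrite ge0_integral_distribution.
transitivity (\int[distribution P X1 \x normal_prob 0 sd]_x phi x)%E.
 apply: eq_measure_integral=> A mA _; apply/esym.
 apply: product_measure_unique=> // B C mB mC.
 rewrite /distribution /pushforward.
 have [_ _ _ hN hI] := hW.
 change (P (B `&` (fun w=> W t w-W s w) @^-1` C) = (P B*normal_prob 0 sd C)%E).
 rewrite hI//; last by apply/(F_measurableE hF).
 by rewrite hN.
rewrite fubini_tonelli1// ge0_integral_distribution//.
- exact: measurable_fun_fubini_tonelli_F.
- by move=> x; apply: integral_ge0=> y _.
Qed.

Lemma adapted_fst (Y : Omega -> R) : adapted F s Y ->
 mrv (fun x : FS*RT=> Y x.1).
by move=> mY; exact: (measurableT_comp mY measurable_fst). Qed.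

(** Averaging over z and -z removes the cross term. The coefficient of u^2 is therefore exactly 1,
    which is what allows the bound to be iterated over many increments. *)
Lemma normal_square (u b : R) :
 (\int[normal_prob 0 sd]_z ((u+b*z)^+2)%:E <= (u^+2+8*(t-s)*b^+2)%:E)%E.
have m1 (c : R) : mrv (fun z : RT=> ((u+c*z)^+2)%:E).
 by mfun.
have p1 (c z : R) : (0 <= ((u+c*z)^+2)%:E)%E by rewrite lee_fin sqr_ge0.
have e1 := normal_symE sd0 (p1 b) (m1 b).
set I := (X in (X <= _)%E) in e1 *.
have : (I+I <= (2*u^+2+2*b^+2*(8*sd^+2))%:E)%E.
 have -> : (I+I = \int[normal_prob 0 sd]_x ((u+b * - x)^+2)%:E+I)%E by rewrite e1.
 rewrite /I -ge0_integralD//; last first.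
  by have := m1 (- b); under eq_fun do rewrite mulNr -mulrN.
 under eq_integral=> z _.
  rewrite -EFinD (_ : _ + _ = 2*u^+2+2*b^+2*z^+2); last by ring.
  rewrite EFinD (EFinM (2*b^+2)); over.
 have sq : mrv (fun z : RT=> (z^+2)%:E) by mfun.
 have sq' : mrv (fun z : RT=> ((2*b^+2)%:E*(z^+2)%:E)%E).
  exact: emeasurable_funM.
 rewrite ge0_integralD//; try by move=> z _; rewrite -?EFinM lee_fin; nneg.
 rewrite ge0_integralZl_EFin//; try by nneg.
 all: try by move=> z _; rewrite lee_fin; nneg.
 have c1 : (\int[normal_prob 0 sd]_(z in setT) cst (2*u^+2)%:E z = (2*u^+2)%:E)%E.
  by rewrite integral_cst//= probability_setT mule1.
 rewrite [X in (X + _)%E]c1 EFinD leeD2l//.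
 rewrite [leRHS]EFinM; apply: lee_wpmul2l; first by rewrite lee_fin; nneg.
 exact: normal_second_moment.
have -> : sd^+2 = t-s by rewrite sqr_sqrtr// subr_ge0 ltW.
have : (0 <= I)%E by apply: integral_ge0.
by case: I {e1} => [r||]//= _; rewrite -EFinD !lee_fin; nra.
Qed.

Lemma sum_step (U a : Omega -> R) : adapted F s U -> adapted F s a ->
 (\int[P]_w ((U w+a w*(W t w-W s w))^+2)%:E <=
  \int[P]_w (U w^+2+8*(t-s)*a w^+2)%:E)%E.
move=> mU ma.
have mU' := adapted_fst mU; have ma' := adapted_fst ma.
have mz : mrv (fun x : FS*RT=> x.2 : R) by exact: measurable_snd.
have mUO := adapted_measurable hF sT mU; have maO := adapted_measurable hF sT ma.
have mphi : mrv (fun x : FS*RT=> ((U x.1+a x.1*x.2)^+2)%:E).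
 by mfun.
have p0 (x : FS*RT) : (0 <= ((U x.1+a x.1*x.2)^+2)%:E)%E by rewrite lee_fin sqr_ge0.
rewrite (freezing p0 mphi) /=.
pose g w := (\int[normal_prob 0 sd]_z ((U w+a w*z)^+2)%:E)%E.
apply: ge0_le_integral=> //.
- by move=> w _; apply: integral_ge0=> z _; rewrite lee_fin sqr_ge0.
- have := measurable_fun_fubini_tonelli_F (m2 := normal_prob 0 sd) _ mphi p0.
 by move=> h; exact: (measurableT_comp h m_idF).
- by mfun.
- by move=> w _; exact: normal_square.
Qed.

End Freezing.

Section Isometry.
Variables (n : nat) (tm : nat -> R).
Hypotheses (tm0 : 0 <= tm 0%N) (tmS : forall i, (i < n)%N -> tm i < tm i.+1).
Hypothesis tmT : tm n <= T.

Lemma tm_ge0 i : (i <= n)%N -> 0 <= tm i.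
by elim: i=> [//|i IH] h; apply: le_trans (IH (ltnW h)) (ltW (tmS h)). Qed.

Lemma tm_mono i j : (i <= j)%N -> (j <= n)%N -> tm i <= tm j.
move=> ij; elim: j ij=> [|j IH]; first by rewrite leqn0=> /eqP ->.
rewrite leq_eqVlt=> /predU1P[->//|ij] jn.
exact: le_trans (IH ij (ltnW jn)) (ltW (tmS jn)).
Qed.

Lemma tm_itv i : (i <= n)%N -> 0 <= tm i <= T.
by move=> h; rewrite tm_ge0//= (le_trans (tm_mono h _)). Qed.

Lemma sum_adapted (a : nat -> Omega -> R) k : (k <= n)%N ->
 (forall i, (i < n)%N -> adapted F (tm i) (a i)) ->
 adapted F (tm k) (fun w=> \sum_(i < k) a i w*(W (tm i.+1) w-W (tm i) w)).
move=> kn ha; apply: measurable_sum=> -[i /= ik].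
have ikn := leq_trans ik kn.
have up j : (j <= k)%N -> forall Y, adapted F (tm j) Y -> adapted F (tm k) Y.
 move=> jk Y; have jn := leq_trans jk kn; apply: (adapted_mono hF).
 - exact: tm_ge0.
 - exact: tm_mono.
 - by case/andP: (tm_itv kn).
apply: measurable_funM; first by apply: (up i (ltnW ik)); exact: ha.
by apply: measurable_funB; [apply: (up i.+1 ik)|apply: (up i (ltnW ik))];
 apply: wiener_adapted; apply: tm_itv=> //; exact: ltnW.
Qed.

(** The upper half of Itô's isometry, up to the factor 8: increments are added one at a time, each
    by [sum_step], with no cross terms. *)
Lemma isometry (a : nat -> Omega -> R) (B : nat -> R) :
 (forall i, (i < n)%N -> adapted F (tm i) (a i)) ->
 (forall i, (i < n)%N -> L1b P setT (fun w=> a i w^+2) (B i)) ->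
 L1b P setT (fun w=> (\sum_(i < n) a i w*(W (tm i.+1) w-W (tm i) w))^+2)
  (\sum_(i < n) 8*(tm i.+1-tm i)*B i).
move=> ha hB.
suff key k : (k <= n)%N ->
  L1b P setT (fun w=> (\sum_(i < k) a i w*(W (tm i.+1) w-W (tm i) w))^+2)
  (\sum_(i < k) 8*(tm i.+1-tm i)*B i) by exact: key.
elim: k=> [_|k IH kn].
 rewrite big_ord0; under eq_fun do rewrite big_ord0 expr0n /=; exact: L1b_cst.
have hk := sum_adapted (ltnW kn) ha.
rewrite big_ord_recr /=; under eq_fun do rewrite big_ord_recr /=.
have [k0 kT] : 0 <= tm k /\ tm k.+1 <= T.
 by split; [apply: tm_ge0; exact: ltnW|case/andP: (tm_itv kn)].
apply: le_trans (sum_step k0 (tmS kn) kT hk (ha k kn)) _.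
have mk := adapted_measurable hF (tm_itv (ltnW kn)) hk.
have ak := adapted_measurable hF (tm_itv (ltnW kn)) (ha k kn).
have d0 : 0 <= 8*(tm k.+1-tm k) by rewrite mulr_ge0// subr_ge0 ltW// tmS.
apply: L1bD=> //; [by mfun|by mfun|by move=> w; nneg|by move=> w; nneg|exact: IH (ltnW kn)|].
apply: L1bZ=> //; [by mfun|by move=> w; nneg|exact: hB].
Qed.

End Isometry.
End Wiener_increments.

(** * Uniform continuity and grids *)

Section Uniform_continuity.
Context {R : realType}.

Lemma heine {U : pseudoMetricType R} (A : set U) (f : U -> R) : compact A ->
 {within A, continuous f} -> forall e, 0 < e -> exists2 r, 0 < r &
  forall x y, A x -> A y -> ball x r y -> `|f x-f y| <= e.
move=> cA /within_continuousP cf e e0.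
have /compact_near_coveringP/(_ R (0 : R)^'+ (fun r x=> A x -> forall y, A y -> ball x r y -> `|f x-f y| <= e)) := cA.
move=> /(_ _ _)[x Ax|].
 have e2 : 0 < e/2 by rewrite divr_gt0.
 have [r r0 hr] := cf x Ax _ e2.
 have r2 : 0 < r/2 by rewrite divr_gt0.
 near=> x' r'; move=> Ax' y Ay x'y.
 have xx' : ball x (r/2) x' by near: x'; exact: nbhsx_ballx.
 have r'r : r' <= r/2 by near: r'; exact: nbhs_right_le.
 have xy : ball x r y.
  by rewrite [r]splitr; apply: ball_triangle xx' _; exact: le_ball x'y.
 have h1 := hr _ Ax' (le_ball (_ : r/2 <= r) xx').
 have {}h1 : `|f x-f x'| < e/2 by apply: h1; lra.
 have h2 := hr _ Ay xy.
 have /= := ler_distD (f x) (f x') (f y); rewrite (distrC (f x') (f x)) /=; lra.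
move=> r /= r0 hr; exists (r/2); first by rewrite divr_gt0.
move=> x y Ax Ay xy; apply: (hr (r/2))=> //; last by rewrite divr_gt0.
by rewrite /ball /= sub0r normrN gtr0_norm ?divr_gt0//; lra.
Unshelve. all: by end_near. Qed.

Lemma heine_itv (T : R) (f : R -> R) : continuous f ->
 forall e, 0 < e -> exists2 r, 0 < r &
  forall s t, 0 <= s <= T -> 0 <= t <= T -> `|s-t| <= r -> `|f s-f t| <= e.
move=> cf e e0; have := @heine _ `[0, T]%classic f (@segment_compact _ _ _).
move=> /(_ (continuous_subspaceT cf) e e0)[r r0 hr].
exists (r/2); first by rewrite divr_gt0.
move=> s t hs ht st; apply: hr; rewrite /= ?in_itv//.
by rewrite /ball /=; apply: le_lt_trans st _; lra.
Qed.

End Uniform_continuity.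

Section Grid.
Context {R : realType}.
Variable T : R.
Hypothesis T0 : 0 < T.

Definition grid (T : R) (n i : nat) : R := i%:R*(T/n%:R).

Lemma grid0 n : grid T n 0 = 0. by rewrite /grid mul0r. Qed.

Lemma gridT n : (0 < n)%N -> grid T n n = T.
by move=> n0; rewrite /grid mulrC divfK// pnatr_eq0 -lt0n. Qed.

Lemma gridS n i : grid T n i.+1-grid T n i = T/n%:R.
by rewrite /grid -natr1; ring. Qed.

Lemma mesh_gt0 n : (0 < n)%N -> 0 < T/n%:R.
by move=> n0; rewrite divr_gt0// ltr0n. Qed.

Lemma grid_ltS n i : (0 < n)%N -> grid T n i < grid T n i.+1.
by move=> n0; rewrite -subr_gt0 gridS mesh_gt0. Qed.

Lemma grid_le n i j : (i <= j)%N -> grid T n i <= grid T n j.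
move=> ij; rewrite /grid ler_wpM2r ?ler_nat// divr_ge0//; exact: ltW.
Qed.

Lemma grid_itv n i : (0 < n)%N -> (i <= n)%N -> 0 <= grid T n i <= T.
move=> n0 h; apply/andP; split.
 by rewrite -[leLHS](grid0 n) grid_le.
by rewrite -[leRHS](gridT n0) grid_le. Qed.

Lemma grid_refine n m j : (0 < m)%N -> grid T (n * m) (j * m) = grid T n j.
move=> m0; rewrite /grid !natrM invfM.
have m0' : m%:R != 0 :> R by rewrite pnatr_eq0 -lt0n.
by rewrite -!mulrA; congr (_*_); rewrite mulrCA; congr (_*_); rewrite mulrC divfK.
Qed.

Lemma grid_cell n t k : (0 < n)%N -> 0 < t <= grid T n k ->
 exists2 i, (i < k)%N & grid T n i < t <= grid T n i.+1.
move=> n0; elim: k=> [|k IH] /andP[t0 tk]; first by move: tk; rewrite grid0 leNgt t0.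
case: (ltP (grid T n k) t)=> h; first by exists k=> //; rewrite h.
have [i ik hi] := IH (introT andP (conj t0 h)); exists i=> //; exact: ltnW.
Qed.

Lemma sum_blocks (k m : nat) (f : nat -> R) :
 \sum_(i < k * m) f i = \sum_(j < k) \sum_(r < m) f (j * m+r)%N.
elim: k=> [|k IH]; first by rewrite mul0n !big_ord0.
by rewrite big_ord_recr /= -IH mulSnr big_split_ord.
Qed.

Lemma sum_telescope (k : nat) (f : nat -> R) : \sum_(j < k) (f j.+1-f j) = f k-f 0%N.
by rewrite -(big_mkord predT (fun j=> f j.+1-f j)) telescope_sumr. Qed.

Lemma mesh_small n (e : R) : (0 < n)%N -> 0 < e -> exists q0, forall q, (q0 <= q)%N ->
 T/(n*q.+1)%:R <= e.
move=> n0 e0; exists (Num.truncn (T/e)).+1=> q hq.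
have h : T/e < (n*q.+1)%:R.
 apply: lt_le_trans (truncnS_gt _) _; rewrite ler_nat.
 by apply: leq_trans hq (leq_trans (leqnSn _) _); exact: leq_pmull.
by rewrite ler_pdivrMr ?ltr0n ?muln_gt0 ?n0// mulrC -ler_pdivrMr// ltW.
Qed.

End Grid.

(** * Stochastic integrals as limits of grid sums *)

Section Simple_integrals.
Context {R : realType} {d : measure_display} {Omega : measurableType d}.
Variables (P : probability Omega R) (F : R -> set (set Omega)) (T : R).
Hypotheses (T0 : 0 < T) (hF : filtration F T).
                                                                           
(** [H0] is the integrand as it occurs in the equation; [H] agrees with it on [0, T] and has paths
    that are continuous at all times. *)
Variables H0 H : R -> Omega -> R.
Hypothesis H0E : forall s w, 0 <= s <= T -> H0 s w = H s w.
Hypothesis cH : forall w, continuous (fun s=> H s w).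
Hypothesis aH : forall s, 0 <= s <= T -> adapted F s (H s).

Definition grid_process (n k : nat) : simple_process :=
 SimpleProcess k (grid T n) (fun i=> H (grid T n i)).

Lemma grid_process_value n k i s w : (0 < n)%N -> (i < k)%N ->
 grid T n i < s <= grid T n i.+1 -> sp_value (grid_process n k) s w = H (grid T n i) w.
move=> n0 ik /andP[h1 h2]; rewrite /sp_value /=.
rewrite (bigD1 (Ordinal ik)) ?h1//= big1 ?addr0// => -[j jk] /= /andP[/andP[j1 j2] ji].
exfalso; move: ji; rewrite -val_eqE /= neq_ltn=> /orP[ji|ij].
 by have := lt_le_trans h1 j2; rewrite ltNge grid_le.
by have := lt_le_trans j1 h2; rewrite ltNge grid_le.
Qed.

(** Uniform continuity of each path empties the exceptional event for fine grids, so
    [measure_eventually0] applies once that event is known to be measurable. *)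
Lemma grid_process_cvg n k : (0 < n)%N -> (k <= n)%N -> forall e, 0 < e ->
 P [set w | exists s : R, 0 < s <= grid T n k /\
    e < `|sp_value (grid_process (n*q.+1) (k*q.+1)) s w-H0 s w| ]
  @[q --> \oo] --> 0%E.
move=> n0 kn e e0.
have nq0 q : (0 < n*q.+1)%N by rewrite muln_gt0 n0.
have kq q : (k*q.+1 <= n*q.+1)%N by rewrite leq_mul2r kn orbT.
have gk q : grid T (n*q.+1) (k*q.+1) = grid T n k by rewrite grid_refine.
apply: measure_eventually0=> [q|w]; last first.
 have [r r0 hr] := heine_itv T (@cH w) e0.
 have [q0 hq] := mesh_small T n0 r0; exists q0=> q /hq mq /= [s [hs]].
 apply/negP; rewrite -leNgt.
 have [i ik hi] : exists2 i, (i < k*q.+1)%N &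
   grid T (n*q.+1) i < s <= grid T (n*q.+1) i.+1.
  by apply: grid_cell=> //; rewrite gk.
 have /andP[i0 iT] := grid_itv T0 (nq0 q) (leq_trans (ltnW ik) (kq q)).
 have /andP[_ jT] := grid_itv T0 (nq0 q) (leq_trans ik (kq q)).
 have sT : 0 <= s <= T.
  by case/andP: hi=> a b; rewrite (le_trans i0 (ltW a)) (le_trans b jT).
 rewrite (grid_process_value _ (nq0 q) ik hi) H0E//; apply: hr=> //; first by rewrite i0.
 rewrite distrC ger0_norm; last by rewrite subr_ge0 ltW//; case/andP: hi.
 by apply: le_trans mq; rewrite -(gridS T (n*q.+1) i) lerD2r; case/andP: hi.
set m := (n*q.+1)%N; set K := (k*q.+1)%N.
have m0 : (0 < m)%N := nq0 q.
(* By continuity of the path a violation at some time entails one at a rational time of the same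
   cell, which makes the event a countable union. *)
rewrite (_ : [set w | _] = \bigcup_(i in `I_K) \bigcup_(r in
  [set r : rat | grid T m i < ratr r <= grid T m i.+1])
  [set w | e < `|H (grid T m i) w-H (ratr r) w|]).
 apply: fin_bigcup_measurable=> // i /= iK.
 have hi := grid_itv T0 m0 (leq_trans (ltnW iK) (kq q)).
 have hi' := grid_itv T0 m0 (leq_trans iK (kq q)).
 rewrite bigcup_mkcond; apply: bigcupT_measurable_rat=> r.
 case: ifPn=> // /set_mem /= /andP[r1 r2].
 have rT : 0 <= (ratr r : R) <= T.
  by case/andP: hi=> a b; case/andP: hi'=> c f; rewrite (le_trans a (ltW r1)) (le_trans r2 f).
 apply: measurable_gt.
 have := adapted_measurable hF hi (aH hi); have := adapted_measurable hF rT (aH rT).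
 by move=> *; mfun.
apply/seteqP; split=> w /=.
 move=> [s [hs]].
 have [i iK hi] : exists2 i, (i < K)%N & grid T m i < s <= grid T m i.+1.
  by apply: grid_cell=> //; rewrite gk.
 rewrite (grid_process_value _ m0 iK hi).
 have /andP[i0 _] := grid_itv T0 m0 (leq_trans (ltnW iK) (kq q)).
 have /andP[_ jT] := grid_itv T0 m0 (leq_trans iK (kq q)).
 case/andP: hi=> hi1 hi2; rewrite H0E; last first.
  by rewrite (le_trans i0 (ltW hi1)) (le_trans hi2 jT).
 move=> he.
 have cs : {for s, continuous (fun s=> `|H (grid T m i) w-H s w|)}.
  by apply: contA; apply: contB; [exact: cst_continuous|exact: cH].
 have he' : 0 < `|H (grid T m i) w-H s w| - e by rewrite subr_gt0.
 have /(@cvgrPdist_lt _ R)/(_ _ he')/nbhs_ballP[r /= r0 hr] := cs.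
 have lt : Num.max (grid T m i) (s-r) < s by rewrite gt_max hi1 ltrBlDr ltrDl.
 have [x] := rat_in_itvoo lt; rewrite in_itv /= gt_max=> /andP[/andP[x1 x2] x3].
 exists i=> //; exists x=> /=; first by rewrite x1 (le_trans (ltW x3)).
 have : ball s r (ratr x) by rewrite /ball /= gtr0_norm ?subr_gt0//; lra.
 move=> /hr; rewrite ltr_norml=> /andP[_]; rewrite ltrD2l ltrN2 //.
move=> [i iK [x /= hx he]]; exists (ratr x).
have /andP[i0 _] := grid_itv T0 m0 (leq_trans (ltnW iK) (kq q)).
have /andP[_ jT] := grid_itv T0 m0 (leq_trans iK (kq q)).
case/andP: (hx)=> x1 x2; rewrite (grid_process_value _ m0 iK hx) H0E; last first.
 by rewrite (le_trans i0 (ltW x1)) (le_trans x2 jT).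
split=> //; rewrite (le_lt_trans i0 x1) -(gk q) (le_trans x2)//; exact: grid_le.
Qed.

(** Only refinements [n * q.+1] of a fixed grid are used: the integrals up to all coarse grid points
    are then approximated along one and the same sequence of sums. *)
Lemma stoch_integral_cvgU n k (Y : R -> Omega -> R) I : (0 < n)%N -> (k <= n)%N ->
 (forall s, 0 <= s <= T -> mrv (Y s)) ->
 stoch_integral P F (grid T n k) H0 Y I ->
 cvgU P (fun q w=> \sum_(i < k*q.+1) H (grid T (n*q.+1) i) w *
   (Y (grid T (n*q.+1) i.+1) w-Y (grid T (n*q.+1) i) w)) I.
move=> n0 kn mY [mI hI] e e0.
have nq0 q : (0 < n*q.+1)%N by rewrite muln_gt0 n0.
have kq q : (k*q.+1 <= n*q.+1)%N by rewrite leq_mul2r kn orbT.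
have ad q : sp_admissible F (grid T n k) (grid_process (n*q.+1) (k*q.+1)).
 split=> /=; [exact: grid0|by rewrite grid_refine|by move=> i _; exact/ltW/grid_ltS|].
 move=> i ik; have hi := grid_itv T0 (nq0 q) (leq_trans (ltnW ik) (kq q)).
 by apply/(adaptedP hF)=> //; exact: aH.
have := hI _ ad (grid_process_cvg n0 kn) e e0=> /cvg0_le/(_ e0)[q0 hq].
exists q0=> q /hq PE; exists [set w | e < `|sp_integral (grid_process (n*q.+1) (k*q.+1)) Y w-I w|].
split=> //; last by move=> w /negP; rewrite -leNgt.
apply: measurable_gt; apply: measurableT_comp=> //; apply: measurable_funB=> //.
apply: measurable_sum=> -[i /= ik].
have hi := grid_itv T0 (nq0 q) (leq_trans (ltnW ik) (kq q)).
have hi' := grid_itv T0 (nq0 q) (leq_trans ik (kq q)).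
by apply: measurable_funM; [exact: (adapted_measurable hF hi (aH hi))|apply: measurable_funB; exact: mY].
Qed.

End Simple_integrals.

Section Stochastic_sums.
Context {R : realType} {d : measure_display} {Omega : measurableType d}.
Variables (P : probability Omega R) (F : R -> set (set Omega)) (T : R).
Variable W : R -> Omega -> R.
Hypotheses (T0 : 0 < T) (hF : filtration F T) (hW : wiener P F T W).
Hypothesis normal_sym : forall s : R, 0 < s -> forall A : set R, measurable A ->
 normal_prob 0 s (-%R @^-1` A) = normal_prob 0 s A.
Variables H0 H : R -> Omega -> R.
Hypothesis H0E : forall s w, 0 <= s <= T -> H0 s w = H s w.
Hypothesis cH : forall w, continuous (fun s=> H s w).
Hypothesis aH : forall s, 0 <= s <= T -> adapted F s (H s).
Variable M : R -> Omega -> R.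
Hypothesis mM : forall t, 0 <= t <= T -> mrv (M t).
Hypothesis hM : forall t, 0 <= t <= T -> exists I, stoch_integral P F t H0 W I /\
 {ae P, forall w, I w = M t w}.

Lemma integral_cvgU n k : (0 < n)%N -> (k <= n)%N ->
 cvgU P (fun q w=> \sum_(i < k*q.+1) H (grid T (n*q.+1) i) w *
   (W (grid T (n*q.+1) i.+1) w-W (grid T (n*q.+1) i) w)) (M (grid T n k)).
move=> n0 kn; have [I [hI IM]] := hM (grid_itv T0 n0 kn).
have := stoch_integral_cvgU T0 hF H0E cH aH n0 kn (wiener_measurable hF hW) hI.
by move=> h; apply: cvgU_ext h _ IM=> q; exact: aeW.
Qed.

                                                                             
                                                  
(** On [A] the refined grid sums for [M] are sums of Wiener increments whose coefficients involve
    the bounded process [HK] in place of [H]. The isometry bounds these sums on the whole space, and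
    [fatou_in_probability] passes to the limit q -> oo. The numbers [e j] are deterministic
    coefficients with which the integrand is compared. *)
Lemma integral_sum_bound n k (c : nat -> Omega -> R) (e b : nat -> R) (C : R)
  (A : set Omega) (HK : R -> Omega -> R) : (0 < n)%N -> (k <= n)%N ->
 measurable A ->
 (forall j, (j < k)%N -> adapted F (grid T n j) (c j)) ->
 (forall j w, (j < k)%N -> `|c j w| <= C) ->
 (forall s, 0 <= s <= T -> adapted F s (HK s)) ->
 (forall j w s, (j < k)%N -> A w -> grid T n j <= s <= grid T n j.+1 ->
   c j w*H s w = c j w*HK s w) ->
 (forall j s, (j < k)%N -> grid T n j <= s <= grid T n j.+1 ->
   L1b P setT (fun w=> (c j w*HK s w-e j)^+2) (b j)) ->
 L1b P A (fun w=> (\sum_(j < k) (c j w*(M (grid T n j.+1) w-M (grid T n j) w)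
   - e j*(W (grid T n j.+1) w-W (grid T n j) w)))^+2)
  (8*(T/n%:R)*\sum_(j < k) b j).
move=> n0 kn mA ac cC aHK cE hb.
have nq0 q : (0 < n*q.+1)%N by rewrite muln_gt0 n0.
have kq q : (k*q.+1 <= n*q.+1)%N by rewrite leq_mul2r kn orbT.
have gitv j : (j <= k)%N -> 0 <= grid T n j <= T.
 by move=> jk; apply: grid_itv=> //; exact: leq_trans jk kn.
have gqitv q j : (j <= k*q.+1)%N -> 0 <= grid T (n*q.+1) j <= T.
 by move=> jk; apply: grid_itv=> //; exact: leq_trans jk (kq q).
have mc j : (j < k)%N -> mrv (c j).
 by move=> jk; apply: (adapted_measurable hF (gitv j (ltnW jk))); exact: ac.
have mW t : 0 <= t <= T -> mrv (W t) by exact: (wiener_measurable hF hW).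
pose S q j w := \sum_(i < j*q.+1) H (grid T (n*q.+1) i) w *
   (W (grid T (n*q.+1) i.+1) w-W (grid T (n*q.+1) i) w).
have mS q j : (j <= k)%N -> mrv (S q j).
 move=> jk; apply: measurable_sum=> -[i /= ij].
 have ik : (i < k*q.+1)%N by apply: leq_trans ij _; rewrite leq_mul2r jk orbT.
 apply: measurable_funM.
  exact: (adapted_measurable hF (gqitv q i (ltnW ik)) (aH (gqitv q i (ltnW ik)))).
 by apply: measurable_funB; apply: mW; apply: gqitv=> //; exact: ltnW.
(* The indicator of [A] belongs to the random variable: the bounded integrand agrees with the true
   one only on [A]. *)
pose D (N : nat -> Omega -> R) w := \1_A w*\sum_(j < k) (c j w*(N j.+1 w-N j w)
  - e j*(W (grid T n j.+1) w-W (grid T n j) w)).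
have mD N : (forall j, (j <= k)%N -> mrv (N j)) -> mrv (D N).
 move=> mN; apply: measurable_funM; first exact: measurable_indic.
 apply: measurable_sum=> -[j /= jk]; apply: measurable_funB.
  apply: measurable_funM; first exact: mc.
  by apply: measurable_funB; apply: mN=> //; exact: ltnW.
 apply: measurable_funM=> //.
 by apply: measurable_funB; apply: mW; apply: gitv=> //; exact: ltnW.
have b0 j : (j < k)%N -> 0 <= b j.
 move=> jk; rewrite -lee_fin; apply: le_trans (hb j (grid T n j) jk _).
  by apply: integral_ge0=> w _; rewrite lee_fin sqr_ge0.
 by rewrite lexx /=; exact: grid_le.
have B0 : 0 <= 8*(T/n%:R)*\sum_(j < k) b j.
 rewrite mulr_ge0//; first by rewrite mulr_ge0// divr_ge0// ltW.
 by apply: sumr_ge0=> j _; exact: b0.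
suff : L1b P A (fun w=> D (fun j=> M (grid T n j)) w^+2) (8*(T/n%:R)*\sum_(j < k) b j).
 have mE : mrv (D (fun j=> M (grid T n j))).
  by apply: mD=> j jk; apply: mM; exact: gitv.
 move=> h; apply: le_trans h; rewrite le_eqVlt; apply/orP; left; apply/eqP.
 by apply: eq_integral=> w wA; rewrite /D indicE wA mul1r.
apply: (fatou_in_probability (Zq := fun q=> D (S q)))=> //.
- by move=> q; apply: mD; exact: mS.
- by apply: mD=> j jk; apply: mM; exact: gitv.
- apply: (@cvgUM _ _ _ _ (fun q w=> \sum_(j < k) _) (fun w=> \sum_(j < k) _) (\1_A) 1).
  apply: (@cvgU_sum _ _ _ P k
   (fun j q w=> c j w*(S q j.+1 w-S q j w)
     - e j*(W (grid T n j.+1) w-W (grid T n j) w))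
   (fun j w=> c j w*(M (grid T n j.+1) w-M (grid T n j) w)
     - e j*(W (grid T n j.+1) w-W (grid T n j) w)))=> j jk.
  apply: cvgUB; last exact: cvgU_cst.
  apply: cvgUM (cC j ^~ jk); apply: cvgUB; apply: integral_cvgU=> //.
   exact: leq_trans jk kn.
  exact: leq_trans (ltnW jk) kn.
 by move=> w; rewrite indicE; case: (_ \in _); rewrite ?normr1 ?normr0.
move=> q; pose m := q.+1; pose g := grid T (n * m).
have m0 : (0 < m)%N by [].
(* Fine index [i] lies in the coarse cell [i %/ m], from which it takes [c] and [e]. *)
pose a i w := c (i %/ m)%N w*HK (g i) w-e (i %/ m)%N.
have im i : (i < k * m)%N -> (i %/ m < k)%N by rewrite ltn_divLR.
have gi i : grid T n (i %/ m)%N <= g i <= grid T n (i %/ m).+1%N.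
 rewrite -!(grid_refine T n _ m0) /g !grid_le//; last exact: leq_divM.
 by rewrite ltnW// ltn_ceil.
have gm j : grid T n j = g (j * m)%N by rewrite /g grid_refine.
have DE w : A w -> D (S q) w = \sum_(i < k * m) a i w*(W (g i.+1) w-W (g i) w).
 move=> Aw; rewrite /D indicE mem_set// mul1r.
 rewrite (sum_blocks k m (fun i=> a i w*(W (g i.+1) w-W (g i) w))).
 pose hw i := H (g i) w*(W (g i.+1) w-W (g i) w).
 apply: eq_bigr=> -[j /= jk] _.
 have -> : S q j.+1 w-S q j w = \sum_(r < m) H (g (j * m+r)%N) w *
   (W (g (j * m+r).+1) w-W (g (j * m+r)%N) w).
  rewrite [S q _ _](sum_blocks j.+1 m hw) [S q _ _](sum_blocks j m hw).
  by rewrite [X in X - _]big_ord_recr /= [X in X - _]addrC addrK.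
 have -> : W (grid T n j.+1) w-W (grid T n j) w =
   \sum_(r < m) (W (g (j * m+r).+1) w-W (g (j * m+r)%N) w).
  rewrite !gm; have := sum_telescope m (fun r=> W (g (j * m+r)%N) w).
  by rewrite addn0 -mulSnr=> <-; apply: eq_bigr=> r _; rewrite addnS.
 rewrite !mulr_sumr -sumrB; apply: eq_bigr=> -[r /= rm] _.
 have jr : ((j * m+r) %/ m = j)%N by rewrite divnMDl// divn_small// addn0.
 rewrite /a jr mulrA (cE j) ?mulrBl//.
 by have := gi (j * m+r)%N; rewrite jr.
have aa i : (i < k * m)%N -> adapted F (g i) (a i).
 move=> ik; have gT := gqitv q i (ltnW ik); case/andP: (gT)=> g0 gT'.
 apply: measurable_funB=> //; apply: measurable_funM; last exact: aHK.
 apply: (adapted_mono hF _ _ gT') (ac _ (im i ik)).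
  by case/andP: (gitv _ (ltnW (im i ik))).
 by case/andP: (gi i).
have kmT : g (k * m)%N <= T by case/andP: (gqitv q (k * m)%N (leqnn _)).
have iso := @isometry _ _ _ P F T W hF hW normal_sym (k * m) g.
have {iso} := iso _ (fun i _=> grid_ltS T0 i (nq0 q)) kmT a (fun i=> b (i %/ m)%N) aa _.
rewrite /g grid0=> /(_ (lexx _)) iso.
have {iso} iso : L1b P setT (fun w=> (\sum_(i < k * m) a i w*(W (g i.+1) w-W (g i) w))^+2)
  (8*(T/n%:R)*\sum_(j < k) b j).
 apply: L1b_mono (iso _).
  rewrite (sum_blocks k m (fun i=> 8*(g i.+1-g i)*b (i %/ m)%N)) mulr_sumr; apply: ler_sum=> -[j /= jk] _.
  under eq_bigr=> r _.
   rewrite gridS divnMDl// divn_small// addn0; over.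
  rewrite sumr_const card_ord -mulr_natr natrM le_eqVlt; apply/orP; left; apply/eqP.
  by field; rewrite !pnatr_eq0 -!lt0n n0.
 by move=> i ik; apply: hb (im i ik) (gi i).
have ma : mrv (fun w=> \sum_(i < k * m) a i w*(W (g i.+1) w-W (g i) w)).
 apply: measurable_sum=> -[i /= ik]; apply: measurable_funM.
  by apply: (adapted_measurable hF (gqitv q i (ltnW ik))); exact: aa.
 by apply: measurable_funB; apply: mW; apply: gqitv=> //; exact: ltnW.
apply: (@L1b_le _ _ _ P A _ (fun w=> (\sum_(i < k * m) a i w*(W (g i.+1) w-W (g i) w))^+2))=> //.
- by apply: measurable_funX; apply: mD; exact: mS.
- exact: measurable_funX.
- by move=> w _; rewrite sqr_ge0.
- by move=> w Aw; rewrite DE.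
- by apply: L1b_subset iso=> //; [exact: measurable_funX|move=> w; rewrite sqr_ge0].
Qed.

End Stochastic_sums.

(** * Stochastic orders of magnitude as eps tends to 0 *)

Section Asymptotics.
Context {R : realType} {d : measure_display} {Omega : measurableType d}.
Variable P : probability Omega R.

Definition small (Q : R -> Prop) : Prop :=
 exists2 r, 0 < r & forall eps, 0 < eps -> eps < r -> Q eps.

Lemma small_and Q Q' : small Q -> small Q' -> small (fun eps=> Q eps /\ Q' eps).
move=> [r r0 h] [r' r'0 h']; exists (Num.min r r'); first by rewrite lt_min r0.
by move=> eps e0; rewrite lt_min=> /andP[/h a /h' b]; split; [exact: a|exact: b].
Qed.

Lemma small_mono (Q Q' : R -> Prop) : small Q -> (forall eps, 0 < eps -> Q eps -> Q' eps) -> small Q'.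
by move=> [r r0 h] QQ'; exists r=> // eps e0 /(h eps e0); exact: QQ'. Qed.

Lemma small_all (Q : R -> Prop) : (forall eps, 0 < eps -> Q eps) -> small Q.
by move=> h; exists 1=> // eps e0 _; exact: h. Qed.

Lemma small_lt c : 0 < c -> small (fun eps=> eps < c).
by exists c. Qed.

Lemma small_le_mul C c : 0 < c -> small (fun eps=> C*eps <= c).
move=> c0; exists (c/(`|C| + 1)); first by rewrite divr_gt0// ltr_pwDr.
move=> eps e0; have C1 : 0 < `|C| + 1 by rewrite ltr_pwDr.
rewrite ltr_pdivlMr// => h; apply: le_trans (ltW h).
rewrite mulrC; apply: ler_wpM2l; first exact: ltW.
by rewrite (le_trans (ler_norm C))// lerDl.
Qed.

Implicit Types (Q : R -> Omega -> Prop) (Y Z : R -> Omega -> R).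

(** [whp] is with probability tending to one; [OP] and [oP] are boundedness and convergence to 0 in
    probability. All are phrased with [up_to], so that they also apply to quantities whose
    measurability in w is not established. *)
Definition whp Q : Prop := forall e, 0 < e -> small (fun eps=> up_to P e (Q eps)).

Definition OP Y : Prop := forall e, 0 < e -> exists2 lam, 0 < lam &
 small (fun eps=> up_to P e (fun w=> `|Y eps w| <= lam)).

Definition oP Y : Prop := forall eta, 0 < eta -> whp (fun eps w=> `|Y eps w| <= eta).

Lemma whp_and Q Q' : whp Q -> whp Q' -> whp (fun eps w=> Q eps w /\ Q' eps w).
move=> h h' e e0; have e2 : 0 < e/2 by rewrite divr_gt0.
apply: small_mono (small_and (h _ e2) (h' _ e2)) _=> eps _ [a b].
by apply: up_to_mono (up_to_and a b)=> //; lra.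
Qed.

Lemma whp_mono Q Q' : whp Q -> small (fun eps=> forall w, Q eps w -> Q' eps w) -> whp Q'.
move=> h h' e e0; apply: small_mono (small_and (h _ e0) h') _=> eps _ [a b].
exact: up_to_mono (lexx _) b a.
Qed.

Lemma whp_small (Q : R -> Prop) : small Q -> whp (fun eps _=> Q eps).
move=> h e e0; apply: small_mono h _=> eps _ q; apply: up_to_all=> //; exact: ltW.
Qed.

Lemma OP_le Y Z : OP Z -> whp (fun eps w=> `|Y eps w| <= `|Z eps w|) -> OP Y.
move=> hZ h e e0; have e2 : 0 < e/2 by rewrite divr_gt0.
have [lam l0 hl] := hZ _ e2; exists lam=> //.
apply: small_mono (small_and hl (h _ e2)) _=> eps _ [a b].
by apply: up_to_mono (up_to_and a b)=> [|w [u v]]; [lra|exact: le_trans v u].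
Qed.
Lemma OP_cst (c : R) : OP (fun _ _=> c).
move=> e e0; exists (`|c| + 1); first by rewrite ltr_pwDr.
by apply: small_all=> eps _; apply: up_to_all=> [|w]; [exact: ltW|rewrite lerDl].
Qed.

Lemma OPD Y Z : OP Y -> OP Z -> OP (fun eps w=> Y eps w+Z eps w).
move=> hY hZ e e0; have e2 : 0 < e/2 by rewrite divr_gt0.
have [l l0 hl] := hY _ e2; have [k k0 hk] := hZ _ e2.
exists (l+k); first exact: addr_gt0.
apply: small_mono (small_and hl hk) _=> eps _ [a b].
apply: up_to_mono (up_to_and a b)=> [|w [u v]]; first by lra.
exact: le_trans (ler_normD _ _) (lerD u v).
Qed.

Lemma OPM Y Z : OP Y -> OP Z -> OP (fun eps w=> Y eps w*Z eps w).
move=> hY hZ e e0; have e2 : 0 < e/2 by rewrite divr_gt0.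
have [l l0 hl] := hY _ e2; have [k k0 hk] := hZ _ e2.
exists (l*k); first exact: mulr_gt0.
apply: small_mono (small_and hl hk) _=> eps _ [a b].
apply: up_to_mono (up_to_and a b)=> [|w [u v]]; first by lra.
by rewrite normrM; apply: ler_pM.
Qed.
Lemma oP_OP Y : oP Y -> OP Y.
by move=> h e e0; exists 1=> //; exact: h. Qed.
Lemma OPZ (c : R) Y : OP Y -> OP (fun eps w=> c*Y eps w).
exact: OPM (OP_cst c). Qed.
                                                                            
                                         
(** The usual way to reach [oP] below: estimates give an arbitrary eta times one fixed
    stochastically bounded variable. *)
Lemma oP_eta Y Z : OP Z ->
 (forall eta, 0 < eta -> whp (fun eps w=> `|Y eps w| <= eta * `|Z eps w|)) -> oP Y.
move=> hZ h eta eta0 e e0; have e2 : 0 < e/2 by rewrite divr_gt0.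
have [l l0 hl] := hZ _ e2; have h' := h _ (divr_gt0 eta0 l0) _ e2.
apply: small_mono (small_and h' hl) _=> eps _ [a b].
apply: up_to_mono (up_to_and a b)=> [|w [u v]]; first by lra.
apply: le_trans u _; rewrite -[leRHS](divfK (lt0r_neq0 l0)).
by rewrite ler_wpM2l// divr_ge0 ?ltW.
Qed.

(** Localisation: moments are bounded only on events where the path stays in a tube of radius
    [lam * eps], and such events have probability as close to 1 as desired for suitable [lam]. *)
Lemma OP_L1 Y (tube : R -> R -> set Omega -> Prop) :
 (forall e, 0 < e -> exists2 lam, 0 < lam & small (fun eps=> exists A,
   [/\ measurable A, (P (~` A) <= e%:E)%E & tube lam eps A])) ->
 (forall eps w, 0 <= Y eps w) -> small (fun eps=> mrv (Y eps)) ->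
 (forall lam, 0 < lam -> exists2 C, 0 < C & small (fun eps=> forall A, measurable A ->
   tube lam eps A -> L1b P A (Y eps) C)) -> OP Y.
move=> ht Y0 mY hY e e0; have e2 : 0 < e/2 by rewrite divr_gt0.
have [lam lam0 hA] := ht _ e2; have [C C0 hC] := hY _ lam0.
exists (C/(e/2)); first by rewrite divr_gt0.
apply: small_mono (small_and (small_and hA hC) mY) _=> eps _ [[[A [mA PA tA]] h] m].
have := L1b_markov mA m (Y0 eps) (divr_gt0 C0 e2) (h _ mA tA) PA.
apply: up_to_mono=> [|w [_]]; last by rewrite ger0_norm.
by rewrite invf_div mulrCA divff ?gt_eqF// mulr1; lra.
Qed.

Lemma oP_L1 Y (tube : R -> R -> set Omega -> Prop) (C : R) :
 (forall e, 0 < e -> exists2 lam, 0 < lam & small (fun eps=> exists A,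
   [/\ measurable A, (P (~` A) <= e%:E)%E & tube lam eps A])) -> 0 <= C ->
 (forall eps w, 0 <= Y eps w) -> small (fun eps=> mrv (Y eps)) ->
 (forall lam eta, 0 < lam -> 0 < eta -> small (fun eps=> forall A, measurable A ->
   tube lam eps A -> L1b P A (Y eps) (eta+C*fine (P (~` A))))) -> oP Y.
move=> ht C0 Y0 mY hY eta eta0 e e0.
have e2 : 0 < e/4 by rewrite divr_gt0.
have C1 : 0 < C+1 by rewrite ltr_pwDr.
(* Makes P(~A) <= e/4 and C P(~A) <= eta e/4, so that Markov's inequality at level eta loses at most
   e/2. *)
pose e1 := Num.min (e/4) (eta*(e/4)/(C+1)).
have e10 : 0 < e1 by rewrite lt_min e2 divr_gt0// mulr_gt0.
have eta4 : 0 < eta*(e/4) by rewrite mulr_gt0.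
have [lam lam0 hA] := ht _ e10; have hC := hY _ _ lam0 eta4.
apply: small_mono (small_and (small_and hA hC) mY) _=> eps _ [[[A [mA PA tA]] h] m].
have := L1b_markov mA m (Y0 eps) eta0 (h _ mA tA) PA.
apply: up_to_mono=> [|w [_]]; last by rewrite ger0_norm.
have pA : fine (P (~` A)) <= e1.
 by rewrite -lee_fin fineK ?fin_num_measure//; exact: measurableC.
have a1 : e1 <= e/4 by rewrite ge_min lexx.
have a2 : e1*(C+1) <= eta*(e/4) by rewrite -ler_pdivlMr// ge_min lexx orbT.
have a3 : C*fine (P (~` A)) <= eta*(e/4).
 apply: le_trans a2; rewrite mulrC; apply: ler_pM=> //; last by rewrite lerDl.
 exact: fine_ge0.
have : (eta*(e/4)+C*fine (P (~` A)))/eta <= e/2.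
 by rewrite ler_pdivrMr//; lra.
lra.
Qed.

End Asymptotics.

(** * Riemann sums and oscillation of paths *)

Section Riemann_sums.
Context {R : realType}.
Variable T : R.
Hypothesis T0 : 0 < T.

Lemma riemann_error (f : R -> R) n k e : continuous f -> (0 < n)%N -> (k <= n)%N ->
 (forall j s, (j < k)%N -> grid T n j <= s <= grid T n j.+1 -> `|f s-f (grid T n j)| <= e) ->
 `|Int 0 (grid T n k) f - \sum_(j < k) f (grid T n j)*(T/n%:R)| <= e*grid T n k.
move=> cf n0 kn he.
have gS j : grid T n j <= grid T n j.+1 by exact/ltW/grid_ltS.
rewrite -{1}(grid0 T n) -Int_telescope// -sumrB.
rewrite -[X in e*X]subr0 -[X in e*(_ - X)](grid0 T n) -sum_telescope mulr_sumr.
apply: le_trans (ler_norm_sum _ _ _) _; apply: ler_sum=> -[j /= jk] _.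
rewrite -(gridS T n j) -Int_cst// -IntB//; last exact: cst_continuous.
apply: Int_bound=> //; first by apply: contB=> //; exact: cst_continuous.
by move=> s hs; exact: he.
Qed.

End Riemann_sums.

Section Paths.
Context {R : realType} {d : measure_display} {Omega : measurableType d}.
Variables (P : probability Omega R) (T : R).
Hypothesis T0 : 0 < T.

(** A pointwise limit of Riemann sums; only measurability at fixed times and continuity in time are
    needed, not joint measurability. *)
Lemma Int_measurable (Y : R -> Omega -> R) t : 0 <= t ->
 (forall w, continuous (fun s=> Y s w)) ->
 (forall s, 0 <= s <= t -> mrv (Y s)) ->
 mrv (fun w=> Int 0 t (fun s=> Y s w)).
rewrite le_eqVlt=> /predU1P[<-|t0] cY mY.
 by under eq_fun do rewrite Int_xx; exact: measurable_cst.
apply: (measurable_fun_cvg (h := fun n w=> \sum_(j < n.+1) Y (grid t n.+1 j) w*(t/n.+1%:R))).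
 move=> n; apply: measurable_sum=> -[j /= jn]; apply: measurable_funM=> //.
 by apply: mY; apply: grid_itv=> //; exact: ltnW.
move=> w _; apply/(@cvgrPdist_le _ R)=> e e0.
have et : 0 < e/t by rewrite divr_gt0.
have [r r0 hr] := @heine_itv _ t _ (cY w) _ et.
have [q0 hq] := mesh_small t (ltn0Sn 0) r0.
exists q0=> // q /= /hq; rewrite mul1n=> mq.
have := @riemann_error _ t t0 (fun s=> Y s w) q.+1 q.+1 (e/t) (cY w) (ltn0Sn q) (leqnn _).
rewrite gridT// divfK ?gt_eqF//; apply=> j s jq /andP[s1 s2].
have /andP[j0 _] := @grid_itv _ t t0 q.+1 j (ltn0Sn q) (ltnW jq).
have /andP[_ jt] := @grid_itv _ t t0 q.+1 j.+1 (ltn0Sn q) jq.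
apply: hr.
- by rewrite (le_trans j0 s1) (le_trans s2 jt).
- by rewrite j0 (le_trans (le_trans s1 s2) jt).
- rewrite ger0_norm ?subr_ge0//; apply: le_trans mq.
 by rewrite -(gridS t q.+1 j) lerD2r.
Qed.

Variable X : R -> Omega -> R.
Hypothesis cX : forall w, continuous (fun s=> X s w).
Hypothesis mX : forall s, 0 <= s <= T -> mrv (X s).

Definition osc_event n (eta : R) : set Omega := [set w | forall j s, (j < n)%N ->
 grid T n j <= s <= grid T n j.+1 -> `|X s w-X (grid T n j) w| <= eta].

(** Continuity reduces the condition to rational times in the open cells. *)
Lemma osc_event_measurable n eta : (0 < n)%N -> measurable (osc_event n eta).
move=> n0; rewrite (_ : osc_event n eta = ~` \bigcup_(j in `I_n) \bigcup_(r in
  [set r : rat | grid T n j < ratr r < grid T n j.+1])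
  [set w | eta < `|X (ratr r) w-X (grid T n j) w|]).
 apply: measurableC; apply: fin_bigcup_measurable=> // j /= jn.
 have /andP[j0 jT] := grid_itv T0 n0 (ltnW jn); have /andP[_ jT'] := grid_itv T0 n0 jn.
 rewrite bigcup_mkcond; apply: bigcupT_measurable_rat=> r.
 case: ifPn=> // /set_mem /= /andP[r1 r2].
 have m1 : mrv (X (ratr r)).
  by apply: mX; rewrite (le_trans j0 (ltW r1)) (le_trans (ltW r2) jT').
 have m2 : mrv (X (grid T n j)) by apply: mX; rewrite j0.
 by apply: measurable_gt; mfun.
apply/seteqP; split=> w /=.
 move=> h [j jn [r /= /andP[r1 r2]]]; apply/negP; rewrite -leNgt.
 by apply: h=> //; rewrite !ltW.
move=> h j s jn /andP[s1 s2]; rewrite leNgt; apply/negP=> hs.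
have cs : {for s, continuous (fun s=> `|X s w-X (grid T n j) w|)}.
 by apply: contA; apply: contB; [exact: cX|exact: cst_continuous].
have he' : 0 < `|X s w-X (grid T n j) w| - eta by rewrite subr_gt0.
have /(@cvgrPdist_lt _ R)/(_ _ he')/nbhs_ballP[r /= r0 hr] := cs.
have gl := grid_ltS T0 j n0.
have lt : Num.max (grid T n j) (s-r) < Num.min (grid T n j.+1) (s+r).
 by rewrite gt_max !lt_min gl /=; apply/andP; split; lra.
have [x] := rat_in_itvoo lt; rewrite in_itv /= gt_max lt_min=> /andP[/andP[x1 x2] /andP[x3 x4]].
apply: h; exists j=> //; exists x=> /=; first by rewrite x1.
have : ball s r (ratr x) by rewrite /ball /= ltr_norml; apply/andP; split; lra.
by move=> /hr; rewrite ltr_norml=> /andP[_]; rewrite ltrD2l ltrN2.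
Qed.

Lemma osc_event_eventually w eta : 0 < eta -> exists r, 0 < r /\ forall n, (0 < n)%N ->
 T/n%:R <= r -> osc_event n eta w.
move=> eta0; have [r r0 hr] := @heine_itv _ T _ (@cX w) _ eta0.
exists r; split=> // n n0 nr j s jn /andP[s1 s2].
have /andP[j0 jT] := grid_itv T0 n0 (ltnW jn); have /andP[_ jT'] := grid_itv T0 n0 jn.
apply: hr; rewrite ?j0 ?(le_trans j0 s1) ?(le_trans s2 jT')//.
by rewrite ger0_norm ?subr_ge0//; apply: le_trans nr; rewrite -(gridS T n j) lerD2r.
Qed.

Lemma osc_event_whp n eta e : (0 < n)%N -> 0 < eta -> 0 < e -> exists q0, forall q, (q0 <= q)%N ->
 (P (~` osc_event (n*q.+1) eta) <= e%:E)%E.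
move=> n0 eta0 e0; apply: (cvg0_le _ e0); apply: measure_eventually0=> [q|w].
 by apply: measurableC; apply: osc_event_measurable; rewrite muln_gt0 n0.
have [r [r0 hr]] := osc_event_eventually w eta0.
have [q0 hq] := mesh_small T n0 r0; exists q0=> q /hq mq h; apply: h; apply: hr=> //.
by rewrite muln_gt0 n0.
Qed.

End Paths.

(** * The diffusion stays close to the limit path *)

Section Diffusion.
Context {R : realType} {d : measure_display} {Omega : measurableType d}.
Variables (P : probability Omega R) (F : R -> set (set Omega)) (T : R).
Variable W : R -> Omega -> R.
Hypotheses (T0 : 0 < T) (hF : filtration F T) (hW : wiener P F T W).
Hypothesis normal_sym : forall s : R, 0 < s -> forall A : set R, measurable A ->
 normal_prob 0 s (-%R @^-1` A) = normal_prob 0 s A.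
Variables (S0 sg : R -> R -> R) (x : R -> R) (x0 L eps : R).
Hypotheses (eps0 : 0 < eps) (L0 : 0 < L).
Hypothesis cS0 : cont2 S0.
Hypothesis csg : cont2 sg.
Hypothesis lipS0 : forall t y z, `|S0 t y-S0 t z| <= L * `|y-z|.
Hypothesis growsg : forall t y, `|sg t y| <= L*(1+`|y|).
Hypothesis cx : continuous x.
Hypothesis xE : forall t, 0 <= t <= T -> x t = x0+Int 0 t (fun s=> S0 s (x s)).
Variable X : R -> Omega -> R.
Hypothesis cX : forall w, continuous (fun s=> X s w).
Hypothesis aX : forall s, 0 <= s <= T -> adapted F s (X s).

(** The stochastic integral of sigma against W, recovered from the path through the equation: the
    equation only provides it almost surely for each t, whereas this version is continuous in t for
    all w. *)
Definition mart t w : R := eps^-1*(X t w-x0-Int 0 t (fun s=> S0 s (X s w))).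

Variable H0 : R -> Omega -> R.
Hypothesis H0E : forall s w, 0 <= s <= T -> H0 s w = sg s (X s w).
Hypothesis hM : forall t, 0 <= t <= T -> exists I, stoch_integral P F t H0 W I /\
 {ae P, forall w, I w = mart t w}.

Lemma mX s : 0 <= s <= T -> mrv (X s).
by move=> sT; exact: (adapted_measurable hF sT (aX sT)). Qed.

Lemma cont_path (g : R -> R -> R) w : cont2 g ->
 continuous (fun s=> g s (X s w)).
move=> cg; apply: (@cont_comp _ _ _ (fun s=> (s, X s w)) (fun p=> g p.1 p.2))=> //.
by apply: cont_pair; [move=> s; exact: cvg_id|exact: cX].
Qed.

Lemma cont_section (g : R -> R -> R) t : cont2 g ->
 continuous (g t).
move=> cg; apply: (@cont_comp _ _ _ (fun y=> (t, y)) (fun p=> g p.1 p.2))=> //.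
by apply: cont_pair; [exact: cst_continuous|move=> s; exact: cvg_id].
Qed.

Lemma adapted_path (g : R -> R -> R) s : cont2 g ->
 0 <= s <= T -> adapted F s (fun w=> g s (X s w)).
move=> cg sT; apply: (measurableT_comp _ (aX sT)).
by apply: continuous_measurable_fun; exact: cont_section.
Qed.

Lemma mart_measurable t : 0 <= t <= T -> mrv (mart t).
move=> tT; case/andP: (tT)=> t0 tT'.
apply: measurable_funM=> //; apply: measurable_funB.
 by apply: measurable_funB=> //; exact: mX.
apply: Int_measurable=> // [w|s /andP[s0 st]]; first exact: cont_path.
have sT : 0 <= s <= T by rewrite s0 (le_trans st).
exact: (adapted_measurable hF sT (adapted_path cS0 sT)).
Qed.

(** Clips the state, so that sigma of it is bounded everywhere and still adapted; as long as the
    path is bounded by K nothing changes. *)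
Definition trunc (K y : R) : R := Num.max (- K) (Num.min y K).

Lemma trunc_id K y : `|y| <= K -> trunc K y = y.
by rewrite ler_norml=> /andP[h1 h2]; rewrite /trunc min_l// max_r. Qed.

Lemma trunc_le K y : 0 <= K -> `|trunc K y| <= K.
move=> K0; rewrite ler_norml /trunc le_max lexx /= ge_max ge_min lexx orbT andbT; lra.
Qed.

Lemma trunc_adapted K s : 0 <= s <= T -> adapted F s (fun w=> sg s (trunc K (X s w))).
move=> sT; apply: (measurableT_comp (f := sg s)).
 by apply: continuous_measurable_fun; exact: cont_section.
by apply: measurable_maxr=> //; apply: measurable_minr=> //; exact: aX.
Qed.

Lemma trunc_sg K s y : 0 <= K -> `|sg s (trunc K y)| <= L*(1+K).
move=> K0; apply: le_trans (growsg _ _) _.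
by apply: ler_wpM2l; [exact: ltW|rewrite lerD2l; exact: trunc_le].
Qed.

Lemma mart_sum_bound n k (c : nat -> Omega -> R) (e b : nat -> R) (C K : R)
  (A : set Omega) : (0 < n)%N -> (k <= n)%N -> measurable A ->
 (forall j, (j < k)%N -> adapted F (grid T n j) (c j)) ->
 (forall j w, (j < k)%N -> `|c j w| <= C) ->
 (forall j w s, (j < k)%N -> A w -> grid T n j <= s <= grid T n j.+1 ->
   c j w != 0 -> `|X s w| <= K) ->
 (forall j s, (j < k)%N -> grid T n j <= s <= grid T n j.+1 ->
   L1b P setT (fun w=> (c j w*sg s (trunc K (X s w))-e j)^+2) (b j)) ->
 L1b P A (fun w=> (\sum_(j < k) (c j w*(mart (grid T n j.+1) w-mart (grid T n j) w)
   - e j*(W (grid T n j.+1) w-W (grid T n j) w)))^+2)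
  (8*(T/n%:R)*\sum_(j < k) b j).
move=> n0 kn mA ac cC cK hb.
apply: (@integral_sum_bound _ _ _ P F T W T0 hF hW normal_sym H0 (fun s w=> sg s (X s w)) H0E
 _ _ mart mart_measurable hM n k c e b C A (fun s w=> sg s (trunc K (X s w))))=> //.
- by move=> w; exact: cont_path.
- by move=> s sT; exact: adapted_path.
- by move=> s sT; exact: trunc_adapted.
- move=> j w s jk Aw hs; case: (eqVneq (c j w) 0)=> [->|c0]; first by rewrite !mul0r.
 by rewrite trunc_id//; exact: cK c0.
Qed.

(** The equation at time 0 contains an integral over a degenerate interval, approximated by empty
    sums, so that X_0 agrees with x0 up to any prescribed error. *)
Lemma start_close e : 0 < e -> up_to P e (fun w=> `|X 0 w-x0| <= e).
move=> e0; have e1 : 0 < Num.min e (eps^-1*e) by pos.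
have := @integral_cvgU _ _ _ P F T W T0 hF hW H0 (fun s w=> sg s (X s w)) H0E
 (fun w=> cont_path csg) (fun s sT=> adapted_path csg sT) mart hM 1 0 isT isT _ e1.
move=> [q0 /(_ q0 (leqnn _))]; apply: up_to_mono; first by rewrite ge_min lexx.
move=> w; rewrite mul0n big_ord0 grid0 sub0r normrN /mart Int_xx subr0.
rewrite le_min=> /andP[_]; rewrite normrM gtr0_norm ?invr_gt0//.
by rewrite ler_pM2l ?invr_gt0.
Qed.

Variables (lam K : R).
Hypotheses (lam0 : 0 < lam) (xK : forall s, 0 <= s <= T -> `|x s| + 2 <= K).
Let kap : R := expR (2*L*T).
Hypothesis lam_small : lam*eps*kap <= 1.

                                                                               
                                                                            
                                                                           
(** Discrete Gronwall barrier. Its growth rate 2L is twice the Lipschitz constant of the drift, so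
    by [barrier_sum] the drift below the barrier explains only half of its height; the noise must
    supply the rest. *)
Let barrier n j : R := lam*eps*(1+2*L*(T/n%:R))^+j.

Let q1 n : (0 < n)%N -> 1 <= 1+2*L*(T/n%:R).
by move=> n0; rewrite lerDl !mulr_ge0// ?invr_ge0//; exact: ltW.
Qed.

Let le0 : 0 < lam*eps. exact: mulr_gt0. Qed.

Lemma barrier_le n j : (0 < n)%N -> (j <= n)%N -> barrier n j <= lam*eps*kap.
move=> n0 jn; rewrite /barrier ler_pM2l//.
apply: le_trans (_ : (1+2*L*(T/n%:R))^+n <= _); first by rewrite ler_weXn2l ?q1.
have -> : kap = expR (2*L*(T/n%:R))^+n.
 rewrite -expRM_natl /kap; congr expR; rewrite mulrCA -[LHS]mulr1; field.
 by rewrite pnatr_eq0 -lt0n.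
by rewrite lerXn2r ?nnegrE ?expR_ge0// ?expR_ge1Dx// (le_trans ler01)// q1.
Qed.

Lemma barrier_sum n k : (0 < n)%N ->
 L*\sum_(j < k) barrier n j*(T/n%:R) = (barrier n k-lam*eps)/2.
move=> n0; have h0 : 0 < T/n%:R by rewrite mesh_gt0.
rewrite -mulr_suml; elim: k=> [|k IH].
 by rewrite big_ord0 /barrier expr0; ring.
rewrite big_ord_recr /= mulrDl mulrDr IH /barrier exprS.
by move: (T/n%:R)=> h; field.
Qed.

(** Before the first crossing the drift difference is at most L times the barrier, up to
    oscillations, hence accounts for (barrier - lam eps)/2. Start, drift and oscillations together
    leave at least lam eps/4 to the noise. *)
Lemma first_crossing n w eta tau : (0 < n)%N -> (tau <= n)%N -> 0 <= eta ->
 osc_event T X n eta w ->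
 (forall j s, (j < n)%N -> grid T n j <= s <= grid T n j.+1 -> `|x s-x (grid T n j)| <= eta) ->
 `|X 0 w-x0| <= lam*eps/8 -> 2*L*T*eta <= lam*eps/8 ->
 (forall j, (j < tau)%N -> `|X (grid T n j) w-x (grid T n j)| <= barrier n j) ->
 barrier n tau < `|X (grid T n tau) w-x (grid T n tau)| ->
 lam/4 <= `|mart (grid T n tau) w-mart 0 w|.
move=> n0 tn eta0 osc oscx h0 hL hj ht.
have titv := grid_itv T0 n0 tn; set t := grid T n tau in titv ht *.
have cSX : continuous (fun s=> S0 s (X s w)) by exact: cont_path.
have cSx : continuous (fun s=> S0 s (x s)).
 apply: (@cont_comp _ _ _ (fun s=> (s, x s)) (fun p=> S0 p.1 p.2))=> //.
 by apply: cont_pair=> // s; exact: cvg_id.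
have gS j : grid T n j <= grid T n j.+1 by exact/ltW/grid_ltS.
pose D s := S0 s (X s w)-S0 s (x s).
have cD : continuous D by exact: contB.
have drift : `|Int 0 t D| <= (barrier n tau-lam*eps)/2+lam*eps/8.
 rewrite -(grid0 T n) -Int_telescope//.
 apply: le_trans (ler_norm_sum _ _ _) _.
 apply: (@le_trans _ _ (\sum_(j < tau) L*(barrier n j+2*eta)*(T/n%:R))).
  apply: ler_sum=> -[j /= jt] _; rewrite -(gridS T n j).
  apply: Int_bound=> // s hs; apply: le_trans (lipS0 _ _ _) _.
  apply: ler_wpM2l; first exact: ltW.
  have jn := leq_trans jt tn.
  have a1 := osc j s jn hs; have a2 := oscx j s jn hs; have a3 := hj j jt.
  rewrite (_ : X s w-x s = (X s w-X (grid T n j) w)-(x s-x (grid T n j))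
    + (X (grid T n j) w-x (grid T n j))); last by ring.
  apply: le_trans (ler_normD _ _) _; rewrite addrC lerD//.
  apply: le_trans (ler_normB _ _) _; lra.
 under eq_bigr do rewrite mulrDr mulrDl -mulrA.
 rewrite big_split /= -mulr_sumr barrier_sum// lerD2l sumr_const card_ord -[leLHS]mulr_natr.
 apply: le_trans hL; rewrite (_ : _*_ = 2*L*eta*(tau%:R*(T/n%:R))); last by ring.
 rewrite [leRHS]mulrAC ler_wpM2l//; first by pos.
 by case/andP: titv.
have mE : eps*(mart t w-mart 0 w) = (X t w-x t)-(X 0 w-x0)-Int 0 t D.
 rewrite /mart Int_xx -mulrBr mulVKf ?gt_eqF//.
 by rewrite IntB// (xE titv); ring.
have : lam*eps/4 <= `|eps*(mart t w-mart 0 w)|.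
 rewrite mE; have b0 : lam*eps <= barrier n tau.
  by rewrite /barrier ler_peMr ?(ltW le0)// exprn_ege1// q1.
 move: ht drift h0 b0 le0; move: (X t w-x t) (X 0 w-x0) (Int 0 t D) (barrier n tau) (lam*eps).
 move=> a1 a2 a3 a4 a5 ht drift h0 b0 a50.
 have := lerB_normD a1 (- a2-a3); rewrite addrA=> n1.
 have := ler_normB (- a2) a3; rewrite normrN=> n2.
 lra.
rewrite (_ : lam*eps/4 = eps*(lam/4)); last by ring.
by rewrite normrM gtr0_norm// ler_pM2l.
Qed.

(** Crossing the barrier forces a large value of the noise stopped at the crossing. The stopped
    noise has a bounded second moment, since the path before the crossing lies in a compact set, and
    Chebyshev's inequality gives the bound in 1/lam^2. *)
Lemma exit_bound e : 0 < e ->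
 up_to P (e+800*T*(L*(1+K))^+2/lam^+2)
  (fun w=> forall s, 0 <= s <= T -> `|X s w-x s| <= (kap+1) * lam*eps).
move=> e0.
(* The three bounds serve the truncation level K, the final estimate between grid points, and the
   hypothesis of [first_crossing], respectively. *)
pose eta := Num.min 1 (Num.min (lam*eps/4) (lam*eps/8/(2*L*T))).
have LT : 0 < 2*L*T by rewrite !mulr_gt0.
have eta0 : 0 < eta by rewrite !lt_min ltr01 !divr_gt0.
have eta1 : eta <= 1 by rewrite ge_min lexx.
have eta2 : eta <= lam*eps/4 by rewrite ge_min ge_min lexx /= orbT.
have eta3 : 2*L*T*eta <= lam*eps/8.
 by rewrite mulrC -ler_pdivlMr// /eta !ge_min lexx !orbT.
have e3 : 0 < e/3 by rewrite divr_gt0.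
have [q1' hq1] := osc_event_whp P T0 cX mX (ltn0Sn 0) eta0 e3.
have [rx rx0 hrx] := @heine_itv _ T x cx _ eta0.
have [q2 hq2] := mesh_small T (ltn0Sn 0) rx0.
pose n := (1*(maxn q1' q2).+1)%N.
have n0 : (0 < n)%N by [].
have PA : (P (~` osc_event T X n eta) <= (e/3)%:E)%E by apply: hq1; exact: leq_maxl.
have mr : T/n%:R <= rx by apply: hq2; exact: leq_maxr.
clearbody n.
have mA : measurable (osc_event T X n eta) by exact: (osc_event_measurable T0 cX mX).
have oscx j s : (j < n)%N -> grid T n j <= s <= grid T n j.+1 -> `|x s-x (grid T n j)| <= eta.
 move=> jn /andP[s1 s2].
 have /andP[j0 jT] := grid_itv T0 n0 (ltnW jn); have /andP[_ jT'] := grid_itv T0 n0 jn.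
 apply: hrx; rewrite ?j0 ?(le_trans j0 s1) ?(le_trans s2 jT')//.
 rewrite ger0_norm ?subr_ge0//; apply: le_trans mr.
 by rewrite -(gridS T n j) lerD2r.
pose ok j w := `|X (grid T n j) w-x (grid T n j)| <= barrier n j.
(* The stopping indicator: 1 as long as no grid time up to j has crossed. It is adapted, so the
   stopped noise is again an admissible sum. *)
pose c j w : R := \1_[set w | forall i, (i <= j)%N -> ok i w] w.
have ac j : (j < n)%N -> adapted F (grid T n j) (c j).
 move=> jn; apply: measurable_indic.
 have /andP[j0 jT] := grid_itv T0 n0 (ltnW jn).
 rewrite (_ : [set w | _] = \bigcap_(i in `I_j.+1)
   ~` [set w | barrier n i < `|X (grid T n i) w-x (grid T n i)|]).
  apply: bigcap_measurable=> [|i /= ij]; first by exists 0%N.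
  apply: measurableC; apply: (@measurable_gt _ _ (g_sigma_algebraType (F (grid T n j)))).
  apply: measurableT_comp=> //; apply: measurable_funB=> //.
  rewrite ltnS in ij.
  have iT : 0 <= grid T n i <= T by apply: grid_itv=> //; exact: ltnW (leq_ltn_trans ij jn).
  case/andP: (iT)=> i0 _; apply: (adapted_mono hF i0 _ jT (aX iT)).
  exact: grid_le.
 apply/seteqP; split=> w /= h i ij; first by apply/negP; rewrite -leNgt; exact: h.
 by rewrite /ok leNgt; apply/negP; exact: h.
have K0 : 0 <= K.
 by have := @xK 0; rewrite lexx (ltW T0)=> /(_ isT); have := normr_ge0 (x 0); lra.
have B0 : 0 <= (L*(1+K))^+2 by rewrite sqr_ge0.
have c1 j w : `|c j w| <= 1.
 by rewrite /c indicE; case: (_ \in _); rewrite ?normr1 ?normr0.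
have mc j : (j < n)%N -> mrv (c j).
 by move=> jn; apply: (adapted_measurable hF (grid_itv T0 n0 (ltnW jn))); exact: ac.
(* Before the crossing X is within 1 of x at the grid point and moves by at most eta <= 1 inside the
   cell; this is the margin 2 in [xK]. *)
have pa j w s : (j < n)%N -> osc_event T X n eta w -> grid T n j <= s <= grid T n j.+1 ->
  c j w != 0 -> `|X s w| <= K.
 move=> jn Aw hs; rewrite /c indicE; case: (boolP (w \in _)); last by rewrite eqxx.
 move=> /set_mem /(_ j (leqnn _)) okj _.
 have /andP[j0 jT] := grid_itv T0 n0 (ltnW jn).
 have := xK (introT andP (conj j0 jT)); have := Aw j s jn hs.
 have {}okj := le_trans okj (le_trans (barrier_le n0 (ltnW jn)) lam_small).
 have := ler_normD (X s w-X (grid T n j) w) (X (grid T n j) w-x (grid T n j)).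
 rewrite subrKA.
 have := ler_normD (X s w-x (grid T n j)) (x (grid T n j)); rewrite subrK; lra.
have pb j s : (j < n)%N -> grid T n j <= s <= grid T n j.+1 ->
  L1b P setT (fun w=> (c j w*sg s (trunc K (X s w))-0)^+2) ((L*(1+K))^+2).
 move=> jn /andP[s1 s2].
 have /andP[j0 jT] := grid_itv T0 n0 (ltnW jn); have /andP[_ jT'] := grid_itv T0 n0 jn.
 have sT : 0 <= s <= T by rewrite (le_trans j0 s1) (le_trans s2 jT').
 have mH := adapted_measurable hF sT (trunc_adapted K sT).
 apply: (L1b_le _ _ _ _ _ (L1b_cst _ _ B0))=> //.
 + by have := mc j jn=> mcj; mfun.
 + by move=> w _; rewrite sqr_ge0.
 + move=> w _; rewrite subr0 -[leLHS]real_normK ?num_real// lerXn2r ?nnegrE//.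
   by rewrite mulr_ge0 ?ltW// ltr_pwDl.
  rewrite normrM -[leRHS]mul1r; apply: ler_pM=> //; exact: trunc_sg.
have := mart_sum_bound n0 (leqnn n) mA ac (fun j w _=> c1 j w) pa pb.
pose Dn w := \sum_(j < n) c j w*(mart (grid T n j.+1) w-mart (grid T n j) w).
set B := 8*_*_; rewrite (_ : (fun w=> _) = (fun w=> Dn w^+2)); last first.
 by apply/funext=> w; congr (_^+2); apply: eq_bigr=> j _; rewrite mul0r subr0.
move=> hB.
have mD : mrv Dn.
 apply: measurable_sum=> -[j /= jn]; apply: measurable_funM; first exact: mc.
 by apply: measurable_funB; apply: mart_measurable; apply: grid_itv=> //; exact: ltnW.
(* The factor 800 is 8 from the isometry times 100 from the threshold lam^2/100, chosen below
   (lam/4)^2. *)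
have BE : B/(lam^+2/100) = 800*T*(L*(1+K))^+2/lam^+2.
 rewrite /B sumr_const card_ord -mulr_natr; field.
 by rewrite !pnatr_eq0 -lt0n n0 gt_eqF.
have lam2 : 0 < lam^+2/100 by rewrite divr_gt0// exprn_gt0.
have := L1b_markov mA (measurable_funX 2 mD) (fun w=> sqr_ge0 (Dn w)) lam2 hB PA.
rewrite BE=> h1.
have e4 : 0 < Num.min (e/3) (lam*eps/8) by rewrite lt_min e3 divr_gt0.
have := up_to_and h1 (start_close e4); apply: up_to_mono.
 have : Num.min (e/3) (lam*eps/8) <= e/3 by rewrite ge_min lexx.
 lra.
move=> w [[Aw hD]]; rewrite le_min=> /andP[_ h0].
have allok j : (j <= n)%N -> ok j w.
 move=> jn; apply: contrapT=> /negP nok.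
 have ex : exists j, (j <= n)%N && ~~ ok j w by exists j; rewrite jn.
 case: (ex_minnP ex)=> tau /andP[tn ntau] tmin.
 have okb i : (i < tau)%N -> ok i w.
  move=> it; apply: contrapT=> /negP ni; have := tmin i.
  by rewrite (leq_trans (ltnW it) tn) ni=> /(_ isT); rewrite leqNgt it.
 (* [c] is 1 before [tau] and 0 from [tau] on, so the sum telescopes to the stopped noise. *)
 have DE : Dn w = mart (grid T n tau) w-mart 0 w.
  rewrite /Dn -[in RHS](grid0 T n) -(sum_telescope tau (fun j=> mart (grid T n j) w)).
  rewrite (big_ord_widen n (fun j=> mart (grid T n j.+1) w-mart (grid T n j) w) tn).
  rewrite [RHS]big_mkcond /=; apply: eq_bigr=> -[i /= ik] _.
  rewrite /c indicE; case: ltnP=> it.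
   rewrite mem_set ?mul1r// => i' i'i; apply: okb; exact: leq_ltn_trans i'i it.
  rewrite memNset ?mul0r// => /(_ tau it); exact/negP.
 have := first_crossing n0 tn (ltW eta0) Aw oscx h0 eta3 okb.
 rewrite ltNge ntau=> /(_ isT); rewrite -DE.
 rewrite -(real_normK (num_real (Dn w))) in hD.
 move=> ha; have : (lam/4)^+2 <= `|Dn w|^+2.
  by rewrite ler_sqr ?nnegrE// ltW// divr_gt0.
 move=> /le_trans /(_ hD); rewrite expr_div_n; move: (exprn_gt0 2 lam0)=> l2.
 by apply/negP; rewrite -ltNge; lra.
have fin j : (j <= n)%N -> `|X (grid T n j) w-x (grid T n j)| <= kap * lam*eps.
 by move=> jn; rewrite -mulrA mulrC; apply: le_trans (allok j jn) _; exact: barrier_le.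
move=> s /andP[]; rewrite le_eqVlt=> /predU1P[<-|s0] sT.
 have := fin 0%N (leq0n _); rewrite grid0=> /le_trans; apply.
 by rewrite mulrDl mulrDl mul1r lerDl ltW.
have [j jn hj] : exists2 j, (j < n)%N & grid T n j < s <= grid T n j.+1.
 by apply: grid_cell=> //; rewrite gridT// s0.
have hj' : grid T n j <= s <= grid T n j.+1 by case/andP: hj=> /ltW -> ->.
have := fin j (ltnW jn); have := Aw j s jn hj'; have := oscx j s jn hj'.
rewrite (_ : X s w-x s = (X s w-X (grid T n j) w)-(x s-x (grid T n j))
    + (X (grid T n j) w-x (grid T n j))); last by ring.
set A1 := X s w - _; set A2 := x s - _; set A3 := X _ w-x _.
have := ler_normD (A1-A2) A3; have := ler_normB A1 A2; rewrite mulrDl mulrDl mul1r; lra.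
Qed.

Hypothesis growS0 : forall t y, `|S0 t y| <= L*(1+`|y|).
Hypothesis K0 : 0 <= K.
Variable A : set Omega.
Hypotheses (mA : measurable A)
 (XK : forall w s, A w -> 0 <= s <= T -> `|X s w| <= K).
Let B : R := (L*(1+K))^+2.
Let B0 : 0 <= B. exact: sqr_ge0. Qed.

Lemma tube_drift w s : A w -> 0 <= s <= T -> `|S0 s (X s w)| <= L*(1+K).
move=> Aw sT; apply: le_trans (growS0 _ _) _.
by apply: ler_wpM2l; [exact: ltW|rewrite lerD2l; exact: XK].
Qed.

Lemma mart_tube_bound n k (c : nat -> Omega -> R) (e : nat -> R) (C b : R) :
 (0 < n)%N -> (k <= n)%N -> 0 <= b ->
 (forall j, (j < k)%N -> adapted F (grid T n j) (c j)) ->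
 (forall j w, (j < k)%N -> `|c j w| <= C) ->
 (forall j s, (j < k)%N -> grid T n j <= s <= grid T n j.+1 ->
   L1b P setT (fun w=> (c j w*sg s (trunc K (X s w))-e j)^+2) b) ->
 L1b P A (fun w=> (\sum_(j < k) (c j w*(mart (grid T n j.+1) w-mart (grid T n j) w)
   - e j*(W (grid T n j.+1) w-W (grid T n j) w)))^+2) (8*grid T n k*b).
move=> n0 kn b0 ac cC hb.
have := mart_sum_bound n0 kn mA ac cC _ hb; rewrite sumr_const card_ord.
rewrite (_ : 8*(T/n%:R)*(b *+ k) = 8*grid T n k*b); last first.
 by rewrite /grid -[b *+ k]mulr_natr; ring.
apply=> j w s jk Aw /andP[s1 s2] _; apply: XK=> //.
have /andP[j0 jT] := grid_itv T0 n0 (leq_trans (ltnW jk) kn).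
have /andP[_ jT'] := grid_itv T0 n0 (leq_trans jk kn).
by rewrite (le_trans j0 s1) (le_trans s2 jT').
Qed.

Lemma mart_increment n i j : (0 < n)%N -> (i <= j)%N -> (j <= n)%N ->
 L1b P A (fun w=> (mart (grid T n j) w-mart (grid T n i) w)^+2)
  (8*(grid T n j-grid T n i)*B).
move=> n0 ij jn.
pose c l (w : Omega) : R := (i <= l)%N%:R.
pose b l : R := (i <= l)%N%:R*B.
have c1 l w : `|c l w| <= 1 by rewrite /c; case: (i <= l)%N; rewrite ?normr1 ?normr0.
have := @mart_sum_bound n j c (fun=> 0) b 1 K A n0 jn mA.
have -> : 8*(T/n%:R)*\sum_(l < j) b l = 8*(grid T n j-grid T n i)*B.
 rewrite /b -mulr_suml.
 have : \sum_(l < j) ((i <= l)%N%:R : R) = (j-i)%:R.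
  elim: j ij {jn} => [|j IH]; first by rewrite leqn0=> /eqP ->; rewrite big_ord0.
  rewrite leq_eqVlt=> /predU1P[->|].
   by rewrite subnn; apply: big1=> -[l /= lj] _; rewrite leqNgt lj.
  by rewrite ltnS big_ord_recr /= => ij; rewrite IH// ij subSn// natr1.
 by move=> ->; rewrite natrB// /grid; ring.
have DE w : \sum_(l < j) (c l w*(mart (grid T n l.+1) w-mart (grid T n l) w)
   - 0*(W (grid T n l.+1) w-W (grid T n l) w)) = mart (grid T n j) w-mart (grid T n i) w.
 elim: j ij {jn} => [|j IH]; first by rewrite leqn0=> /eqP ->; rewrite big_ord0 subrr.
 rewrite leq_eqVlt=> /predU1P[eij|].
  rewrite [in RHS]eij subrr; apply: big1=> -[l /= lj] _.
  have /negbTE jl : ~~ (j < l)%N by rewrite -leqNgt -ltnS.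
  by rewrite /c eij jl !mul0r subrr.
 rewrite ltnS big_ord_recr /= => ij; rewrite IH// /c ij mul1r mul0r subr0; ring.
under eq_fun do rewrite DE; apply=> //.
- by move=> l _; exact: measurable_cst.
- move=> l w s lj Aw /andP[s1 s2] _; apply: XK=> //.
 have /andP[j0 jT] := grid_itv T0 n0 (leq_trans (ltnW lj) jn).
 have /andP[_ jT'] := grid_itv T0 n0 (leq_trans lj jn).
 by rewrite (le_trans j0 s1) (le_trans s2 jT').
- move=> l s lj /andP[s1 s2].
 have /andP[j0 jT] := grid_itv T0 n0 (leq_trans (ltnW lj) jn).
 have /andP[_ jT'] := grid_itv T0 n0 (leq_trans lj jn).
 have sT : 0 <= s <= T by rewrite (le_trans j0 s1) (le_trans s2 jT').
 have mH := adapted_measurable hF sT (trunc_adapted K sT).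
 have b0 : 0 <= b l by rewrite /b mulr_ge0.
 apply: (L1b_le _ _ _ _ _ (L1b_cst _ _ b0))=> //.
 + by rewrite /c; mfun.
 + by move=> w _; rewrite sqr_ge0.
 + move=> w _; rewrite subr0 /c /b; case: (i <= l)%N; last by rewrite !mul0r expr0n.
  rewrite !mul1r -[leLHS]real_normK ?num_real// lerXn2r ?nnegrE//.
   by pos.
  exact: trunc_sg.
Qed.

(** The drift contributes the squared length of the interval, the noise eps^2 times the length; on
    cells of length about eps^2 both are of order eps^4. *)
Lemma X_increment n i j : (0 < n)%N -> (i <= j)%N -> (j <= n)%N ->
 L1b P A (fun w=> (X (grid T n j) w-X (grid T n i) w)^+2)
  (2*B*(grid T n j-grid T n i)^+2+16*eps^+2*(grid T n j-grid T n i)*B).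
move=> n0 ij jn; have hi := grid_itv T0 n0 (leq_trans ij jn); have hj := grid_itv T0 n0 jn.
have gij := grid_le T0 n ij.
set ti := grid T n i in hi gij *; set tj := grid T n j in hj gij *.
have mXi := mX hi; have mXj := mX hj.
have mi := mart_measurable hi; have mj := mart_measurable hj.
apply: (@L1b_le _ _ _ _ _ _ (fun w=> 2*B*(tj-ti)^+2+2*eps^+2*(mart tj w-mart ti w)^+2))=> //.
- by mfun.
- by mfun.
- by move=> w _; rewrite sqr_ge0.
- move=> w Aw.
 have cSX : continuous (fun s=> S0 s (X s w)) by exact: cont_path.
 have E : X tj w-X ti w = Int ti tj (fun s=> S0 s (X s w))+eps*(mart tj w-mart ti w).
  case/andP: hi=> hi0 hiT; rewrite /mart -mulrBr mulVKf ?gt_eqF//.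
  by rewrite (Int_split cSX hi0 gij); ring.
 have hI : `|Int ti tj (fun s=> S0 s (X s w))| <= L*(1+K)*(tj-ti).
  apply: Int_bound=> // s /andP[s1 s2]; apply: tube_drift=> //.
  by case/andP: hi=> a _; case/andP: hj=> _ b; rewrite (le_trans a s1) (le_trans s2 b).
 rewrite E; set I := Int _ _ _ in hI *; set D := mart tj w-mart ti w.
 have : I^+2 <= B*(tj-ti)^+2.
  rewrite -exprMn -[leLHS]real_normK ?num_real// lerXn2r ?nnegrE//.
  by pos.
 have := sqr_ge0 (I-eps*D); rewrite (_ : 2*eps^+2*D^+2 = 2*(eps*D)^+2); last by ring.
 set u := eps*D; nra.
- have p1 : 0 <= 2*B*(tj-ti)^+2 by nneg.
 have p2 : 0 <= 2*eps^+2 by nneg.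
 apply: L1bD=> //.
 + by mfun.
 + by move=> w; nneg.
 + exact: L1b_cst.
 + rewrite (_ : 16*eps^+2*(tj-ti)*B = 2*eps^+2*(8*(tj-ti)*B)); last by ring.
  apply: L1bZ=> //; [by mfun|by move=> w; nneg|exact: mart_increment].
Qed.

Section Likelihood_sums.
Variable n : nat.
Hypothesis n0 : (0 < n)%N.

(** An integral of phi(t, X_t) against dX, known only as the limit of its grid sums. Linearity in
    phi, needed to subtract log-likelihoods, is then immediate. *)
Definition grid_integral (phi : R -> R -> R) (J : Omega -> R) : Prop :=
 cvgU P (fun q w=> \sum_(i < n*q.+1)
   phi (grid T (n*q.+1) i) (X (grid T (n*q.+1) i) w) *
   (X (grid T (n*q.+1) i.+1) w-X (grid T (n*q.+1) i) w)) J.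

Lemma grid_integral_lin phi phi' J J' (a b : R) :
 grid_integral phi J -> grid_integral phi' J' ->
 grid_integral (fun t y=> a * phi t y+b * phi' t y) (fun w=> a*J w+b*J' w).
move=> h h'; have := cvgUD (cvgUZ a h) (cvgUZ b h').
rewrite /grid_integral (_ : (fun q w=> _ + _) = (fun q w=> \sum_(i < n*q.+1)
 (a * phi (grid T (n*q.+1) i) (X (grid T (n*q.+1) i) w)
  + b * phi' (grid T (n*q.+1) i) (X (grid T (n*q.+1) i) w)) *
   (X (grid T (n*q.+1) i.+1) w-X (grid T (n*q.+1) i) w)))//.
apply/funext=> q; apply/funext=> w; rewrite !mulr_sumr -big_split /=.
by apply: eq_bigr=> i _; ring.
Qed.

Lemma stoch_grid_integral (phi : R -> R -> R) J (H1 X1 : R -> Omega -> R) :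
 cont2 phi ->
 (forall s w, 0 <= s <= T -> H1 s w = phi s (X s w)) ->
 (forall s w, 0 <= s <= T -> X1 s w = X s w) ->
 stoch_integral P F T H1 X1 J -> grid_integral phi J.
move=> cphi H1E X1E hJ; have := @stoch_integral_cvgU _ _ _ P F T T0 hF H1 (fun s w=> phi s (X s w))
 H1E (fun w=> cont_path cphi) (fun s sT=> adapted_path cphi sT) n n X1 J n0 (leqnn n).
have mX1 s : 0 <= s <= T -> mrv (X1 s).
 by move=> sT; rewrite (_ : X1 s = X s); [exact: mX|apply/funext=> w; exact: X1E].
rewrite gridT// => /(_ mX1 hJ) h; apply: cvgU_ext h _ _; last exact: aeW.
move=> q; apply: aeW=> w; apply: eq_bigr=> -[i /= iq] _.
have nq0 : (0 < n*q.+1)%N by rewrite muln_gt0 n0.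
by rewrite !X1E// grid_itv// ltnW.
Qed.

(** Subtracting the drift from the integral against dX and dividing by eps leaves the integral of
    phi sigma against W, which is compared with a Wiener sum with deterministic coefficients [e]. *)
Lemma likelihood_bound (phi : R -> R -> R) J (e : nat -> R) (C b : R) :
 cont2 phi -> (forall t y, `|phi t y| <= C) ->
 mrv J -> grid_integral phi J -> 0 <= b ->
 (forall j r s, (j < n)%N -> grid T n j <= r <= grid T n j.+1 ->
   grid T n j <= s <= grid T n j.+1 ->
   L1b P setT (fun w=> (phi r (X r w)*sg s (trunc K (X s w))-e j)^+2) b) ->
 L1b P A (fun w=> (eps^-1*(J w-Int 0 T (fun s=> phi s (X s w)*S0 s (X s w)))
   - \sum_(j < n) e j*(W (grid T n j.+1) w-W (grid T n j) w))^+2) (8*T*b).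
move=> cphi phiC mJ hJ b0 hb.
have nq0 q : (0 < n*q.+1)%N by rewrite muln_gt0 n0.
have cpS : continuous (fun p : R*R=> phi p.1 p.2*S0 p.1 p.2) by exact: contM.
have TT : 0 <= T <= T by rewrite (ltW T0) lexx.
have mW t : 0 <= t <= T -> mrv (W t) by exact: (wiener_measurable hF hW).
have mI : mrv (fun w=> Int 0 T (fun s=> phi s (X s w)*S0 s (X s w))).
 apply: Int_measurable=> [|w|s sT]; [exact: ltW|exact: (@cont_path (fun t y=> phi t y*S0 t y) w cpS)|].
 exact: (adapted_measurable hF sT (@adapted_path (fun t y=> phi t y*S0 t y) _ cpS sT)).
pose g q := grid T (n*q.+1).
pose Z q w := \sum_(i < n*q.+1) (phi (g q i) (X (g q i) w)*(mart (g q i.+1) w-mart (g q i) w)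
 - e (i %/ q.+1)%N*(W (g q i.+1) w-W (g q i) w)).
have mZ q : mrv (Z q).
 apply: measurable_sum=> -[i /= iq].
 have hi : 0 <= g q i <= T by apply: grid_itv=> //; exact: ltnW.
 have hi' : 0 <= g q i.+1 <= T by apply: grid_itv.
 have m1 := adapted_measurable hF hi (adapted_path cphi hi).
 have m2 := mart_measurable hi; have m3 := mart_measurable hi'.
 by have m4 := mW _ hi; have m5 := mW _ hi'; mfun.
have mR : mrv (fun w=>
  \sum_(j < n) e j*(W (grid T n j.+1) w-W (grid T n j) w)).
 apply: measurable_sum=> -[j /= jn].
 have m4 := mW _ (grid_itv T0 n0 (ltnW jn)); have m5 := mW _ (grid_itv T0 n0 jn).
 by mfun.
apply: (fatou_in_probability (Zq := Z))=> //.
- by mfun.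
(* In the drift part phi is frozen at the left end of each fine cell; by uniform continuity of the
   path of phi this converges to the integral of phi S0. *)
- have hd : cvgU P (fun q w=> \sum_(i < n*q.+1) phi (g q i) (X (g q i) w) *
   Int (g q i) (g q i.+1) (fun s=> S0 s (X s w)))
   (fun w=> Int 0 T (fun s=> phi s (X s w)*S0 s (X s w))).
  apply: cvgU_pointwise=> //.
   move=> q; apply: measurable_sum=> -[i /= iq].
   have hi : 0 <= g q i <= T by apply: grid_itv=> //; exact: ltnW.
   have hi' : 0 <= g q i.+1 <= T by apply: grid_itv.
   have m2 := mart_measurable hi; have m3 := mart_measurable hi'.
   have m1 := adapted_measurable hF hi (adapted_path cphi hi).
   have m4 := mX hi; have m5 := mX hi'.
   apply: measurable_funM=> //.
   rewrite (_ : (fun w=> _) = (fun w=> X (g q i.+1) w-X (g q i) w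
    - eps*(mart (g q i.+1) w-mart (g q i) w))); first by mfun.
   apply/funext=> w; rewrite /mart -mulrBr mulVKf ?gt_eqF//.
   rewrite [Int 0 (g q i.+1) _](Int_split (b := g q i) (@cont_path S0 w cS0)); [by ring|by case/andP: hi|].
   exact: grid_le.
  move=> w e1 e10.
  have [CS CS1 hCS] : exists2 CS, 1 <= CS & forall s, 0 <= s <= T -> `|S0 s (X s w)| <= CS.
   have cX1 : continuous (fun s=> `|X s w|) by apply: contA; exact: cX.
   have [s0 _ hs0] := @EVT_max R (fun s=> `|X s w|) 0 T (ltW T0) (continuous_subspaceT cX1).
   exists (1+L*(1+`|X s0 w|)); first by rewrite lerDl mulr_ge0 ?ltW// ltr_pwDl.
   move=> s sT; apply: le_trans (growS0 _ _) _; rewrite -[leLHS]add0r lerD//.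
   apply: ler_wpM2l; first exact: ltW.
   by rewrite lerD2l; apply: hs0; rewrite in_itv.
  have e2 : 0 < e1/(CS*T) by rewrite divr_gt0// mulr_gt0// (lt_le_trans ltr01).
  have [r r0 hr] := @heine_itv _ T _ (@cont_path phi w cphi) _ e2.
  have [q0 hq] := mesh_small T n0 r0; exists q0=> q /hq mq.
  have gT : g q (n*q.+1)%N = T by rewrite /g gridT.
  have := @Int_telescope _ _ (g q) (n*q.+1) (@cont_path (fun t y=> phi t y*S0 t y) w cpS)
   (fun i=> ltW (grid_ltS T0 i (nq0 q))).
  rewrite gT {3}/g grid0=> <-.
  rewrite -sumrB; apply: le_trans (ler_norm_sum _ _ _) _.
  apply: (@le_trans _ _ (\sum_(i < n*q.+1) e1/T*(T/(n*q.+1)%:R))); last first.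
   have N0 : (n*q.+1)%:R != 0 :> R by rewrite pnatr_eq0 -lt0n nq0.
   rewrite sumr_const card_ord -[leLHS]mulr_natr; move: (n*q.+1)%:R N0=> N N0.
   rewrite (_ : _*N = e1)//; field; by rewrite N0 gt_eqF.
  apply: ler_sum=> -[i /= iq] _.
  rewrite -IntZ; last exact: cont_path.
  rewrite -IntB; [|by apply: contM; [exact: cst_continuous|exact: cont_path]|exact: (@cont_path (fun t y=> phi t y*S0 t y) w cpS)].
  rewrite -(gridS T _ i); apply: Int_bound.
  - apply: contB; last exact: (@cont_path (fun t y=> phi t y*S0 t y) w cpS).
   by apply: contM; [exact: cst_continuous|exact: cont_path].
  - exact/ltW/grid_ltS.
  move=> s /andP[s1 s2]; rewrite -mulrBl normrM.
  have /andP[i0 iT] := grid_itv T0 (nq0 q) (ltnW iq).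
  have /andP[_ iT'] := grid_itv T0 (nq0 q) iq.
  have sT : 0 <= s <= T by rewrite (le_trans i0 s1) (le_trans s2 iT').
  rewrite (_ : e1/T = e1/(CS*T)*CS); last first.
   by field; rewrite !gt_eqF// (lt_le_trans ltr01).
  apply: ler_pM=> //; last exact: hCS.
  apply: hr=> //; first by rewrite i0.
  rewrite distrC ger0_norm ?subr_ge0//; apply: le_trans mq.
  by rewrite -(gridS T _ i) lerD2r.
 have := cvgUB (cvgUZ eps^-1 (cvgUB hJ hd)) (cvgU_cst P (fun w=>
  \sum_(j < n) e j*(W (grid T n j.+1) w-W (grid T n j) w))).
 move=> h; apply: cvgU_ext h _ _; last exact: aeW.
 move=> q; apply: aeW=> w; rewrite /Z sumrB; congr (_ - _).
  rewrite -sumrB mulr_sumr; apply: eq_bigr=> -[i /= iq] _.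
  have /andP[i0 iT] := grid_itv T0 (nq0 q) (ltnW iq).
  rewrite /mart -/(g q i) -/(g q i.+1).
  rewrite [Int 0 (g q i.+1) _](Int_split (b := g q i) (@cont_path S0 w cS0))//; last exact: grid_le.
  by ring.
 rewrite (sum_blocks n q.+1 (fun i=> e (i %/ q.+1)%N*(W (g q i.+1) w-W (g q i) w))).
 apply: eq_bigr=> -[j /= jn] _.
 under eq_bigr=> r _ do rewrite divnMDl// divn_small// addn0.
 rewrite -mulr_sumr; congr (_*_).
 rewrite -!(grid_refine T n _ (ltn0Sn q)).
 have := sum_telescope q.+1 (fun r=> W (g q (j*q.+1+r)%N) w).
 by rewrite addn0 -mulSnr=> <-; apply: eq_bigr=> r _; rewrite addnS.
- by rewrite mulr_ge0// mulr_ge0// ltW.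
move=> q; have := @mart_tube_bound (n*q.+1) (n*q.+1)
 (fun i w=> phi (g q i) (X (g q i) w)) (fun i=> e (i %/ q.+1)%N) C b (nq0 q) (leqnn _) b0.
rewrite gridT//; apply=> //.
- move=> i iq; apply: adapted_path=> //; apply: grid_itv=> //; exact: ltnW.
- move=> i s iq /andP[s1 s2].
 have ij : (i %/ q.+1 < n)%N by rewrite ltn_divLR.
 have gi : grid T n (i %/ q.+1) <= g q i <= grid T n (i %/ q.+1).+1.
  rewrite -!(grid_refine T n _ (ltn0Sn q)) /g !grid_le//; last exact: leq_divM.
  by rewrite ltnW// ltn_ceil.
 have gi' : g q i.+1 <= grid T n (i %/ q.+1).+1.
  by rewrite -(grid_refine T n _ (ltn0Sn q)) /g grid_le// ltn_ceil.
 apply: hb=> //; case/andP: gi=> g1 g2.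
 by rewrite (le_trans g1 s1) (le_trans s2 gi').
Qed.

End Likelihood_sums.

End Diffusion.

(** * A uniform modulus for random functions of a parameter *)

Section Dyadic_sobolev.
Context {R : realType}.

Lemma sqr_sum_le n (a : nat -> R) : (\sum_(i < n) a i)^+2 <= n%:R*\sum_(i < n) a i^+2.
elim: n=> [|n IH]; first by rewrite !big_ord0 expr0n mul0r.
rewrite !big_ord_recr /= -natr1; set s := \sum_(i < n) a i in IH *.
set q := \sum_(i < n) a i^+2 in IH *.
case: n @s @q IH=> [|n] s q IH; first by rewrite /s /q !big_ord0; lra.
have n0 : 0 < n.+1%:R :> R by [].
have : 0 <= n.+1%:R*(q+n.+1%:R*a n.+1^+2-2*s*a n.+1).
 by have := sqr_ge0 (s-n.+1%:R*a n.+1); nra.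
rewrite pmulr_rge0// => h; nra.
Qed.

Lemma dyadic_dense (t r : R) : 0 < t < 1 -> 0 < r -> exists m0, forall m, (m0 <= m)%N ->
 exists k, [/\ (0 < k)%N, (k < 2 ^ m)%N & `|k%:R/(2 ^ m)%:R-t| <= r].
move=> /andP[t0 t1] r0; pose z := t^-1+r^-1.
have z0 : 0 <= z by rewrite addr_ge0// invr_ge0 ltW.
exists (Num.truncn z).+1=> m hm.
have N0 : 0 < (2 ^ m)%:R :> R by rewrite ltr0n expn_gt0.
have zN : z <= (2 ^ m)%:R.
 apply: le_trans (ltW (truncnS_gt _)) _; rewrite ler_nat; apply: leq_trans hm _.
 exact/ltnW/ltn_expl.
have rN : r^-1 <= (2 ^ m)%:R by apply: le_trans zN; rewrite lerDr invr_ge0 ltW.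
have tN : t^-1 <= (2 ^ m)%:R by apply: le_trans zN; rewrite lerDl invr_ge0 ltW.
have p0 : 0 <= t*(2 ^ m)%:R by rewrite mulr_ge0// ltW.
have /andP[k1 k2] := truncn_itv p0.
set k := Num.truncn _ in k1 k2; exists k; split.
- rewrite -ltnS -(ltr_nat R) (le_lt_trans _ k2)// mulrC -ler_pdivrMr//.
 by rewrite div1r.
- by rewrite -(ltr_nat R) (le_lt_trans k1)// gtr_pMl.
- rewrite ler_norml; apply/andP; split.
  rewrite lerBrDr -(ler_pM2r N0) mulrDl divfK ?gt_eqF//.
  have : 1 <= r*(2 ^ m)%:R by rewrite mulrC -ler_pdivrMr// div1r.
  by move: k2; rewrite -natr1; lra.
 have : k%:R/(2 ^ m)%:R <= t by rewrite ler_pdivrMr.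
 lra.
Qed.

Context {d : measure_display} {Omega : measurableType d}.
Variable P : probability Omega R.
Variables (y : R -> Omega -> R) (A : set Omega) (C lam e : R).
Hypotheses (mA : measurable A) (PA : (P (~` A) <= e%:E)%E) (lam0 : 0 < lam).
Hypothesis my : forall t, 0 < t < 1 -> mrv (y t).
Hypothesis cy : forall w t, 0 < t < 1 -> forall c, 0 < c -> exists2 r, 0 < r &
 forall t', 0 < t' < 1 -> `|t-t'| < r -> `|y t w-y t' w| <= c.
Hypothesis hy : forall s t, 0 < s < 1 -> 0 < t < 1 ->
 L1b P A (fun w=> (y s w-y t w)^+2) (C*(s-t)^+2).
Hypothesis C0 : 0 <= C.

Let p m k : R := k%:R/(2 ^ m)%:R.
(** Cells touching 0 or 1 are dropped, as nothing is assumed about [y] at the endpoints. *)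
Let inside m k := (0 < k)%N && (k.+1 < 2 ^ m)%N.
Let g m k w : R := if inside m k then y (p m k.+1) w-y (p m k) w else 0.
(** Dirichlet energy of the piecewise linear interpolation of [y] at level m, outside the two end
    cells. *)
Let D m w : R := (2 ^ m)%:R*\sum_(k < 2 ^ m) g m k w^+2.

Let N0 m : 0 < (2 ^ m)%:R :> R. by rewrite ltr0n expn_gt0. Qed.

Let p01 m k : (0 < k)%N -> (k < 2 ^ m)%N -> 0 < p m k < 1.
move=> k0 kN; rewrite /p divr_gt0 ?ltr0n ?expn_gt0//=.
by rewrite ltr_pdivrMr// mul1r ltr_nat.
Qed.

Let mg m k : mrv (g m k).
rewrite /g; case: (boolP (inside m k))=> [/andP[k0 kN]|_]; last exact: measurable_cst.
by apply: measurable_funB; apply: my; apply: p01=> //; exact: ltnW.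
Qed.

Let mD m : mrv (D m).
apply: measurable_funM=> //; apply: measurable_sum=> k; apply: measurable_funX; exact: mg.
Qed.

Let D0 m w : 0 <= D m w.
by rewrite /D mulr_ge0 ?(ltW (N0 m))//; apply: sumr_ge0=> k _; exact: sqr_ge0. Qed.

Let D_mono m w : D m w <= D m.+1 w.
rewrite /D; have -> : (2 ^ m.+1 = 2 ^ m*2)%N by rewrite expnSr.
rewrite (sum_blocks (2 ^ m) 2 (fun k=> g m.+1 k w^+2)) natrM -mulrA.
apply: ler_wpM2l; first exact: ltW.
rewrite mulr_sumr; apply: ler_sum=> -[k /= kN] _.
rewrite big_ord_recr big_ord_recr big_ord0 /= add0r addn0 addn1.
rewrite {1}/g; case: ifPn=> [/andP[k0 kN']|_]; last first.
 by rewrite expr0n mulr_ge0// addr_ge0// sqr_ge0.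
have i1 : inside m.+1 (k*2).
 rewrite /inside muln_gt0 k0 /= expnS mulnC; move: k0 kN'; move: (2 ^ m)%N=> N k0 kN'.
 by rewrite (@leq_trans (2*k.+1))// ?leq_mul2l ?(ltnW kN')// mulnS add2n.
have i2 : inside m.+1 (k*2).+1.
 rewrite /inside /= expnS mulnC; move: kN'; move: (2 ^ m)%N=> N kN'.
 by rewrite (@leq_trans (2*k.+2))// ?leq_mul2l ?kN' ?orbT// !mulnS !add2n.
rewrite /g i1 i2.
have pE l : p m l = p m.+1 (l*2).
 by rewrite /p expnSr !natrM; field; rewrite gt_eqF.
rewrite !pE (_ : (k.+1*2 = (k*2).+2)%N); last by rewrite mulSn.
set a := y _ w; set b := y _ w; set c := y _ w.
by have := sqr_ge0 (a-2*c+b); nra.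
Qed.

Let D_moment m : L1b P A (D m) C.
have hg k : (k < 2 ^ m)%N -> L1b P A (fun w=> g m k w^+2) (C/(2 ^ m)%:R^+2).
 move=> kN; have c0 : 0 <= C/(2 ^ m)%:R^+2 by rewrite divr_ge0// sqr_ge0.
 rewrite /g; case: (boolP (inside m k))=> [/andP[k0 kN']|_].
  rewrite (_ : C/_ = C*(p m k.+1-p m k)^+2).
   by apply: hy; apply: p01=> //; exact: ltnW.
  by rewrite /p -natr1; field; rewrite gt_eqF.
 by under eq_fun do rewrite expr0n /=; apply: L1b_mono (L1b_cst _ mA (lexx 0)).
have := L1bZ mA _ (ltW (N0 m)) _ (L1b_sum mA (fun k=> measurable_funX 2 (mg m k))
 (fun k w=> sqr_ge0 _) hg).
have -> : (2 ^ m)%:R*\sum_(k < 2 ^ m) C/(2 ^ m)%:R^+2 = C.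
 rewrite sumr_const card_ord -[X in _*X]mulr_natr.
 by move: (N0 m); move: (2 ^ m)%:R=> N Np; field; rewrite gt_eqF.
apply; first by apply: measurable_sum=> k; apply: measurable_funX; exact: mg.
by move=> w; apply: sumr_ge0=> k _; exact: sqr_ge0.
Qed.

(** Refinement increases the energy by convexity, and its mean is at most C at every level, so its
    supremum over all levels exceeds lam with probability at most C/lam on [A]. Bounded energy gives
    the Hölder-1/2 bound between dyadic points by Cauchy-Schwarz, and continuity of [y] extends it
    to all points. *)
Lemma dyadic_sobolev : up_to P (e+C/lam) (fun w=> A w /\
 forall s t, 0 < s < 1 -> 0 < t < 1 -> (y s w-y t w)^+2 <= lam * `|s-t|).
pose B m := A `&` [set w | lam < D m w].
have mB m : measurable (B m) by apply: measurableI=> //; exact: measurable_gt.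
have PB m : (P (B m) <= (C/lam)%:E)%E.
 rewrite mulrC EFinM -lee_pdivrMl ?invr_gt0// invrK.
 apply: le_trans (D_moment m); rewrite -integral_cst//.
 have h1 : (\int[P]_(x in B m) cst lam%:E x <= \int[P]_(w in B m) (D m w)%:E)%E.
  apply: ge0_le_integral=> //.
  + by move=> w _; rewrite lee_fin ltW.
  + by apply/measurable_EFinP; exact: measurable_funTS.
  + by move=> w [_ /= h]; rewrite lee_fin ltW.
 apply: (le_trans h1); apply: ge0_subset_integral=> //.
 + by apply/measurable_EFinP; exact: measurable_funTS.
 + by move=> w _; rewrite lee_fin.
 + by move=> w [].
have mU : measurable (\bigcup_m B m) by exact: bigcup_measurable.
have PU : (P (\bigcup_m B m) <= (C/lam)%:E)%E.
 have Bm : {homo B : n m/(n <= m)%N >-> (n <= m)%O}.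
  apply: homo_leq=> [//|? ? ?|m']; first exact: le_trans.
  apply/subsetPset=> w [Aw /= h]; split=> //=; exact: lt_le_trans h (D_mono m' w).
 have cv := @nondecreasing_cvg_mu _ _ _ P _ mB mU Bm.
 rewrite -(cvg_lim _ cv)//; apply: lime_le; first by apply/cvg_ex; eexists; exact: cv.
 by near=> m; exact: PB.
exists (~` A `|` \bigcup_m B m); split.
- by apply: measurableU=> //; exact: measurableC.
- apply: le_trans (measureU2 _ (measurableC mA) mU) _; rewrite EFinD leeD//.
move=> w /= /not_orP[/contrapT Aw nB]; split=> //.
have Dl m : D m w <= lam by rewrite leNgt; apply/negP=> h; apply: nB; exists m.
have dy m k k' : (0 < k)%N -> (k <= k')%N -> (k' < 2 ^ m)%N ->
  (y (p m k') w-y (p m k) w)^+2 <= lam*(p m k'-p m k).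
 move=> k0 kk' kN.
 have := sqr_sum_le (k'-k) (fun i=> y (p m (k+i).+1) w-y (p m (k+i)%N) w).
 have -> : \sum_(i < k'-k) (y (p m (k+i).+1) w-y (p m (k+i)%N) w)
   = y (p m k') w-y (p m k) w.
  have := sum_telescope (k'-k) (fun i=> y (p m (k+i)%N) w).
  by rewrite addn0 subnKC// => <-; apply: eq_bigr=> i _; rewrite addnS.
 move/le_trans; apply.
 have -> : p m k'-p m k = (k'-k)%:R*(2 ^ m)%:R^-1 by rewrite /p natrB// mulrBl.
 rewrite mulrCA ler_wpM2l// ler_pdivlMr//.
 apply: le_trans (Dl m); rewrite mulrC /D ler_wpM2l ?(ltW (N0 m))//.
 rewrite -(big_mkord predT (fun i=> (y (p m (k+i).+1) w-y (p m (k+i)%N) w)^+2)).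
 rewrite -(big_mkord predT (fun i=> g m i w^+2)).
 have kN' := ltnW (leq_ltn_trans kk' kN).
 rewrite [X in _ <= X](big_cat_nat (n := k))//=.
 rewrite [X in _ <= _ + X](big_cat_nat (n := k'))//=; last exact: ltnW.
 rewrite -[X in X <= _]add0r lerD//; first by apply: sumr_ge0=> i _; exact: sqr_ge0.
 rewrite -[X in X <= _]addr0 lerD//; last by apply: sumr_ge0=> i _; exact: sqr_ge0.
 rewrite [X in _ <= X](_ : _ = \sum_(0 <= i < k'-k) g m (i+k)%N w^+2); last first.
  by rewrite -{1}[k]add0n big_addn.
 rewrite le_eqVlt; apply/orP; left; apply/eqP; apply: eq_big_nat=> i /andP[_ ik].
 rewrite /g /inside addn_gt0 k0 orbT /= addnC (leq_ltn_trans _ kN)//.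
 by rewrite addnC -ltn_subRL.
suff H s t : 0 < s < 1 -> 0 < t < 1 -> s <= t -> (y t w-y s w)^+2 <= lam*(t-s).
 move=> s t hs ht; case: (leP s t)=> st.
  by rewrite distrC -sqrrN opprB ger0_norm ?subr_ge0//; exact: H.
 rewrite ger0_norm; first by apply: H=> //; exact: ltW.
 by rewrite subr_ge0; exact: ltW.
move=> hs ht st; rewrite leNgt; apply/negP=> gap.
pose a : R := `|y t w-y s w|.
have a2 : (y t w-y s w)^+2 = a^+2 by rewrite real_normK// num_real.
rewrite a2 in gap; have a0 : 0 <= a by exact: normr_ge0.
pose G := a^+2-lam*(t-s); have G0 : 0 < G by rewrite subr_gt0.
(* Moving both ends to dyadic points changes [y] by at most c at each; the loss 4 a c + lam c stays
   below the assumed gap [G]. *)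
pose c := G/(2*(4*a+2 * lam)).
have den : 0 < 4*a+2 * lam by rewrite ltr_wpDl// ?mulr_ge0// mulr_gt0.
have c0 : 0 < c by rewrite divr_gt0// mulr_gt0.
have cE : c*(4*a+2 * lam) = G/2 by rewrite /c; field; rewrite gt_eqF.
clearbody c; have [r1 r10 h1] := cy w hs c0; have [r2 r20 h2] := cy w ht c0.
pose r := Num.min (c/2) (Num.min (r1/2) (r2/2)).
have r0 : 0 < r.
 by rewrite !lt_min; apply/andP; split; [|apply/andP; split]; exact: divr_gt0.
have rc : r <= c/2 by rewrite ge_min lexx.
have rr1 : r <= r1/2 by rewrite /r !ge_min lexx orbT.
have rr2 : r <= r2/2 by rewrite /r !ge_min lexx !orbT.
have [m1 d1] := dyadic_dense hs r0; have [m2 d2] := dyadic_dense ht r0.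
have [k [k0 kN ks]] := d1 _ (leq_maxl m1 m2); have [k' [k'0 k'N kt]] := d2 _ (leq_maxr m1 m2).
set m := maxn m1 m2 in kN ks k'N kt; rewrite -!/(p _ _) in ks kt.
have ps := p01 k0 kN; have pt := p01 k'0 k'N.
have b1 : `|y s w-y (p m k) w| <= c by apply: h1=> //; rewrite distrC; apply: le_lt_trans ks _; lra.
have b2 : `|y t w-y (p m k') w| <= c by apply: h2=> //; rewrite distrC; apply: le_lt_trans kt _; lra.
have b3 : (y (p m k') w-y (p m k) w)^+2 <= lam*(t-s+c).
 have : lam * `|p m k'-p m k| <= lam*(t-s+c).
  apply: ler_wpM2l; first exact: ltW.
  move: ks kt; rewrite !ler_norml=> /andP[u1 u2] /andP[u3 u4].
  by apply/andP; split; lra.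
 apply: le_trans; case: (leqP k k')=> kk'.
  by apply: le_trans (dy m k k' k0 kk' k'N) _; rewrite ler_wpM2l ?ler_norm// ltW.
 rewrite -sqrrN opprB distrC.
 by apply: le_trans (dy m k' k k'0 (ltnW kk') kN) _; rewrite ler_wpM2l ?ler_norm// ltW.
pose u : R := `|y (p m k') w-y (p m k) w|.
have u2 : u^+2 <= lam*(t-s+c) by rewrite real_normK ?num_real.
have ua : a <= u+2*c.
 have := ler_normD (y t w-y (p m k') w-(y s w-y (p m k) w)) (y (p m k') w-y (p m k) w).
 have := ler_normB (y t w-y (p m k') w) (y s w-y (p m k) w).
 have -> : y t w-y (p m k') w-(y s w-y (p m k) w)+(y (p m k') w-y (p m k) w)
  = y t w-y s w by ring.
 rewrite -/a -/u; lra.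
have u0 : 0 <= u by exact: normr_ge0.
have : a^+2-4*a*c <= u^+2.
 case: (leP a (2*c))=> ac.
  have : a*(a-4*c) <= 0 by rewrite mulr_ge0_le0//; lra.
  by have := sqr_ge0 u; lra.
 have : (a-2*c)^+2 <= u^+2 by rewrite ler_sqr ?nnegrE; lra.
 by have := sqr_ge0 c; lra.
have := mulr_gt0 lam0 c0; have : 0 <= a*c by rewrite mulr_ge0// ltW.
move: cE u2; rewrite /G; move: (t-s)=> v k1 k2 k3 k4; apply/negP; rewrite -ltNge; lra.
Unshelve. all: by end_near. Qed.

End Dyadic_sobolev.

(** * Moments of time integrals, and the choice of mesh *)

Section Rectangles.
Context {R : realType}.

Lemma heine_rect (T K : R) (g : R -> R -> R) : cont2 g ->
 forall e, 0 < e -> exists2 r, 0 < r & forall s s' y y', 0 <= s <= T -> 0 <= s' <= T ->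
  `|y| <= K -> `|y'| <= K -> `|s-s'| <= r -> `|y-y'| <= r -> `|g s y-g s' y'| <= e.
move=> cg e e0.
have cA : compact (`[0, T]%classic `*` `[- K, K]%classic : set (R*R)).
 by apply: compact_setX; exact: segment_compact.
have [r r0 hr] := heine cA (continuous_subspaceT cg) e0.
exists (r/2); first by rewrite divr_gt0.
have r2 : r/2 < r by lra.
move=> s s' y y' hs hs' hy hy' ss yy; apply: (hr (s, y) (s', y')).
- by split; rewrite /= in_itv /=// -ler_norml.
- by split; rewrite /= in_itv /=// -ler_norml.
- by split; rewrite /ball /=; exact: le_lt_trans r2.
Qed.

Lemma riemann_cell (f : R -> R) (t : nat -> R) k e : continuous f ->
 (forall j, t j <= t j.+1) ->
 (forall j s, (j < k)%N -> t j <= s <= t j.+1 -> `|f s-f (t j)| <= e) ->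
 `|Int (t 0%N) (t k) f - \sum_(j < k) f (t j)*(t j.+1-t j)| <= e*(t k-t 0%N).
move=> cf tS he; rewrite -Int_telescope// -sumrB -sum_telescope mulr_sumr.
apply: le_trans (ler_norm_sum _ _ _) _; apply: ler_sum=> -[j /= jk] _.
rewrite -Int_cst// -IntB//; last exact: cst_continuous.
apply: Int_bound=> //; first by apply: contB=> //; exact: cst_continuous.
by move=> s hs; exact: he.
Qed.

Lemma sqrt_dist (u v e : R) : 0 <= u -> 0 <= v -> 0 <= e -> `|u-v| <= e^+2 ->
 `|Num.sqrt u-Num.sqrt v| <= e.
move=> + + e0; wlog uv : u v/v <= u.
 move=> H u0 v0; case: (leP v u)=> uv; first exact: H.
 by rewrite distrC (distrC (Num.sqrt u)); exact: (H _ _ (ltW uv)).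
move=> u0 v0; rewrite !ger0_norm ?subr_ge0 ?ler_sqrt// => h.
rewrite lerBlDr -ler_sqr ?nnegrE ?addr_ge0 ?sqrtr_ge0// sqr_sqrtr//.
have := mulr_ge0 e0 (sqrtr_ge0 v); have := sqr_sqrtr v0.
set w := Num.sqrt v; nra.
Qed.

End Rectangles.

Section Integral_moments.
Context {R : realType} {d : measure_display} {Omega : measurableType d}.
Variables (P : probability Omega R) (T : R).
Hypothesis T0 : 0 < T.

(** Apply [fatou_in_probability] to square roots, since that lemma concerns squares. *)
Lemma L1b_pointwise (A : set Omega) (Zq : nat -> Omega -> R) (Z : Omega -> R) (B : R) : measurable A -> 0 <= B ->
 (forall q, mrv (Zq q)) -> mrv Z ->
 (forall q w, 0 <= Zq q w) -> (forall w, 0 <= Z w) ->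
 (forall w e, 0 < e -> exists q0, forall q, (q0 <= q)%N -> `|Zq q w-Z w| <= e) ->
 (forall q, L1b P A (Zq q) B) -> L1b P A Z B.
move=> mA B0 mq mZ q0 Z0 cv hq.
have msq (Y : Omega -> R) : mrv Y -> mrv (fun w=> Num.sqrt (Y w)).
 move=> mY; apply: (measurableT_comp _ mY); apply: continuous_measurable_fun; exact: sqrt_continuous.
have sqE (Y : Omega -> R) : (forall w, 0 <= Y w) -> (fun w=> Num.sqrt (Y w)^+2) = Y.
 by move=> Y0; apply/funext=> w; rewrite sqr_sqrtr.
rewrite -(sqE _ Z0); apply: (fatou_in_probability (Zq := fun q w=> Num.sqrt (Zq q w)))=> //.
- by move=> q; exact: msq.
- exact: msq.
- apply: cvgU_pointwise; [by move=> q; exact: msq|exact: msq|].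
 move=> w e e0; have [n hn] := cv w (e^+2) (exprn_gt0 _ e0).
 by exists n=> q /hn h; apply: sqrt_dist=> //; exact: ltW.
- by move=> q; rewrite sqE.
Qed.

Lemma L1b_sum_lt (A : set Omega) n (Z : nat -> Omega -> R) (B : nat -> R) : measurable A ->
 (forall i, (i < n)%N -> mrv (Z i)) -> (forall i w, 0 <= Z i w) ->
 (forall i, (i < n)%N -> L1b P A (Z i) (B i)) ->
 L1b P A (fun w=> \sum_(i < n) Z i w) (\sum_(i < n) B i).
move=> mA mZ Z0 hb.
have := @L1b_sum _ _ _ P A n (fun i=> if (i < n)%N then Z i else fun=> 0) B mA.
have -> : (fun w=> \sum_(i < n) (if (i < n)%N then Z i else fun=> 0) w) =
  (fun w=> \sum_(i < n) Z i w).
 by apply/funext=> w; apply: eq_bigr=> -[i iq] _ /=; rewrite iq.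
apply.
- by move=> i; case: ifPn=> [/mZ//|_]; exact: measurable_cst.
- by move=> i w; case: ifP.
- by move=> i jn; rewrite jn; exact: hb.
Qed.

(** Riemann sums on refined grids replace Fubini: a moment bound is required only at the refined
    grid points inside the cell. *)
Lemma L1b_Int_cell (Y : R -> Omega -> R) A n j b : measurable A -> (j < n)%N -> 0 <= b ->
 (forall w, continuous (fun s=> Y s w)) ->
 (forall s, 0 <= s <= T -> mrv (Y s)) -> (forall s w, 0 <= Y s w) ->
 (forall q i, (i < q.+1)%N -> L1b P A (Y (grid T (n*q.+1) (j*q.+1+i)%N)) b) ->
 L1b P A (fun w=> Int (grid T n j) (grid T n j.+1) (fun s=> Y s w)) (T/n%:R*b).
move=> mA jn b0 cY mY Y0 hb.
have n0 : (0 < n)%N by exact: leq_ltn_trans jn.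
pose t q i : R := grid T (n*q.+1) (j*q.+1+i).
have nq q : (0 < n*q.+1)%N by rewrite muln_gt0 n0.
have t0 q : t q 0%N = grid T n j by rewrite /t addn0 grid_refine.
have tN q : t q q.+1 = grid T n j.+1 by rewrite /t -mulSnr grid_refine.
have tS q i : t q i.+1-t q i = T/(n*q.+1)%:R by rewrite /t addnS gridS.
have tle q i : t q i <= t q i.+1.
 by rewrite -subr_ge0 tS ltW// mesh_gt0.
have tT q i : (i <= q.+1)%N -> 0 <= t q i <= T.
 move=> iq; apply: grid_itv=> //; apply: (@leq_trans (j*q.+1+q.+1)); first by rewrite leq_add2l.
 by rewrite -mulSnr leq_pmul2r.
have jT : 0 <= grid T n j <= T by exact/grid_itv/ltnW.
have jT' : 0 <= grid T n j.+1 <= T by exact: grid_itv.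
have hh : 0 < T/n%:R by exact: mesh_gt0.
apply: (@L1b_pointwise A (fun q w=> \sum_(i < q.+1) Y (t q i) w*(T/(n*q.+1)%:R)))=> //.
- by pos.
- move=> q; apply: measurable_sum=> i; apply: measurable_funM=> //; apply: mY; apply: tT.
 exact: ltnW.
- have -> : (fun w=> Int (grid T n j) (grid T n j.+1) (fun s=> Y s w)) =
   (fun w=> Int 0 (grid T n j.+1) (fun s=> Y s w)-Int 0 (grid T n j) (fun s=> Y s w)).
  apply/funext=> w; have /andP[j0 _] := jT.
  by rewrite (Int_split (cY w) j0 (grid_le T0 n (leqnSn j))); ring.
 case/andP: jT=> a0 aT; case/andP: jT'=> c0 cT.
 apply: measurable_funB; apply: Int_measurable=> // s /andP[s0 s1]; apply: mY.
  by rewrite s0 (le_trans s1).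
 by rewrite s0 (le_trans s1).
- by move=> q w; apply: sumr_ge0=> i _; rewrite mulr_ge0// ltW// mesh_gt0.
- by move=> w; exact: Int_ge0.
- move=> w e e0; have e1 : 0 < e/(T/n%:R) by rewrite divr_gt0.
 have [r r0 hr] := @heine_itv _ T _ (cY w) _ e1.
 have [q0 hq0] := mesh_small T n0 r0; exists q0=> q hq; rewrite distrC.
 have := @riemann_cell _ (fun s=> Y s w) (t q) q.+1 (e/(T/n%:R)) (cY w) (tle q).
 rewrite t0 tN gridS mulfVK ?gt_eqF//.
 under eq_bigr do rewrite tS; apply=> i s iq /andP[s1 s2].
 have /andP[a0 aT] := tT _ _ (ltnW iq); have /andP[c0 cT] := tT _ _ iq.
 apply: hr; [by rewrite (le_trans a0 s1) (le_trans s2 cT)|by rewrite a0 aT|].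
 rewrite ger0_norm ?subr_ge0//; apply: le_trans (hq0 _ hq); rewrite -(tS q i); lra.
- move=> q; have h0 : 0 <= T/(n*q.+1)%:R by rewrite ltW// mesh_gt0.
 have := @L1b_sum_lt A q.+1 (fun i w=> Y (t q i) w*(T/(n*q.+1)%:R)) (fun=> T/(n*q.+1)%:R*b) mA.
 rewrite sumr_const card_ord (_ : _ *+ q.+1 = T/n%:R*b); last first.
  rewrite -[LHS]mulr_natr natrM; field.
  by rewrite nat1r !pnatr_eq0 -lt0n n0.
 apply.
 + by move=> i iq; apply: measurable_funM=> //; exact/mY/tT/ltnW.
 + by move=> i w; rewrite mulr_ge0.
 + move=> i iq; under eq_fun do rewrite mulrC.
  by apply: L1bZ=> //; [exact/mY/tT/ltnW|exact: hb].
Qed.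

End Integral_moments.

Section Mesh.
Context {R : realType}.

(** About eps^-2 cells. In a cell the drift moves X by the mesh, of order eps^2, and the noise by
    eps times its square root, of order eps^2 as well; the sum of squared increments is then of
    order eps^2. *)
Definition ncell (eps : R) : nat := (Num.truncn (eps^-2)).+1.

Lemma ncell_gt0 eps : (0 < ncell eps)%N. by []. Qed.

Lemma ncell_ge (eps : R) : 0 < eps -> 1 <= (ncell eps)%:R*eps^+2.
move=> e0; rewrite -ler_pdivrMr ?exprn_gt0// div1r ltW// truncnS_gt//.
Qed.

Lemma ncell_le (eps : R) : 0 < eps -> eps <= 1 -> (ncell eps)%:R*eps^+2 <= 2.
move=> e0 e1; rewrite /ncell -natr1 mulrDl mul1r.
have h : eps^+2 <= 1 by rewrite expr_le1// ltW.
have : (Num.truncn (eps^-2))%:R <= eps^-2 :> R by rewrite truncn_le// invr_ge0 sqr_ge0.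
rewrite -div1r ler_pdivlMr ?exprn_gt0// => h2.
rewrite (_ : 2 = 1+1 :> R); last by ring.
by apply: lerD.
Qed.

Lemma mesh_le (T eps : R) : 0 < T -> 0 < eps -> T/(ncell eps)%:R <= T*eps^+2.
move=> T0 e0; rewrite ler_pdivrMr// -mulrA -[leLHS]mulr1 ler_pM2l//.
by rewrite mulrC ncell_ge.
Qed.

End Mesh.

(** * Pathwise expansion of the statistic *)

Section Statistic_path.
Context {R : realType}.
Variables (T : R) (n : nat) (eps eta u C Cd : R).
Hypotheses (T0 : 0 < T) (n0 : (0 < n)%N) (eps0 : 0 < eps) (eta0 : 0 <= eta) (C0 : 0 <= C).
Hypothesis Cd0 : 0 <= Cd.
Hypotheses (hn : T/n%:R <= T*eps^+2) (neps : n%:R*eps^+2 <= 2).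
Variables (X M S0X SdX DX : R -> R) (G V V' : R -> R -> R).
Hypotheses (cX : continuous X) (cS0 : continuous S0X) (cSd : continuous SdX) (cD : continuous DX).
Hypothesis cG : cont2 G.
Hypothesis cV' : cont2 V'.
Hypothesis XE : forall s t, 0 <= s -> s <= t -> t <= T ->
 X t-X s = Int s t S0X+eps*(M t-M s).
Hypothesis XC : forall s, 0 <= s <= T -> `|X s| <= C.
Hypothesis hS0 : forall s, 0 <= s <= T -> `|S0X s| <= C.
Hypothesis hSd : forall s, 0 <= s <= T -> `|SdX s| <= C.
Hypothesis hD : forall s, 0 <= s <= T -> `|DX s-(S0X s+u*eps*SdX s)| <= Cd*eps^+2.
Hypothesis hG : forall s c, 0 <= s <= T -> `|c| <= C -> `|G s c| <= C.
(** In space only a modulus at scale eps is available: for |c - c'| of order eps^2, the size of a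
    cell increment, the right-hand side is eta times order eps. *)
Hypothesis hGmod : forall s s' c c', 0 <= s <= T -> 0 <= s' <= T -> `|c| <= C -> `|c'| <= C ->
 `|G s c-G s' c'| <= C * `|s-s'| + eta*(eps+`|c-c'| / eps).
Hypothesis hV : forall t c c', 0 <= t <= T -> `|c| <= C -> `|c'| <= C ->
 `|V t c'-V t c-G t c*(c'-c)| <= eta*(eps * `|c'-c| + (c'-c)^+2/eps).
Hypothesis hVlip : forall t c c', 0 <= t <= T -> `|c| <= C -> `|c'| <= C ->
 `|V t c'-V t c| <= C * `|c'-c|.
Hypothesis hV' : forall s c c', 0 <= s <= T -> `|c| <= C -> `|c'| <= C ->
 `|V' s c'-V' s c| <= C * `|c'-c|.
Hypothesis hVt : forall t t' c, 0 <= t -> t <= t' -> t' <= T -> `|c| <= C ->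
 V t' c-V t c = Int t t' (fun s=> V' s c).

(** With V the primitive of G in x and V' its time derivative, this is R - Q without the factor
    I^(-1/2). *)
Definition path_stat s : R := V s (X s)-Int 0 s (fun r=> V' r (X r)) -
 Int 0 s (fun r=> G r (X r)*DX r).

Let t j : R := grid T n j.
Let h : R := T/n%:R.
Let dX j : R := X (t j.+1)-X (t j).
Let dM j : R := M (t j.+1)-M (t j).
Let VX : R := eps^-2*\sum_(j < n) dX j^+2.
Let UX : R := eps^-4*\sum_(j < n) Int (t j) (t j.+1) (fun s=>
 (X s-X (t j))^+2+(X (t j.+1)-X s)^+2).

Let cGX : continuous (fun s=> G s (X s)).
by apply: (cont_comp (cont_pair (fun s=> @cvg_id _ (nbhs s)) cX) cG). Qed.
Let cVX : continuous (fun s=> V' s (X s)).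
by apply: (cont_comp (cont_pair (fun s=> @cvg_id _ (nbhs s)) cX) cV'). Qed.
Let cVc c : continuous (fun s=> V' s c).
by apply: (cont_comp (cont_pair (fun s=> @cvg_id _ (nbhs s)) (@cst_continuous _ _ c)) cV'). Qed.
Let cst_cont (c : R) : continuous (fun _ : R=> c). exact: cst_continuous. Qed.

Let ti j : (j <= n)%N -> 0 <= t j <= T. exact: grid_itv. Qed.
Let tS j : t j <= t j.+1. exact: grid_le. Qed.
Let hE j : t j.+1-t j = h. exact: gridS. Qed.
Let h0 : 0 < h. exact: mesh_gt0. Qed.
Let cell j s : (j < n)%N -> t j <= s <= t j.+1 -> 0 <= s <= T.
move=> jn /andP[s1 s2]; have /andP[a _] := ti (ltnW jn); have /andP[_ b] := ti jn.
by rewrite (le_trans a s1) (le_trans s2 b).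
Qed.

(** The four summands bound E1, E2, E3 and E4 of [cell_error], in this order. *)
Let bound_j j : R := eta*(3/2*dX j^+2/eps+eps^+3/2)
 + C*(Int (t j) (t j.+1) (fun s=> (X (t j.+1)-X s)^+2)/eps^+2+eps^+2*h)/2
 + C*(C*h^+2+eta*(eps*h)
    + eta*(Int (t j) (t j.+1) (fun s=> (X s-X (t j))^+2)/eps^+3+eps*h)/2)
 + C*Cd*eps^+2*h.

                                       
Let young (a v : R) : 0 < v -> `|a| <= (a^+2/v+v)/2.
move=> v0; have E : a^+2 = `|a|^+2 by rewrite real_normK// num_real.
rewrite ler_pdivlMr// -(ler_pM2r v0) mulrDl divfK ?gt_eqF// E.
by have := sqr_ge0 (`|a| - v); nra.
Qed.

(** Over a cell, V is expanded in x at the left time (E1), its time derivative is taken at the right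
    end of the path (E2), G is frozen at the left end in the drift (E3), and D is replaced by its
    linearisation in the parameter (E4). What remains is eps G dM minus the information term; Itô's
    correction is absorbed in E1. *)
Lemma cell_error j : (j < n)%N ->
 `|path_stat (t j.+1)-path_stat (t j)-(eps*(G (t j) (X (t j))*dM j)
   - u*eps*Int (t j) (t j.+1) (fun s=> G s (X s)*SdX s))| <= bound_j j.
move=> jn; have hj := ti (ltnW jn); have hj' := ti jn; have /andP[t0 tT] := hj; have /andP[_ tT'] := hj'.
have Xj := XC hj; have Xj' := XC hj'.
set a := t j in hj hj' t0 tT tT' Xj Xj' *; set b := t j.+1 in hj' tT' Xj' *.
have ab : a <= b by exact: tS.
have bE : b-a = h by exact: hE.
have hcell s : a <= s <= b -> 0 <= s <= T by exact: cell.
pose E1 := V a (X b)-V a (X a)-G a (X a)*(X b-X a).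
pose E2 := Int a b (fun s=> V' s (X b)-V' s (X s)).
pose E3 := Int a b (fun s=> (G a (X a)-G s (X s))*S0X s).
pose E4 := Int a b (fun s=> G s (X s)*(DX s-(S0X s+u*eps*SdX s))).
have c3 : continuous (fun s=> (G a (X a)-G s (X s))*S0X s) by apply: contM=> //; exact: contB.
have c5 : continuous (fun s=> S0X s+u*eps*SdX s) by apply: contD=> //; exact: contM.
have c4 : continuous (fun s=> G s (X s)*(DX s-(S0X s+u*eps*SdX s))) by apply: contM=> //; exact: contB.
have cGD : continuous (fun s=> G s (X s)*DX s) by exact: contM.
have cGS : continuous (fun s=> G s (X s)*SdX s) by exact: contM.
have -> : path_stat b-path_stat a-(eps*(G a (X a)*dM j)
   - u*eps*Int a b (fun s=> G s (X s)*SdX s)) = E1+E2+E3-E4.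
 have e2 : E2 = V b (X b)-V a (X b)-Int a b (fun s=> V' s (X s)).
  by rewrite /E2 IntB// hVt.
 have e3 : E3 = G a (X a)*Int a b S0X-Int a b (fun s=> G s (X s)*S0X s).
  rewrite /E3 -IntZ// -IntB//; [|exact: contM|exact: contM].
  by apply: eq_Int=> s _; ring.
 have e4 : E4 = Int a b (fun s=> G s (X s)*DX s)-Int a b (fun s=> G s (X s)*S0X s)
    - u*eps*Int a b (fun s=> G s (X s)*SdX s).
  rewrite /E4 -IntZ// -!IntB//; [|by apply: contB=> //; exact: contM|exact: contM|exact: contM].
  by apply: eq_Int=> s _; ring.
 have e5 : eps*dM j = X b-X a-Int a b S0X by rewrite (XE t0 ab tT') /dM -/a -/b; ring.
 rewrite /path_stat (Int_split cVX t0 ab) (Int_split cGD t0 ab) e2 e3 e4 /E1.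
 rewrite (_ : eps*(G a (X a)*dM j) = G a (X a)*(eps*dM j)); last by ring.
 by rewrite e5; ring.
have q1 : `|E1| <= eta*(3/2*dX j^+2/eps+eps^+3/2).
 apply: le_trans (hV hj Xj Xj') _; apply: ler_wpM2l=> //; rewrite -/(dX j) -/b -/a.
 have e2 : 0 < eps^+2 by rewrite exprn_gt0.
 have := ler_wpM2l (ltW eps0) (young (dX j) e2).
 rewrite (_ : eps*((dX j^+2/eps^+2+eps^+2)/2) = (dX j^+2/eps+eps^+3)/2); last by field; rewrite gt_eqF.
 rewrite /dX -/a -/b; lra.
have Ih c : Int a b (fun=> c) = c*h by rewrite Int_cst// bE.
have cb : continuous (fun s=> (X b-X s)^+2) by apply: contX; exact: contB.
have ca : continuous (fun s=> (X s-X a)^+2) by apply: contX; exact: contB.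
have q2 : `|E2| <= C*(Int a b (fun s=> (X b-X s)^+2)/eps^+2+eps^+2*h)/2.
 have -> : C*(Int a b (fun s=> (X b-X s)^+2)/eps^+2+eps^+2*h)/2 =
   Int a b (fun s=> C/(2*eps^+2)*(X b-X s)^+2+C*eps^+2/2).
  rewrite IntD//; last exact: contM.
  by rewrite IntZ// Ih; field; rewrite gt_eqF.
 apply: Int_abs_le; [by apply: contB|by apply: contD=> //; exact: contM|].
 move=> s hs; have hs' := hcell s hs; apply: le_trans (hV' hs' (XC hs') Xj') _.
 have e2 : 0 < eps^+2 by rewrite exprn_gt0.
 have := young (X b-X s) e2; move/(ler_wpM2l C0)/le_trans; apply.
 by rewrite le_eqVlt; apply/orP; left; apply/eqP; field; rewrite gt_eqF.
have q3 : `|E3| <= C*(C*h^+2+eta*(eps*h)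
    + eta*(Int a b (fun s=> (X s-X a)^+2)/eps^+3+eps*h)/2).
 have -> : C*(C*h^+2+eta*(eps*h)
    + eta*(Int a b (fun s=> (X s-X a)^+2)/eps^+3+eps*h)/2) =
   Int a b (fun s=> C*eta/(2*eps^+3)*(X s-X a)^+2+C*(C*h+eta*eps+eta*eps/2)).
  rewrite IntD//; last exact: contM.
  by rewrite IntZ// Ih; field; rewrite gt_eqF.
 apply: Int_abs_le=> //; first by apply: contD=> //; exact: contM.
 move=> s hs; have hs' := hcell s hs; have /andP[s1 s2] := hs.
 rewrite normrM mulrC.
 have q := hGmod hj hs' Xj (XC hs').
 have d1 : `|a-s| <= h by rewrite distrC ger0_norm ?subr_ge0// -bE lerB.
 have d2 := young (X s-X a) (exprn_gt0 2 eps0).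
 have d3 : `|X a-X s| / eps <= ((X s-X a)^+2/eps^+3+eps)/2.
  rewrite distrC ler_pdivrMr//; apply: le_trans d2 _.
  by rewrite le_eqVlt; apply/orP; left; apply/eqP; field; rewrite gt_eqF.
 apply: le_trans (ler_pM _ _ (hS0 hs') q) _=> //.
 apply: (@le_trans _ _ (C*(C*h+eta*(eps+((X s-X a)^+2/eps^+3+eps)/2)))).
  by apply: ler_wpM2l=> //; apply: lerD; apply: ler_wpM2l=> //; rewrite lerD2l.
 by rewrite le_eqVlt; apply/orP; left; apply/eqP; field; rewrite gt_eqF.
have q4 : `|E4| <= C*Cd*eps^+2*h.
 rewrite -bE; apply: Int_bound=> // s hs; have hs' := hcell s hs.
 rewrite normrM -[leRHS]mulrA; apply: ler_pM=> //; [by apply: hG=> //; exact: XC|exact: hD].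
apply: le_trans (ler_normB _ _) _; rewrite /bound_j -/a -/b; apply: lerD=> //.
by apply: le_trans (ler_normD _ _) _; apply: lerD=> //; apply: le_trans (ler_normD _ _) _; exact: lerD.
Qed.

(** After division by eps, as in K, every error is eta or eps times a quantity that will be shown to
    be stochastically bounded; this is where the mesh eps^2 is used. *)
Let bound_sum : \sum_(j < n) bound_j j <= eps *
 (eta*(3/2*VX+1+C*(3/2*T+UX/2))+eps*(C*(UX+T)/2+C^+2*T^+2+C*Cd*T)).
have cb j : continuous (fun s=> (X (t j.+1)-X s)^+2) by apply: contX; exact: contB.
have ca j : continuous (fun s=> (X s-X (t j))^+2) by apply: contX; exact: contB.
pose I1 := \sum_(j < n) Int (t j) (t j.+1) (fun s=> (X s-X (t j))^+2).
pose I2 := \sum_(j < n) Int (t j) (t j.+1) (fun s=> (X (t j.+1)-X s)^+2).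
pose SV := \sum_(j < n) dX j^+2.
have I10 : 0 <= I1 by apply: sumr_ge0=> j _; apply: Int_ge0=> s _; exact: sqr_ge0.
have I20 : 0 <= I2 by apply: sumr_ge0=> j _; apply: Int_ge0=> s _; exact: sqr_ge0.
have UE : UX = eps^-4*(I1+I2).
 by rewrite /UX /I1 /I2 -big_split /=; congr (_*_); apply: eq_bigr=> j _; exact: IntD.
have VE : VX = eps^-2*SV by [].
have nh : n%:R*h = T by rewrite /h mulrC divfK// pnatr_eq0 -lt0n.
have E : \sum_(j < n) bound_j j = eta*(3/2*SV/eps+n%:R*eps^+3/2)
 + C*(I2/eps^+2+eps^+2*T)/2
 + C*(C*T*h+eta*(eps*T)+eta*(I1/eps^+3+eps*T)/2)
 + C*Cd*eps^+2*T.
 pose v : R := eta*eps^+3/2+C*(eps^+2*h)/2+C*(C*h^+2+eta*(eps*h)+eta*(eps*h)/2)+C*Cd*eps^+2*h.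
 have -> : \sum_(j < n) bound_j j = eta*(3/2/eps)*SV+C/eps^+2/2*I2+C*eta/eps^+3/2*I1+n%:R*v.
  rewrite /SV /I1 /I2 !mulr_sumr -!big_split /= (_ : n%:R*v = \sum_(j < n) v) -?big_split /=; last by rewrite sumr_const card_ord mulr_natl.
  by apply: eq_bigr=> j _; rewrite /bound_j /v; field; rewrite gt_eqF.
 rewrite -nh /v; field; rewrite gt_eqF//.
have p1 : SV = eps^+2*VX by rewrite VE mulrA divff ?mul1r// expf_neq0// gt_eqF.
have p2 : I1+I2 = eps^+4*UX by rewrite UE mulrA divff ?mul1r// expf_neq0// gt_eqF.
have i1 : I1/eps^+3 <= eps*UX.
 rewrite ler_pdivrMr ?exprn_gt0// (_ : eps*UX*eps^+3 = eps^+4*UX); last by ring.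
 by rewrite -p2 lerDl.
have i2 : I2/eps^+2 <= eps^+2*UX.
 rewrite ler_pdivrMr ?exprn_gt0// (_ : eps^+2*UX*eps^+2 = eps^+4*UX); last by ring.
 by rewrite -p2 lerDr.
rewrite E p1.
have k1 : n%:R*eps^+3/2 <= eps.
 have := ler_wpM2r (ltW eps0) neps; lra.
have k2 : C*T*h <= C*T*(T*eps^+2) by apply: ler_wpM2l=> //; rewrite mulr_ge0// ltW.
rewrite (_ : 3/2*(eps^+2*VX)/eps = 3/2*eps*VX); last by field; rewrite gt_eqF.
have w1 : eta*(3/2*eps*VX+n%:R*eps^+3/2) <= eta*(3/2*eps*VX+eps).
 by apply: ler_wpM2l=> //; rewrite lerD2l.
have w2 : C*(I2/eps^+2+eps^+2*T) <= C*(eps^+2*UX+eps^+2*T).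
 by apply: ler_wpM2l=> //; rewrite lerD2r.
have w3 : C*(C*T*h+eta*(eps*T)+eta*(I1/eps^+3+eps*T)/2) <=
  C*(C*T*(T*eps^+2)+eta*(eps*T)+eta*(eps*UX+eps*T)/2).
 apply: ler_wpM2l=> //; apply: lerD; first by rewrite lerD2r.
 by rewrite ler_pM2r ?invr_gt0//; apply: ler_wpM2l=> //; rewrite lerD2r.
move: w1 w2 w3; lra.
Qed.

Let path_stat_grid k : (k <= n)%N -> `|path_stat (t k)-path_stat 0-(eps*(\sum_(j < k) G (t j) (X (t j))*dM j)
   - u*eps*Int 0 (t k) (fun s=> G s (X s)*SdX s))| <= \sum_(j < n) bound_j j.
move=> kn.
have cGS : continuous (fun s=> G s (X s)*SdX s) by exact: contM.
have B0 j : (j < n)%N -> 0 <= bound_j j by move=> jn; apply: le_trans (cell_error jn).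
have t0 : t 0 = 0 by exact: grid0.
have -> : path_stat (t k)-path_stat 0-(eps*(\sum_(j < k) G (t j) (X (t j))*dM j)
   - u*eps*Int 0 (t k) (fun s=> G s (X s)*SdX s)) =
  \sum_(j < k) (path_stat (t j.+1)-path_stat (t j)-(eps*(G (t j) (X (t j))*dM j)
   - u*eps*Int (t j) (t j.+1) (fun s=> G s (X s)*SdX s))).
 rewrite sumrB (sum_telescope k (fun j=> path_stat (t j))) sumrB -!mulr_sumr (@Int_telescope _ _ t k cGS tS) t0.
 by [].
apply: le_trans (ler_norm_sum _ _ _) _.
apply: (@le_trans _ _ (\sum_(j < k) bound_j j)).
 by apply: ler_sum=> -[j /= jk] _; apply: cell_error; exact: leq_trans kn.
rewrite -(big_mkord predT bound_j) -(big_mkord predT (fun j=> bound_j j)) [leRHS](big_cat_nat (n := k))//=.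
rewrite lerDl big_nat_cond; apply: sumr_ge0=> j /andP[/andP[_ jn] _]; exact: B0.
Qed.

(** The cell errors are summed up to [t k]; the remaining time in the cell costs a Lipschitz term in
    X and drift terms of the order of the mesh. *)
Lemma path_stat_expansion k s : (k < n)%N -> t k <= s <= t k.+1 ->
 `|path_stat s/eps-(\sum_(j < k) G (t j) (X (t j))*dM j
   - u*Int 0 (t k) (fun s=> G s (X s)*SdX s))| <=
 `|V 0 (X 0)| / eps+C * `|X s-X (t k)| / eps +
 eta*(3/2*VX+1+C*(3/2*T+UX/2)) +
 eps*(C*(UX+T)/2+C^+2*T^+2+C*Cd*T +
  C*(3*C+`|u|*eps*C+Cd*eps^+2)*T).
move=> kn hs; have hs' := cell kn hs; have hk := ti (ltnW kn).
have /andP[s1 s2] := hs; have /andP[t0 tT] := hk; have /andP[_ sT] := hs'.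
have cGD : continuous (fun s=> G s (X s)*DX s) by exact: contM.
have Xs := XC hs'; have Xk := XC hk; set a := t k in hs s1 t0 tT hk Xk *.
have hh : s-a <= h by rewrite -(hE k) -/a lerB.
have sub r : a <= r <= s -> 0 <= r <= T.
 by move=> /andP[r1 r2]; rewrite (le_trans t0 r1) (le_trans r2 sT).
have step : `|path_stat s-path_stat a| <= C * `|X s-X a| +
  C*(3*C+`|u|*eps*C+Cd*eps^+2)*h.
 have -> : path_stat s-path_stat a = Int a s (fun r=> V' r (X s)-V' r (X r))+(V a (X s)-V a (X a))
    - Int a s (fun r=> G r (X r)*DX r).
  rewrite /path_stat (Int_split cVX t0 s1) (Int_split cGD t0 s1) IntB// -hVt//; ring.
 have q1 : `|Int a s (fun r=> V' r (X s)-V' r (X r))| <= C*(2*C)*(s-a).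
  apply: Int_bound=> //; first exact: contB.
  move=> r hr; have hr' := sub r hr; apply: le_trans (hV' hr' (XC hr') Xs) _.
  apply: ler_wpM2l=> //; apply: le_trans (ler_normB _ _) _; have := XC hr'; lra.
 have q2 : `|Int a s (fun r=> G r (X r)*DX r)| <= C*(C+`|u|*eps*C+Cd*eps^+2)*(s-a).
  apply: Int_bound=> // r hr; have hr' := sub r hr.
  rewrite normrM; apply: ler_pM=> //; first by apply: hG=> //; exact: XC.
  have := ler_normD (DX r-(S0X r+u*eps*SdX r)) (S0X r+u*eps*SdX r); rewrite subrK.
  move/le_trans; apply; rewrite addrC; apply: lerD; last exact: hD.
  apply: le_trans (ler_normD _ _) _; apply: lerD; first exact: hS0.
  rewrite !normrM (gtr0_norm eps0); apply: ler_wpM2l; last exact: hSd.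
  by pos.
 apply: le_trans (ler_normB _ _) _; have := ler_normD (Int a s (fun r=> V' r (X s)-V' r (X r))) (V a (X s)-V a (X a)).
 have := hVlip hk Xk Xs.
 have : C*(3*C+`|u|*eps*C+Cd*eps^+2)*(s-a) <= C*(3*C+`|u|*eps*C+Cd*eps^+2)*h.
  apply: ler_wpM2l=> //; apply: mulr_ge0=> //; apply: addr_ge0; last by pos.
  by apply: addr_ge0; rewrite ?mulr_ge0// ltW.
 lra.
have g := le_trans (path_stat_grid (ltnW kn)) bound_sum.
have p0 : path_stat 0 = V 0 (X 0) by rewrite /path_stat !Int_xx !subr0.
rewrite p0 -/a in g.
set A := \sum_(j < k) _ in g *; set I := Int 0 a _ in g *.
have -> : path_stat s/eps-(A-u*I) = ((path_stat s-path_stat a)+V 0 (X 0)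
  + (path_stat a-V 0 (X 0)-(eps*A-u*eps*I)))/eps by field; rewrite gt_eqF.
rewrite normrM normfV (gtr0_norm eps0) ler_pdivrMr//.
have w : C*(3*C+`|u|*eps*C+Cd*eps^+2)*h <= C*(3*C+`|u|*eps*C+Cd*eps^+2)*(T*eps^+2).
 apply: ler_wpM2l=> //; apply: mulr_ge0=> //; apply: addr_ge0; last by pos.
 by apply: addr_ge0; rewrite ?mulr_ge0// ltW.
apply: le_trans (ler_normD _ _) _; apply: le_trans (lerD (ler_normD _ _) (lexx _)) _.
apply: le_trans (lerD (lerD step (lexx _)) g) _.
move: w; set W := C*(3*C + _ + _); set Z1 := 3/2*VX+1 + _; set Z2 := C*(UX+T)/2 + _ + _=> w.
rewrite [leRHS](_ : _ = `|V 0 (X 0)| + C * `|X s-X a| + eps*(eta*Z1)+eps^+2*(Z2+W*T)).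
 by move: w; lra.
by field; rewrite gt_eqF.
Qed.

End Statistic_path.

Lemma half_band {R : realType} (v phi e : R) : e <= phi/2 -> 0 < phi -> `|v-phi| <= e/2 ->
 phi/2 <= v <= 3/2 * phi.
by move=> h1 h2; rewrite ler_norml=> /andP[u1 u2]; apply/andP; split; lra. Qed.

Lemma young_product {R : realType} (e y : R) : e * `|y| <= (y^+2+e^+2)/2.
by have := sqr_ge0 (`|y| - e); rewrite -(@real_normK _ y) ?num_real//; lra. Qed.

Lemma add_errors {R : realType} (e c z1 z2 z3 z4 z5 v0 be y1 y2 y3 y4 p p' : R) :
 `|y3| <= e*z4 -> `|y4| <= e*z5 -> v0 <= e*c -> `|y1| <= v0+be+e*z1+e*z2 ->
 `|y2| <= e*z3 ->
 `|y1+y2+(p+p')-y3-y4| <= e*(c+z1+z2+z3+z4+z5)+be+`|p| + `|p'|.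
have := ler_normB (y1+y2+(p+p')-y3) y4; have := ler_normB (y1+y2+(p+p')) y3.
have := ler_normD (y1+y2) (p+p'); have := ler_normD y1 y2; have := ler_normD p p'; lra.
Qed.

(** * From the integrated square to a quadratic form *)

Section Quadratic_comparison.
Context {R : realType}.
Variables (T : R) (n : nat).
Hypotheses (T0 : 0 < T) (n0 : (0 < n)%N).
Let t j : R := grid T n j.
Let h : R := T/n%:R.
Let tS j : t j <= t j.+1. exact: grid_le. Qed.
Let cst_cont (c : R) : continuous (fun _ : R=> c). exact: cst_continuous. Qed.
Let Ih j c : Int (t j) (t j.+1) (fun=> c) = h*c.
by rewrite Int_cst// mulrC /t gridS. Qed.

(** Write a^2 = b^2 + 2b(a - b) + (a - b)^2 and split the cross term by Young's inequality with
    weight eta, so that the squared error carries 1/eta and the main term only eta. *)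
Lemma quadratic_comparison (a q : R -> R) (b q0 : nat -> R) (C eta : R) :
 continuous a -> continuous q -> 0 < eta -> 0 <= C ->
 (forall s, 0 <= s <= T -> `|q s| <= C) ->
 (forall j s, (j < n)%N -> t j <= s <= t j.+1 -> `|q s-q0 j| <= eta) ->
 `|Int 0 T (fun s=> a s^+2*q s) - \sum_(j < n) b j^+2*q0 j*h| <=
  C*(1+eta^-1)*\sum_(j < n) Int (t j) (t j.+1) (fun s=> (a s-b j)^+2)
  + (C+1)*eta*\sum_(j < n) h*b j^+2.
move=> ca cq e0 C0 qC qq.
have caq : continuous (fun s=> a s^+2*q s) by apply: contM=> //; exact: contX.
rewrite -(gridT T n0) -{1}(grid0 T n) -(@Int_telescope _ _ t n caq tS) -sumrB.
rewrite !mulr_sumr -big_split /=; apply: le_trans (ler_norm_sum _ _ _) _.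
apply: ler_sum=> -[j /= jn] _.
have cab : continuous (fun s=> (a s-b j)^+2) by apply: contX; exact: contB.
rewrite (_ : b j^+2*q0 j*h = Int (t j) (t j.+1) (fun=> b j^+2*q0 j)); last by rewrite Ih mulrC.
rewrite -IntB//.
have -> : C*(1+eta^-1)*Int (t j) (t j.+1) (fun s=> (a s-b j)^+2)+(C+1)*eta*(h*b j^+2)
  = Int (t j) (t j.+1) (fun s=> C*(1+eta^-1)*(a s-b j)^+2+(C+1)*eta*b j^+2).
 rewrite IntD//; last exact: contM.
 by rewrite IntZ// Ih; ring.
apply: Int_abs_le; [by apply: contB|by apply: contD=> //; apply: contM|].
move=> s hs.
have hs' : 0 <= s <= T.
 case/andP: hs=> s1 s2; have /andP[a0 _] := grid_itv T0 n0 (ltnW jn); have /andP[_ b0] := grid_itv T0 n0 jn.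
 by rewrite (le_trans a0 s1) (le_trans s2 b0).
have q1 := qC _ hs'; have q2 := qq _ _ jn hs.
rewrite (_ : _ - _ = ((a s-b j)^+2+2*b j*(a s-b j))*q s+b j^+2*(q s-q0 j)); last by ring.
apply: le_trans (ler_normD _ _) _; rewrite !normrM.
have d0 : `|(a s-b j)^+2+2*b j*(a s-b j)| <= (1+eta^-1)*(a s-b j)^+2+eta*b j^+2.
 set v := a s-b j; set w := b j.
 have := sqr_ge0 (eta*w-v); have := sqr_ge0 (eta*w+v)=> p1 p2.
 have m1 : 2*w*v <= eta*w^+2+eta^-1*v^+2.
  rewrite -(ler_pM2l e0) (_ : eta*(_ + _) = eta^+2*w^+2+v^+2); last by field; rewrite gt_eqF.
  by nra.
 have m2 : - (2*w*v) <= eta*w^+2+eta^-1*v^+2.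
  rewrite -(ler_pM2l e0) (_ : eta*(_ + _) = eta^+2*w^+2+v^+2); last by field; rewrite gt_eqF.
  by nra.
 have m3 := sqr_ge0 v; rewrite ler_norml; apply/andP; split; last lra.
 lra.
have k1 := ler_pM (normr_ge0 _) (normr_ge0 _) d0 q1.
have k2 : `|b j^+2| * `|q s-q0 j| <= b j^+2*eta.
 by rewrite ger0_norm ?sqr_ge0//; apply: ler_wpM2l=> //; exact: sqr_ge0.
rewrite -normrM in k1; rewrite -!normrM; apply: le_trans (lerD k1 _) _; first by rewrite normrM; exact: k2.
by rewrite le_eqVlt; apply/orP; left; apply/eqP; ring.
Qed.

Lemma square_error (a X : R -> R) (b r r' : nat -> R) (al be : R) :
 continuous a -> continuous X -> 0 <= al -> 0 <= be ->
 (forall j s, (j < n)%N -> t j <= s <= t j.+1 ->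
   `|a s-b j| <= al+be * `|X s-X (t j)| + `|r j| + `|r' j|) ->
 \sum_(j < n) Int (t j) (t j.+1) (fun s=> (a s-b j)^+2) <=
 4*(T*al^+2+be^+2*(\sum_(j < n) Int (t j) (t j.+1) (fun s=> (X s-X (t j))^+2))
  + \sum_(j < n) h*r j^+2 + \sum_(j < n) h*r' j^+2).
move=> ca cX al0 be0 hab.
have -> : T*al^+2 = \sum_(j < n) h*al^+2.
 by rewrite sumr_const card_ord -mulrnAl /h -[_ *+ n]mulr_natr divfK// pnatr_eq0 -lt0n.
rewrite mulr_sumr -!big_split /= mulr_sumr; apply: ler_sum=> -[j /= jn] _.
have cXj : continuous (fun s=> (X s-X (t j))^+2) by apply: contX; exact: contB.
have -> : 4*(h*al^+2+be^+2*Int (t j) (t j.+1) (fun s=> (X s-X (t j))^+2)+h*r j^+2+h*r' j^+2)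
  = Int (t j) (t j.+1) (fun s=> 4*be^+2*(X s-X (t j))^+2+4*(al^+2+r j^+2+r' j^+2)).
 by rewrite IntD// ?IntZ// ?Ih; [ring|exact: contM].
apply: Int_le; [by apply: contX; exact: contB|by apply: contD=> //; exact: contM|].
move=> s hs; have := hab _ _ jn hs.
have sq (v : R) : v^+2 = `|v|^+2 by rewrite real_normK// num_real.
rewrite (sq (a s-b j)) (sq (X s-X (t j))) (sq (r j)) (sq (r' j)).
set v1 := `|a s-b j|; set v2 := `|X s - _|; set v3 := `|r j|; set v4 := `|r' j| => hv.
have v10 : 0 <= v1 := normr_ge0 _; have v20 : 0 <= be*v2 := mulr_ge0 be0 (normr_ge0 _).
have v30 : 0 <= v3 := normr_ge0 _; have v40 : 0 <= v4 := normr_ge0 _.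
have : v1^+2 <= (al+be*v2+v3+v4)^+2 by rewrite lerXn2r// nnegrE !addr_ge0.
rewrite -mulrA -exprMn; move: (be*v2)=> z; move: v1 v3 v4 {hv v10 v20 v30 v40} => v1 v3 v4.
have := sqr_ge0 (al-z); have := sqr_ge0 (al-v3); have := sqr_ge0 (al-v4).
have := sqr_ge0 (z-v3); have := sqr_ge0 (z-v4); have := sqr_ge0 (v3-v4); lra.
Qed.

End Quadratic_comparison.

Section Op_calculus.
Context {R : realType} {d : measure_display} {Omega : measurableType d}.
Variable P : probability Omega R.
Implicit Types Y Z : R -> Omega -> R.

Lemma OP_abs Y : OP P Y -> OP P (fun eps w=> `|Y eps w|).
by move=> hY e /hY[lam l0 h]; exists lam=> //; under eq_fun do under eq_fun do rewrite normr_id. Qed.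

Lemma OPX Y k : OP P Y -> OP P (fun eps w=> Y eps w^+k).
move=> hY; elim: k=> [|k IH]; first by under eq_fun do under eq_fun do rewrite expr0; exact: OP_cst.
by under eq_fun do under eq_fun do rewrite exprS; exact: OPM.
Qed.

Lemma OP_whp_small Y r : OP P Y -> 0 < r -> whp P (fun eps w=> `|eps*Y eps w| <= r).
move=> hY r0 e e0; have [lam l0 hl] := hY _ e0.
apply: small_mono (small_and hl (small_le_mul lam r0)) _=> eps e1 [h lr].
apply: up_to_mono (lexx _) _ h=> w hw; rewrite normrM gtr0_norm//; apply: le_trans lr.
by rewrite mulrC ler_pM2r.
Qed.

End Op_calculus.

Ltac op := repeat first
 [ assumption
 | match goal with
  | |- OP _ (fun _ _=> _ + _)=> apply: OPD
  | |- OP _ (fun _ _=> _*_)=> apply: OPM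
  | |- OP _ (fun _ _=> _^+_)=> apply: OPX
  | |- OP _ (fun _ _=> `|_|)=> apply: OP_abs
  end
 | apply: OP_cst ].

Lemma Int_continuous {R : realType} (g : R -> R) : continuous g -> continuous (fun s=> Int 0 s g).
move=> cg s; pose c := `|s| + 1.
have c0 : 0 <= c by rewrite addr_ge0.
have [M hM] : exists M, forall y, 0 <= y <= c -> `|g y| <= M.
 have cag : {within `[0, c], continuous (fun y=> `|g y|)}.
  by apply: continuous_subspaceT; exact: contA.
 have [y0 _ hy0] := EVT_max c0 cag; exists `|g y0| => y hy; apply: hy0; rewrite in_itv//.
have M0 : 0 <= M by apply: le_trans (hM 0 _); rewrite ?lexx.
have key u v : u <= v -> v <= c -> `|Int 0 v g-Int 0 u g| <= M*(v-u).
 move=> uv vc; case: (leP 0 u)=> u0.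
  rewrite (Int_split cg u0 uv) addrAC subrr add0r; apply: Int_bound=> // y /andP[y1 y2].
  by apply: hM; rewrite (le_trans u0 y1) (le_trans y2 vc).
 rewrite [Int 0 u g](_ : _ = 0) ?subr0; last first.
  by rewrite /Int set_itv_ge ?Rintegral_set0// bnd_simp -ltNge.
 case: (leP 0 v)=> v0.
  apply: le_trans (Int_bound (M := M) cg v0 _) _.
   by move=> y /andP[y1 y2]; apply: hM; rewrite y1 (le_trans y2 vc).
  by apply: ler_wpM2l=> //; lra.
 rewrite /Int set_itv_ge ?Rintegral_set0 ?normr0 ?bnd_simp -?ltNge//.
 by pos.
apply/cvgrPdist_le=> e e0; near=> v.
have vc : v <= c.
 have : `|s-v| <= 1 by apply: ltW; near: v; exact: (nbhsx_ballx s 1 ltr01).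
 by have := ler_norm (v-s); rewrite distrC /c; have := ler_norm s; lra.
have sc : s <= c by rewrite /c; have := ler_norm s; lra.
have sv : `|s-v| <= e/(M+1).
 apply: ltW; near: v; apply: (nbhsx_ballx s (e/(M+1))).
 by pos.
have hh : M * `|s-v| <= e.
 have h1 : (M+1) * `|s-v| <= e by rewrite mulrC -ler_pdivlMr// ltr_wpDl.
 by apply: le_trans h1; rewrite ler_wpM2r// lerDl.
case: (leP v s)=> vs.
 by apply: le_trans (key _ _ vs sc) _; rewrite ger0_norm ?subr_ge0// in hh.
rewrite distrC; apply: le_trans (key _ _ (ltW vs) vc) _.
by rewrite distrC ger0_norm ?subr_ge0 ?(ltW vs)// in hh.
Unshelve. all: by end_near. Qed.

(** * Stochastic orders for the diffusion with small noise *)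

Section Small_noise.
Context {R : realType} {d : measure_display} {Omega : measurableType d}.
Variables (P : probability Omega R) (F : R -> set (set Omega)) (T : R).
Variable W : R -> Omega -> R.
Hypotheses (T0 : 0 < T) (hF : filtration F T) (hW : wiener P F T W).
Hypothesis normal_sym : forall s : R, 0 < s -> forall A : set R, measurable A ->
 normal_prob 0 s (-%R @^-1` A) = normal_prob 0 s A.
Variables (S0 sg : R -> R -> R) (x : R -> R) (x0 L K : R).
Hypothesis L0 : 0 < L.
Hypothesis cS0 : cont2 S0.
Hypothesis csg : cont2 sg.
Hypothesis lipS0 : forall t y z, `|S0 t y-S0 t z| <= L * `|y-z|.
Hypothesis growS0 : forall t y, `|S0 t y| <= L*(1+`|y|).
Hypothesis growsg : forall t y, `|sg t y| <= L*(1+`|y|).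
Hypothesis cx : continuous x.
Hypothesis xE : forall t, 0 <= t <= T -> x t = x0+Int 0 t (fun s=> S0 s (x s)).
Hypothesis xK : forall s, 0 <= s <= T -> `|x s| + 2 <= K.
Variables X H0 : R -> R -> Omega -> R.
Hypothesis cX : forall eps, 0 < eps < 1 -> forall w, continuous (fun s=> X eps s w).
Hypothesis aX : forall eps, 0 < eps < 1 -> forall s, 0 <= s <= T -> adapted F s (X eps s).
Hypothesis H0E : forall eps, 0 < eps < 1 -> forall s w, 0 <= s <= T ->
 H0 eps s w = sg s (X eps s w).
Let M eps := mart S0 x0 eps (X eps).
Hypothesis hM : forall eps, 0 < eps < 1 -> forall t, 0 <= t <= T ->
 exists I, stoch_integral P F t (H0 eps) W I /\ {ae P, forall w, I w = M eps t w}.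

Let n := @ncell R.
Let t eps j : R := grid T (n eps) j.
Let h eps : R := T/(n eps)%:R.
Let dX eps j w : R := X eps (t eps j.+1) w-X eps (t eps j) w.
Let dM eps j w : R := M eps (t eps j.+1) w-M eps (t eps j) w.
Let dW eps j w : R := W (t eps j.+1) w-W (t eps j) w.

Definition tube lam eps (A : set Omega) : Prop := forall w s, A w -> 0 <= s <= T ->
 `|X eps s w-x s| <= lam*eps.

Let K0 : 0 <= K.
by apply: le_trans (xK (_ : 0 <= 0 <= T)); rewrite ?lexx ?ltW// addr_ge0. Qed.

Let small01 : small (fun eps : R=> 0 < eps < 1).
by exists 1=> // eps e0 e1; rewrite e0. Qed.

Lemma tube_bound lam eps A : lam*eps <= 1 -> tube lam eps A ->
 forall w s, A w -> 0 <= s <= T -> `|X eps s w| <= K.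
move=> le1 hA w s Aw hs; have := hA w s Aw hs; have := xK hs.
have := ler_normD (X eps s w-x s) (x s); rewrite subrK; lra.
Qed.

(** [exit_bound] with a large barrier height; the complement of its exceptional set is the event
    [A]. *)
Lemma tube_whp e : 0 < e -> exists2 lam, 0 < lam & small (fun eps=> exists A,
 [/\ measurable A, (P (~` A) <= e%:E)%E & tube lam eps A]).
move=> e0.
have [c cE c0] : exists2 c, c = 800*T*(L*(1+K))^+2 & 0 <= c.
 exists (800*T*(L*(1+K))^+2); first exact: erefl.
 apply: mulr_ge0; [apply: mulr_ge0; [exact: ler0n|exact: ltW]|exact: sqr_ge0].
(* Since l >= 1, c/l^2 <= c/l <= e/2. *)
pose l := Num.max 1 (2*c/e).
have l1 : 1 <= l by rewrite le_max lexx.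
have l0 : 0 < l by exact: lt_le_trans l1.
have cl : c/l^+2 <= e/2.
 rewrite ler_pdivrMr ?exprn_gt0//.
 have h1 : 2*c/e <= l by rewrite le_max lexx orbT.
 have h2 : 2*c <= l*e by rewrite -ler_pdivrMr.
 have h3 : l*e <= e * l^+2 by rewrite mulrC ler_pM2l// expr2 ler_peMr// ltW.
 lra.
exists ((expR (2*L*T)+1) * l); first by rewrite mulr_gt0.
apply: small_mono (small_and small01 (small_le_mul (expR (2*L*T) * l) ltr01)) _=> eps e1 [e01 hl].
have e2 : 0 < e/2 by rewrite divr_gt0.
have := @exit_bound _ _ _ P F T W T0 hF hW normal_sym S0 sg x x0 L eps e1 L0 cS0 csg lipS0 growsg cx xE
 (X eps) (cX e01) (aX e01) (H0 eps) (H0E e01) (hM e01) l K l0 xK.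
move=> /(_ _ (e/2) e2)[|N [mN PN hN]]; first by apply: le_trans hl; rewrite le_eqVlt; apply/orP; left; apply/eqP; ring.
exists (~` N); split; first exact: measurableC.
- rewrite setCK; apply: le_trans PN _; rewrite lee_fin -cE; lra.
- by move=> w s nN hs; exact: hN.
Qed.

Let mXe eps s : 0 < eps < 1 -> 0 <= s <= T -> mrv (X eps s).
by move=> e01 hs; apply: (adapted_measurable hF hs); exact: aX. Qed.

Let mMe eps s : 0 < eps < 1 -> 0 <= s <= T -> mrv (M eps s).
by move=> e01 hs; apply: (mart_measurable hF x0 eps cS0 (cX e01) (aX e01)) hs. Qed.

Let ti eps j : (j <= n eps)%N -> 0 <= t eps j <= T.
exact: grid_itv. Qed.

Let mdM eps j : 0 < eps < 1 -> (j < n eps)%N -> mrv (dM eps j).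
by move=> e01 jn; apply: measurable_funB; apply: mMe=> //; apply: ti=> //; exact: ltnW. Qed.

Let mdX eps j : 0 < eps < 1 -> (j < n eps)%N -> mrv (dX eps j).
by move=> e01 jn; apply: measurable_funB; apply: mXe=> //; apply: ti=> //; exact: ltnW. Qed.

Let mdW eps j : (j < n eps)%N -> mrv (dW eps j).
by move=> jn; apply: measurable_funB; apply: (wiener_measurable hF hW); apply: ti=> //; exact: ltnW.
Qed.

Let Bb : R := (L*(1+K))^+2.
Let B0 : 0 <= Bb. exact: sqr_ge0. Qed.
Let TB : 0 <= T*Bb. by pos. Qed.
Let TTB : 0 <= T^+2*Bb. by pos. Qed.

Let X_inc eps A m i j : 0 < eps < 1 -> measurable A ->
 (forall w s, A w -> 0 <= s <= T -> `|X eps s w| <= K) -> (0 < m)%N -> (i <= j)%N -> (j <= m)%N ->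
 L1b P A (fun w=> (X eps (grid T m j) w-X eps (grid T m i) w)^+2)
  (2*Bb*(grid T m j-grid T m i)^+2+16*eps^+2*(grid T m j-grid T m i)*Bb).
move=> e01 mA hA m0 ij jm; have /andP[e0 _] := e01.
exact: (@X_increment _ _ _ P F T W T0 hF hW normal_sym S0 sg x0 L eps e0 L0 cS0 csg growsg
 (X eps) (cX e01) (aX e01) (H0 eps) (H0E e01) (hM e01) K growS0 K0 A mA hA m i j m0 ij jm).
Qed.

Let hE eps : (n eps)%:R*h eps = T.
by rewrite /h mulrC divfK// pnatr_eq0. Qed.

Let h0 eps : 0 < h eps. exact: mesh_gt0. Qed.

Let h_le eps : 0 < eps -> h eps <= T*eps^+2. exact: mesh_le. Qed.

Let tube1 lam : 0 < lam -> small (fun eps=> 0 < eps < 1 /\ forall A, tube lam eps A ->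
 forall w s, A w -> 0 <= s <= T -> `|X eps s w| <= K).
move=> l0; apply: small_mono (small_and small01 (small_le_mul lam ltr01)) _=> eps _ [e01 le1].
by split=> // A; exact: tube_bound.
Qed.

Lemma mart_variation_OP : OP P (fun eps w=> \sum_(j < n eps) dM eps j w^+2).
apply: (OP_L1 tube_whp).
- by move=> eps w; apply: sumr_ge0=> j _; exact: sqr_ge0.
- apply: small_mono small01 _=> eps e0 e01; apply: measurable_sum=> -[j /= jn].
 by apply: measurable_funX; exact: mdM.
- move=> lam l0; exists (8*T*Bb+1); first by have := TB; lra.
 apply: small_mono (tube1 l0) _=> eps e0 [e01 hK] A mA /hK hA.
 apply: (@L1b_mono _ _ _ _ _ _ (\sum_(j < n eps) 8*h eps*Bb)).
  rewrite sumr_const card_ord -[_ *+ n eps]mulr_natr (_ : _*_ = 8*((n eps)%:R*h eps)*Bb); last by ring.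
  by rewrite hE; lra.
 apply: (L1b_sum_lt (Z := fun j w=> dM eps j w^+2) (B := fun=> _))=> //.
 + by move=> i ni; apply: measurable_funX; exact: mdM.
 + by move=> i w; exact: sqr_ge0.
 + move=> i ni; rewrite /h -(gridS T (n eps) i).
  exact: (@mart_increment _ _ _ P F T W T0 hF hW normal_sym S0 sg x0 L eps L0 cS0 csg growsg
   (X eps) (cX e01) (aX e01) (H0 eps) (H0E e01) (hM e01) K K0 A mA hA (n eps) i i.+1 isT (leqnSn _) ni).
Qed.

Lemma X_variation_OP : OP P (fun eps w=> eps^-2*\sum_(j < n eps) dX eps j w^+2).
apply: (OP_L1 tube_whp).
- by move=> eps w; rewrite mulr_ge0 ?invr_ge0 ?sqr_ge0//; apply: sumr_ge0=> j _; exact: sqr_ge0.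
- apply: small_mono small01 _=> eps e0 e01; apply: measurable_funM=> //; apply: measurable_sum=> -[j /= jn].
 by apply: measurable_funX; exact: mdX.
- move=> lam l0; exists (2*Bb*T^+2+16*T*Bb+1).
  by have := TB; have := TTB; lra.
 apply: small_mono (tube1 l0) _=> eps e0 [e01 hK] A mA /hK hA.
 have e2 : 0 < eps^+2 by pos.
 apply: (@L1b_mono _ _ _ _ _ _ (eps^-2*\sum_(j < n eps) (2*Bb*h eps^+2+16*eps^+2*h eps*Bb))).
  rewrite mulrC ler_pdivrMr// sumr_const card_ord -[_ *+ n eps]mulr_natr.
  rewrite (_ : (_ + _)*_ = 2*Bb*h eps*((n eps)%:R*h eps)+16*eps^+2*((n eps)%:R*h eps)*Bb); last by ring.
  rewrite hE; have := h_le e0; have := mulr_ge0 B0 (ltW T0); move: (h eps)=> v p1 p2.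
  by nra.
 apply: L1bZ=> //.
 + by apply: measurable_sum=> -[j /= jn]; apply: measurable_funX; exact: mdX.
 + by pos.
 + by move=> w; apply: sumr_ge0=> j _; exact: sqr_ge0.
 apply: (L1b_sum_lt (Z := fun j w=> dX eps j w^+2) (B := fun=> _))=> //.
 + by move=> i ni; apply: measurable_funX; exact: mdX.
 + by move=> i w; exact: sqr_ge0.
 + by move=> i ni; rewrite /h -(gridS T (n eps) i); exact: X_inc.
Qed.

(** Inside a cell the squared displacements from both ends have mean of order eps^4, and the cells
    have total length T; this explains the factor eps^-4. *)
Lemma X_oscillation_OP : OP P (fun eps w=> eps^-4*\sum_(j < n eps)
 Int (t eps j) (t eps j.+1) (fun s=> (X eps s w-X eps (t eps j) w)^+2 +
   (X eps (t eps j.+1) w-X eps s w)^+2)).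
pose Y eps j s w : R := (X eps s w-X eps (t eps j) w)^+2+(X eps (t eps j.+1) w-X eps s w)^+2.
have Y0 eps j s w : 0 <= Y eps j s w by rewrite addr_ge0 ?sqr_ge0.
have mY eps j s : 0 < eps < 1 -> (j < n eps)%N -> 0 <= s <= T -> mrv (Y eps j s).
 move=> e01 jn hs; have m1 := mXe e01 hs; have m2 := mXe e01 (ti (ltnW jn)); have m3 := mXe e01 (ti jn).
 by rewrite /Y; mfun.
have cY eps j w : 0 < eps < 1 -> continuous (fun s=> Y eps j s w).
 move=> e01; have c1 := @cX eps e01 w.
 by apply: contD; apply: contX; apply: contB=> //; exact: cst_continuous.
have mI eps j : 0 < eps < 1 -> (j < n eps)%N ->
  mrv (fun w=> Int (t eps j) (t eps j.+1) (fun s=> Y eps j s w)).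
 move=> e01 jn; have /andP[t0 tT] := ti (ltnW jn); have /andP[t0' tT'] := ti jn.
 have -> : (fun w=> Int (t eps j) (t eps j.+1) (fun s=> Y eps j s w)) =
   (fun w=> Int 0 (t eps j.+1) (fun s=> Y eps j s w)-Int 0 (t eps j) (fun s=> Y eps j s w)).
  apply/funext=> w; rewrite (Int_split (cY eps j w e01) t0 (grid_le T0 (n eps) (leqnSn j))); ring.
 apply: measurable_funB; apply: Int_measurable=> //.
 - by move=> w; exact: cY.
 - by move=> s /andP[s0 s1]; apply: mY=> //; rewrite s0 (le_trans s1).
 - by move=> w; exact: cY.
 - by move=> s /andP[s0 s1]; apply: mY=> //; rewrite s0 (le_trans s1).
apply: (OP_L1 tube_whp).
- move=> eps w; rewrite mulr_ge0 ?invr_ge0 ?exprn_even_ge0//; apply: sumr_ge0=> j _.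
 by apply: Int_ge0=> s _; exact: Y0.
- apply: small_mono small01 _=> eps e0 e01; apply: measurable_funM=> //; apply: measurable_sum=> -[j /= jn].
 exact: mI.
- move=> lam l0; exists (T*(2*(2*Bb*T^+2+16*T*Bb))+1).
  by have := mulr_ge0 (ltW T0) TB; have := mulr_ge0 (ltW T0) TTB; lra.
 apply: small_mono (tube1 l0) _=> eps e0 [e01 hK] A mA /hK hA.
 have e4 : 0 < eps^+4 by pos.
 pose b := 2*(2*Bb*h eps^+2+16*eps^+2*h eps*Bb).
 have b0 : 0 <= b.
  have hh := ltW (h0 eps); apply: mulr_ge0; first exact: ler0n.
  apply: addr_ge0; first by apply: mulr_ge0; [apply: mulr_ge0|exact: sqr_ge0].
  by apply: mulr_ge0=> //; apply: mulr_ge0=> //; apply: mulr_ge0; [exact: ler0n|exact: sqr_ge0].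
 apply: (@L1b_mono _ _ _ _ _ _ (eps^-4*\sum_(j < n eps) h eps*b)).
  rewrite mulrC ler_pdivrMr// sumr_const card_ord -[_ *+ n eps]mulr_natr.
  rewrite (_ : _*_*_ = ((n eps)%:R*h eps)*b); last by ring.
  rewrite hE; have := h_le e0; have hh := ltW (h0 eps); rewrite /b; move: (h eps) hh=> v v0 p1.
  have p2 : v^+2 <= (T*eps^+2)^+2 by rewrite lerXn2r// nnegrE mulr_ge0// ?ltW// exprn_gt0.
  have p3 : Bb*v^+2 <= Bb*(T*eps^+2)^+2 by rewrite ler_wpM2l.
  have p4 : Bb*(eps^+2*v) <= Bb*(eps^+2*(T*eps^+2)).
   by rewrite ler_wpM2l// ler_wpM2l// sqr_ge0.
  rewrite [leRHS]mulrDl mul1r.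
  have : 2*(2*Bb*v^+2+16*eps^+2*v*Bb) <= 2*(2*Bb*T^+2+16*T*Bb)*eps^+4 by lra.
  move=> q; apply: le_trans (_ : T*(2*(2*Bb*T^+2+16*T*Bb)*eps^+4) <= _); first by rewrite ler_wpM2l// ltW.
  by rewrite mulrA lerDl ltW.
 apply: L1bZ=> //.
 + by apply: measurable_sum=> -[j /= jn]; exact: mI.
 + by pos.
 + by move=> w; apply: sumr_ge0=> j _; apply: Int_ge0=> s _; exact: Y0.
 apply: (L1b_sum_lt (Z := fun j w=> Int (t eps j) (t eps j.+1) (fun s=> Y eps j s w)) (B := fun=> _))=> //.
 + by move=> i ni; exact: mI.
 + by move=> i w; apply: Int_ge0=> s _; exact: Y0.
 + move=> i ni; apply: (L1b_Int_cell T0 (Y := Y eps i))=> //.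
  * by move=> w; exact: cY.
  * by move=> s; exact: mY.
  move=> q l lq.
  have nq : (0 < n eps*q.+1)%N by [].
  have l1 : (i*q.+1+l <= i.+1*q.+1)%N by rewrite mulSnr leq_add2l ltnW.
  have l2 : (i.+1*q.+1 <= n eps*q.+1)%N by rewrite leq_pmul2r.
  have := X_inc e01 mA hA nq (leq_addr l (i*q.+1)%N) (leq_trans l1 l2).
  have := X_inc e01 mA hA nq l1 l2.
  rewrite !grid_refine//; set s := grid T _ (_ + _)=> q1 q2.
  have s1 : t eps i <= s by rewrite /t -(grid_refine T (n eps) i (ltn0Sn q)); apply: grid_le=> //; exact: leq_addr.
  have s2 : s <= t eps i.+1 by rewrite /t -(grid_refine T (n eps) i.+1 (ltn0Sn q)); exact: grid_le.
  have hs : 0 <= s <= T.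
   by have /andP[a0 _] := ti (ltnW ni); have /andP[_ aT] := ti ni; rewrite (le_trans a0 s1) (le_trans s2 aT).
  have cmp (u : R) : 0 <= u -> u <= h eps ->
    2*Bb*u^+2+16*eps^+2*u*Bb <= 2*Bb*h eps^+2+16*eps^+2*h eps*Bb.
   move=> u0 uh; apply: lerD.
    by apply: ler_wpM2l; [exact: mulr_ge0|rewrite lerXn2r// nnegrE ltW].
   by rewrite ler_wpM2r// ler_wpM2l// mulr_ge0 ?sqr_ge0 ?ler0n.
  have hE' : h eps = t eps i.+1-t eps i by rewrite /h -(gridS T (n eps) i).
  have m1 := mXe e01 hs; have m2 := mXe e01 (ti (ltnW ni)); have m3 := mXe e01 (ti ni).
  rewrite /b mulr_natl mulr2n; apply: L1bD=> //; try by mfun.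
  * by move=> w; exact: sqr_ge0.
  * by move=> w; exact: sqr_ge0.
  * by apply: L1b_mono q2; apply: cmp; [rewrite subr_ge0|rewrite hE'; rewrite -/(t _ _); lra].
  * by apply: L1b_mono q1; apply: cmp; [rewrite subr_ge0|rewrite hE'; rewrite -/(t _ _); lra].
Qed.


Let Dc (C : R) : R := C*(L*(1+K)).

Lemma product_close (G : R -> R -> R) (C : R) : cont2 G ->
 (forall s y, `|G s y| <= C) -> forall e, 0 < e -> exists2 r, 0 < r & forall s s' y y',
  0 <= s <= T -> 0 <= s' <= T -> `|s-s'| <= r -> `|y-x s| <= r -> `|y'-x s'| <= r ->
  `|G s y*sg s' y'-G s (x s)*sg s (x s)| <= e.
move=> cG GC e e0; have C0 : 0 <= C by exact: le_trans (GC 0 0).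
have LK : 0 < L*(1+K) by rewrite mulr_gt0// ltr_pwDl.
pose c := 2*(C+1+L*(1+K)).
have c0 : 0 < c by rewrite /c; lra.
have ec : 0 < e/c by rewrite divr_gt0.
have [r1 r10 hr1] := @heine_rect _ T K _ cG _ ec.
have [r2 r20 hr2] := @heine_rect _ T K _ csg _ ec.
have [r3 r30 hr3] := @heine_itv _ T _ cx _ (divr_gt0 r20 (ltr0n _ 2)).
pose r := Num.min 1 (Num.min r1 (Num.min (r2/2) r3)).
have r0 : 0 < r by rewrite !lt_min ltr01 r10 r30 divr_gt0.
have rl1 : r <= 1 by rewrite ge_min lexx.
have rr1 : r <= r1 by rewrite /r !ge_min lexx !orbT.
have rr2 : r <= r2/2 by rewrite /r !ge_min lexx !orbT.
have rr2' : r <= r2 by lra.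
have rr3 : r <= r3 by rewrite /r !ge_min lexx !orbT.
exists r=> // s s' y y' hs hs' ss hy hy'.
have ay : `|y| <= K by have := xK hs; have := ler_normD (y-x s) (x s); rewrite subrK; lra.
have ay' : `|y'| <= K by have := xK hs'; have := ler_normD (y'-x s') (x s'); rewrite subrK; lra.
have ax : `|x s| <= K by have := xK hs; lra.
have g1 : `|G s y-G s (x s)| <= e/c.
 by apply: hr1=> //; [rewrite subrr normr0 ltW|exact: le_trans rr1].
have g2 : `|sg s' y'-sg s (x s)| <= e/c.
 apply: hr2=> //; first by rewrite distrC; exact: le_trans rr2'.
 have xx : `|x s'-x s| <= r2/2 by apply: hr3=> //; rewrite distrC; exact: le_trans rr3.
 by have := ler_normD (y'-x s') (x s'-x s); rewrite addrA subrK; lra.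
have g3 : `|sg s (x s)| <= L*(1+K).
 by apply: le_trans (growsg _ _) _; rewrite ler_pM2l// lerD2l.
rewrite (_ : _ - _ = G s y*(sg s' y'-sg s (x s))+(G s y-G s (x s))*sg s (x s)); last by ring.
apply: le_trans (ler_normD _ _) _; rewrite !normrM.
have q1 := ler_pM (normr_ge0 _) (normr_ge0 _) (GC s y) g2.
have q2 := ler_pM (normr_ge0 _) (normr_ge0 _) g1 g3.
apply: le_trans (lerD q1 q2) _.
have : C*(e/c)+e/c*(L*(1+K)) <= e/c*(c/2) by have := ltW ec; rewrite /c; nra.
have -> : e/c*(c/2) = e/2 by field; rewrite gt_eqF.
lra.
Qed.

(** Inside a tube of radius O(eps) the integrand G sigma along X is uniformly close to its value
    along the limit path, so the difference of the two sums is a stochastic integral with a small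
    integrand. *)
Lemma weighted_sum_oP (G : R -> R -> R) (C : R) : cont2 G ->
 (forall s y, `|G s y| <= C) ->
 oP P (fun eps w=> \sum_(k < n eps) h eps*(\sum_(j < k)
   (G (t eps j) (X eps (t eps j) w)*dM eps j w
    - G (t eps j) (x (t eps j))*sg (t eps j) (x (t eps j))*dW eps j w))^+2).
move=> cG GC; have C0 : 0 <= C by exact: le_trans (GC 0 0).
have LK : 0 < L*(1+K) by rewrite mulr_gt0// ltr_pwDl.
have D0 : 0 <= Dc C by rewrite /Dc mulr_ge0// ltW.
have T2 : 0 < 8*T^+2 by rewrite mulr_gt0// exprn_gt0.
pose Z eps k w := \sum_(j < k) (G (t eps j) (X eps (t eps j) w)*dM eps j w
    - G (t eps j) (x (t eps j))*sg (t eps j) (x (t eps j))*dW eps j w).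
have mG eps j : 0 < eps < 1 -> 0 <= t eps j <= T -> adapted F (t eps j) (fun w=> G (t eps j) (X eps (t eps j) w)).
 by move=> e01 hj; exact: (adapted_path (aX e01) cG hj).
have mZ eps k : 0 < eps < 1 -> (k <= n eps)%N -> mrv (Z eps k).
 move=> e01 kn; apply: measurable_sum=> -[j /= jk].
 have jn : (j < n eps)%N by exact: leq_trans kn.
 have hj := ti (ltnW jn).
 apply: measurable_funB; apply: measurable_funM=> //; [|exact: mdM|exact: mdW].
 by apply: (adapted_measurable hF hj); exact: mG.
apply: (oP_L1 (C := 8*T^+2*(4*Dc C^+2)) tube_whp).
- by rewrite mulr_ge0 ?(ltW T2)// mulr_ge0// sqr_ge0.
- by move=> eps w; apply: sumr_ge0=> k _; rewrite mulr_ge0 ?sqr_ge0// ltW.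
- apply: small_mono small01 _=> eps e0 e01; apply: measurable_sum=> -[k /= kn].
 by apply: measurable_funM=> //; apply: measurable_funX; apply: mZ=> //; exact: ltnW.
move=> lam eta l0 eta0.
pose e1 := Num.min 1 (eta/(8*T^+2)).
have e10 : 0 < e1 by rewrite lt_min ltr01 divr_gt0.
have e1T : 8*T^+2*e1 <= eta by rewrite mulrC -ler_pdivlMr// ge_min lexx orbT.
have e11 : e1 <= 1 by rewrite ge_min lexx.
have e1e : e1^+2 <= e1 by rewrite expr2 ler_piMl// ltW.
have [r r0 hr] := product_close cG GC e10.
apply: small_mono (small_and (small_and (tube1 l0) (small_le_mul lam r0)) (small_le_mul T r0)) _.
move=> eps e0 [[[e01 hK] lr] Tr] A mA tA; have hA := hK A tA; have /andP[_ el1] := e01.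
have hr' : h eps <= r.
 apply: le_trans (h_le e0) _; apply: le_trans Tr; rewrite ler_pM2l// expr2 ler_piMl// ?ltW//.
have pA0 : 0 <= fine (P (~` A)) by exact: fine_ge0.
(* [b] bounds the second moment of the integrand: small on [A], and crudely bounded times P(~A)
   elsewhere. *)
set pA := fine (P (~` A)) in pA0 *; set b := e1^+2+4*Dc C^+2 * pA.
have b0 : 0 <= b by rewrite /b addr_ge0 ?sqr_ge0// mulr_ge0// mulr_ge0// sqr_ge0.
apply: (@L1b_mono _ _ _ _ _ _ (\sum_(k < n eps) h eps*(8*T*b))).
 rewrite sumr_const card_ord -[_ *+ n eps]mulr_natr (_ : _*_ = 8*((n eps)%:R*h eps)*(T*b)); last by ring.
 rewrite hE /b.
 have : 8*T^+2*e1^+2 <= eta by apply: le_trans e1T; rewrite ler_pM2l.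
 by lra.
apply: (L1b_sum_lt (Z := fun k w=> h eps*Z eps k w^+2) (B := fun=> _))=> //.
- move=> k kn; apply: measurable_funM=> //; apply: measurable_funX; apply: mZ=> //; exact: ltnW.
- by move=> k w; rewrite mulr_ge0 ?sqr_ge0// ltW.
move=> k kn; apply: L1bZ=> //; [|by rewrite ltW|by move=> w; exact: sqr_ge0|].
 by apply: measurable_funX; apply: mZ=> //; exact: ltnW.
have kT : 8*t eps k*b <= 8*T*b.
 by rewrite ler_wpM2r// ler_pM2l//; case/andP: (ti (ltnW kn)).
apply: L1b_mono kT _.
have jT j : (j < k)%N -> 0 <= t eps j <= T.
 by move=> jk; apply: ti; exact: ltnW (leq_trans jk (ltnW kn)).
apply: (@mart_tube_bound _ _ _ P F T W T0 hF hW normal_sym S0 sg x0 eps cS0 csg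
 (X eps) (cX e01) (aX e01) (H0 eps) (H0E e01) (hM e01) K A mA hA (n eps) k
 (fun j w=> G (t eps j) (X eps (t eps j) w)) (fun j=> G (t eps j) (x (t eps j))*sg (t eps j) (x (t eps j)))
 C b isT (ltnW kn) b0)=> //.
 by move=> j jk; apply: mG=> //; exact: jT.
move=> j s jk /andP[s1 s2].
have hj := jT _ jk; have hj' : 0 <= t eps j.+1 <= T by apply: ti; exact: leq_trans jk (ltnW kn).
have hs : 0 <= s <= T.
 by case/andP: hj=> a0 _; case/andP: hj'=> _ aT; rewrite (le_trans a0 s1) (le_trans s2 aT).
have mc := adapted_measurable hF hj (mG _ _ e01 hj).
have mt := adapted_measurable hF hs (trunc_adapted csg (aX e01) K hs).
have mnA : measurable (~` A) by exact: measurableC.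
(* On [A] truncation does nothing and [product_close] applies; off [A] each of the two terms is at
   most [Dc C] thanks to the truncation. *)
apply: (@L1b_le _ _ _ _ _ _ (fun w=> e1^+2+4*Dc C^+2*\1_(~` A) w))=> //.
- by mfun.
- by mfun.
- by move=> w _; exact: sqr_ge0.
- move=> w _; have bd : `|G (t eps j) (X eps (t eps j) w)*sg s (trunc K (X eps s w))
    - G (t eps j) (x (t eps j))*sg (t eps j) (x (t eps j))| <= 2*Dc C.
  apply: le_trans (ler_normB _ _) _; rewrite !normrM mulr_natl mulr2n; apply: lerD.
   by apply: ler_pM=> //; exact: trunc_sg.
  apply: ler_pM=> //; apply: le_trans (growsg _ _) _; rewrite ler_pM2l// lerD2l.
  by have := xK hj; lra.
 rewrite indicE; case: (boolP (w \in ~` A))=> [_|].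
  rewrite mulr1 -[leLHS]real_normK ?num_real//.
  apply: (@le_trans _ _ ((2*Dc C)^+2)); first by rewrite lerXn2r// nnegrE mulr_ge0.
  by have := sqr_ge0 e1; lra.
 rewrite notin_setE /= => /contrapT Aw; rewrite mulr0 addr0.
 rewrite -[leLHS]real_normK ?num_real// lerXn2r ?nnegrE ?(ltW e10)//.
 rewrite trunc_id; last exact: hA.
 apply: hr=> //.
 + rewrite distrC ger0_norm ?subr_ge0//; apply: le_trans hr'; rewrite /h -(gridS T (n eps) j).
  by move: s2; rewrite /t; lra.
 + exact: le_trans (tA _ _ Aw hj) lr.
 + exact: le_trans (tA _ _ Aw hs) lr.
- have p0 : 0 <= 4*Dc C^+2 by rewrite mulr_ge0// sqr_ge0.
 apply: L1bD=> //.
 + by mfun.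
 + by move=> w; exact: sqr_ge0.
 + by move=> w; rewrite mulr_ge0// indicE.
 + by apply: L1b_cst=> //; exact: sqr_ge0.
 + exact: L1b_indic.
Qed.

Lemma noise_bound (f : R -> R) (C : R) eps k : (forall s, 0 <= s <= T -> `|f s| <= C) -> (k <= n eps)%N ->
 L1b P setT (fun w=> (\sum_(j < k) f (t eps j)*dW eps j w)^+2) (8*T*C^+2).
move=> fC kn; have tS i : t eps i < t eps i.+1 by exact: grid_ltS.
have := @isometry _ _ _ P F T W hF hW normal_sym k (t eps) _ (fun i _=> tS i) _
 (fun j _=> f (t eps j)) (fun=> C^+2).
have -> : \sum_(i < k) 8*(t eps i.+1-t eps i)*C^+2 = 8*t eps k*C^+2.
 rewrite -mulr_suml -mulr_sumr -(big_mkord predT (fun i=> t eps i.+1-t eps i)) telescope_sumr//.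
 by rewrite /t grid0 subr0.
move=> H; apply: L1b_mono (H _ _ _ _).
- by rewrite ler_wpM2r ?sqr_ge0// ler_pM2l//; case/andP: (ti kn).
- by rewrite /t grid0.
- by case/andP: (ti kn).
- by move=> i _; exact: measurable_cst.
- move=> i ik; apply: (L1b_le _ _ _ _ _ (L1b_cst P measurableT (sqr_ge0 C)))=> //.
 + by move=> w _; exact: sqr_ge0.
 + move=> w _; rewrite -[leLHS]real_normK ?num_real// lerXn2r ?nnegrE//.
   by apply: le_trans (fC 0 _)=> //; rewrite lexx ltW.
  by apply: fC; apply: ti; exact: ltnW (leq_trans ik kn).
Qed.

Lemma noise_OP (f : R -> R) (C : R) (k : R -> nat) : (forall s, 0 <= s <= T -> `|f s| <= C) ->
 (forall eps, (k eps <= n eps)%N) ->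
 OP P (fun eps w=> (\sum_(j < k eps) f (t eps j)*dW eps j w)^+2).
move=> fC kn; apply: (OP_L1 tube_whp).
- by move=> eps w; exact: sqr_ge0.
- apply: small_mono small01 _=> eps _ _; apply: measurable_funX; apply: measurable_sum=> -[j /= jk].
 by apply: measurable_funM=> //; apply: mdW; exact: leq_trans (kn _).
- move=> lam l0; exists (8*T*C^+2+1).
  by rewrite ltr_wpDl// mulr_ge0 ?sqr_ge0// mulr_ge0// ltW.
 apply: small_mono small01 _=> eps e0 e01 A mA _.
 apply: (L1b_mono (B := 8*T*C^+2)); first by rewrite lerDl.
 apply: (@L1b_subset _ _ _ _ _ setT)=> //; [|by move=> w; exact: sqr_ge0|exact: noise_bound].
 apply: measurable_funX; apply: measurable_sum=> -[j /= jk].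
 by apply: measurable_funM=> //; apply: mdW; exact: leq_trans (kn _).
Qed.

Lemma noise_sum_OP (f : R -> R) (C : R) : (forall s, 0 <= s <= T -> `|f s| <= C) ->
 OP P (fun eps w=> \sum_(k < n eps) h eps*(\sum_(j < k) f (t eps j)*dW eps j w)^+2).
move=> fC.
have mS eps k : (k < n eps)%N -> mrv (fun w=> (\sum_(j < k) f (t eps j)*dW eps j w)^+2).
 move=> kn; apply: measurable_funX; apply: measurable_sum=> -[j /= jk].
 by apply: measurable_funM=> //; apply: mdW; exact: ltn_trans kn.
apply: (OP_L1 tube_whp).
- by move=> eps w; apply: sumr_ge0=> k _; rewrite mulr_ge0 ?sqr_ge0// ltW.
- apply: small_mono small01 _=> eps _ _; apply: measurable_sum=> -[k /= kn].
 by apply: measurable_funM=> //; exact: mS.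
- move=> lam l0; exists (T*(8*T*C^+2)+1).
  have := mulr_ge0 (sqr_ge0 T) (sqr_ge0 C); lra.
 apply: small_mono small01 _=> eps e0 e01 A mA _.
 apply: (@L1b_mono _ _ _ _ _ _ (\sum_(k < n eps) h eps*(8*T*C^+2))).
  rewrite sumr_const card_ord -[_ *+ n eps]mulr_natr.
  rewrite (_ : _*_ = ((n eps)%:R*h eps)*(8*T*C^+2)); last by ring.
  by rewrite hE lerDl.
 apply: (L1b_sum_lt (Z := fun k w=> h eps*(\sum_(j < k) f (t eps j)*dW eps j w)^+2) (B := fun=> _))=> //.
 + by move=> k kn; apply: measurable_funM=> //; exact: mS.
 + by move=> k w; rewrite mulr_ge0 ?sqr_ge0// ltW.
 + move=> k kn; apply: L1bZ=> //; [exact: mS|by rewrite ltW|by move=> w; exact: sqr_ge0|].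
  apply: (@L1b_subset _ _ _ _ _ setT)=> //; [exact: mS|by move=> w; exact: sqr_ge0|].
  by apply: noise_bound=> //; exact: ltnW.
Qed.

(** * The statistic is asymptotically a quadratic form in Wiener increments *)

Section Statistic_limit.
Variables (th0 rho C : R) (G D Sd V V' : R -> R -> R -> R) (Gd : R -> R -> R) (fi : R -> R).
Hypotheses (rho0 : 0 < rho) (C1 : 1 <= C) (KC : K <= C) (fi0 : 0 < fi th0).
Let near th := `|th-th0| <= rho.
Hypothesis cG : forall th, near th -> cont2 (G th).
Hypothesis cD : forall th, near th -> cont2 (D th).
Hypothesis cSd : forall th, near th -> cont2 (Sd th).
Hypothesis cV : forall th, near th -> cont2 (V th).
Hypothesis cV' : forall th, near th -> cont2 (V' th).
Hypothesis cGd : cont2 Gd.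
Hypothesis GC : forall th s y, near th -> `|G th s y| <= C.
Hypothesis GdC : forall s y, `|Gd s y| <= C.
Hypothesis SdC : forall th s y, near th -> `|Sd th s y| <= C.
Hypothesis S0C : forall s y, 0 <= s <= T -> `|y| <= K -> `|S0 s y| <= C.
Hypothesis hDS : forall th s y, near th -> 0 <= s <= T ->
 `|D th s y-(S0 s y+(th-th0)*Sd th s y)| <= C*(`|y-x s| + `|th-th0|)^+2.
Hypothesis hGmod : forall eta, 0 < eta -> small (fun eps=> forall th s s' c c', near th ->
 0 <= s <= T -> 0 <= s' <= T -> `|c| <= C -> `|c'| <= C ->
 `|G th s c-G th s' c'| <= C * `|s-s'| + eta*(eps+`|c-c'| / eps)).
Hypothesis hV : forall eta, 0 < eta -> small (fun eps=> forall th t c c', near th ->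
 0 <= t <= T -> `|c| <= C -> `|c'| <= C ->
 `|V th t c'-V th t c-G th t c*(c'-c)| <= eta*(eps * `|c'-c| + (c'-c)^+2/eps)).
Hypothesis hVlip : forall th t c c', near th -> 0 <= t <= T -> `|c| <= C -> `|c'| <= C ->
 `|V th t c'-V th t c| <= C * `|c'-c|.
Hypothesis hV' : forall th s c c', near th -> 0 <= s <= T -> `|c| <= C -> `|c'| <= C ->
 `|V' th s c'-V' th s c| <= C * `|c'-c|.
Hypothesis hVt : forall th t t' c, near th -> 0 <= t -> t <= t' -> t' <= T -> `|c| <= C ->
 V th t' c-V th t c = Int t t' (fun s=> V' th s c).
Hypothesis V0 : forall th t, V th t x0 = 0.
(** The estimator depends on the whole path, so a sum with G(theta_hat) is not a stochastic integral
    of an adapted process. Linearising at [th0] leaves adapted sums multiplied by the random factor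
    theta_hat - th0. [Gd] is the theta-derivative of G at [th0]. *)
Hypothesis Gtaylor : forall eta, 0 < eta -> exists2 r, 0 < r & forall th s y,
 `|th-th0| <= r -> 0 <= s <= T -> `|y| <= K ->
 `|G th s y-G th0 s y-(th-th0)*Gd s y| <= eta * `|th-th0|.
Let f s : R := G th0 s (x s)*sg s (x s).
Hypothesis GSd_near : forall eta, 0 < eta -> exists2 r, 0 < r & forall th s s' y,
 `|th-th0| <= r -> 0 <= s <= T -> 0 <= s' <= T -> `|s-s'| <= r -> `|y-x s| <= r ->
 `|G th s y*Sd th s y-f s'^+2| <= eta.
Hypothesis fi_near : forall eta, 0 < eta -> exists2 r, 0 < r & forall th,
 `|th-th0| <= r -> `|fi th-fi th0| <= eta.
Hypothesis fi_f : fi th0 = Int 0 T (fun s=> f s^+2).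

Variable th : R -> Omega -> R.
Let u eps w : R := (th eps w-th0)/eps.

Definition score eps k w : R := \sum_(j < k) f (t eps j)*dW eps j w.
Definition partial_info eps k : R := \sum_(j < k) f (t eps j)^+2*h eps.

Hypothesis u_OP : OP P u.
Hypothesis u_score : oP P (fun eps w=> u eps w-score eps (n eps) w/partial_info eps (n eps)).

Let a eps w s : R := path_stat (fun s=> X eps s w) (fun s=> D (th eps w) s (X eps s w))
 (G (th eps w)) (V (th eps w)) (V' (th eps w)) s/eps.
(** The score minus its final value weighted by the share of information: up to normalisation, a
    Brownian bridge in the information clock. *)
Let b eps w k : R := score eps k w-partial_info eps k*(score eps (n eps) w/partial_info eps (n eps)).
(** As [a] is sqrt(I) K, the weight left over from K^2 h^2 is Sdot^2/(sigma^2 I^2) = G Sdot/I^2. *)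
Let q eps w s : R := G (th eps w) s (X eps s w)*Sd (th eps w) s (X eps s w)/fi (th eps w)^+2.
Let q0 eps k : R := f (t eps k)^+2/partial_info eps (n eps)^+2.

Definition weighted_stat eps w : R := Int 0 T (fun s=> a eps w s^+2*q eps w s).
Definition quadratic_form eps w : R := \sum_(k < n eps) b eps w k^+2*q0 eps k*h eps.

Let C0 : 0 <= C. exact: le_trans ler01 C1. Qed.
Let near0 : near th0. by rewrite /near subrr normr0 ltW. Qed.

Let fC s : 0 <= s <= T -> `|f s| <= C*(L*(1+K)).
move=> hs; rewrite normrM; apply: ler_pM=> //; first exact: GC.
by apply: le_trans (growsg _ _) _; rewrite ler_pM2l// lerD2l; have := xK hs; lra.
Qed.

(** The random radius of the tube in units of eps. It enters the quadratic remainder of D and has to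
    be stochastically bounded as one variable. *)
Definition deviation eps w : R := sup [set `|X eps s w-x s| / eps | s in `[0, T]].

Let dev_tube lam eps w : 0 < eps -> (forall s, 0 <= s <= T -> `|X eps s w-x s| <= lam*eps) ->
 0 <= deviation eps w <= lam /\ forall s, 0 <= s <= T -> `|X eps s w-x s| <= deviation eps w*eps.
move=> e0 hl; rewrite /deviation; set Y := (X in sup X).
have ub : ubound Y lam by move=> _ [s /= hs <-]; rewrite ler_pdivrMr// hl// -in_itv.
have Y0 : Y (`|X eps 0 w-x 0| / eps) by exists 0=> //=; rewrite in_itv /= lexx ltW.
have hsup s : 0 <= s <= T -> `|X eps s w-x s| / eps <= sup Y.
 by move=> hs; apply: ub_le_sup; [exists lam|exists s=> //=; rewrite in_itv].
split; last by move=> s /hsup; rewrite ler_pdivrMr.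
apply/andP; split; last by apply: ge_sup=> //; exists (`|X eps 0 w-x 0| / eps).
by apply: le_trans (hsup 0 _); [rewrite divr_ge0// ltW|rewrite lexx ltW].
Qed.

Let tube_whp' e : 0 < e -> exists2 lam, 0 < lam & small (fun eps=>
 up_to P e (fun w=> forall s, 0 <= s <= T -> `|X eps s w-x s| <= lam*eps)).
move=> e0; have [lam l0 hl] := @tube_whp e e0.
exists lam=> //; apply: small_mono hl _=> eps e1 [A [mA PA tA]].
by apply: (up_to_setC mA PA)=> w Aw s hs; exact: tA.
Qed.

Lemma deviation_OP : OP P deviation.
move=> e /tube_whp'[lam l0 hl]; exists lam=> //; apply: small_mono hl _=> eps e1.
by apply: up_to_mono=> // w /(dev_tube e1)[/andP[d0 d1] _]; rewrite ger0_norm.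
Qed.

Lemma deviation_whp : whp P (fun eps w=> 0 <= deviation eps w /\
 forall s, 0 <= s <= T -> `|X eps s w-x s| <= deviation eps w*eps).
move=> e /tube_whp'[lam l0 hl]; apply: small_mono hl _=> eps e1.
by apply: up_to_mono=> // w /(dev_tube e1)[/andP[d0 d1] ?].
Qed.

Lemma start_whp : whp P (fun eps w=> `|X eps 0 w-x0| <= eps^+2).
move=> e e0; apply: small_mono (small_and small01 (small_lt e0)) _=> eps e1 [e01 el].
have e2 : 0 < Num.min e (eps^+2) by pos.
have := @start_close _ _ _ P F T W T0 hF hW S0 sg x0 eps e1 csg (X eps) (cX e01) (aX e01) (H0 eps)
 (H0E e01) (hM e01) _ e2.
apply: up_to_mono; first by rewrite ge_min lexx.
by move=> w; rewrite le_min=> /andP[].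
Qed.

Let ws_oP (g : R -> R -> R) := @weighted_sum_oP g C.

Let BB eps w := \sum_(k < n eps) h eps*(\sum_(j < k) Gd (t eps j) (X eps (t eps j) w)*dM eps j w)^+2.
Let VX eps w := eps^-2*\sum_(j < n eps) dX eps j w^+2.
Let VM eps w := \sum_(j < n eps) dM eps j w^+2.
Let UX eps w := eps^-4*\sum_(j < n eps)
 Int (t eps j) (t eps j.+1) (fun s=> (X eps s w-X eps (t eps j) w)^+2 +
   (X eps (t eps j.+1) w-X eps s w)^+2).

Let VX_OP : OP P VX.
exact: (@X_variation_OP).
Qed.

Let VM_OP : OP P VM.
exact: (@mart_variation_OP).
Qed.

Let UX_OP : OP P UX.
exact: (@X_oscillation_OP).
Qed.

Let score_sum_OP : OP P (fun eps w=> \sum_(k < n eps) h eps*score eps k w^+2).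
exact: (@noise_sum_OP f _ fC).
Qed.

(** By [weighted_sum_oP] the sums with [Gd] along X are close to Wiener sums with deterministic
    coefficients, whose second moments are bounded. *)
Let BB_OP : OP P BB.
pose fd s := Gd s (x s)*sg s (x s).
have fdC s : 0 <= s <= T -> `|fd s| <= C*(L*(1+K)).
 move=> hs; rewrite normrM; apply: ler_pM=> //.
 by apply: le_trans (growsg _ _) _; rewrite ler_pM2l// lerD2l; have := xK hs; lra.
have h1 := oP_OP (ws_oP cGd GdC).
have h2 := @noise_sum_OP fd _ fdC.
apply: (OP_le (OPD (OPZ 2 h1) (OPZ 2 h2))); apply: (whp_mono (whp_small P small01)).
apply: small_mono small01 _=> eps e0 e01 w _.
have p k (g : nat -> R) : 0 <= \sum_(k < k) h eps*g k^+2.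
 by apply: sumr_ge0=> j _; rewrite mulr_ge0 ?sqr_ge0// ltW.
rewrite [leLHS]ger0_norm; last exact: (p _ (fun k=> \sum_(j < k) Gd (t eps j) (X eps (t eps j) w)*dM eps j w)).
rewrite ger0_norm; last first.
 apply: addr_ge0; apply: mulr_ge0=> //; first exact: (p _ (fun k=> \sum_(j < k) (Gd (t eps j) (X eps (t eps j) w)*dM eps j w-fd (t eps j)*dW eps j w))).
 exact: (p _ (fun k=> \sum_(j < k) fd (t eps j)*dW eps j w)).
rewrite !mulr_sumr -big_split /=; apply: ler_sum=> -[k /= kn] _.
rewrite sumrB; set A := \sum_(j < k) Gd _ _*_; set B' := \sum_(j < k) _*dW _ _ _.
rewrite (_ : _ + _ = h eps*(2*(A-B')^+2+2*B'^+2)); last by rewrite /h /n; ring.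
apply: ler_wpM2l; first exact: ltW.
by have := sqr_ge0 (A-B'-B'); lra.
Qed.

Let ratio eps w : R := score eps (n eps) w/partial_info eps (n eps).
Let ratio_OP : OP P ratio.
have := OPD u_OP (OPZ (-1) (oP_OP u_score)).
rewrite (_ : (fun eps w=> _) = ratio)//.
by apply/funext=> eps; apply/funext=> w; rewrite /ratio; ring.
Qed.

Let CF : R := (C*(L*(1+K)))^+2*T.
Let CF0 : 0 <= CF. by rewrite /CF mulr_ge0 ?sqr_ge0// ltW. Qed.
Let info_bound eps k : (k <= n eps)%N -> 0 <= partial_info eps k <= CF.
move=> kn; have p j : 0 <= f (t eps j)^+2*h eps by pos.
apply/andP; split; first by apply: sumr_ge0.
apply: (@le_trans _ _ (\sum_(j < k) (C*(L*(1+K)))^+2*h eps)).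
 apply: ler_sum=> -[j /= jk] _; rewrite ler_pM2r//.
 rewrite -[leLHS]real_normK ?num_real// lerXn2r ?nnegrE//.
  by pos.
 by apply: fC; apply: ti; exact: ltnW (leq_trans jk kn).
rewrite sumr_const card_ord -mulrnAr /CF; apply: ler_wpM2l; first exact: sqr_ge0.
by rewrite -[_ *+ k]mulr_natl -(hE eps) ler_pM2r// ler_nat.
Qed.

Let form_OP : OP P (fun eps w=> \sum_(k < n eps) h eps*b eps w k^+2).
have h1 := OPD (OPZ 2 score_sum_OP) (OPZ (2*T*CF^+2) (OPX 2 ratio_OP)).
apply: (OP_le h1); apply: (whp_mono (whp_small P small01)); apply: small_mono small01 _=> eps e0 e01 w _.
rewrite [leLHS]ger0_norm; last by apply: sumr_ge0=> k _; rewrite mulr_ge0 ?sqr_ge0// ltW.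
rewrite ger0_norm; last first.
 apply: addr_ge0; last by apply: mulr_ge0; [apply: mulr_ge0; [rewrite mulr_ge0// ltW|exact: sqr_ge0]|exact: sqr_ge0].
 by apply: mulr_ge0=> //; apply: sumr_ge0=> k _; rewrite mulr_ge0 ?sqr_ge0// ltW.
rewrite (_ : 2*T*_*_ = \sum_(k < n eps) h eps*(2*CF^+2*ratio eps w^+2)); last first.
 by rewrite sumr_const card_ord -[_ *+ n eps]mulr_natl -[in LHS](hE eps); ring.
rewrite mulr_sumr -big_split /=; apply: ler_sum=> -[k /= kn] _.
rewrite (_ : _ + _ = h eps*(2*score eps k w^+2+2*(CF^+2*ratio eps w^+2))); last by ring.
apply: ler_wpM2l; first exact: ltW.
rewrite /b -/(ratio eps w); have /andP[i0 i1] := info_bound (ltnW kn).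
have : partial_info eps k^+2*ratio eps w^+2 <= CF^+2*ratio eps w^+2.
 by rewrite ler_wpM2r ?sqr_ge0// lerXn2r ?nnegrE.
rewrite -exprMn; have := sqr_ge0 (score eps k w+partial_info eps k*ratio eps w); lra.
Qed.

Let cf : continuous f.
have cidx : continuous (fun s=> (s, x s)) by apply: cont_pair=> // s; exact: cvg_id.
by apply: contM; [exact: (cont_comp cidx (cG near0))|exact: (cont_comp cidx csg)].
Qed.

Lemma ncell_small r : 0 < r -> small (fun eps=> h eps <= r).
move=> r0; apply: small_mono (small_and small01 (small_le_mul T r0)) _=> eps e0 [/andP[_ e1] hr].
apply: le_trans (mesh_le T0 e0) _; apply: le_trans hr; rewrite ler_pM2l// expr2 ler_piMl// ltW//.
Qed.

Lemma info_near eta : 0 < eta -> small (fun eps=> `|partial_info eps (n eps)-fi th0| <= eta).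
move=> e0; have cf2 : continuous (fun s=> f s^+2) by exact: contX.
have e1 : 0 < eta/T by rewrite divr_gt0.
have [r r0 hr] := heine_itv T cf2 e1.
apply: small_mono (ncell_small r0) _=> eps ep hh.
have := @riemann_error _ T T0 _ (n eps) (n eps) (eta/T) cf2 isT (leqnn _).
rewrite gridT// divfK ?gt_eqF// fi_f distrC; apply=> j s jn hs.
have hj := ti (ltnW jn); have hj' := ti jn; case/andP: hs=> s1 s2.
apply: hr=> //.
 by case/andP: hj=> a0 _; case/andP: hj'=> _ b0; rewrite (le_trans a0 s1) (le_trans s2 b0).
rewrite ger0_norm ?subr_ge0//; apply: le_trans hh; rewrite /h -(gridS T (n eps) j); exact: lerB.
Qed.

Let Cd eps w : R := C*(deviation eps w+`|u eps w|)^+2.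
(** Collects all stochastically bounded factors that multiply eta in [pathwise]. *)
Let ZA eps w : R := C+(3/2*VX eps w+1+C*(3/2*T+UX eps w/2))
 + (C*(UX eps w+T)/2+C^+2*T^+2+C*Cd eps w*T+C*(3*C+`|u eps w|*C+Cd eps w)*T)
 + `|u eps w|*(VM eps w+2)/2+`|u eps w|*T+CF.

Let ZA_OP : OP P ZA.
rewrite /ZA /Cd; move: deviation_OP VX_OP UX_OP VM_OP u_OP; move: deviation VX UX VM u CF=> d1 v1 u1 m1 u2 c *.
by op.
Qed.

Definition good eta r eps w : Prop :=
 [/\ `|th eps w-th0| <= r,
   0 <= deviation eps w /\ (forall s, 0 <= s <= T -> `|X eps s w-x s| <= deviation eps w*eps),
   deviation eps w*eps <= r /\ deviation eps w*eps <= 1,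
   `|X eps 0 w-x0| <= eps^+2 & `|u eps w-ratio eps w| <= eta].

Let uE eps w : 0 < eps -> eps*u eps w = th eps w-th0.
by move=> e0; rewrite /u mulrC divfK// gt_eqF. Qed.

Lemma good_whp eta r : 0 < eta -> 0 < r -> whp P (good eta r).
move=> e0 r0.
have h1 := OP_whp_small u_OP r0.
have h2 := deviation_whp.
have m0 : 0 < Num.min r 1 by pos.
have h3 := OP_whp_small deviation_OP m0.
have h4 := start_whp.
have h5 := u_score e0.
apply: (whp_mono (whp_and (whp_and (whp_and h1 h2) (whp_and h3 h4)) h5)).
apply: small_mono small01 _=> eps ep _ w [[[q1 [q2 q2']] [q3 q4]] q5]; split=> //.
- by rewrite -uE.
- move: q3; rewrite normrM (gtr0_norm ep) (ger0_norm q2) mulrC le_min=> /andP[-> ->] //.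
Qed.

Let cell eps j s : (j < n eps)%N -> t eps j <= s <= t eps j.+1 -> 0 <= s <= T.
move=> jn /andP[s1 s2]; have /andP[a0 _] := ti (ltnW jn); have /andP[_ b0] := ti jn.
by rewrite (le_trans a0 s1) (le_trans s2 b0).
Qed.

Let cpath (g : R -> R -> R) eps w : 0 < eps < 1 -> cont2 g ->
 continuous (fun s=> g s (X eps s w)).
by move=> e01 cg; exact: (cont_path (cX e01)). Qed.

Let ca eps w : 0 < eps < 1 -> near (th eps w) -> continuous (a eps w).
move=> e01 nr; rewrite /a; apply: contM; last exact: cst_continuous.
rewrite /path_stat; apply: contB; first apply: contB.
- exact: cpath (cV nr).
- exact/Int_continuous/(cpath _ (cV' nr)).
- by apply: Int_continuous; apply: contM; [exact: cpath (cG nr)|exact: cpath (cD nr)].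
Qed.

(** On the event [good] the comparison of [a] with [b] involves no further probability: it combines
    the path expansion, the linearisation in theta, the Riemann approximation of the information,
    and the closeness of u to the score ratio. *)
Let pathwise eta : 0 < eta -> eta <= 1 -> exists2 r, 0 < r & small (fun eps=> forall w, good eta r eps w ->
 \sum_(k < n eps) h eps*(\sum_(j < k) (G th0 (t eps j) (X eps (t eps j) w)*dM eps j w
   - f (t eps j)*dW eps j w))^+2 <= eta ->
 \sum_(k < n eps) Int (t eps k) (t eps k.+1) (fun s=> (a eps w s-b eps w k)^+2) <=
 eta*(4*(T*ZA eps w^+2+C^+2*UX eps w+1+u eps w^+2*BB eps w))).
move=> eta0 eta1.
have [r1 r10 hr1] := Gtaylor eta0; have [r2 r20 hr2] := GSd_near eta0.
pose r := Num.min rho (Num.min r1 (Num.min r2 1)).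
have r0 : 0 < r by rewrite !lt_min rho0 r10 r20 ltr01.
have rrho : r <= rho by rewrite ge_min lexx.
have rr1 : r <= r1 by rewrite /r !ge_min lexx !orbT.
have rr2 : r <= r2 by rewrite /r !ge_min lexx !orbT.
exists r=> //.
apply: small_mono (small_and (small_and (small_and small01 (ncell_small r20)) (small_and (hGmod eta0) (hV eta0))) (small_lt eta0)) _.
move=> eps ep [[[e01 hh] [gmod gV]] epseta] w [g1 [g2 g2'] [g3 g3'] g4 g5] hA.
have /andP[_ eps1] := e01.
set v := u eps w in g5 *; have vE : eps*v = th eps w-th0 by exact: uE.
have nr : near (th eps w) by exact: le_trans rrho.
have XK s : 0 <= s <= T -> `|X eps s w| <= K.
 move=> hs; have := g2' s hs; have := xK hs; have := ler_normD (X eps s w-x s) (x s); rewrite subrK; lra.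
have XC s : 0 <= s <= T -> `|X eps s w| <= C by move=> hs; apply: le_trans (XK s hs) KC.
have Cd0 : 0 <= Cd eps w by rewrite /Cd mulr_ge0 ?sqr_ge0.
have VX0 : 0 <= VX eps w by rewrite /VX mulr_ge0 ?invr_ge0 ?sqr_ge0//; apply: sumr_ge0=> j _; exact: sqr_ge0.
have VM0 : 0 <= VM eps w by apply: sumr_ge0=> j _; exact: sqr_ge0.
have UX0 : 0 <= UX eps w.
 rewrite /UX mulr_ge0 ?invr_ge0 ?exprn_even_ge0//; apply: sumr_ge0=> j _; apply: Int_ge0=> s _.
 by rewrite addr_ge0 ?sqr_ge0.
have XE s s' : 0 <= s -> s <= s' -> s' <= T -> X eps s' w-X eps s w =
  Int s s' (fun s=> S0 s (X eps s w))+eps*(M eps s' w-M eps s w).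
 move=> s0 ss s'T; have cSX := cpath (w := w) e01 cS0; rewrite /M /mart -mulrBr mulVKf ?gt_eqF//.
 by rewrite (Int_split cSX s0 ss); ring.
have hDD s : 0 <= s <= T -> `|D (th eps w) s (X eps s w)-(S0 s (X eps s w)+v*eps*Sd (th eps w) s (X eps s w))|
  <= Cd eps w*eps^+2.
 move=> hs; rewrite [v*eps]mulrC vE; apply: le_trans (hDS _ nr hs) _.
 rewrite /Cd -mulrA -exprMn; apply: ler_wpM2l=> //; rewrite lerXn2r ?nnegrE ?addr_ge0// ?mulr_ge0 ?addr_ge0// ?(ltW ep)//.
 rewrite mulrDl; apply: lerD; first exact: g2'.
 by rewrite -vE normrM (gtr0_norm ep) mulrC.
have exp := @path_stat_expansion R T (n eps) eps eta v C (Cd eps w) T0 isT ep (ltW eta0) C0 Cd0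
 (mesh_le T0 ep) (ncell_le ep (ltW eps1)) (fun s=> X eps s w) (fun s=> M eps s w) (fun s=> S0 s (X eps s w))
 (fun s=> Sd (th eps w) s (X eps s w)) (fun s=> D (th eps w) s (X eps s w)) (G (th eps w)) (V (th eps w)) (V' (th eps w))
 (cX e01 (w := w)) (cpath (w := w) e01 cS0) (cpath (w := w) e01 (cSd nr)) (cpath (w := w) e01 (cD nr)) (cG nr) (cV' nr)
 XE XC (fun s hs=> S0C hs (XK s hs)) (fun s hs=> SdC _ _ nr) hDD
 (fun s c hs hc=> GC _ _ nr) (fun s s' c c'=> @gmod _ s s' c c' nr) (fun t c c'=> @gV _ t c c' nr)
 (fun t c c'=> @hVlip _ t c c' nr) (fun t c c'=> @hV' _ t c c' nr) (fun t t' c=> @hVt _ t t' c nr).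
(* [rk] comes from replacing the integrand along X by the one along the limit path, [rk'] is the
   first-order term in theta. Both depend on the cell and are kept in mean square. *)
pose rk k := \sum_(j < k) (G th0 (t eps j) (X eps (t eps j) w)*dM eps j w-f (t eps j)*dW eps j w).
pose rk' k := v*eps*\sum_(j < k) Gd (t eps j) (X eps (t eps j) w)*dM eps j w.
pose Z1 := 3/2*VX eps w+1+C*(3/2*T+UX eps w/2).
pose Z2 := C*(UX eps w+T)/2+C^+2*T^+2+C*Cd eps w*T+C*(3*C+`|v|*C+Cd eps w)*T.
have v0 : 0 <= `|v| by [].
have ZAE : ZA eps w = C+Z1+Z2+`|v|*(VM eps w+2)/2+`|v|*T+CF by [].
have T0' := ltW T0.
have Z10 : 0 <= Z1.
 apply: addr_ge0; first by apply: addr_ge0=> //; rewrite mulr_ge0// divr_ge0.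
 apply: mulr_ge0=> //; apply: addr_ge0; last by rewrite divr_ge0.
 by rewrite mulr_ge0// divr_ge0.
have Z20 : 0 <= Z2.
 rewrite /Z2; apply: addr_ge0; last by rewrite !mulr_ge0// !addr_ge0// ?mulr_ge0.
 apply: addr_ge0; last by apply: mulr_ge0=> //; exact: mulr_ge0.
 by apply: addr_ge0; [rewrite !mulr_ge0 ?addr_ge0|rewrite mulr_ge0 ?sqr_ge0].
have Z30 : 0 <= `|v|*(VM eps w+2)/2 by rewrite !mulr_ge0// addr_ge0.
have Z40 : 0 <= `|v|*T by rewrite mulr_ge0.
have ZA0 : 0 <= ZA eps w by rewrite ZAE; do ! apply: addr_ge0=> //.
have key k s : (k < n eps)%N -> t eps k <= s <= t eps k.+1 ->
  `|a eps w s-b eps w k| <= eta*ZA eps w+C/eps * `|X eps s w-X eps (t eps k) w| + `|rk k| + `|rk' k|.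
 move=> kn hs; have ex := exp k s kn hs.
 pose A := \sum_(j < k) G (th eps w) (t eps j) (X eps (t eps j) w)*dM eps j w.
 pose A0 := \sum_(j < k) G th0 (t eps j) (X eps (t eps j) w)*dM eps j w.
 pose Ad := \sum_(j < k) Gd (t eps j) (X eps (t eps j) w)*dM eps j w.
 pose I := Int 0 (t eps k) (fun s=> G (th eps w) s (X eps s w)*Sd (th eps w) s (X eps s w)).
 rewrite -/A -/I in ex.
 have tj j : (j < k)%N -> 0 <= t eps j <= T by move=> jk; apply: ti; exact: ltnW (leq_trans jk (ltnW kn)).
 (* The Taylor remainder eta eps |v| is multiplied by |dM| and summed; Young's inequality and n
    eps^2 <= 2 turn the sum of eps |dM| into [(VM + 2)/2]. *)
 have b1 : `|A-A0-v*eps*Ad| <= eta*(`|v|*(VM eps w+2)/2).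
  rewrite /A /A0 /Ad -sumrB mulr_sumr -sumrB; apply: le_trans (ler_norm_sum _ _ _) _.
  apply: (@le_trans _ _ (\sum_(j < n eps) eta * `|v|*((dM eps j w^+2+eps^+2)/2))); last first.
   rewrite -mulr_sumr -mulr_suml big_split /= sumr_const card_ord -[eps^+2 *+ _]mulr_natl.
   rewrite -[leLHS]mulrA; apply: ler_wpM2l; first exact: ltW.
   rewrite -[leRHS]mulrA; apply: ler_wpM2l=> //; rewrite ler_pM2r ?invr_gt0// lerD2l.
   exact: ncell_le (ltW eps1).
  rewrite -(big_mkord predT (fun j=> eta * `|v|*((dM eps j w^+2+eps^+2)/2))).
  rewrite (big_cat_nat (n := k))//=; last exact: ltnW.
  rewrite big_mkord -[leLHS]addr0; apply: lerD; last first.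
   apply: sumr_ge0=> j _; apply: mulr_ge0; first by rewrite mulr_ge0// ltW.
   by rewrite mulr_ge0// addr_ge0 ?sqr_ge0.
  apply: ler_sum=> -[j /= jk] _.
  rewrite (_ : _ - _ - _ = (G (th eps w) (t eps j) (X eps (t eps j) w)-G th0 (t eps j) (X eps (t eps j) w)
    - (th eps w-th0)*Gd (t eps j) (X eps (t eps j) w))*dM eps j w); last by rewrite -vE; ring.
  rewrite normrM.
  have q1 := hr1 _ _ _ (le_trans g1 rr1) (tj j jk) (XK _ (tj j jk)).
  rewrite -[in X in _ <= X]vE normrM (gtr0_norm ep) in q1.
  apply: le_trans (ler_wpM2r (normr_ge0 _) q1) _.
  rewrite (_ : eta*(eps * `|v|)*_ = eta * `|v|*(eps * `|dM eps j w|)); last by ring.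
  apply: ler_wpM2l; first by rewrite mulr_ge0// ltW.
  exact: young_product.
 have cGS : continuous (fun s=> G (th eps w) s (X eps s w)*Sd (th eps w) s (X eps s w)).
  by apply: contM; [exact: cpath (cG nr)|exact: cpath (cSd nr)].
 have b2 : `|I-partial_info eps k| <= eta*T.
  have tS j : t eps j <= t eps j.+1 by exact: grid_le.
  rewrite /I /partial_info -{1}(grid0 T (n eps)) -/(t eps 0) -(@Int_telescope _ _ (t eps) k cGS tS) -sumrB.
  apply: le_trans (ler_norm_sum _ _ _) _.
  apply: (@le_trans _ _ (\sum_(j < k) eta*h eps)).
   apply: ler_sum=> -[j /= jk] _; have jn := leq_trans jk (ltnW kn).
   have hj : t eps j.+1-t eps j = h eps by exact: gridS.
   rewrite -[in X in _ - X]hj -Int_cst// -IntB//; last exact: cst_continuous.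
   rewrite -[in leRHS]hj; apply: Int_bound=> //; first by apply: contB=> //; exact: cst_continuous.
   move=> r' hr'; have hr'' := cell jn hr'; apply: hr2=> //.
   - exact: le_trans rr2.
   - exact: ti (ltnW jn).
   - case/andP: hr'=> s1 s2; rewrite ger0_norm ?subr_ge0//; apply: le_trans hh; rewrite -hj; exact: lerB.
   - by apply: le_trans (g2' _ hr'') _; exact: le_trans rr2.
  rewrite sumr_const card_ord -mulrnAr; apply: ler_wpM2l; first exact: ltW.
  by rewrite -[_ *+ k]mulr_natl -(hE eps) ler_pM2r// ler_nat ltnW.
 have /andP[i0 i1] := info_bound (ltnW kn).
 (* The five errors, in order: path expansion, theta remainder, the two residual sums, approximation
    of the information integral, and u against the score ratio. *)
 have -> : a eps w s-b eps w k = (a eps w s-(A-v*I))+(A-A0-v*eps*Ad)+(rk k+rk' k)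
   - (v*(I-partial_info eps k))-(v-ratio eps w) * partial_info eps k.
  have rkE : rk k = A0-score eps k w by rewrite /rk sumrB.
  rewrite rkE /rk' -/Ad /b -/(ratio eps w); ring.
 have c1 : `|v*(I-partial_info eps k)| <= eta*(`|v|*T).
  by rewrite normrM mulrCA; apply: ler_wpM2l.
 have c2 : `|(v-ratio eps w) * partial_info eps k| <= eta*CF.
  by rewrite normrM; apply: ler_pM=> //; rewrite ger0_norm.
 (* V vanishes at x0 and X_0 is within eps^2 of x0, which absorbs the division by eps because eps <
    eta. *)
 have c3 : `|V (th eps w) 0 (X eps 0 w)| / eps <= eta*C.
  rewrite ler_pdivrMr//; have hx0 : 0 <= (0 : R) <= T by rewrite lexx.
  have x0C : `|x0| <= C.
   have xx : x 0 = x0 by rewrite (xE hx0) Int_xx addr0.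
   by rewrite -xx; apply: le_trans KC; apply: le_trans (xK hx0); rewrite lerDl.
  have := hVlip nr hx0 x0C (XC _ hx0); rewrite V0 subr0=> /le_trans; apply.
  apply: le_trans (ler_wpM2l C0 g4) _.
  rewrite (_ : _*eps = C*(eta*eps)); last by ring.
  by apply: ler_wpM2l=> //; rewrite expr2 ler_pM2r// ltW.
 have c4 : `|a eps w s-(A-v*I)| <= `|V (th eps w) 0 (X eps 0 w)| / eps+C/eps * `|X eps s w-X eps (t eps k) w|
   + eta*Z1+eta*Z2.
  apply: le_trans ex _; rewrite -/(VX eps w) -/(UX eps w) -/Z1.
  rewrite (_ : C*_/eps = C/eps * `|X eps s w-X eps (t eps k) w|); last by ring.
  apply: lerD=> //; apply: ler_pM; [exact: ltW| |exact: ltW|].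
   apply: addr_ge0; last first.
    apply: mulr_ge0=> //; apply: mulr_ge0=> //; apply: addr_ge0; last by apply: mulr_ge0=> //; exact: sqr_ge0.
    by apply: addr_ge0; [exact: mulr_ge0|apply: mulr_ge0=> //; apply: mulr_ge0=> //; exact: ltW].
   apply: addr_ge0; last by apply: mulr_ge0=> //; exact: mulr_ge0.
   by apply: addr_ge0; [rewrite !mulr_ge0 ?addr_ge0|rewrite mulr_ge0 ?sqr_ge0].
  rewrite /Z2 lerD2l; apply: ler_wpM2r=> //; apply: ler_wpM2l=> //.
  apply: lerD; first by rewrite lerD2l; apply: ler_wpM2r=> //; rewrite ler_piMr// ltW.
  by rewrite ler_piMr// expr_le1// ltW.
 rewrite ZAE; exact: (add_errors _ _ c1 c2 c3 c4 b1).
apply: le_trans (square_error T0 (ltn0Sn _) (ca e01 nr) (cX e01 (w := w)) (mulr_ge0 (ltW eta0) ZA0) (divr_ge0 C0 (ltW ep)) key) _.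
rewrite [leRHS]mulrCA; apply: ler_wpM2l=> //.
rewrite [leRHS](_ : _ = eta*(T*ZA eps w^+2)+eta*(C^+2*UX eps w)+eta
 + eta*(v^+2*BB eps w)); last first.
 by rewrite -/v; move: (ZA eps w) (UX eps w) (v^+2*BB eps w)=> z1 z2 z3; ring.
have e2 : eta^+2 <= eta by rewrite expr2 ler_piMl// ltW.
apply: lerD; first apply: lerD; first apply: lerD.
- rewrite exprMn mulrCA; apply: ler_wpM2r=> //; by rewrite mulr_ge0 ?sqr_ge0.
- have : \sum_(j < n eps) Int (t eps j) (t eps j.+1) (fun s=> (X eps s w-X eps (t eps j) w)^+2) <= eps^+4*UX eps w.
  rewrite /UX mulrA divff ?expf_neq0 ?gt_eqF// mul1r; apply: ler_sum=> -[j /= jn] _.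
  have cXw := cX e01 (w := w).
  have c1 : continuous (fun s=> (X eps s w-X eps (t eps j) w)^+2) by apply: contX; apply: contB=> //; exact: cst_continuous.
  have c2 : continuous (fun s=> (X eps (t eps j.+1) w-X eps s w)^+2) by apply: contX; apply: contB=> //; exact: cst_continuous.
  by apply: Int_le=> //; [exact: contD|move=> s _; rewrite lerDl sqr_ge0].
 move/(ler_wpM2l (sqr_ge0 (C/eps)))/le_trans; apply.
 rewrite (_ : (C/eps)^+2*_ = eps^+2*(C^+2*UX eps w)); last by field; rewrite gt_eqF.
 apply: ler_wpM2r; first by rewrite mulr_ge0 ?sqr_ge0.
 by apply: le_trans e2; rewrite lerXn2r ?nnegrE ?ltW.
- by [].
- rewrite /BB mulr_sumr mulr_sumr; apply: ler_sum=> -[k /= kn] _.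
 rewrite -[X in X*_ <= _]/(h eps) /rk' [leLHS](_ : _ = eps^+2*(v^+2*(h eps*(\sum_(j < k) Gd (t eps j) (X eps (t eps j) w)*dM eps j w)^+2))); last by move: (h eps) (\sum_(j < k) _)=> z1 z2; ring.
 apply: ler_wpM2r; first by apply: mulr_ge0; [exact: sqr_ge0|apply: mulr_ge0; [exact: ltW|exact: sqr_ge0]].
 by apply: le_trans e2; rewrite lerXn2r ?nnegrE ?ltW.
Qed.

Let square_error_oP : oP P (fun eps w=> \sum_(k < n eps)
 Int (t eps k) (t eps k.+1) (fun s=> (a eps w s-b eps w k)^+2)).
have hZ : OP P (fun eps w=> 4*(T*ZA eps w^+2+C^+2*UX eps w+1+u eps w^+2*BB eps w)).
 by move: ZA_OP UX_OP u_OP BB_OP; move: ZA UX u BB=> z1 z2 z3 z4 *; op.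
apply: (oP_eta hZ)=> eta eta0.
pose eta1 := Num.min 1 eta.
have e10 : 0 < eta1 by rewrite lt_min ltr01.
have e11 : eta1 <= 1 by rewrite ge_min lexx.
have e1e : eta1 <= eta by rewrite ge_min lexx orbT.
have [r r0 hr] := pathwise e10 e11.
apply: (whp_mono (whp_and (good_whp e10 r0) (ws_oP (cG near0) (fun s y=> GC s y near0) e10))).
apply: small_mono hr _=> eps ep hr w [hg].
have p0 (g : nat -> R) : 0 <= \sum_(k < n eps) h eps*g k^+2.
 by apply: sumr_ge0=> j _; rewrite mulr_ge0 ?sqr_ge0// ltW.
rewrite ger0_norm; last exact: (p0 (fun k=> \sum_(j < k) (G th0 (t eps j) (X eps (t eps j) w)*dM eps j w-f (t eps j)*dW eps j w))).
move/(hr w hg)=> h1; rewrite ger0_norm; last first.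
 by apply: sumr_ge0=> k _; apply: Int_ge0=> s _; exact: sqr_ge0.
apply: (le_trans h1); apply: (le_trans (ler_wpM2l (ltW e10) (ler_norm _))).
exact: ler_wpM2r.
Qed.

Let inverse_square_close (A B p i e1 e2 phi : R) : 0 < phi -> `|A-B| <= e1 ->
 phi/2 <= p <= 3/2 * phi -> phi/2 <= i <= 3/2 * phi -> `|i-p| <= e2 ->
 `|A/p^+2-B/i^+2| <= 4/phi^+2*e1+`|B|*(48*e2/phi^+3).
move=> f0 hA /andP[p1 p2] /andP[i1 i2] hi.
have p0 : 0 < p by lra. have i0 : 0 < i by lra.
have inv (v : R) : phi/2 <= v -> 0 < v -> v^-2 <= 4/phi^+2.
 move=> h1 v0; rewrite -[v^-2]div1r ler_pdivrMr ?exprn_gt0// mulrAC ler_pdivlMr ?exprn_gt0// mul1r.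
 have : (phi/2)^+2 <= v^+2 by rewrite lerXn2r// nnegrE; lra.
 lra.
have ip := inv _ p1 p0; have ii := inv _ i1 i0.
have ip0 : 0 <= p^-2 by pos.
have ii0 : 0 <= i^-2 by pos.
have -> : A/p^+2-B/i^+2 = (A-B)/p^+2+B*((i-p)*(i+p)*(p^-2*i^-2)).
 by field; rewrite !gt_eqF.
apply: le_trans (ler_normD _ _) _; apply: lerD.
 by rewrite normrM mulrC; apply: ler_pM=> //; rewrite ger0_norm.
rewrite normrM; apply: ler_wpM2l=> //; rewrite !normrM (ger0_norm ip0) (ger0_norm ii0).
have s0 : `|i+p| <= 3 * phi by rewrite ger0_norm; lra.
have -> : 48*e2/phi^+3 = e2*(3 * phi)*(4/phi^+2*(4/phi^+2)) by field; rewrite gt_eqF.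
by apply: ler_pM; rewrite ?mulr_ge0//; apply: ler_pM.
Qed.

Let Cq : R := 4*C^+2/fi th0^+2.

Let q_near eta : 0 < eta -> exists2 r, 0 < r & small (fun eps=> forall w, good 1 r eps w ->
 near (th eps w) /\ (forall s, 0 <= s <= T -> `|q eps w s| <= Cq) /\
 forall j s, (j < n eps)%N -> t eps j <= s <= t eps j.+1 -> `|q eps w s-q0 eps j| <= eta).
move=> eta0; have phi0 := fi0; set phi := fi th0 in phi0 *; pose CB : R := (C*(L*(1+K)))^+2.
have CB0 : 0 <= CB by exact: sqr_ge0.
pose e1 := eta * phi^+2/8; pose e2 := Num.min (phi/2) (eta * phi^+3/(96*(CB+1))).
have e10 : 0 < e1 by rewrite divr_gt0// mulr_gt0// exprn_gt0.
have CB1 : 0 < 96*(CB+1) by lra.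
have e20 : 0 < e2 by rewrite lt_min !divr_gt0// mulr_gt0// exprn_gt0.
have e22 : 0 < e2/2 by rewrite divr_gt0.
have e2a : e2 <= phi/2 by rewrite ge_min lexx.
have e2b : e2*(96*(CB+1)) <= eta * phi^+3 by rewrite -ler_pdivlMr// ge_min lexx orbT.
have [r2 r20 hr2] := GSd_near e10; have [r3 r30 hr3] := fi_near e22.
pose r := Num.min rho (Num.min r2 r3).
have r0 : 0 < r by rewrite !lt_min rho0 r20 r30.
have rrho : r <= rho by rewrite ge_min lexx.
have rr2 : r <= r2 by rewrite /r !ge_min lexx !orbT.
have rr3 : r <= r3 by rewrite /r !ge_min lexx !orbT.
exists r=> //.
apply: small_mono (small_and (small_and small01 (ncell_small r20)) (info_near e22)) _.
move=> eps ep [[e01 hh] hinfo] w [g1 [g2 g2'] [g3 g3'] g4 g5].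
have nr : near (th eps w) by exact: le_trans rrho.
have hfi := hr3 _ (le_trans g1 rr3); rewrite -/phi in hfi hinfo.
have bnd (v : R) : `|v-phi| <= e2/2 -> phi/2 <= v <= 3/2 * phi.
 by exact: half_band.
have b1 := bnd _ hfi; have b2 := bnd _ hinfo.
have p0 : 0 < fi (th eps w) by case/andP: b1=> + _; lra.
split=> //; split.
 move=> s hs; rewrite /q normrM normrM /Cq.
 have -> : 4*C^+2/phi^+2 = C*C*(4/phi^+2) by ring.
 apply: ler_pM=> //; first by apply: ler_pM=> //; [exact: GC|exact: SdC].
 rewrite ger0_norm ?invr_ge0 ?sqr_ge0// -[leLHS]div1r ler_pdivrMr ?exprn_gt0// mulrAC ler_pdivlMr ?exprn_gt0// mul1r.
 have : (phi/2)^+2 <= fi (th eps w)^+2.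
  case/andP: b1=> b1 _; have b1' : 0 <= phi/2 by rewrite divr_ge0// ltW.
  by rewrite lerXn2r// nnegrE// ltW.
 by rewrite expr_div_n ler_pdivrMr ?exprn_gt0// mulrC (_ : 2^+2 = 4 :> R)// -natrX.
move=> j s jn hs; have hs' := cell jn hs.
have hA : `|G (th eps w) s (X eps s w)*Sd (th eps w) s (X eps s w)-f (t eps j)^+2| <= e1.
 apply: hr2=> //; [exact: le_trans rr2|exact: ti (ltnW jn)| |].
 - case/andP: hs=> s1 s2; rewrite ger0_norm ?subr_ge0//; apply: le_trans hh.
  by rewrite /h -(gridS T (n eps) j); exact: lerB.
 - by apply: le_trans (g2' _ hs') _; exact: le_trans rr2.
have hi : `|partial_info eps (n eps)-fi (th eps w)| <= e2.
 have := ler_distD phi (partial_info eps (n eps)) (fi (th eps w)).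
 by rewrite (distrC phi); lra.
apply: le_trans (inverse_square_close phi0 hA b1 b2 hi) _.
have hB : `|f (t eps j)^+2| <= CB.
 rewrite normrX /CB lerXn2r ?nnegrE//; last by apply: fC; exact: ti (ltnW jn).
 by rewrite !mulr_ge0 ?addr_ge0// ltW.
have w0 : 0 <= 48*e2/phi^+3 by rewrite divr_ge0 ?exprn_ge0 ?ltW// mulr_gt0.
apply: le_trans (lerD (lexx _) (ler_wpM2r w0 hB)) _.
have w1 : 4/phi^+2*e1 = eta/2 by rewrite /e1; field; rewrite gt_eqF.
have w2 : CB*(48*e2/phi^+3) <= eta/2.
 rewrite mulrA ler_pdivrMr ?exprn_gt0//; have k1 := mulr_ge0 CB0 (ltW e20); lra.
lra.
Qed.

(** [quadratic_comparison] with mean square error controlled by [square_error_oP] and weights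
    controlled by [q_near]; the discrete form [b] itself is stochastically bounded in mean
    square. *)
Theorem statistic_limit : oP P (fun eps w=> weighted_stat eps w-quadratic_form eps w).
have Cq0 : 0 <= Cq by rewrite /Cq divr_ge0 ?sqr_ge0// mulr_ge0// sqr_ge0.
have hZ := OPD (OP_cst P 1) (OPZ (Cq+1) form_OP).
apply: (oP_eta hZ)=> eta eta0.
have [r r0 hr] := q_near eta0.
pose c := Cq*(1+eta^-1)+1.
have c0 : 0 < c by rewrite /c ltr_wpDl// mulr_ge0// addr_ge0// invr_ge0 ltW.
have ec : 0 < eta/c by rewrite divr_gt0.
apply: (whp_mono (whp_and (good_whp ltr01 r0) (square_error_oP ec))).
apply: small_mono (small_and small01 hr) _=> eps ep [e01 {}hr] w [hg hS].
have [nr [hq hq']] := hr w hg.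
have cq : continuous (q eps w).
 apply: contM; last exact: cst_continuous.
 by apply: contM; [exact: cpath (cG nr)|exact: cpath (cSd nr)].
have := @quadratic_comparison _ T (n eps) T0 (ltn0Sn _) _ _ (b eps w) _ _ _ (ca e01 nr) cq eta0 Cq0 hq hq'.
rewrite -/(weighted_stat eps w) -/(quadratic_form eps w)=> /le_trans; apply.
set Q := \sum_(j < _) h eps*_; set SE := \sum_(j < _) Int _ _ _ in hS *.
have Q0 : 0 <= Q by apply: sumr_ge0=> j _; rewrite mulr_ge0 ?sqr_ge0// ltW.
have SE0 : 0 <= SE by apply: sumr_ge0=> k _; apply: Int_ge0=> s _; exact: sqr_ge0.
rewrite ger0_norm in hS; last by [].
have h1 : c*SE <= eta by rewrite mulrC -ler_pdivlMr.
rewrite [X in _ <= _*X]ger0_norm; last by pos.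
move: h1; rewrite /c; nra.
Qed.
End Statistic_limit.
End Small_noise.

(** * Likelihood and the maximum likelihood estimator *)

Lemma sum_three {R : realFieldType} (T e1 p pa tau y1 y2 B : R) : 0 < tau -> 0 < e1 -> 0 < p ->
 (16*T*y1^+2+1)*tau <= B/3 -> (16*T+1)*e1 <= B/3 ->
 (64*T*y2^+2+1) * p <= B/3 ->
 T*(y2^+2 * pa) <= T*(y2^+2 * p) -> T*e1^+2 <= T*e1 ->
 T*(y1^+2*tau^+2) <= T*(y1^+2*tau) ->
 8*T*(2*(y1^+2*tau^+2)+2*(e1^+2+4*y2^+2 * pa)) <= B.
lra. Qed.

Lemma quarter_sum {R : realFieldType} (c p q : R) : p <= c/8 -> q <= c/8 -> 0 < c ->
 p+q+(p+c/8) <= c.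
lra. Qed.

Lemma sqr_le_abs {R : realDomainType} (u v : R) : 0 <= v -> u^+2 <= v^+2 -> `|u| <= v.
by move=> v0 h; rewrite -ler_sqr ?nnegrE// real_normK// num_real. Qed.

(** The parabola v vs i - v^2 i/2 exceeds its value at v by i (v - vs)^2/2 at its vertex [vs]. If
    the likelihood at v is nevertheless at least that at vs, this excess is at most the two
    approximation errors. *)
Lemma argmax_close {R : realType} (a b b0 eta1 eta v vs i info : R) :
 0 < eta -> 0 < info -> 0 < eta1 -> eta1 <= eta*info/8 -> info/2 <= i ->
 `|a-b0-(v*(vs*i)-v^+2/2*i)| <= eta1*(`|v| + v^+2) ->
 `|b-b0-(vs*(vs*i)-vs^+2/2*i)| <= eta1*(`|vs| + vs^+2) ->
 b <= a -> (v-vs)^+2 <= eta*(1+v^+2+vs^+2).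
move=> e0 i0 e10 e1e ii; rewrite !ler_norml=> /andP[_ s1] /andP[s2 _] ab.
have y1 := young_product 1 v; have y2 := young_product 1 vs.
rewrite !mul1r !expr1n in y1 y2.
have q1 : i/2*(v-vs)^+2 <= eta1*(2*(1+v^+2+vs^+2)).
 have : eta1*(`|v| + v^+2+(`|vs| + vs^+2)) <= eta1*(2*(1+v^+2+vs^+2)).
  by rewrite ler_pM2l//; have := sqr_ge0 v; have := sqr_ge0 vs; lra.
 lra.
have z0 : 0 <= 1+v^+2+vs^+2 by pos.
have q2 : info/4*(v-vs)^+2 <= i/2*(v-vs)^+2 by apply: ler_wpM2r; [exact: sqr_ge0|lra].
have q3 : eta1*(2*(1+v^+2+vs^+2)) <= eta*info/8*(2*(1+v^+2+vs^+2)).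
 by apply: ler_wpM2r=> //; rewrite mulr_ge0.
rewrite -(ler_pM2l (_ : 0 < info/4)); first lra.
by rewrite divr_gt0.
Qed.

Lemma band_interval {R : realFieldType} (lo hi c g v : R) : g < c-lo -> g < hi-c ->
 `|v-c| <= g -> lo < v < hi.
by rewrite ler_norml=> g1 g2 /andP[v1 v2]; apply/andP; split; lra. Qed.

Section Likelihood_limit.
Context {R : realType} {d : measure_display} {Omega : measurableType d}.
Variables (P : probability Omega R) (F : R -> set (set Omega)) (T : R).
Variable W : R -> Omega -> R.
Hypotheses (T0 : 0 < T) (hF : filtration F T) (hW : wiener P F T W).
Hypothesis normal_sym : forall s : R, 0 < s -> forall A : set R, measurable A ->
 normal_prob 0 s (-%R @^-1` A) = normal_prob 0 s A.
Variables (lo hi th0 : R) (S Sd : R -> R -> R -> R) (sg : R -> R -> R) (x : R -> R) (x0 L K C : R).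
Hypothesis hth0 : lo < th0 < hi.
Let S0 := S th0.
Let Th th := lo < th < hi.
Hypothesis L0 : 0 < L.
Hypothesis cS : forall th, Th th -> cont2 (S th).
Hypothesis cSd : cont2 (Sd th0).
Hypothesis csg : cont2 sg.
Hypothesis lipS0 : forall t y z, `|S0 t y-S0 t z| <= L * `|y-z|.
Hypothesis growS0 : forall t y, `|S0 t y| <= L*(1+`|y|).
Hypothesis growsg : forall t y, `|sg t y| <= L*(1+`|y|).
Hypothesis sg0 : forall t y, sg t y != 0.
Hypothesis cx : continuous x.
Hypothesis xE : forall t, 0 <= t <= T -> x t = x0+Int 0 t (fun s=> S0 s (x s)).
Hypothesis xK : forall s, 0 <= s <= T -> `|x s| + 2 <= K.
Variables X H0 : R -> R -> Omega -> R.
Hypothesis cX : forall eps, 0 < eps < 1 -> forall w, continuous (fun s=> X eps s w).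
Hypothesis aX : forall eps, 0 < eps < 1 -> forall s, 0 <= s <= T -> adapted F s (X eps s).
Hypothesis H0E : forall eps, 0 < eps < 1 -> forall s w, 0 <= s <= T ->
 H0 eps s w = sg s (X eps s w).
Let M eps := mart S0 x0 eps (X eps).
Hypothesis hM : forall eps, 0 < eps < 1 -> forall t, 0 <= t <= T ->
 exists I, stoch_integral P F t (H0 eps) W I /\ {ae P, forall w, I w = M eps t w}.

Hypothesis C0 : 0 <= C.
(** Difference quotient of the drift in theta, over sigma^2. Its stochastic integral is the random
    part of the log-likelihood ratio divided by (th - th0)/eps; at [th0] itself the quotient takes
    the default value 0. *)
Definition slope_drift th t y : R := (S th t y-S th0 t y)/((th-th0)*sg t y^+2).
Let psi := slope_drift.
Let G0 t y : R := Sd th0 t y/sg t y^+2.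
Hypothesis psiC : forall th t y, Th th -> `|psi th t y| <= C.
Hypothesis G0C : forall t y, `|G0 t y| <= C.
Hypothesis psi_lip : forall th th' t y, Th th -> Th th' -> 0 < (th-th0)*(th'-th0) ->
 `|psi th t y-psi th' t y| <= C * `|th-th'|.
Hypothesis psi_G0 : forall th t y, Th th -> th != th0 -> `|psi th t y-G0 t y| <= C * `|th-th0|.

Variable J : R -> R -> Omega -> R.
Hypothesis mJ : forall eps, 0 < eps < 1 -> forall th, Th th -> mrv (J eps th).
Hypothesis hJ : forall eps, 0 < eps < 1 -> forall th, Th th -> forall n, (0 < n)%N ->
 grid_integral P T (X eps) n (fun t y=> S th t y/(eps^+2*sg t y^+2)) (J eps th).
Hypothesis cJ : forall eps, 0 < eps < 1 -> forall w th, Th th -> {for th, continuous (fun v=> J eps v w)}.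

Let n := @ncell R.
Let t eps j : R := grid T (n eps) j.
Let h eps : R := T/(n eps)%:R.
Let dW eps j w : R := W (t eps j.+1) w-W (t eps j) w.
Let f s : R := G0 s (x s)*sg s (x s).
Let score_n eps w : R := \sum_(j < n eps) f (t eps j)*dW eps j w.

Let hth0' : Th th0. by []. Qed.
Let cS0 : cont2 S0. exact: cS. Qed.
Let LK : 0 < L*(1+K).
have K0 : 0 <= K by apply: le_trans (xK (_ : 0 <= 0 <= T)); rewrite ?lexx ?ltW// addr_ge0.
by pos.
Qed.
Let D : R := L*(1+K).
Let D0 : 0 <= D. exact: ltW. Qed.
Let K0 : 0 <= K.
by apply: le_trans (xK (_ : 0 <= 0 <= T)); rewrite ?lexx ?ltW// addr_ge0. Qed.
Let small01 : small (fun eps : R=> 0 < eps < 1).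
by exists 1=> // eps e0 e1; rewrite e0. Qed.
Let ti eps j : (j <= n eps)%N -> 0 <= t eps j <= T. exact: grid_itv. Qed.

Let csg2 : continuous (fun p : R*R=> (sg p.1 p.2^+2)^-1).
by apply: contV; [move=> p; rewrite expf_neq0|exact: contX]. Qed.

Let cpsi th : Th th -> cont2 (psi th).
move=> hth; have -> : (fun p : R*R=> psi th p.1 p.2) =
  (fun p=> (S th p.1 p.2-S th0 p.1 p.2)*((th-th0)^-1*(sg p.1 p.2^+2)^-1)).
 by apply/funext=> p; rewrite /psi /slope_drift invfM.
apply: contM; first by apply: contB; exact: cS.
by apply: contM=> //; exact: cst_continuous.
Qed.

Let cG0 : cont2 G0.
exact: contM. Qed.

(** The stochastic integral of psi sigma against W, expressed through the likelihood integrals [J],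
    so that it inherits their continuity in theta. *)
Definition scaled_likelihood eps th w : R := eps^-1*(eps^+2/(th-th0)*(J eps th w-J eps th0 w)
 - Int 0 T (fun s=> psi th s (X eps s w)*S0 s (X eps s w))).
Let Y := scaled_likelihood.

Let cpX eps w (g : R -> R -> R) : 0 < eps < 1 -> cont2 g ->
 continuous (fun s=> g s (X eps s w)).
by move=> e01 cg; exact: (cont_path (cX e01)). Qed.

Let cpsiS eps w th : 0 < eps < 1 -> Th th -> continuous (fun s=> psi th s (X eps s w)*S0 s (X eps s w)).
by move=> e01 hth; apply: contM; apply: cpX=> //; exact: cpsi. Qed.

Let mXe eps s : 0 < eps < 1 -> 0 <= s <= T -> mrv (X eps s).
by move=> e01 hs; apply: (adapted_measurable hF hs); exact: aX. Qed.

Let mg eps (g : R -> R -> R) s : 0 < eps < 1 -> cont2 g ->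
 0 <= s <= T -> mrv (fun w=> g s (X eps s w)).
by move=> e01 cg hs; exact: (adapted_measurable hF hs (adapted_path (aX e01) cg hs)). Qed.

Let mY eps th : 0 < eps < 1 -> Th th -> mrv (Y eps th).
move=> e01 hth; apply: measurable_funM=> //; apply: measurable_funB.
 by apply: measurable_funM=> //; apply: measurable_funB; exact: mJ.
apply: Int_measurable=> //; first exact: ltW.
- by move=> w; exact: cpsiS.
- by move=> s hs; apply: measurable_funM; apply: mg=> //; exact: cpsi.
Qed.

Let psi_grid eps th : 0 < eps < 1 -> Th th -> th != th0 ->
 grid_integral P T (X eps) (n eps) (psi th) (fun w=> eps^+2/(th-th0)*(J eps th w-J eps th0 w)).
move=> e01 hth nth; have e0 : eps != 0 by case/andP: e01=> e0 _; rewrite gt_eqF.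
have d0 : th-th0 != 0 by rewrite subr_eq0.
have := grid_integral_lin (eps^+2/(th-th0)) (- (eps^+2/(th-th0)))
 (hJ e01 hth (ncell_gt0 eps)) (hJ e01 hth0' (ncell_gt0 eps)).
have -> : (fun s y=> eps^+2/(th-th0)*(S th s y/(eps^+2*sg s y^+2)) +
  - (eps^+2/(th-th0))*(S th0 s y/(eps^+2*sg s y^+2))) = psi th.
 by apply/funext=> s; apply/funext=> y; rewrite /psi /slope_drift; field; rewrite sg0 d0.
by rewrite (_ : (fun w=> _) = (fun w=> eps^+2/(th-th0)*(J eps th w-J eps th0 w)))//;
 apply/funext=> w; ring.
Qed.

Let lik_bound eps A (phi : R -> R -> R) Jp (e : nat -> R) c b : 0 < eps < 1 -> measurable A ->
 (forall w s, A w -> 0 <= s <= T -> `|X eps s w| <= K) ->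
 cont2 phi -> (forall t y, `|phi t y| <= c) ->
 mrv Jp -> grid_integral P T (X eps) (n eps) phi Jp -> 0 <= b ->
 (forall j r s, (j < n eps)%N -> t eps j <= r <= t eps j.+1 -> t eps j <= s <= t eps j.+1 ->
   L1b P setT (fun w=> (phi r (X eps r w)*sg s (trunc K (X eps s w))-e j)^+2) b) ->
 L1b P A (fun w=> (eps^-1*(Jp w-Int 0 T (fun s=> phi s (X eps s w)*S0 s (X eps s w)))
   - \sum_(j < n eps) e j*dW eps j w)^+2) (8*T*b).
move=> e01 mA XK cphi phic mJp gJ b0 hb; have /andP[e0 _] := e01.
exact: (@likelihood_bound _ _ _ P F T W T0 hF hW normal_sym S0 sg x0 L eps e0 L0 cS0 csg (X eps)
 (cX e01) (aX e01) (H0 eps) (H0E e01) (hM e01) K growS0 A mA XK (n eps) isT phi Jp e c b).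
Qed.

Let cellT eps j s : (j < n eps)%N -> t eps j <= s <= t eps j.+1 -> 0 <= s <= T.
move=> jn /andP[s1 s2]; have /andP[a0 _] := ti (ltnW jn); have /andP[_ b0] := ti jn.
by rewrite (le_trans a0 s1) (le_trans s2 b0).
Qed.

Let mtr eps s : 0 < eps < 1 -> 0 <= s <= T -> mrv (fun w=> sg s (trunc K (X eps s w))).
by move=> e01 hs; exact: (adapted_measurable hF hs (trunc_adapted csg (aX e01) K hs)). Qed.

(** Restricted to parameters on the same side of [th0], where psi is Lipschitz in theta; the second
    moment of the increment is quadratic in the distance. *)
Let increment_bound eps A th th' : 0 < eps < 1 -> measurable A ->
 (forall w s, A w -> 0 <= s <= T -> `|X eps s w| <= K) -> Th th -> Th th' ->
 0 < (th-th0)*(th'-th0) ->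
 L1b P A (fun w=> (Y eps th w-Y eps th' w)^+2) (8*T*(C*D)^+2*(th-th')^+2).
move=> e01 mA XK hth hth' hs.
have nth : th != th0 by apply: contraTN hs=> /eqP ->; rewrite subrr mul0r ltxx.
have nth' : th' != th0 by apply: contraTN hs=> /eqP ->; rewrite subrr mulr0 ltxx.
pose phi s y := 1 * psi th s y+(-1) * psi th' s y.
have phiE s y : phi s y = psi th s y-psi th' s y by rewrite /phi; ring.
have cphi : cont2 phi.
 by apply: contD; apply: contM; [exact: cst_continuous|exact: cpsi|exact: cst_continuous|exact: cpsi].
have phic s y : `|phi s y| <= C * `|th-th'| by rewrite phiE; exact: psi_lip.
pose c s := eps^+2/(s-th0); pose Jp w := 1*(c th*(J eps th w-J eps th0 w))+(-1)*(c th'*(J eps th' w-J eps th0 w)).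
have mJp : mrv Jp.
 apply: measurable_funD; apply: measurable_funM=> //; apply: measurable_funM=> //; apply: measurable_funB; exact: mJ.
have gJ : grid_integral P T (X eps) (n eps) phi Jp.
 exact: (grid_integral_lin 1 (-1) (psi_grid e01 hth nth) (psi_grid e01 hth' nth')).
have b0 : 0 <= (C*D)^+2*(th-th')^+2 by pos.
have := lik_bound (e := fun=> 0) e01 mA XK cphi phic mJp gJ b0.
rewrite mulrA; have -> : (fun w=> (eps^-1*(Jp w-Int 0 T (fun s=> phi s (X eps s w)*S0 s (X eps s w)))
   - \sum_(j < n eps) 0*dW eps j w)^+2) = (fun w=> (Y eps th w-Y eps th' w)^+2).
 apply/funext=> w; rewrite big1; last by move=> j _; rewrite mul0r.
 rewrite subr0 /Y /scaled_likelihood -mulrBr; congr ((_*_)^+2).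
 have -> : Int 0 T (fun s=> phi s (X eps s w)*S0 s (X eps s w)) =
   Int 0 T (fun s=> psi th s (X eps s w)*S0 s (X eps s w))-Int 0 T (fun s=> psi th' s (X eps s w)*S0 s (X eps s w)).
  rewrite -IntB; [|exact: cpsiS|exact: cpsiS].
  by apply: eq_Int=> s _; rewrite phiE; ring.
 by rewrite /Jp /c; ring.
apply=> j r s jn hr hs'.
have hr' := cellT jn hr; have hs'' := cellT jn hs'.
apply: (L1b_le _ _ _ _ _ (L1b_cst P measurableT b0))=> //.
- have m1 := mg e01 cphi hr'; have m2 := mtr e01 hs''; by mfun.
- by move=> w _; exact: sqr_ge0.
- move=> w _; rewrite subr0 -[leLHS]real_normK ?num_real// normrM.
 rewrite -[(th-th')^+2]real_normK ?num_real// -exprMn lerXn2r ?nnegrE//.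
  by apply: mulr_ge0=> //; apply: mulr_ge0=> //; exact: ltW.
 by rewrite [leRHS]mulrAC; apply: ler_pM=> //; exact: trunc_sg.
Qed.

(** The error has three sources: psi against its limit G0, the discretised path against the limit
    path, and the complement of the tube. *)
Let score_bound e1 : 0 < e1 -> exists2 r, 0 < r & forall eps A th, 0 < eps < 1 -> h eps <= r ->
 measurable A -> (forall w s, A w -> 0 <= s <= T -> `|X eps s w-x s| <= r) ->
 Th th -> th != th0 ->
 L1b P A (fun w=> (Y eps th w-score_n eps w)^+2)
  (8*T*(2*(C * `|th-th0|*D)^+2+2*(e1^+2+4*(C*D)^+2*fine (P (~` A))))).
move=> e10.
have e12 : 0 < e1/2 by rewrite divr_gt0.
have [ra ra0 hra] := @product_close _ T T0 sg x L K L0 csg growsg cx xK G0 C cG0 G0C _ e12.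
have cf : continuous f.
 have cidx : continuous (fun s=> (s, x s)) by apply: cont_pair=> // s; exact: cvg_id.
 by apply: contM; [exact: (cont_comp cidx cG0)|exact: (cont_comp cidx csg)].
have [rb rb0 hrb] := heine_itv T cf e12.
pose r := Num.min 1 (Num.min ra rb).
have r0 : 0 < r by rewrite !lt_min ltr01 ra0.
have r1 : r <= 1 by rewrite ge_min lexx.
have rra : r <= ra by rewrite /r !ge_min lexx !orbT.
have rrb : r <= rb by rewrite /r !ge_min lexx !orbT.
exists r=> // eps A th e01 hh mA tA hth nth.
have XK w s : A w -> 0 <= s <= T -> `|X eps s w| <= K.
 move=> Aw hs; have := tA w s Aw hs; have := xK hs.
 have := ler_normD (X eps s w-x s) (x s); rewrite subrK; lra.
have mnA : measurable (~` A) by exact: measurableC.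
have pA0 : 0 <= fine (P (~` A)) by exact: fine_ge0.
set pA := fine (P (~` A)) in pA0 *.
have p4 : 0 <= 4*(C*D)^+2 by rewrite mulr_ge0 ?sqr_ge0.
pose b := 2*(C * `|th-th0|*D)^+2+2*(e1^+2+4*(C*D)^+2 * pA).
have b0 : 0 <= b.
 by rewrite /b; apply: addr_ge0; apply: mulr_ge0=> //; [exact: sqr_ge0|apply: addr_ge0; [exact: sqr_ge0|exact: mulr_ge0]].
apply: (lik_bound (e := fun j=> f (t eps j)) e01 mA XK (cpsi hth) _ _ (psi_grid e01 hth nth) b0).
- by move=> s y; exact: psiC.
- by apply: measurable_funM=> //; apply: measurable_funB; exact: mJ.
move=> j r' s jn hr' hs.
have hr'' := cellT jn hr'; have hs' := cellT jn hs; have hj := ti (ltnW jn).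
have m1 := mg e01 (cpsi hth) hr''; have m2 := mtr e01 hs'.
apply: (@L1b_le _ _ _ _ _ _ (fun w=> (2*(C * `|th-th0|*D)^+2+2*e1^+2)+2*(4*(C*D)^+2)*\1_(~` A) w))=> //.
- by mfun.
- by mfun.
- by move=> w _; exact: sqr_ge0.
- move=> w _.
 set a1 := psi th r' _; set sv := sg s _; set fj := f _.
 have sv0 : `|sv| <= D by exact: trunc_sg.
 have d1 : `|(a1-G0 r' (X eps r' w))*sv| <= C * `|th-th0|*D.
  by rewrite normrM; apply: ler_pM=> //; exact: psi_G0.
 have d2 : (G0 r' (X eps r' w)*sv-fj)^+2 <= e1^+2+4*(C*D)^+2*\1_(~` A) w.
  rewrite indicE; case: (boolP (w \in ~` A))=> [_|].
   rewrite mulr1; have bd : `|G0 r' (X eps r' w)*sv-fj| <= 2*(C*D).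
    have b1 : `|G0 r' (X eps r' w)*sv| <= C*D by rewrite normrM; exact: ler_pM.
    have b2 : `|fj| <= C*D.
     rewrite normrM; apply: ler_pM=> //; apply: le_trans (growsg _ _) _; rewrite ler_pM2l// lerD2l.
     by have := xK hj; lra.
    by apply: le_trans (ler_normB _ _) _; lra.
   rewrite -[leLHS]real_normK ?num_real//.
   apply: (@le_trans _ _ ((2*(C*D))^+2)); first by rewrite lerXn2r// nnegrE mulr_ge0// mulr_ge0// ltW.
   by have := sqr_ge0 e1; lra.
  rewrite notin_setE /= => /contrapT Aw; rewrite mulr0 addr0.
  rewrite /sv trunc_id; last exact: XK.
  have cl (u v : R) : t eps j <= u <= t eps j.+1 -> t eps j <= v <= t eps j.+1 -> `|u-v| <= h eps.
   rewrite /h -(gridS T (n eps) j) ler_norml /t=> /andP[u1 u2] /andP[u3 u4].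
   by apply/andP; split; lra.
  have q1 : `|G0 r' (X eps r' w)*sg s (X eps s w)-G0 r' (x r')*sg r' (x r')| <= e1/2.
   apply: hra=> //; [|by apply: le_trans rra; exact: tA|by apply: le_trans rra; exact: tA].
   by apply: le_trans rra; apply: le_trans hh; exact: cl.
  have q2 : `|f r'-fj| <= e1/2.
   apply: hrb=> //; apply: le_trans rrb; apply: le_trans hh; apply: cl=> //.
   by rewrite lexx grid_le.
  rewrite -[leLHS]real_normK ?num_real// lerXn2r ?nnegrE//; first exact: ltW.
  have := ler_distD (f r') (G0 r' (X eps r' w)*sg s (X eps s w)) fj.
  by rewrite /f in q2 *; lra.
 have q3 : (a1*sv-fj)^+2 <= 2*((a1-G0 r' (X eps r' w))*sv)^+2+2*(G0 r' (X eps r' w)*sv-fj)^+2.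
  have := sqr_ge0 ((a1-G0 r' (X eps r' w))*sv-(G0 r' (X eps r' w)*sv-fj)); lra.
 have q4 : ((a1-G0 r' (X eps r' w))*sv)^+2 <= (C * `|th-th0|*D)^+2.
  rewrite -[leLHS]real_normK ?num_real// lerXn2r ?nnegrE//.
  by apply: mulr_ge0=> //; exact: mulr_ge0.
 apply: (le_trans q3); move: q4 d2; lra.
- rewrite (_ : b = (2*(C * `|th-th0|*D)^+2+2*e1^+2)+2*(4*(C*D)^+2) * pA); last by rewrite /b; ring.
 have k0 : 0 <= 2*(C * `|th-th0|*D)^+2+2*e1^+2 by rewrite addr_ge0// mulr_ge0 ?sqr_ge0.
 apply: L1bD=> //.
 + by mfun.
 + by move=> w; apply: mulr_ge0; [rewrite mulr_ge0|rewrite indicE].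
 + exact: L1b_cst.
 + by apply: L1b_indic=> //; rewrite mulr_ge0.
Qed.

(** Parametrises the open segment from [th0] to an end [e] of Theta by tau in (0, 1). The two sides
    are handled separately since psi is singular at [th0]. *)
Let side (e : R) tau : R := th0+(e-th0)*tau.
Let sideB e tau : side e tau-th0 = (e-th0)*tau. by rewrite /side; ring. Qed.

Let y_cont eps w e : 0 < eps < 1 -> (forall tau, 0 < tau < 1 -> Th (side e tau)) -> e != th0 ->
 forall tau, 0 < tau < 1 -> forall c, 0 < c -> exists2 r, 0 < r & forall tau', 0 < tau' < 1 ->
  `|tau-tau'| < r -> `|Y eps (side e tau) w-Y eps (side e tau') w| <= c.
move=> e01 hside ne tau ht c c0; have /andP[e0 _] := e01; have /andP[tau0 _] := ht.
have de : e-th0 != 0 by rewrite subr_eq0.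
have cside : continuous (side e).
 by apply: contD; [exact: cst_continuous|apply: contM; [exact: cst_continuous|move=> v; exact: cvg_id]].
have c1 : 0 < c*eps/2 by pos.
have c2 : {for tau, continuous (fun v=> eps^+2/(side e v-th0)*(J eps (side e v) w-J eps th0 w))}.
 apply: cvgM.
  apply: cvgM; first exact: cvg_cst.
  apply: cvgV; first by rewrite /side addrAC subrr add0r mulf_neq0// gt_eqF.
  by apply: cvgB; [exact: cside|exact: cvg_cst].
 apply: cvgB; last exact: cvg_cst.
 apply: (@cvg_comp _ _ _ (side e) (fun v=> J eps v w)); first exact: cside.
 by apply: cJ=> //; exact: hside.
have /cvgrPdist_le/(_ _ c1)/nbhs_ballP[r1 /= r10 hr1] := c2.
have [m hm] : exists m, forall s, 0 <= s <= T -> `|S0 s (X eps s w)| <= m.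
 have cag : {within `[0, T], continuous (fun s=> `|S0 s (X eps s w)|)}.
  by apply: continuous_subspaceT; apply: contA; exact: cpX.
 by have [y0 _ hy0] := EVT_max (ltW T0) cag; eexists=> s hs; apply: hy0; rewrite in_itv.
have m0 : 0 <= m by apply: (le_trans (normr_ge0 _) (hm 0 _)); rewrite lexx ltW.
pose k := C * `|e-th0| * m*T+1.
have k0 : 0 < k by rewrite ltr_wpDl// mulr_ge0 ?(ltW T0)// !mulr_ge0.
exists (Num.min r1 (c*eps/2/k)); first by pos.
move=> tau' ht'; rewrite lt_min=> /andP[q1 q2]; have /andP[tau0' _] := ht'.
have {}hr1 := hr1 tau' q1.
have q3 : k * `|tau-tau'| <= c*eps/2 by rewrite mulrC -ler_pdivlMr// ltW.
rewrite /Y /scaled_likelihood -mulrBr normrM gtr0_norm ?invr_gt0// ler_pdivrMl//.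
set A := eps^+2/_*_ in hr1 *; set A' := eps^+2/_*_ in hr1 *.
set I := Int _ _ _; set I' := Int _ _ _.
have hI : `|I-I'| <= c*eps/2.
 rewrite /I /I' -IntB; [|by apply: cpsiS=> //; exact: hside|by apply: cpsiS=> //; exact: hside].
 apply: le_trans q3.
 have ci th : Th th -> continuous (fun s=> psi th s (X eps s w)*S0 s (X eps s w)) by move=> ?; exact: cpsiS.
 apply: (@le_trans _ _ (C * `|e-th0| * `|tau-tau'| * m*(T-0))).
  apply: Int_bound; [by apply: contB; apply: ci; exact: hside|exact: ltW|].
  move=> s hs; rewrite -mulrBl normrM; apply: ler_pM=> //; last exact: hm.
  have -> : C * `|e-th0| * `|tau-tau'| = C * `|side e tau-side e tau'|.
   by rewrite -mulrA -normrM; congr (_ * `|_|); rewrite /side; ring.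
  apply: psi_lip; [exact: hside|exact: hside|].
  rewrite !sideB mulrACA -expr2; apply: mulr_gt0; last exact: mulr_gt0.
  by rewrite exprn_even_gt0.
 rewrite subr0 /k mulrDl mul1r.
 by rewrite (_ : _*_ = C * `|e-th0| * m*T * `|tau-tau'|); [rewrite lerDl|ring].
rewrite (_ : A-I-(A'-I') = A-A'-(I-I')); last by ring.
apply: le_trans (ler_normB _ _) _; apply: le_trans (lerD hr1 hI) _.
by rewrite -splitr mulrC.
Qed.

(** At one small parameter [tau1] the variable Y is close to the score in mean square, and the
    uniform modulus of [dyadic_sobolev] carries this closeness to all tau below [tau1], and
    boundedness to the whole segment. *)
Lemma scaled_likelihood_side (e eta c : R) : (forall tau, 0 < tau < 1 -> Th (side e tau)) -> e != th0 ->
 0 < eta -> 0 < c -> exists lam tau1, [/\ 0 < lam, 0 < tau1 < 1 & small (fun eps=> up_to P c (fun w=>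
  (forall tau, 0 < tau < 1 -> `|Y eps (side e tau) w-score_n eps w| <= lam) /\
  (forall tau, 0 < tau <= tau1 -> `|Y eps (side e tau) w-score_n eps w| <= eta)))].
move=> hside ne eta0 c0.
have de : 0 < `|e-th0| by rewrite normr_gt0 subr_eq0.
pose C3 := 8*T*(C*D)^+2*(e-th0)^+2.
have C30 : 0 <= C3 by rewrite /C3; apply: mulr_ge0; [apply: mulr_ge0; [rewrite mulr_ge0// ltW|exact: sqr_ge0]|exact: sqr_ge0].
pose lam := 8*C3/c+1.
have lam0 : 0 < lam by rewrite ltr_wpDl// divr_ge0//; [exact: mulr_ge0|exact: ltW].
have lamC : C3/lam <= c/8.
 rewrite ler_pdivrMr// /lam mulrDr (_ : c/8*(8*C3/c) = C3); last by field; rewrite gt_eqF.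
 by rewrite lerDl mulr1 ltW// divr_gt0.
pose B1 := eta^+2/4*(c/8).
have B10 : 0 < B1 by rewrite /B1 !mulr_gt0// ?exprn_gt0// invr_gt0.
pose k1 := 16*T*(C * `|e-th0|*D)^+2+1.
have k10 : 0 < k1 by rewrite ltr_wpDl// mulr_ge0 ?sqr_ge0// mulr_ge0// ltW.
(* Small enough for the modulus over (0, tau1] to stay below eta/2, and for the first of the three
   contributions to [B1] to stay below a third; [e1] and [p] look after the other two. *)
pose tau1 := Num.min (1/2) (Num.min (eta^+2/4/lam) (B1/3/k1)).
have t10 : 0 < tau1 by rewrite !lt_min !divr_gt0// exprn_gt0.
have t12 : tau1 <= 1/2 by rewrite ge_min lexx.
have t1l : lam*tau1 <= eta^+2/4 by rewrite mulrC -ler_pdivlMr// /tau1 !ge_min lexx !orbT.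
have t1k : k1*tau1 <= B1/3 by rewrite mulrC -ler_pdivlMr// /tau1 !ge_min lexx !orbT.
have half1 : 1/2 < 1 :> R by rewrite div1r invf_lt1// ltr1n.
have tau11 : 0 < tau1 < 1 by rewrite t10 (le_lt_trans t12).
have tau1w : tau1 <= 1 by case/andP: tau11=> _ /ltW.
pose k2 := 16*T+1.
have k20 : 0 < k2 by rewrite ltr_wpDl// mulr_ge0// ltW.
pose e1 := Num.min 1 (B1/3/k2).
have e10 : 0 < e1 by rewrite lt_min ltr01 !divr_gt0.
have e1k : k2*e1 <= B1/3 by rewrite mulrC -ler_pdivlMr// ge_min lexx orbT.
have e11 : e1 <= 1 by rewrite ge_min lexx.
have [r0 r00 hr0] := score_bound e10.
pose r := Num.min r0 1.
pose k3 := 64*T*(C*D)^+2+1.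
have k30 : 0 < k3 by rewrite ltr_wpDl// mulr_ge0 ?sqr_ge0// mulr_ge0// ltW.
pose p := Num.min (c/8) (B1/3/k3).
have p0 : 0 < p by rewrite lt_min !divr_gt0.
have pc : p <= c/8 by rewrite ge_min lexx.
have pk : k3 * p <= B1/3 by rewrite mulrC -ler_pdivlMr// ge_min lexx orbT.
have [l l0 hl] := @tube_whp _ _ _ P F T W T0 hF hW normal_sym S0 sg x x0 L K L0 cS0 csg lipS0
 growsg cx xE xK X H0 cX aX H0E hM p p0.
exists (eta+Num.sqrt lam), tau1; split=> //; first by rewrite ltr_pwDl// sqrtr_ge0.
have rr0 : r <= r0 by rewrite ge_min lexx.
have rl1 : r <= 1 by rewrite ge_min lexx orbT.
have rp : 0 < r by rewrite lt_min r00 ltr01.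
apply: small_mono (small_and (small_and small01 hl) (small_and (small_le_mul l rp) (small_le_mul T r00))) _.
move=> eps ep [[e01 [A [mA PA tA]]] [lr Tr]].
have hh : h eps <= r0.
 case/andP: e01=> _ el1; apply: le_trans (mesh_le T0 ep) _; apply: le_trans Tr.
 by rewrite ler_pM2l// expr2 ler_piMl// ltW.
have tA' w s : A w -> 0 <= s <= T -> `|X eps s w-x s| <= r.
 by move=> Aw hs; apply: le_trans lr; exact: tA.
have XK w s : A w -> 0 <= s <= T -> `|X eps s w| <= K.
 move=> Aw hs; have := tA' w s Aw hs; have := xK hs.
 have := ler_normD (X eps s w-x s) (x s); rewrite subrK; lra.
have nside tau : 0 < tau -> side e tau != th0.
 by move=> t0; rewrite /side -subr_eq0 addrAC subrr add0r mulf_neq0 ?subr_eq0// gt_eqF.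
have hs1 tau tau' : 0 < tau -> 0 < tau' -> 0 < (side e tau-th0)*(side e tau'-th0).
 move=> t0 t0'; rewrite !sideB mulrACA -expr2; apply: mulr_gt0; last exact: mulr_gt0.
 by rewrite exprn_even_gt0//= subr_eq0.
(* The singular endpoint tau = 0 is excluded, which is why the Sobolev bound was stated on an open
   interval. *)
have dy := @dyadic_sobolev R _ _ P (fun tau w=> Y eps (side e tau) w) A C3 lam p mA PA lam0
 (fun tau ht=> mY e01 (hside tau ht)) (fun w tau ht c c0=> y_cont w e01 hside ne ht c0) _ C30.
have {}dy : up_to P (p+C3/lam) (fun w=> A w /\ forall s t0, 0 < s < 1 -> 0 < t0 < 1 ->
  (Y eps (side e s) w-Y eps (side e t0) w)^+2 <= lam * `|s-t0|).
 apply: dy=> s s' hs hs'; have /andP[s0 _] := hs; have /andP[s0' _] := hs'.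
 have := increment_bound e01 mA XK (hside _ hs) (hside _ hs') (hs1 _ _ s0 s0').
 rewrite (_ : _*(side e s-side e s')^+2 = C3*(s-s')^+2)//.
 by rewrite /C3 /side; ring.
have md : mrv (score_n eps).
 apply: measurable_sum=> -[j /= jn]; apply: measurable_funM=> //; apply: measurable_funB;
  apply: (wiener_measurable hF hW); apply: ti=> //; exact: ltnW.
have h1 : L1b P A (fun w=> (Y eps (side e tau1) w-score_n eps w)^+2) B1.
 have pA : fine (P (~` A)) <= p by rewrite -lee_fin fineK ?fin_num_measure//; exact: measurableC.
 have hb := hr0 eps A (side e tau1) e01 hh mA (fun w s Aw hs=> le_trans (tA' w s Aw hs) rr0) (hside _ tau11) (nside _ t10).
 apply: L1b_mono hb.
 rewrite sideB normrM (gtr0_norm t10).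
  rewrite (_ : C*(`|e-th0|*tau1)*D = C * `|e-th0|*D*tau1); last by ring.
  rewrite exprMn.
  have u1 : (C * `|e-th0|*D)^+2*tau1^+2 <= (C * `|e-th0|*D)^+2*tau1.
   by apply: ler_wpM2l; [exact: sqr_ge0|rewrite expr2 ler_piMl// ltW].
  have u2 : e1^+2 <= e1 by rewrite expr2 ler_piMl// ltW.
  have u3 : (C*D)^+2*fine (P (~` A)) <= (C*D)^+2 * p by apply: ler_wpM2l=> //; exact: sqr_ge0.
  have := ler_wpM2l (ltW T0) u1; have := ler_wpM2l (ltW T0) u2; have := ler_wpM2l (ltW T0) u3.
  move: t1k e1k pk; rewrite /k1 /k2 /k3; move: t10 e10 p0.
  exact: sum_three.
have e4 : 0 < eta^+2/4 by rewrite divr_gt0// exprn_gt0.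
have mk : up_to P (p+B1/(eta^+2/4)) (fun w=> A w /\
  (Y eps (side e tau1) w-score_n eps w)^+2 <= eta^+2/4).
 apply: L1b_markov=> //; last by move=> w; exact: sqr_ge0.
 apply: measurable_funX; apply: measurable_funB=> //.
 by apply: mY=> //; exact: hside.
have BE : B1/(eta^+2/4) = c/8 by rewrite /B1; field; rewrite gt_eqF.
rewrite BE in mk.
apply: up_to_mono (up_to_and dy mk)=> [|w [[_ q1] [_ q2]]].
 by apply: (@quarter_sum _ c p (C3/lam)).
have sq4 : eta^+2/4 = (eta/2)^+2 by rewrite expr_div_n; congr (_/_); rewrite -natrX.
have a1 : `|Y eps (side e tau1) w-score_n eps w| <= eta/2.
 by apply: sqr_le_abs; [rewrite divr_ge0// ltW|rewrite -sq4].
have tri tau v : `|Y eps (side e tau) w-Y eps (side e tau1) w| <= v ->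
  `|Y eps (side e tau) w-score_n eps w| <= v+eta/2.
 by move=> hv; apply: le_trans (ler_distD (Y eps (side e tau1) w) _ _) _; exact: lerD.
split=> tau ht.
 have a2 : `|Y eps (side e tau) w-Y eps (side e tau1) w| <= Num.sqrt lam.
  apply: sqr_le_abs; [exact: sqrtr_ge0|rewrite sqr_sqrtr; last exact: ltW].
  apply: le_trans (q1 _ _ ht tau11) _; rewrite -[leRHS]mulr1; apply: ler_wpM2l; first exact: ltW.
  case/andP: ht=> u1 u2; case/andP: tau11=> u3 u4; rewrite ler_norml; apply/andP; split.
   by rewrite lerBrDr -[X in X <= _]addrC; apply: (le_trans (_ : _ <= 0)); [rewrite subr_le0 ltW|exact: ltW].
  by rewrite lerBlDr; apply: (le_trans (ltW u2)); rewrite lerDl ltW.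
 apply: le_trans (tri _ _ a2) _; rewrite addrC lerD2r ler_pdivrMr// mulr_natr mulr2n lerDl; exact: ltW.
case/andP: ht=> u1 u2.
have ht' : 0 < tau < 1 by rewrite u1 (le_lt_trans u2)//; case/andP: tau11.
have a2 : `|Y eps (side e tau) w-Y eps (side e tau1) w| <= eta/2.
 apply: sqr_le_abs; [rewrite divr_ge0// ltW//|rewrite -sq4].
 apply: le_trans (q1 _ _ ht' tau11) _; apply: le_trans t1l; apply: ler_wpM2l; first exact: ltW.
 by rewrite distrC ger0_norm ?subr_ge0// lerBlDr lerDl ltW.
by apply: le_trans (tri _ _ a2) _; rewrite -splitr.
Qed.

Lemma scaled_likelihood_near (eta c : R) : 0 < eta -> 0 < c -> exists lam r, [/\ 0 < lam, 0 < r &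
 small (fun eps=> up_to P c (fun w=> forall th, Th th -> th != th0 ->
  `|Y eps th w-score_n eps w| <= lam /\
  (`|th-th0| <= r -> `|Y eps th w-score_n eps w| <= eta)))].
move=> eta0 c0; have /andP[hlo hhi] := hth0; have c2 : 0 < c/2 by rewrite divr_gt0.
have slo tau : 0 < tau < 1 -> Th (side lo tau).
 move=> /andP[t1 t2]; rewrite /Th /side; apply/andP; split; nra.
have shi tau : 0 < tau < 1 -> Th (side hi tau).
 move=> /andP[t1 t2]; rewrite /Th /side; apply/andP; split; nra.
have nlo : lo != th0 by rewrite lt_eqF.
have nhi : hi != th0 by rewrite gt_eqF.
have [l1 [t1 [l10 /andP[t10 t11] h1]]] := scaled_likelihood_side slo nlo eta0 c2.
have [l2 [t2 [l20 /andP[t20 t21] h2]]] := scaled_likelihood_side shi nhi eta0 c2.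
have d1 : 0 < th0-lo by rewrite subr_gt0.
have d2 : 0 < hi-th0 by rewrite subr_gt0.
exists (Num.max l1 l2), (Num.min (t1*(th0-lo)) (t2*(hi-th0))); split.
- by rewrite lt_max l10.
- by rewrite lt_min !mulr_gt0.
apply: small_mono (small_and h1 h2) _=> eps ep [k1 k2].
apply: up_to_mono (up_to_and k1 k2)=> [|w [[p1 p2] [p3 p4]] th /andP[th1 th2] nth]; first by rewrite -splitr.
case: (ltP th th0)=> hth.
 pose tau := (th0-th)/(th0-lo).
 have tE : side lo tau = th by rewrite /side /tau; field; rewrite gt_eqF.
 have tau0 : 0 < tau by rewrite divr_gt0// subr_gt0.
 have tau1 : tau < 1 by rewrite ltr_pdivrMr// mul1r ltrD2l ltrN2.
 rewrite -tE; split; first by apply: le_trans (p1 tau _) _; [rewrite tau0|rewrite le_max lexx].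
 rewrite tE distrC ger0_norm; last by rewrite subr_ge0 ltW.
 rewrite le_min=> /andP[q _]; rewrite -tE; apply: p2; rewrite tau0 /=.
 by rewrite ler_pdivrMr.
have {}hth : th0 < th by rewrite lt_neqAle eq_sym nth.
pose tau := (th-th0)/(hi-th0).
have tE : side hi tau = th by rewrite /side /tau; field; rewrite gt_eqF.
have tau0 : 0 < tau by rewrite divr_gt0// subr_gt0.
have tau1 : tau < 1 by rewrite ltr_pdivrMr// mul1r ltrD2r.
rewrite -tE; split; first by apply: le_trans (p3 tau _) _; [rewrite tau0|rewrite le_max lexx orbT].
rewrite tE ger0_norm; last by rewrite subr_ge0 ltW.
rewrite le_min=> /andP[_ q]; rewrite -tE; apply: p4; rewrite tau0 /=.
by rewrite ler_pdivrMr.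
Qed.

Hypothesis S_lip : forall th th' t y, Th th -> Th th' -> `|S th t y-S th' t y| <= C * `|th-th'|.
(** Identifiability and positive information in one statement, uniform in theta and stable under
    perturbation of the path. *)
Hypothesis Phi_low : exists c r : R, [/\ 0 < c, 0 < r & forall th, Th th -> th != th0 ->
 forall z : R -> R, continuous z -> (forall s, 0 <= s <= T -> `|z s-x s| <= r) ->
 c <= Int 0 T (fun s=> (psi th s (z s)*sg s (z s))^+2)].
Hypothesis info_pos : 0 < Int 0 T (fun s=> f s^+2).

Definition log_likelihood eps th w : R := J eps th w -
 Int 0 T (fun s=> S th s (X eps s w)^+2/(2*eps^+2*sg s (X eps s w)^+2)).
Let ll := log_likelihood.
Let Phi eps th w : R := Int 0 T (fun s=> (psi th s (X eps s w)*sg s (X eps s w))^+2).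

(** Completing the square in S(th)^2 - S(th0)^2 moves the drift part into Y; the identity is exact,
    with no remainder. *)
Let ll_diff eps th w : 0 < eps < 1 -> Th th -> th != th0 ->
 ll eps th w-ll eps th0 w = (th-th0)/eps*Y eps th w-((th-th0)/eps)^+2/2*Phi eps th w.
move=> e01 hth nth; have e0 : eps != 0 by case/andP: e01=> e0 _; rewrite gt_eqF.
have d0 : th-th0 != 0 by rewrite subr_eq0.
have cL v : Th v -> continuous (fun s=> S v s (X eps s w)^+2/(2*eps^+2*sg s (X eps s w)^+2)).
 move=> hv; apply: contM; first by apply: contX; apply: cpX=> //; exact: cS.
 apply: contV; first by move=> s; rewrite !mulf_neq0 ?expf_neq0// pnatr_eq0.
 by apply: contM; [exact: cst_continuous|apply: contX; exact: cpX].
have c1 : continuous (fun s=> (psi th s (X eps s w)*sg s (X eps s w))^+2).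
 by apply: contX; apply: contM; apply: cpX=> //; exact: cpsi.
have c2 := cpsiS (w := w) e01 hth.
have E : Int 0 T (fun s=> S th s (X eps s w)^+2/(2*eps^+2*sg s (X eps s w)^+2))
  - Int 0 T (fun s=> S th0 s (X eps s w)^+2/(2*eps^+2*sg s (X eps s w)^+2)) =
  (th-th0)^+2/(2*eps^+2)*Phi eps th w+(th-th0)/eps^+2 *
   Int 0 T (fun s=> psi th s (X eps s w)*S0 s (X eps s w)).
 rewrite /Phi -IntB; [|exact: cL|exact: cL].
 rewrite -!IntZ// -IntD; [|by apply: contM=> //; exact: cst_continuous|by apply: contM=> //; exact: cst_continuous].
 apply: eq_Int=> s _; rewrite /psi /slope_drift /S0; field.
 by rewrite sg0 d0 e0.
rewrite /ll /log_likelihood (_ : _ - _ - _ = J eps th w-J eps th0 w-(Int 0 T (fun s=> S th s (X eps s w)^+2/(2*eps^+2*sg s (X eps s w)^+2))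
  - Int 0 T (fun s=> S th0 s (X eps s w)^+2/(2*eps^+2*sg s (X eps s w)^+2)))); last by ring.
by rewrite E /Y /scaled_likelihood; field; rewrite e0 d0.
Qed.

Let ll_cont eps w th : 0 < eps < 1 -> Th th -> {for th, continuous (fun v=> ll eps v w)}.
move=> e01 hth; have /andP[lt1 lt2] := hth.
pose k s := (2 * `|S th s (X eps s w)| + C*(hi-lo)) * `|(2*eps^+2*sg s (X eps s w)^+2)^-1|.
have cden : continuous (fun s=> (2*eps^+2*sg s (X eps s w)^+2)^-1).
 apply: contV; first by move=> s; rewrite !mulf_neq0 ?expf_neq0// ?pnatr_eq0// gt_eqF//; case/andP: e01.
 by apply: contM; [exact: cst_continuous|apply: contX; exact: cpX].
have cSp v : Th v -> continuous (fun s=> S v s (X eps s w)) by move=> hv; apply: cpX=> //; exact: cS.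
have [m hm] : exists m, forall s, 0 <= s <= T -> k s <= m.
 have cag : {within `[0, T], continuous k}.
  apply: continuous_subspaceT; apply: contM; last exact: contA.
  apply: contD; last exact: cst_continuous.
  by apply: contM; [exact: cst_continuous|apply: contA; exact: cSp].
 by have [y0 _ hy0] := EVT_max (ltW T0) cag; eexists=> s hs; apply: hy0; rewrite in_itv.
pose g v := Int 0 T (fun s=> S v s (X eps s w)^+2/(2*eps^+2*sg s (X eps s w)^+2)).
have hl0 : 0 <= hi-lo by rewrite subr_ge0 ltW// (lt_trans lt1).
have hg v : Th v -> `|g th-g v| <= C * m*T * `|th-v|.
 move=> hv; have cI z : Th z -> continuous (fun s=> S z s (X eps s w)^+2/(2*eps^+2*sg s (X eps s w)^+2)).
  by move=> hz; apply: contM=> //; apply: contX; exact: cSp.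
 rewrite /g -IntB; [|exact: cI|exact: cI].
 rewrite (_ : C * m*T*_ = C * `|th-v| * m*(T-0)); last by rewrite subr0; ring.
 apply: Int_bound; [by apply: contB; exact: cI|exact: ltW|].
 move=> s hs; rewrite -mulrBl subr_sqr -[X in `|X|]mulrA normrM; apply: ler_pM=> //; first exact: S_lip.
 apply: le_trans (hm _ hs); rewrite normrM /k; apply: ler_wpM2r=> //.
 have -> : S th s (X eps s w)+S v s (X eps s w) = 2*S th s (X eps s w)-(S th s (X eps s w)-S v s (X eps s w)) by ring.
 apply: le_trans (ler_normB _ _) _; apply: lerD; first by rewrite normrM ger0_norm.
 apply: le_trans (S_lip _ _ hth hv) _; apply: ler_wpM2l=> //.
 by case/andP: hv=> v1 v2; rewrite ler_norml; apply/andP; split; lra.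
have m0 : 0 <= m.
 apply: (le_trans _ (hm 0 _)); last by rewrite lexx ltW.
 by rewrite /k mulr_ge0// addr_ge0// ?mulr_ge0.
apply: (@cvgB _ _ _ (nbhs th) _ (fun v=> J eps v w) g (J eps th w) (g th)); first exact: cJ.
apply/cvgrPdist_le=> e e0; near=> v.
have hv : Th v by near: v; apply: near_in_itvoo; rewrite in_itv.
apply: le_trans (hg _ hv) _.
have q : `|th-v| <= e/(C * m*T+1).
 apply: ltW; near: v; apply: (nbhsx_ballx th (e/(C * m*T+1))).
 by rewrite divr_gt0// ltr_wpDl// mulr_ge0 ?(ltW T0)// mulr_ge0.
have p0 : 0 <= C * m*T by rewrite mulr_ge0 ?(ltW T0)// mulr_ge0.
rewrite ler_pdivlMr ?ltr_wpDl// in q.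
by apply: le_trans q; rewrite mulrDr mulr1 mulrC lerDl.
Unshelve. all: by end_near. Qed.

Variable thhat : R -> Omega -> R.
Hypothesis thhat_in : forall eps, 0 < eps < 1 -> forall w, Th (thhat eps w).
Hypothesis thhat_max : forall eps, 0 < eps < 1 -> {ae P, forall w,
 (exists2 th, Th th & forall th', Th th' -> expR (ll eps th' w) <= expR (ll eps th w)) ->
 expR (ll eps (thhat eps w) w) = sup [set expR (ll eps th w) | th in [set th | Th th]]}.
Let u eps w : R := (thhat eps w-th0)/eps.
Let I_n eps : R := \sum_(j < n eps) f (t eps j)^+2*h eps.

Let fC s : 0 <= s <= T -> `|f s| <= C*D.
move=> hs; rewrite normrM; apply: ler_pM=> //; apply: le_trans (growsg _ _) _.
by rewrite ler_pM2l// lerD2l; have := xK hs; lra.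
Qed.

Let score_OP : OP P score_n.
have h2 := @noise_OP _ _ _ P F T W T0 hF hW normal_sym S0 sg x x0 L K L0 cS0 csg lipS0
 growsg cx xE xK X H0 cX aX H0E hM f (C*D) n fC (fun=> leqnn _).
apply: (OP_le (OPD (OP_cst P 1) h2)); apply: (whp_mono (whp_small P small01)).
apply: small_mono small01 _=> eps ep _ w _.
rewrite [leRHS]ger0_norm; last by rewrite addr_ge0// sqr_ge0.
rewrite -/(score_n eps w); have := young_product 1 (score_n eps w).
by rewrite mul1r expr1n; have := sqr_ge0 (score_n eps w); lra.
Qed.

Let tube_up e : 0 < e -> exists2 lam, 0 < lam & small (fun eps=>
 up_to P e (fun w=> forall s, 0 <= s <= T -> `|X eps s w-x s| <= lam*eps)).
move=> e0; have [lam l0 hl] := @tube_whp _ _ _ P F T W T0 hF hW normal_sym S0 sg x x0 L K L0 cS0 csg lipS0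
 growsg cx xE xK X H0 cX aX H0E hM e e0.
exists lam=> //; apply: small_mono hl _=> eps e1 [A [mA PA tA]].
by apply: (up_to_setC mA PA)=> w Aw s hs; exact: tA.
Qed.

(** Beyond distance Rr eps from [th0] the quadratic term beats the bounded linear one, so the
    likelihood is smaller than at [th0]. The supremum is therefore attained on a compact interval
    inside the open set Theta, which is the situation in which the estimator is prescribed. *)
Let mle_maximizes c : 0 < c -> exists2 Rr, 0 < Rr & small (fun eps=> up_to P c (fun w=>
 `|u eps w| <= Rr /\ forall th, Th th -> ll eps th w <= ll eps (thhat eps w) w)).
move=> c0; have c4 : 0 < c/4 by rewrite divr_gt0.
have [c1 [rt [c10 rt0 hPhi]]] := Phi_low.
have [l1 [r1 [l10 r10 h1]]] := scaled_likelihood_near ltr01 c4.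
have [l2 l20 h2] := score_OP c4.
have [l3 l30 h3] := tube_up c4.
(* For |v| > Rr, |v|(l1 + l2) < v^2 c1/2, where l1 + l2 bounds |Y| and c1 bounds Phi from below. *)
pose Rr := 2*(l1+l2)/c1+1.
have R0 : 0 < Rr by rewrite ltr_wpDl// divr_ge0 ?(ltW c10)// mulr_ge0// addr_ge0// ltW.
have Rc : 2*(l1+l2) < Rr*c1 by rewrite (_ : Rr*c1 = 2*(l1+l2)+c1) ?ltrDl//; rewrite /Rr; field; rewrite gt_eqF.
have /andP[hlo hhi] := hth0.
pose gap := Num.min (th0-lo) (hi-th0)/2.
have g0 : 0 < gap by rewrite divr_gt0// lt_min !subr_gt0 hlo.
have g1 : gap < th0-lo.
 by rewrite ltr_pdivrMr// mulr_natr mulr2n; apply: (@le_lt_trans _ _ (th0-lo)); [rewrite ge_min lexx|rewrite ltrDl subr_gt0].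
have g2 : gap < hi-th0.
 by rewrite ltr_pdivrMr// mulr_natr mulr2n; apply: (@le_lt_trans _ _ (hi-th0)); [rewrite ge_min lexx orbT|rewrite ltrDl subr_gt0].
exists Rr=> //.
apply: small_mono (small_and (small_and (small_and h1 h2) (small_and h3 small01)) (small_and (small_le_mul Rr g0) (small_le_mul l3 rt0))) _.
move=> eps ep [[[k1 k2] [k3 e01]] [Rg lr]].
have k4 := up_to_ae (ltW c4) (thhat_max e01).
apply: up_to_mono (up_to_and (up_to_and k1 k2) (up_to_and k3 k4))=> [|w [[p1 p2] [p3 p4]]]; first lra.
have Yb th : Th th -> th != th0 -> `|Y eps th w| <= l1+l2.
 move=> hth nth; have [q1 _] := p1 th hth nth.
 by have := ler_normD (Y eps th w-score_n eps w) (score_n eps w); rewrite subrK; lra.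
have far th : Th th -> Rr*eps < `|th-th0| -> ll eps th w < ll eps th0 w.
 move=> hth hfar; have nth : th != th0.
  by apply: contraTN hfar=> /eqP ->; rewrite subrr normr0 -leNgt mulr_ge0// ltW.
 rewrite -subr_lt0 ll_diff//; set v := (th-th0)/eps.
 have vR : Rr < `|v| by rewrite /v normrM normfV (gtr0_norm ep) ltr_pdivlMr.
 have hP : c1 <= Phi eps th w.
  apply: hPhi=> //; first exact: cX.
  by move=> s hs; apply: le_trans lr; exact: p3.
 have hY := Yb th hth nth.
 have q1 : v*Y eps th w <= `|v|*(l1+l2).
  by apply: le_trans (ler_norm _) _; rewrite normrM; apply: ler_wpM2l.
 have q2 : `|v|*(Rr*c1)/2 <= v^+2/2*Phi eps th w.
  apply: (@le_trans _ _ (v^+2/2*c1)); last by apply: ler_wpM2l=> //; rewrite divr_ge0// sqr_ge0.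
  rewrite -[v^+2]real_normK ?num_real//.
  rewrite (_ : `|v|*(Rr*c1)/2 = `|v|*Rr*(c1/2)); last by ring.
  rewrite (_ : `|v|^+2/2*c1 = `|v| * `|v|*(c1/2)); last by ring.
  by rewrite ler_pM2r ?divr_gt0//; apply: ler_wpM2l=> //; exact: ltW.
 have vp : 0 < `|v| by exact: lt_trans vR.
 have q3 : `|v|*(2*(l1+l2)) < `|v|*(Rr*c1) by rewrite ltr_pM2l.
 lra.
pose A := th0-Rr*eps; pose B := th0+Rr*eps.
have Re : 0 < Rr*eps by rewrite mulr_gt0.
have AB : A <= B by apply: (@le_trans _ _ th0); rewrite ?lerBlDr lerDl ltW.
have inT v : A <= v <= B -> Th v.
 by rewrite -ler_distl=> hv; apply: band_interval g1 g2 _; exact: le_trans Rg.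
(* Continuity of the version [J] in theta enters here, through the extreme value theorem. *)
have cll : {within `[A, B], continuous (fun v=> ll eps v w)}.
 apply: continuous_in_subspaceT=> v; rewrite inE /= in_itv /= => hv; apply: ll_cont=> //; exact: inT.
have [vm hvm hmax] := EVT_max AB cll.
rewrite in_itv /= in hvm.
have all_le th : Th th -> ll eps th w <= ll eps vm w.
 move=> hth; case: (leP `|th-th0| (Rr*eps))=> hc.
  by apply: hmax; rewrite in_itv /= -ler_distl.
 by apply: le_trans (ltW (far _ hth hc)) _; apply: hmax; rewrite in_itv /= -ler_distl subrr normr0 ltW.
have hs : expR (ll eps (thhat eps w) w) = sup [set expR (ll eps th w) | th in [set th | Th th]].
 apply: p4; exists vm; first exact: inT.
 by move=> th' hth'; rewrite ler_expR; exact: all_le.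
have max th : Th th -> ll eps th w <= ll eps (thhat eps w) w.
 move=> hth; rewrite -ler_expR hs; apply: ub_le_sup; last by exists th.
 by exists (expR (ll eps vm w))=> _ [th' hth' <-]; rewrite ler_expR; exact: all_le.
split=> //; rewrite /u normrM normfV (gtr0_norm ep) ler_pdivrMr//.
rewrite leNgt; apply/negP=> hfar.
by have := far _ (thhat_in e01 w) hfar; rewrite ltNge max.
Qed.

Theorem mle_OP : OP P u.
move=> c /mle_maximizes[Rr R0 hR]; exists Rr=> //; apply: small_mono hR _=> eps ep.
by apply: up_to_mono=> // w [].
Qed.

Let info := Int 0 T (fun s=> f s^+2).

Let cf : continuous f.
have cidx : continuous (fun s=> (s, x s)) by apply: cont_pair=> // s; exact: cvg_id.
by apply: contM; [exact: (cont_comp cidx cG0)|exact: (cont_comp cidx csg)].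
Qed.

Let info_near eta : 0 < eta -> small (fun eps=> `|I_n eps-info| <= eta).
move=> e0; have cf2 : continuous (fun s=> f s^+2) by exact: contX.
have e1 : 0 < eta/T by rewrite divr_gt0.
have [r r0 hr] := heine_itv T cf2 e1.
apply: small_mono (ncell_small T0 r0) _=> eps ep hh.
have := @riemann_error _ T T0 _ (n eps) (n eps) (eta/T) cf2 isT (leqnn _).
rewrite gridT// divfK ?gt_eqF// distrC; apply=> j s jn hs.
have hj := ti (ltnW jn); have hs' := cellT jn hs; case/andP: hs=> s1 s2.
apply: hr=> //; rewrite ger0_norm ?subr_ge0//; apply: le_trans hh.
by rewrite /h -(gridS T (n eps) j); exact: lerB.
Qed.

Let Phi_near eta : 0 < eta -> exists2 r, 0 < r & forall eps th w, 0 < eps < 1 -> Th th -> th != th0 ->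
 `|th-th0| <= r -> (forall s, 0 <= s <= T -> `|X eps s w-x s| <= r) -> `|Phi eps th w-info| <= eta.
move=> eta0.
pose k := 2*(C*D)*T+1.
have CD0 : 0 <= C*D by exact: mulr_ge0.
have k0 : 0 < k by rewrite ltr_wpDl// mulr_ge0 ?(ltW T0)// mulr_ge0.
have e1 : 0 < eta/k/2 by rewrite !divr_gt0.
have [ra ra0 hra] := @product_close _ T T0 sg x L K L0 csg growsg cx xK G0 C cG0 G0C _ e1.
pose r := Num.min 1 (Num.min ra (eta/k/2/(C*D+1))).
have CD1 : 0 < C*D+1 by rewrite ltr_wpDl.
have r0 : 0 < r by rewrite !lt_min ltr01 ra0 divr_gt0.
have r1 : r <= 1 by rewrite ge_min lexx.
have rra : r <= ra by rewrite /r !ge_min lexx !orbT.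
have rr : r*(C*D+1) <= eta/k/2 by rewrite -ler_pdivlMr// /r !ge_min lexx !orbT.
exists r=> // eps th w e01 hth nth hr hX.
have XK s : 0 <= s <= T -> `|X eps s w| <= K.
 move=> hs; have := hX s hs; have := xK hs; have := ler_normD (X eps s w-x s) (x s); rewrite subrK; lra.
have c1 : continuous (fun s=> (psi th s (X eps s w)*sg s (X eps s w))^+2).
 by apply: contX; apply: contM; apply: cpX=> //; exact: cpsi.
rewrite /Phi /info -IntB//; last exact: contX.
apply: (@le_trans _ _ (eta/k*(2*(C*D))*(T-0))); last first.
 rewrite subr0 (_ : _*_*T = eta*(2*(C*D)*T/k)); last by ring.
 by rewrite ler_piMr ?(ltW eta0)// ler_pdivrMr// mul1r /k lerDl.
apply: Int_bound; [by apply: contB=> //; exact: contX|exact: ltW|].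
move=> s hs; rewrite subr_sqr normrM; have sgD : `|sg s (X eps s w)| <= D.
 by apply: le_trans (growsg _ _) _; rewrite ler_pM2l// lerD2l XK.
apply: ler_pM=> //.
 have q1 : `|G0 s (X eps s w)*sg s (X eps s w)-f s| <= eta/k/2.
  by apply: hra=> //; [rewrite subrr normr0 ltW|apply: le_trans rra; exact: hX|apply: le_trans rra; exact: hX].
 have q2 : `|(psi th s (X eps s w)-G0 s (X eps s w))*sg s (X eps s w)| <= eta/k/2.
  rewrite normrM; apply: le_trans rr; apply: (@le_trans _ _ (C*r*D)).
   apply: ler_pM=> //; apply: le_trans (psi_G0 _ _ hth nth) _; exact: ler_wpM2l.
  rewrite mulrDr mulr1 (_ : r*(C*D) = C*r*D); last by ring.
  by rewrite lerDl ltW.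
 rewrite (_ : _ - f s = (psi th s (X eps s w)-G0 s (X eps s w))*sg s (X eps s w)+(G0 s (X eps s w)*sg s (X eps s w)-f s)); last by ring.
 by apply: le_trans (ler_normD _ _) _; rewrite [leRHS]splitr; exact: lerD.
apply: le_trans (ler_normD _ _) _; rewrite mulr_natl mulr2n; apply: lerD; last exact: fC.
by rewrite normrM; apply: ler_pM=> //; exact: psiC.
Qed.

Let u_star eps w : R := score_n eps w/I_n eps.

Let u_star_OP : OP P u_star.
have i2 : 0 < info/2 by rewrite divr_gt0.
apply: (OP_le (OPZ (2/info) score_OP)); apply: (whp_mono (whp_small P (info_near i2))).
apply: small_mono small01 _=> eps ep _ w; rewrite ler_norml=> /andP[q1 q2].
have ip : info/2 <= I_n eps by lra.
have ip0 : 0 < I_n eps by exact: lt_le_trans ip.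
rewrite /u_star !normrM mulrC; apply: ler_wpM2r=> //.
have n1 : `|info^-1| = info^-1 by rewrite ger0_norm// invr_ge0 ltW.
rewrite normfV (gtr0_norm ip0) n1 ger0_norm//.
by rewrite -[leLHS]div1r ler_pdivrMr// mulrAC ler_pdivlMr//; rewrite mul1r mulrC; lra.
Qed.

(** The log-likelihood is uniformly close to the parabola with vertex score/information at the two
    points theta_hat and th0 + eps [u_star]; maximality of theta_hat and [argmax_close] compare
    them. *)
Theorem mle_score : oP P (fun eps w=> u eps w-score_n eps w/I_n eps).
have Z_OP : OP P (fun eps w=> 1+u eps w^+2+u_star eps w^+2).
 by move: mle_OP u_star_OP; move: u u_star=> v1 v2 *; op.
suff h2 : oP P (fun eps w=> (u eps w-u_star eps w)^+2).
 move=> eta e0; have e2 : 0 < eta^+2 by rewrite exprn_gt0.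
 move=> c c0; apply: small_mono (h2 _ e2 c c0) _=> eps ep.
 apply: up_to_mono=> // w; rewrite ger0_norm ?sqr_ge0//; apply: sqr_le_abs; exact: ltW.
apply: (oP_eta Z_OP)=> eta eta0.
pose eta1 := Num.min (info/2) (eta*info/8).
have e10 : 0 < eta1 by rewrite lt_min !divr_gt0// mulr_gt0.
have e1i : eta1 <= info/2 by rewrite ge_min lexx.
have e1e : eta1 <= eta*info/8 by rewrite ge_min lexx orbT.
have [r2 r20 hP] := Phi_near e10.
have /andP[hlo hhi] := hth0.
move=> c c0; have c6 : 0 < c/6 by rewrite divr_gt0.
have [l1 [r1 [l10 r10 h1]]] := scaled_likelihood_near e10 c6.
pose r := Num.min (Num.min r1 r2) (Num.min (th0-lo) (hi-th0)/2).
have gp : 0 < Num.min (th0-lo) (hi-th0) by rewrite lt_min !subr_gt0 hlo.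
have r0 : 0 < r by rewrite !lt_min r10 r20 divr_gt0// lt_min.
have rr1 : r <= r1 by rewrite /r !ge_min lexx.
have rr2 : r <= r2 by rewrite /r !ge_min lexx orbT.
have rg : r < Num.min (th0-lo) (hi-th0).
 apply: (@le_lt_trans _ _ (Num.min (th0-lo) (hi-th0)/2)); first by rewrite ge_min lexx orbT.
 by rewrite ltr_pdivrMr// mulr_natr mulr2n ltrDl.
have h2 := OP_whp_small mle_OP r0 c6.
have h3 := OP_whp_small u_star_OP r0 c6.
have [Rr R0 h4] := mle_maximizes c6.
have [l3 l30 h5] := tube_up c6.
apply: small_mono (small_and (small_and (small_and h1 h2) (small_and h3 h4)) (small_and (small_and h5 small01) (small_and (small_le_mul l3 r20) (info_near e10)))) _.
move=> eps ep [[[k1 k2] [k3 k4]] [[k5 e01] [lr hI]]].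
apply: up_to_mono (up_to_and (up_to_and (up_to_and k1 k2) (up_to_and k3 k4)) k5)=> [|w [[[p1 p2] [p3 [_ p4]]] p5]]; first lra.
have inT v : `|eps*v| <= r -> Th (th0+eps*v).
 move=> hv; move: rg; rewrite lt_min=> /andP[g1 g2]; apply: band_interval g1 g2 _.
 by rewrite addrAC subrr add0r.
have hX s : 0 <= s <= T -> `|X eps s w-x s| <= r2.
 by move=> hs; apply: le_trans lr; exact: p5.
(* The exact formula of [ll_diff] with Y replaced by the score and Phi by the discrete information;
   v = 0 is separate, since Y is only controlled off [th0]. *)
have expand v : `|eps*v| <= r -> `|ll eps (th0+eps*v) w-ll eps th0 w
  - (v*score_n eps w-v^+2/2*I_n eps)| <= eta1*(`|v| + v^+2).
 move=> hv; case: (eqVneq v 0)=> [->|v0].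
  by rewrite mulr0 addr0 subrr mul0r expr0n /= !mul0r !subr0 normr0 addr0 mulr0.
 have nth : th0+eps*v != th0 by rewrite -subr_eq0 addrAC subrr add0r mulf_neq0// gt_eqF.
 have hth := inT _ hv; have dE : th0+eps*v-th0 = eps*v by ring.
 have [_ q1] := p1 _ hth nth.
 have {}q1 : `|Y eps (th0+eps*v) w-score_n eps w| <= eta1 by apply: q1; rewrite dE (le_trans hv).
 have q2 : `|Phi eps (th0+eps*v) w-info| <= eta1.
  by apply: hP=> //; rewrite dE (le_trans hv).
 have vE : eps*v/eps = v by rewrite mulrC mulKf// gt_eqF.
 rewrite (ll_diff w e01 hth nth) dE vE.
 have q3 : `|I_n eps-Phi eps (th0+eps*v) w| <= 2*eta1.
  rewrite mulr_natl mulr2n; apply: le_trans (ler_distD info _ _) (lerD hI _).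
  by rewrite distrC.
 set y := Y _ _ _ in q1 *; set ph := Phi _ _ _ in q2 q3 *.
 rewrite [X in `|X|](_ : _ = v*(y-score_n eps w)+v^+2/2*(I_n eps-ph)); last first.
  by ring.
 apply: le_trans (ler_normD _ _) _; rewrite [leRHS]mulrDr; apply: lerD.
  by rewrite normrM mulrC; apply: ler_wpM2r.
 have v2 : 0 <= v^+2/2 by rewrite divr_ge0// sqr_ge0.
 rewrite normrM (ger0_norm v2) (_ : eta1*v^+2 = v^+2/2*(2*eta1)); last by field.
 exact: ler_wpM2l.
have uE : th0+eps*u eps w = thhat eps w by rewrite /u mulrC divfK ?gt_eqF//; ring.
have s1 := expand _ p2; have s2 := expand _ p3.
have s3 := p4 _ (inT _ p3); rewrite uE in s1.
have ip : info/2 <= I_n eps by move: hI; rewrite ler_norml=> /andP[]; lra.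
have ip0 : 0 < I_n eps by apply: lt_le_trans ip; rewrite divr_gt0.
have sE : score_n eps w = u_star eps w*I_n eps by rewrite /u_star divfK// gt_eqF.
rewrite ger0_norm ?sqr_ge0// ger0_norm; last by rewrite !addr_ge0// sqr_ge0.
move: s1 s2 s3; rewrite sE.
exact: (argmax_close eta0 info_pos e10 e1e ip).
Qed.
End Likelihood_limit.

(** * Expectations of bounded random variables *)

Section Bounded_expectation.
Context {R : realType} {d : measure_display} {Omega : measurableType d}.
Variable P : probability Omega R.
Implicit Types f g : Omega -> R.

Definition bounded_rv f : Prop := mrv f /\ exists M, forall w, `|f w| <= M.

Definition Ex f : R := \int[P]_w f w.

Lemma bounded_rv_integrable f : bounded_rv f -> P.-integrable setT (EFin \o f).
move=> [mf [M hM]]; apply: measurable_bounded_integrable=> //; first by rewrite [X in (X < _)%E](@probability_setT _ _ _ P) ltry.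
by exists M; split; [exact: num_real|move=> x /ltW Mx w _; exact: le_trans (hM w) Mx].
Qed.

Lemma bounded_rvD f g : bounded_rv f -> bounded_rv g -> bounded_rv (fun w=> f w+g w).
move=> [mf [M hM]] [mg [N hN]]; split; first exact: measurable_funD.
by exists (M+N)=> w; apply: le_trans (ler_normD _ _) _; exact: lerD.
Qed.

Lemma bounded_rvM f g : bounded_rv f -> bounded_rv g -> bounded_rv (fun w=> f w*g w).
move=> [mf [M hM]] [mg [N hN]]; split; first exact: measurable_funM.
by exists (M*N)=> w; rewrite normrM; exact: ler_pM.
Qed.

Lemma bounded_rv_cst (c : R) : bounded_rv (fun=> c).
by split; [exact: measurable_cst|exists `|c|]. Qed.

Lemma bounded_rv_comp (Y : Omega -> R) (g : R -> R) (M : R) : mrv Y -> continuous g ->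
 (forall y, `|g y| <= M) -> bounded_rv (fun w=> g (Y w)).
move=> mY cg hM; split; last by exists M.
by apply: (measurableT_comp _ mY); exact: continuous_measurable_fun.
Qed.

Lemma ExD f g : bounded_rv f -> bounded_rv g -> Ex (fun w=> f w+g w) = Ex f+Ex g.
by move=> bf bg; apply: RintegralD=> //; exact: bounded_rv_integrable. Qed.

Lemma ExZ (c : R) f : bounded_rv f -> Ex (fun w=> c*f w) = c*Ex f.
by move=> bf; apply: RintegralZl=> //; exact: bounded_rv_integrable. Qed.

Lemma ExB f g : bounded_rv f -> bounded_rv g -> Ex (fun w=> f w-g w) = Ex f-Ex g.
by move=> bf bg; apply: RintegralB=> //; exact: bounded_rv_integrable. Qed.

Lemma Ex_cst (c : R) : Ex (fun=> c) = c.
by rewrite /Ex Rintegral_cst// [X in fine X](@probability_setT _ _ _ P) /= mulr1. Qed.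

Lemma Ex_le f g : bounded_rv f -> bounded_rv g -> (forall w, f w <= g w) -> Ex f <= Ex g.
by move=> bf bg h; apply: le_Rintegral=> //; exact: bounded_rv_integrable. Qed.

Lemma bounded_rv_sum n (f : 'I_n -> Omega -> R) : (forall i, bounded_rv (f i)) ->
 bounded_rv (fun w=> \sum_(i < n) f i w).
elim: n f=> [|n IH] f bf; first by under eq_fun do rewrite big_ord0; exact: bounded_rv_cst.
under eq_fun do rewrite big_ord_recr; apply: bounded_rvD=> //; exact: IH.
Qed.

Lemma Ex_sum n (f : 'I_n -> Omega -> R) : (forall i, bounded_rv (f i)) ->
 Ex (fun w=> \sum_(i < n) f i w) = \sum_(i < n) Ex (f i).
elim: n f=> [|n IH] f bf.
 by rewrite big_ord0; under eq_fun do rewrite big_ord0; rewrite Ex_cst.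
rewrite big_ord_recr /= -IH//; under eq_fun do rewrite big_ord_recr; rewrite ExD//.
exact: bounded_rv_sum.
Qed.

Lemma Ex_abs_le f (e : R) : bounded_rv f -> (forall w, `|f w| <= e) -> `|Ex f| <= e.
move=> bf h; rewrite ler_norml -[X in X <= _ <= _]Ex_cst -[X in _ <= _ <= X]Ex_cst.
by apply/andP; split; apply: Ex_le=> //; try exact: bounded_rv_cst; move=> w; have := h w; rewrite ler_norml=> /andP[].
Qed.

Lemma ExE f : bounded_rv f -> (Ex f)%:E = (\int[P]_w (f w)%:E)%E.
by move=> bf; rewrite /Ex /Rintegral fineK// integrable_fin_num//; exact: bounded_rv_integrable. Qed.

Lemma Ex_cvg (fn : nat -> Omega -> R) f (M : R) : (forall n, mrv (fn n)) ->
 (forall n w, `|fn n w| <= M) -> mrv f ->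
 (forall w, fn n w @[n --> \oo] --> f w) -> Ex (fn n) @[n --> \oo] --> Ex f.
move=> mfn hM mf cv.
have fM w : `|f w| <= M.
 rewrite -(cvg_lim _ (cvg_norm (cv w)))//; apply: limr_le; last by near=> n; exact: hM.
 by apply/cvg_ex; eexists; exact: cvg_norm (cv w).
have bfn n : bounded_rv (fn n) by split=> //; exists M.
have bf : bounded_rv f by split=> //; exists M.
have h := @dominated_cvg _ _ _ P setT measurableT (fun n w=> (fn n w)%:E) (fun w=> (f w)%:E) (fun=> M%:E).
have {}h : (\int[P]_w (fn n w)%:E)%E @[n --> \oo] --> (\int[P]_w (f w)%:E)%E.
 apply: h=> //.
 - by move=> n; apply/measurable_EFinP.
 - by move=> w _; apply: cvg_EFin; [exact: nearW|exact: cv].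
 - exact: (bounded_rv_integrable (bounded_rv_cst M)).
 - by move=> m w _; rewrite lee_fin; exact: hM.
rewrite -(ExE bf) in h; apply: (fine_cvg (f := fun n=> (Ex (fn n))%:E)).
by under eq_fun do rewrite ExE//.
Unshelve. all: by end_near. Qed.

End Bounded_expectation.

Section Same_law.
Context {R : realType} {d d' : measure_display} {Omega : measurableType d} {Omega' : measurableType d'}.
Variables (P : probability Omega R) (P' : probability Omega' R).

Lemma Ex_same_law (Y : Omega -> R) (Y' : Omega' -> R) (g : R -> R) (M : R) :
 mrv Y -> mrv Y' -> continuous g -> (forall y, `|g y| <= M) ->
 (forall A : set R, measurable A -> P (Y @^-1` A) = P' (Y' @^-1` A)) ->
 Ex P (fun w=> g (Y w)) = Ex P' (fun w=> g (Y' w)).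
move=> mY mY' cg hM hL; apply: EFin_inj.
have b1 := bounded_rv_comp mY cg hM; have b2 := bounded_rv_comp mY' cg hM.
have mg : mrv (fun y=> (g y)%:E) by apply/measurable_EFinP; exact: continuous_measurable_fun.
rewrite !ExE// -[LHS](@integral_pushforward _ _ _ _ R Y mY P setT (fun y=> (g y)%:E))//; last exact: bounded_rv_integrable.
rewrite -[RHS](@integral_pushforward _ _ _ _ R Y' mY' P' setT (fun y=> (g y)%:E))//; last exact: bounded_rv_integrable.
by apply: eq_measure_integral=> A mA _; exact: hL.
Qed.

End Same_law.

(** * Polynomial approximation, cosine powers and cut-offs *)

Section Bernstein.
Context {R : realType}.

                                                                                
(** The mean of phi(k) for k binomial with parameters n and u, as a polynomial in u, defined by
    conditioning on one trial. *)
Fixpoint bernstein (n : nat) (phi : nat -> R) : {poly R} :=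
 if n is m.+1 then 'X*bernstein m (fun k=> phi k.+1)+(1 - 'X)*bernstein m phi
 else (phi 0%N)%:P.

Lemma bernsteinS n phi u : (bernstein n.+1 phi).[u] =
 u*(bernstein n (fun k=> phi k.+1)).[u]+(1-u)*(bernstein n phi).[u].
by rewrite /= !hornerE. Qed.

Lemma bernstein_le n phi psi u : 0 <= u <= 1 -> (forall k, (k <= n)%N -> phi k <= psi k) ->
 (bernstein n phi).[u] <= (bernstein n psi).[u].
move=> /andP[u0 u1]; elim: n phi psi=> [|n IH] phi psi h; first by rewrite /= !hornerC; exact: h.
rewrite !bernsteinS; apply: lerD; apply: ler_wpM2l; rewrite ?subr_ge0//; apply: IH=> k kn; apply: h=> //.
exact: leqW.
Qed.

(** The second moment of the binomial law about an arbitrary point a. *)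
Lemma bernstein_affine n u c e (a : R) :
 (bernstein n (fun k=> c+e*(k%:R-a)^+2)).[u] = c+e*((n%:R*u-a)^+2+n%:R*(u*(1-u))).
elim: n a=> [|n IH] a; first by rewrite /= hornerC !mul0r addr0.
rewrite bernsteinS IH.
have -> : (fun k=> c+e*(k.+1%:R-a)^+2) = (fun k=> c+e*(k%:R-(a-1))^+2).
 by apply/funext=> k; rewrite -natr1; congr (_ + _*_^+2); ring.
by rewrite IH -natr1; ring.
Qed.

(** Chebyshev's argument: g(k/n) differs from g(u) by e/2 + c (k/n - u)^2, the second term covering
    the distant k, and the binomial variance makes its mean at most c/(4n). *)
Lemma weierstrass (g : R -> R) e : continuous g -> 0 < e ->
 exists p : {poly R}, forall u, 0 <= u <= 1 -> `|p.[u]-g u| <= e.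
move=> cg e0; have e2 : 0 < e/2 by rewrite divr_gt0.
have [r r0 hr] := heine_itv 1 cg e2.
have [M hM] : exists M, forall y, 0 <= y <= 1 -> `|g y| <= M.
 have cag : {within `[0, 1], continuous (fun y=> `|g y|)}.
  by apply: continuous_subspaceT; exact: contA.
 by have [y0 _ hy0] := EVT_max ler01 cag; exists `|g y0| => y hy; apply: hy0; rewrite in_itv.
have M0 : 0 <= M by apply: (le_trans (normr_ge0 _) (hM 0 _)); rewrite lexx ler01.
pose c := 2*M/r^+2.
have c0 : 0 <= c by rewrite divr_ge0 ?sqr_ge0// mulr_ge0.
pose n := (Num.truncn (c/e)).+1.
have n0 : 0 < n%:R :> R by rewrite ltr0n.
have cn : c <= n%:R*e.
 by rewrite -ler_pdivrMr// ltW// truncnS_gt.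
exists (bernstein n (fun k=> g (k%:R/n%:R)))=> u hu.
have close k : (k <= n)%N -> `|g (k%:R/n%:R)-g u| <= e/2+c*(k%:R/n%:R-u)^+2.
 move=> kn; have hk : 0 <= (k%:R/n%:R : R) <= 1.
  by rewrite divr_ge0//= ler_pdivrMr// mul1r ler_nat.
 case: (leP `|k%:R/n%:R-u| r)=> h.
  by apply: le_trans (hr _ _ hk hu h) _; rewrite lerDl mulr_ge0// sqr_ge0.
 have : 2*M <= c*(k%:R/n%:R-u)^+2.
  rewrite /c mulrAC ler_pdivlMr ?exprn_gt0//; apply: ler_wpM2l; first exact: mulr_ge0.
  by rewrite -[leRHS]real_normK ?num_real// lerXn2r ?nnegrE// ltW.
 by have := ler_normB (g (k%:R/n%:R)) (g u); have := hM _ hk; have := hM _ hu; lra.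
have E (v a : R) : (bernstein n (fun k=> v+a*(k%:R/n%:R-u)^+2)).[u] = v+a/n%:R*(u*(1-u)).
 have -> : (fun k=> v+a*(k%:R/n%:R-u)^+2) = (fun k=> v+a/n%:R^+2*(k%:R-n%:R*u)^+2).
  by apply/funext=> k; field; rewrite gt_eqF.
 rewrite bernstein_affine subrr expr0n /= add0r.
 by move: (n%:R : R) n0=> N N0; field; rewrite gt_eqF.
have bd : c/n%:R*(u*(1-u)) <= e/2.
 have h1 : c/n%:R <= e by rewrite ler_pdivrMr// mulrC.
 have h2 : u*(1-u) <= 1/4 by have := sqr_ge0 (u-1/2); lra.
 have h3 : 0 <= u*(1-u) by case/andP: hu=> u0 u1; rewrite mulr_ge0// subr_ge0.
 have h4 : 0 <= c/n%:R by pos.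
 have := ler_pM h4 h3 h1 h2; lra.
have up := @bernstein_le n (fun k=> g (k%:R/n%:R)) (fun k=> (g u+e/2)+c*(k%:R/n%:R-u)^+2) u hu.
have lo := @bernstein_le n (fun k=> (g u-e/2)+(- c)*(k%:R/n%:R-u)^+2) (fun k=> g (k%:R/n%:R)) u hu.
rewrite E in up; rewrite E in lo.
have {}up : (bernstein n (fun k=> g (k%:R/n%:R))).[u] <= g u+e/2+c/n%:R*(u*(1-u)).
 by apply: up=> k /close; rewrite ler_norml=> /andP[_]; lra.
have {}lo : g u-e/2 + - c/n%:R*(u*(1-u)) <= (bernstein n (fun k=> g (k%:R/n%:R))).[u].
 by apply: lo=> k /close; rewrite ler_norml=> /andP[+ _]; lra.
by rewrite ler_norml; apply/andP; split; lra.
Qed.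

End Bernstein.

Section Gaussian_limit.
Context {R : realType}.

Lemma derive_sequence (f : R -> R) (df : R) (u : nat -> R) : is_derive (0 : R) 1 f df ->
 (forall m, u m != 0) -> u m @[m --> \oo] --> (0 : R) ->
 (f (u m)-f 0)/u m @[m --> \oo] --> df.
move=> [dv dE] u0 cu.
have := dv; rewrite /derivable=> /cvg_ex[l hl].
have ldf : l = df by rewrite -dE; apply/esym/cvg_lim.
rewrite {}ldf in hl; apply/cvgrPdist_le=> e e0.
move/cvgrPdist_le/(_ e e0): hl; rewrite /= near_withinE=> /nbhs_ballP[r /= r0 hr].
have /cvgrPdist_lt/(_ _ r0) := cu; apply: filterS=> m hm.
have := hr (u m) hm (u0 m); rewrite scaler1 addr0=> H.
by rewrite mulrC; exact: H.
Qed.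

Lemma expr_dist (a b : R) n : `|a| <= 1 -> `|b| <= 1 -> `|a^+n-b^+n| <= n%:R * `|a-b|.
move=> a1 b1; elim: n=> [|n IH]; first by rewrite !expr0 subrr normr0 mul0r.
rewrite !exprS (_ : _ - _ = a*(a^+n-b^+n)+(a-b)*b^+n); last by ring.
apply: le_trans (ler_normD _ _) _; rewrite -natr1 [leRHS]mulrDl mul1r !normrM; apply: lerD.
 by apply: le_trans IH; rewrite ler_piMl.
by rewrite ler_piMr// normrX exprn_ile1.
Qed.

Lemma cvg_prod_ord n (F : 'I_n -> nat -> R) (l : 'I_n -> R) : (forall k, F k m @[m --> \oo] --> l k) ->
 \prod_(k < n) F k m @[m --> \oo] --> \prod_(k < n) l k.
elim: n F l=> [|n IH] F l h.
 by rewrite big_ord0; under eq_fun do rewrite big_ord0; exact: cvg_cst.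
rewrite big_ord_recr /=; under eq_fun do rewrite big_ord_recr /=.
by apply: cvgM; [apply: IH=> k; exact: h|exact: h].
Qed.

(** With y = x/sqrt(m+1), cos y and exp(-y^2/2) have the same coefficient -1/2 at order y^2, so they
    differ by o(y^2); raising numbers in [-1, 1] to the power m+1 multiplies the difference by at
    most m+1 = x^2/y^2. *)
Lemma cos_pow_gaussian (x : R) :
 cos (x/Num.sqrt m.+1%:R)^+m.+1 @[m --> \oo] --> expR (- (x^+2/2)).
case: (eqVneq x 0)=> [->|x0].
 rewrite expr0n /= mul0r oppr0 expR0; under eq_fun do rewrite mul0r cos0 expr1n.
 exact: cvg_cst.
pose y m : R := x/Num.sqrt m.+1%:R.
have y0 m : y m != 0 by rewrite mulf_neq0// invr_neq0// gt_eqF.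
have y2 m : m.+1%:R*y m^+2 = x^+2.
 rewrite /y expr_div_n sqr_sqrtr ?ler0n// mulrCA divff ?mulr1// pnatr_eq0//.
have cy : y m @[m --> \oo] --> (0 : R).
 apply/cvgrPdist_le=> e e0; near=> m; rewrite sub0r normrN.
 apply: sqr_le_abs; first exact: ltW.
 rewrite -(ler_pM2l (_ : 0 < m.+1%:R :> R)) ?ltr0n// y2 -ler_pdivrMr ?exprn_gt0//.
 apply: le_trans (_ : m%:R <= _); last by rewrite ler_nat.
 by near: m; exact: nbhs_infty_ger.
have cy2 : y m/2 @[m --> \oo] --> (0 : R) by rewrite -(mul0r 2^-1); apply: cvgM=> //; exact: cvg_cst.
have h1 : (cos (y m)-1)/y m^+2 @[m --> \oo] --> - (1/2 : R).
 have two : 2 != 0 :> R by pos.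
 have hs : is_derive (0 : R) 1 sin 1 by rewrite -[X in is_derive _ _ _ X]cos0; exact: is_derive_sin.
 have := derive_sequence hs (fun m=> mulf_neq0 (y0 m) (invr_neq0 two)) cy2.
 rewrite sin0=> h.
 have h' : - (1/2)*((sin (y m/2)-0)/(y m/2))*((sin (y m/2)-0)/(y m/2)) @[m --> \oo] --> - (1/2 : R)*1*1.
  by apply: cvgM=> //; apply: cvgM=> //; exact: cvg_cst.
 rewrite !mulr1 in h'; apply: cvg_trans h'; apply: near_eq_cvg; apply: nearW=> m /=.
 have -> : cos (y m) = 1-2*sin (y m/2)^+2.
  have c2 := cos2Dsin2 (y m/2); have -> : cos (y m) = cos (y m/2)^+2-sin (y m/2)^+2.
   by rewrite !expr2 -cosD -splitr.
  by move: c2; lra.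
 by rewrite subr0; field; rewrite y0.
have h2 : (expR (- (y m^+2/2))-1)/y m^+2 @[m --> \oo] --> - (1/2 : R).
 have hs : is_derive (0 : R) 1 expR 1 by rewrite -[X in is_derive _ _ _ X]expR0; exact: is_derive_expR.
 have n0 m : - (y m^+2/2) != 0 by rewrite oppr_eq0 mulf_neq0// expf_neq0.
 have c0 : - (y m^+2/2) @[m --> \oo] --> (0 : R).
  rewrite -oppr0 -(mul0r (2^-1 : R)) -(mul0r (0 : R)); apply: cvgN; apply: cvgM; last exact: cvg_cst.
  by under eq_fun do rewrite expr2; exact: cvgM.
 have := derive_sequence hs n0 c0; rewrite expR0=> h.
 have h' : - (1/2)*((expR (- (y m^+2/2))-1) / - (y m^+2/2)) @[m --> \oo] --> - (1/2 : R)*1.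
  by apply: cvgM=> //; exact: cvg_cst.
 rewrite mulr1 in h'; apply: cvg_trans h'; apply: near_eq_cvg; apply: nearW=> m /=.
 by field; rewrite y0.
apply/cvgrPdist_le=> e e0.
have h3 : (cos (y m)-1)/y m^+2-(expR (- (y m^+2/2))-1)/y m^+2 @[m --> \oo] --> (0 : R).
 by rewrite -(subrr (- (1/2 : R))); exact: cvgB.
have e1 : 0 < e/x^+2 by rewrite divr_gt0// exprn_even_gt0.
have /cvgrPdist_le/(_ _ e1) := h3; apply: filterS=> m; rewrite sub0r normrN -mulrBl.
set c := cos _; set b := expR _=> hm.
have bE : expR (- (x^+2/2)) = b^+m.+1.
 rewrite /b -expRM_natl -(y2 m); congr expR; rewrite -mulr_natl; ring.
rewrite bE distrC.
have c1 : `|c| <= 1 by rewrite ler_norml cos_geN1 cos_le1.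
have b1 : `|b| <= 1.
 by rewrite ger0_norm ?expR_ge0// -expR0 ler_expR oppr_le0 divr_ge0// sqr_ge0.
apply: le_trans (expr_dist m.+1 c1 b1) _.
have yp : 0 < y m^+2 by rewrite exprn_even_gt0//= y0.
have cb : c-1-(b-1) = c-b by ring.
move: hm; rewrite cb.
rewrite normrM normfV (gtr0_norm yp) ler_pdivrMr// => hm.
apply: le_trans (ler_wpM2l (ler0n _ _) hm) _.
by rewrite mulrCA y2 divfK// expf_neq0.
Unshelve. all: by end_near. Qed.

End Gaussian_limit.

Section Cutoff.
Context {R : realType}.

Definition pospart (z : R) : R := (z+`|z|)/2.

Lemma pospart_ge0 z : 0 <= pospart z.
by have := ler_norm (- z); rewrite normrN /pospart; lra. Qed.

Lemma pospart_id z : 0 <= z -> pospart z = z.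
by move=> z0; rewrite /pospart ger0_norm//; lra. Qed.

Lemma pospart_eq0 z : z <= 0 -> pospart z = 0.
by move=> z0; rewrite /pospart ler0_norm//; lra. Qed.

Lemma cont_pospart (U : topologicalType) (g : U -> R) : continuous g -> continuous (fun u=> pospart (g u)).
move=> cg; apply: contM; last exact: cst_continuous.
by apply: contD=> //; exact: contA.
Qed.

(** Piecewise linear: 1 up to N, 0 from N + 1 on. *)
Definition cutoff (N q : R) : R := 1-pospart (1-pospart (N+1-q)).

Lemma cutoff_itv N q : 0 <= cutoff N q <= 1.
have p := pospart_ge0 (N+1-q); have p' := pospart_ge0 (1-pospart (N+1-q)).
rewrite /cutoff; case: (leP (pospart (N+1-q)) 1)=> h.
 by rewrite (pospart_id (_ : 0 <= 1 - _)); lra.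
by rewrite (pospart_eq0 (_ : 1 - _ <= 0)); lra.
Qed.

Lemma cutoff1 N q : q <= N -> cutoff N q = 1.
by move=> h; rewrite /cutoff [pospart (_ - q)]pospart_id ?[pospart _]pospart_eq0; lra. Qed.

Lemma cutoff0 N q : N+1 <= q -> cutoff N q = 0.
by move=> h; rewrite /cutoff [pospart (_ - q)]pospart_eq0 ?[pospart _]pospart_id; lra. Qed.

Lemma cutoff_continuous N : continuous (cutoff N).
apply: contB; first exact: cst_continuous.
apply: cont_pospart; apply: contB; first exact: cst_continuous.
by apply: cont_pospart; apply: contB; [exact: cst_continuous|move=> q; exact: cvg_id].
Qed.

End Cutoff.

(** * Cosines of linear forms determine the law of a diagonal quadratic form *)

Section Laplace.
Context {R : realType} {d d' : measure_display} {Omega : measurableType d} {Omega' : measurableType d'}.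
Variables (P : probability Omega R) (P' : probability Omega' R) (n : nat).
Variables (Z : nat -> Omega -> R) (Z' : nat -> Omega' -> R).
Hypothesis mZ : forall k, (k < n)%N -> mrv (Z k).
Hypothesis mZ' : forall k, (k < n)%N -> mrv (Z' k).
Hypothesis cosZ : forall a : nat -> R, Ex P (fun w=> cos (\sum_(k < n) a k*Z k w)) =
 Ex P' (fun w=> cos (\sum_(k < n) a k*Z' k w)).

Let cos1 (y : R) : `|cos y| <= 1. by rewrite ler_norml cos_geN1 cos_le1. Qed.

Let bcos {d0} {O : measurableType d0} (Q : probability O R) (V : nat -> O -> R) a :
 (forall k, (k < n)%N -> mrv (V k)) ->
 bounded_rv (fun w=> cos (\sum_(k < n) a k*V k w)).
move=> mV; apply: (@bounded_rv_comp _ _ _ _ cos 1)=> //; last exact: continuous_cos.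
by apply: measurable_sum=> -[k kn]; apply: measurable_funM=> //; exact: mV.
Qed.

Let bprod {d0} {O : measurableType d0} (Q : probability O R) (V : nat -> O -> R) (s : seq (nat -> R)) :
 (forall k, (k < n)%N -> mrv (V k)) ->
 bounded_rv (fun w=> \prod_(c <- s) cos (\sum_(k < n) c k*V k w)).
move=> mV; elim: s=> [|c s IH].
 by under eq_fun do rewrite big_nil; exact: bounded_rv_cst.
by under eq_fun do rewrite big_cons; apply: bounded_rvM=> //; exact: bcos.
Qed.

                                                                              
(** Product-to-sum formulas reduce a product of cosines of linear forms to single cosines; the free
    form [a] makes the induction pass. *)
Lemma Ex_prod_cos (s : seq (nat -> R)) (a : nat -> R) :
 Ex P (fun w=> cos (\sum_(k < n) a k*Z k w)*\prod_(c <- s) cos (\sum_(k < n) c k*Z k w)) =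
 Ex P' (fun w=> cos (\sum_(k < n) a k*Z' k w)*\prod_(c <- s) cos (\sum_(k < n) c k*Z' k w)).
elim: s a=> [|c s IH] a.
 by under [in LHS]eq_fun do rewrite big_nil mulr1; under [in RHS]eq_fun do rewrite big_nil mulr1.
have key d0 (O : measurableType d0) (Q : probability O R) (V : nat -> O -> R) :
  (forall k, (k < n)%N -> mrv (V k)) ->
  Ex Q (fun w=> cos (\sum_(k < n) a k*V k w)*\prod_(c <- c :: s) cos (\sum_(k < n) c k*V k w)) =
  2^-1*(Ex Q (fun w=> cos (\sum_(k < n) (a k+c k)*V k w)*\prod_(c <- s) cos (\sum_(k < n) c k*V k w)) +
   Ex Q (fun w=> cos (\sum_(k < n) (a k-c k)*V k w)*\prod_(c <- s) cos (\sum_(k < n) c k*V k w))).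
 move=> mV.
 have b1 := bounded_rvM (bcos Q (fun k=> a k+c k) mV) (bprod Q s mV).
 have b2 := bounded_rvM (bcos Q (fun k=> a k-c k) mV) (bprod Q s mV).
 rewrite -ExD// -ExZ; last exact: bounded_rvD.
 congr Ex; apply/funext=> w; rewrite big_cons.
 have -> : \sum_(k < n) (a k+c k)*V k w = \sum_(k < n) a k*V k w + \sum_(k < n) c k*V k w.
  by rewrite -big_split; apply: eq_bigr=> k _; rewrite mulrDl.
 have -> : \sum_(k < n) (a k-c k)*V k w = \sum_(k < n) a k*V k w - \sum_(k < n) c k*V k w.
  by rewrite -sumrB; apply: eq_bigr=> k _; rewrite mulrBl.
 by rewrite cosD cosB; field.
by rewrite !key// (IH (fun k=> a k+c k)) (IH (fun k=> a k-c k)).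
Qed.


(** For each coordinate j, m+1 copies of the form sqrt(2 c_j) Z_j/sqrt(m+1). By [cos_pow_gaussian]
    the product of their cosines tends to exp(-sum c_j Z_j^2). *)
Let laplace_seq (c : nat -> R) m : seq (nat -> R) := flatten
 [seq nseq m.+1 (fun k=> if k == j then Num.sqrt (2*c j)/Num.sqrt m.+1%:R else 0) | j <- iota 0 n].

Let laplace_seqE c m (V : nat -> R) :
 \prod_(a <- laplace_seq c m) cos (\sum_(k < n) a k*V k) =
 \prod_(k < n) cos (Num.sqrt (2*c k)*V k/Num.sqrt m.+1%:R)^+m.+1.
rewrite /laplace_seq big_flatten big_map -{1}[n]subn0 -/(index_iota 0 n) big_mkord.
apply: eq_bigr=> j _; rewrite big_nseq iter_mulr_1; congr (cos _^+_).
rewrite (bigD1 j)//= eqxx big1 ?addr0; first by rewrite mulrAC.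
by move=> k kj; rewrite (_ : (k == j :> nat) = false) ?mul0r//; apply/negbTE.
Qed.

Lemma Ex_laplace (c : nat -> R) : (forall k, 0 <= c k) ->
 Ex P (fun w=> expR (- \sum_(k < n) c k*Z k w^+2)) =
 Ex P' (fun w=> expR (- \sum_(k < n) c k*Z' k w^+2)).
move=> c0.
have key d0 (O : measurableType d0) (Q : probability O R) (V : nat -> O -> R) :
  (forall k, (k < n)%N -> mrv (V k)) ->
  Ex Q (fun w=> \prod_(a <- laplace_seq c m) cos (\sum_(k < n) a k*V k w)) @[m --> \oo] -->
  Ex Q (fun w=> expR (- \sum_(k < n) c k*V k w^+2)).
 move=> mV; apply: (@Ex_cvg _ _ _ Q _ _ 1).
 - by move=> m; have [] := bprod Q (laplace_seq c m) mV.
 - move=> m w; elim: (laplace_seq c m)=> [|a s IH]; first by rewrite big_nil normr1.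
  by rewrite big_cons normrM mulr_ile1.
 - apply: measurableT_comp=> //; apply: measurableT_comp=> //; apply: measurable_sum=> -[k kn].
  by apply: measurable_funM=> //; apply: measurable_funX; exact: mV.
 - move=> w; rewrite (_ : (fun m=> _) = (fun m=> \prod_(k < n) cos (Num.sqrt (2*c k)*V k w/Num.sqrt m.+1%:R)^+m.+1)); last first.
   by apply/funext=> m; exact: (laplace_seqE c m (fun k=> V k w)).
    rewrite -sumrN expR_sum; apply: cvg_prod_ord=> k.
  have := @cos_pow_gaussian R (Num.sqrt (2*c k)*V k w).
  rewrite exprMn sqr_sqrtr ?mulr_ge0// (_ : 2*c k*V k w^+2/2 = c k*V k w^+2)//.
  by field.
have h1 := key _ _ P Z mZ; have h2 := key _ _ P' Z' mZ'.
have E m : Ex P (fun w=> \prod_(a <- laplace_seq c m) cos (\sum_(k < n) a k*Z k w)) =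
  Ex P' (fun w=> \prod_(a <- laplace_seq c m) cos (\sum_(k < n) a k*Z' k w)).
 have := Ex_prod_cos (laplace_seq c m) (fun=> 0).
 have z0 (V : nat -> R) : cos (\sum_(k < n) 0*V k) = 1 :> R.
  by rewrite big1 ?cos0// => k _; rewrite mul0r.
 have zE d0 (O : measurableType d0) (V : nat -> O -> R) :
   (fun w=> cos (\sum_(k < n) 0*V k w)*\prod_(a <- laplace_seq c m) cos (\sum_(k < n) a k*V k w)) =
   (fun w=> \prod_(a <- laplace_seq c m) cos (\sum_(k < n) a k*V k w)).
  by apply/funext=> w; rewrite (z0 (fun k=> V k w)) mul1r.
 by rewrite !zE.
rewrite -(cvg_lim _ h1)//; under eq_fun do rewrite E.
exact: cvg_lim h2.
Qed.

                                                                              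
                                                            
(** The Laplace transform of the form Q at integer multiples gives the means of all polynomials in
    exp(-Q). Weierstrass on [0, 1] then gives the functions that vanish for large Q, and the cut-off
    is removed by dominated convergence. *)
Theorem quadratic_same_law (c : nat -> R) (f : R -> R) (M : R) : (forall k, 0 <= c k) ->
 continuous f -> (forall x, `|f x| <= M) ->
 Ex P (fun w=> f (\sum_(k < n) c k*Z k w^+2)) =
 Ex P' (fun w=> f (\sum_(k < n) c k*Z' k w^+2)).
move=> c0 cf fM; have M0 : 0 <= M by exact: le_trans (fM 0).
pose fN (N : nat) q := f q*cutoff N%:R q.
have fNM N q : `|fN N q| <= M.
 by have /andP[a0 a1] := cutoff_itv N%:R q; rewrite normrM (ger0_norm a0) -[leRHS]mulr1; apply: ler_pM.
have cfN N : continuous (fN N) by apply: contM=> //; exact: cutoff_continuous.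
(* The cut-off function read in the variable u = exp(-q). The maximum of u with exp(-(N+2)) keeps
   the logarithm continuous at u = 0 and only acts where [fN] is zero. *)
pose g N u := fN N (- ln ((u+expR (- (N%:R+2))+`|u-expR (- (N%:R+2))|)/2)).
have cg N : continuous (g N).
 have cm : continuous (fun u : R=> (u+expR (- (N%:R+2))+`|u-expR (- (N%:R+2))|)/2).
  apply: contM; last exact: cst_continuous.
  have ci : continuous (fun u : R=> u) by move=> u; exact: cvg_id.
  by apply: contD; [apply: contD=> //; exact: cst_continuous|apply: contA; apply: contB=> //; exact: cst_continuous].
 have cl : continuous (fun u : R=> ln ((u+expR (- (N%:R+2))+`|u-expR (- (N%:R+2))|)/2)).
  move=> u; apply: continuous_comp; [exact: cm|apply: continuous_ln].
  have := expR_gt0 (- (N%:R+2) : R); have := ler_norm (- (u-expR (- (N%:R+2)))); rewrite normrN; lra.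
 by apply: (cont_comp (contN cl)).
have gE N q : 0 <= q -> g N (expR (- q)) = fN N q.
 move=> q0; rewrite /g; case: (leP q (N%:R+2))=> h.
  rewrite ger0_norm; last by rewrite subr_ge0 ler_expR lerN2.
  rewrite (_ : (_ + _)/2 = expR (- q)); last by field.
  by rewrite expRK opprK.
 rewrite ltr0_norm; last by rewrite subr_lt0 ltr_expR ltrN2.
 rewrite (_ : (_ + _)/2 = expR (- (N%:R+2))); last by field.
 by rewrite expRK opprK /fN !cutoff0 ?mulr0//; lra.
have mQ d0 (O : measurableType d0) (V : nat -> O -> R) (c' : nat -> R) : (forall k, (k < n)%N -> mrv (V k)) ->
  mrv (fun w=> \sum_(k < n) c' k*V k w^+2).
 move=> mV; apply: measurable_sum=> -[k kn].
 by apply: measurable_funM=> //; apply: measurable_funX; exact: mV.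
have Q0 d0 (O : measurableType d0) (V : nat -> O -> R) w : 0 <= \sum_(k < n) c k*V k w^+2.
 by apply: sumr_ge0=> k _; rewrite mulr_ge0// sqr_ge0.
have bexp d0 (O : measurableType d0) (V : nat -> O -> R) (i : nat) : (forall k, (k < n)%N -> mrv (V k)) ->
  bounded_rv (fun w=> expR (- \sum_(k < n) c k*V k w^+2)^+i).
 move=> mV; split.
  apply: measurable_funX; apply: measurableT_comp=> //; apply: measurableT_comp=> //; exact: mQ.
 by exists 1=> w; rewrite ger0_norm ?exprn_ge0 ?expR_ge0// exprn_ile1 ?expR_ge0// -expR0 ler_expR oppr_le0 Q0.
have poly_eq (p : {poly R}) : Ex P (fun w=> p.[expR (- \sum_(k < n) c k*Z k w^+2)]) =
  Ex P' (fun w=> p.[expR (- \sum_(k < n) c k*Z' k w^+2)]).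
 have key d0 (O : measurableType d0) (Q : probability O R) (V : nat -> O -> R) :
   (forall k, (k < n)%N -> mrv (V k)) ->
   Ex Q (fun w=> p.[expR (- \sum_(k < n) c k*V k w^+2)]) =
   \sum_(i < size p) p`_i*Ex Q (fun w=> expR (- \sum_(k < n) (i%:R*c k)*V k w^+2)).
  move=> mV; under eq_fun do rewrite horner_coef.
  rewrite Ex_sum; last by move=> i; apply: bounded_rvM; [exact: bounded_rv_cst|exact: bexp].
  apply: eq_bigr=> i _; rewrite ExZ; last exact: bexp.
  congr (_*Ex _ _); apply/funext=> w; rewrite -expRM_natl; congr expR.
  by rewrite mulrN mulr_sumr; congr (- _); apply: eq_bigr=> k _; rewrite mulrA.
 rewrite !key//; apply: eq_bigr=> i _; congr (_*_).
 by apply: (Ex_laplace (c := fun k=> i%:R*c k))=> k; rewrite mulr_ge0.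
have gN_eq N : Ex P (fun w=> fN N (\sum_(k < n) c k*Z k w^+2)) = Ex P' (fun w=> fN N (\sum_(k < n) c k*Z' k w^+2)).
 have close e : 0 < e -> `|Ex P (fun w=> fN N (\sum_(k < n) c k*Z k w^+2))-Ex P' (fun w=> fN N (\sum_(k < n) c k*Z' k w^+2))| <= e+e.
  move=> e0; have [p hp] := weierstrass (cg N) e0.
  have key d0 (O : measurableType d0) (Q : probability O R) (V : nat -> O -> R) :
   (forall k, (k < n)%N -> mrv (V k)) ->
   `|Ex Q (fun w=> fN N (\sum_(k < n) c k*V k w^+2))-Ex Q (fun w=> p.[expR (- \sum_(k < n) c k*V k w^+2)])| <= e.
   move=> mV; have b1 : bounded_rv (fun w=> fN N (\sum_(k < n) c k*V k w^+2)).
    by apply: (bounded_rv_comp (M := M))=> //; exact: mQ.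
   have b2 : bounded_rv (fun w=> p.[expR (- \sum_(k < n) c k*V k w^+2)]).
    under eq_fun do rewrite horner_coef; apply: bounded_rv_sum=> i.
    by apply: bounded_rvM; [exact: bounded_rv_cst|exact: bexp].
   rewrite -ExB//; apply: Ex_abs_le; first by split; [apply: measurable_funB; [case: b1|case: b2]|
    case: b1=> _ [M1 h1]; case: b2=> _ [M2 h2]; exists (M1+M2)=> w; apply: le_trans (ler_normB _ _) _; exact: lerD].
   move=> w; rewrite -(gE N) ?Q0// distrC; apply: hp; rewrite expR_ge0/=.
   by rewrite -expR0 ler_expR oppr_le0 Q0.
  have k1 := key _ _ P Z mZ; have k2 := key _ _ P' Z' mZ'; rewrite poly_eq in k1.
  by apply: le_trans (ler_distD _ _ _) (lerD k1 _); rewrite distrC.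
 apply/eqP; rewrite -subr_eq0 -normr_le0; apply/ler_addgt0Pl=> e e0; rewrite addr0.
 by rewrite [leRHS]splitr; apply: close; rewrite divr_gt0.
have key d0 (O : measurableType d0) (Q : probability O R) (V : nat -> O -> R) :
  (forall k, (k < n)%N -> mrv (V k)) ->
  Ex Q (fun w=> fN N (\sum_(k < n) c k*V k w^+2)) @[N --> \oo] --> Ex Q (fun w=> f (\sum_(k < n) c k*V k w^+2)).
 move=> mV; apply: (@Ex_cvg _ _ _ Q _ _ M)=> //.
 - by move=> N; apply: (measurableT_comp _ (mQ _ _ V c mV)); exact: continuous_measurable_fun.
 - by apply: (measurableT_comp _ (mQ _ _ V c mV)); exact: continuous_measurable_fun.
 - move=> w; apply: cvg_near_cst; near=> N; rewrite /fN cutoff1 ?mulr1//.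
  by near: N; exact: nbhs_infty_ger.
have h1 := key _ _ P Z mZ; have h2 := key _ _ P' Z' mZ'.
rewrite -(cvg_lim _ h1)//; under eq_fun do rewrite gN_eq.
exact: cvg_lim h2.
Unshelve. all: by end_near. Qed.

End Laplace.

Lemma eq_opp0 {R : realFieldType} (z : R) : z = - z -> z = 0.
lra. Qed.

(** * Gaussian cosines from the bridge and the Wiener process *)

Section Bridge.
Context {R : realType} {d' : measure_display} {Omega' : measurableType d'}.
Variables (P' : probability Omega' R) (B : R -> Omega' -> R).
Hypothesis hB : brownian_bridge P' B.

Let half : 0 <= (1/2 : R) <= 1. by rewrite divr_ge0//= ler_pdivrMr// mul1r ler1n. Qed.

Lemma bridge_measurable s : 0 <= s <= 1 -> mrv (B s).
by case: hB=> h _ _; exact: h. Qed.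

Let mbeta : mrv (B (1/2)). exact: bridge_measurable. Qed.

Let beta_law (c : R) (A : set R) : measurable A ->
 P' ((fun w=> c*B (1/2) w) @^-1` A) = centered_gaussian (c^+2/4) A.
move=> mA; have [_ _ /(_ 1%N (fun=> 1/2) (fun=> c) (fun=> half) A mA)] := hB.
under eq_fun do rewrite big_ord1; move=> ->; rewrite !big_ord1 minxx; congr (centered_gaussian _ _).
by field.
Qed.

(** The characteristic function of the centred normal law of variance v, realised by the bridge at
    time 1/2, whose variance is 1/4. It is used only through its multiplicativity, so its explicit
    form never enters. *)
Definition gauss_cos (v : R) : R := Ex P' (fun w=> cos (2*Num.sqrt v*B (1/2) w)).

Let cos1 (y : R) : `|cos y| <= 1. by rewrite ler_norml cos_geN1 cos_le1. Qed.
Let sin1 (y : R) : `|sin y| <= 1. by rewrite ler_norml sin_geN1 sin_le1. Qed.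
Let ci : continuous (fun z : R=> z). by move=> z; exact: cvg_id. Qed.

Lemma bridge_cos (n : nat) (s c : 'I_n -> R) : (forall i, 0 <= s i <= 1) ->
 0 <= \sum_(i < n) \sum_(j < n) c i*c j*(Num.min (s i) (s j)-s i*s j) ->
 Ex P' (fun w=> cos (\sum_(i < n) c i*B (s i) w)) =
 gauss_cos (\sum_(i < n) \sum_(j < n) c i*c j*(Num.min (s i) (s j)-s i*s j)).
move=> hs; set v := (X in 0 <= X)=> v0.
apply: (@Ex_same_law _ _ _ _ _ P' P' _ (fun w=> 2*Num.sqrt v*B (1/2) w) cos 1)=> //.
- by apply: measurable_sum=> i; apply: measurable_funM=> //; exact: bridge_measurable.
- exact: measurable_funM.
- exact: continuous_cos.
- move=> A mA; have [_ _ /(_ n s c hs A mA) ->] := hB.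
 rewrite (beta_law _ mA) exprMn (sqr_sqrtr v0) (_ : 2^+2*v/4 = v); [reflexivity|by field].
Qed.

Let normal_beta (s : R) (A : set R) : 0 < s -> measurable A ->
 normal_prob 0 s A = P' ((fun w=> 2*s*B (1/2) w) @^-1` A).
move=> s0 mA; rewrite (beta_law _ mA) /centered_gaussian (_ : (2*s)^+2/4 = s^+2); last by field.
have -> : (s^+2 == 0) = false by rewrite gt_eqF// exprn_gt0.
rewrite sqrtr_sqr (gtr0_norm s0); reflexivity.
Qed.

(** The law of c B(1/2) depends on c only through c^2, by the definition of a bridge; every centred
    normal law is of this form. *)
Lemma bridge_normal_sym (s : R) : 0 < s -> forall A : set R, measurable A ->
 normal_prob 0 s (-%R @^-1` A) = normal_prob 0 s A.
move=> s0 A mA.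
have mNA : measurable (-%R @^-1` A : set (measurableTypeR R)).
 by rewrite -[X in measurable X]setTI; exact: (oppr_measurable measurableT mA).
rewrite [LHS](normal_beta s0 mNA) -[LHS]/(P' ((fun w=> - (2*s*B (1/2) w)) @^-1` A)).
rewrite [RHS](normal_beta s0 mA) (beta_law _ mA).
have -> : (fun w=> - (2*s*B (1/2) w)) = (fun w=> (- (2*s))*B (1/2) w).
 by apply/funext=> w; rewrite mulNr.
rewrite (beta_law _ mA) sqrrN; reflexivity.
Qed.

Let mid : mrv (fun z : measurableTypeR R=> z : R). exact: measurable_id. Qed.

Lemma normal_cos (b s : R) : 0 < s ->
 Ex (normal_prob 0 s) (fun z=> cos (b*z)) = gauss_cos (b^+2*s^+2).
move=> s0; have cb : continuous (fun z : R=> cos (b*z)).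
 by apply: (cont_comp (contM (@cst_continuous _ _ b) ci)); exact: continuous_cos.
transitivity (Ex P' (fun w=> cos (b*(2*s*B (1/2) w)))).
 apply: (@Ex_same_law _ _ _ _ _ (normal_prob 0 s) P' (fun z=> z) (fun w=> 2*s*B (1/2) w) (fun z=> cos (b*z)) 1)=> //.
 - exact: measurable_funM.
 - by move=> A mA; exact: normal_beta.
rewrite /gauss_cos -exprMn sqrtr_sqr; congr Ex; apply/funext=> w.
case: (leP 0 b)=> b0.
 have bs0 : 0 <= b*s by rewrite mulr_ge0// ltW.
 by rewrite (ger0_norm bs0); apply: congr1; ring.
rewrite ltr0_norm; last by rewrite nmulr_rlt0.
by rewrite -cosN; apply: congr1; ring.
Qed.

Lemma normal_sin (b s : R) : 0 < s -> Ex (normal_prob 0 s) (fun z=> sin (b*z)) = 0.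
move=> s0; have cb : continuous (fun z : R=> sin (b*z)).
 by apply: (cont_comp (contM (@cst_continuous _ _ b) ci)); exact: continuous_sin.
have mN : mrv (fun z : measurableTypeR R=> - z : R) by exact: oppr_measurable.
have h : Ex (normal_prob 0 s) (fun z=> sin (b*z)) = Ex (normal_prob 0 s) (fun z=> sin (b*(- z))).
 apply: (@Ex_same_law _ _ _ _ _ (normal_prob 0 s) (normal_prob 0 s) (fun z=> z) (fun z=> - z) (fun z=> sin (b*z)) 1)=> //.
 by move=> A mA; rewrite -[RHS]/(normal_prob 0 s (-%R @^-1` A)) bridge_normal_sym.
have bs : bounded_rv (fun z : measurableTypeR R=> sin (b*z)) by exact: (bounded_rv_comp (M := 1) mid cb).
have h2 : Ex (normal_prob 0 s) (fun z=> sin (b*(- z))) = - Ex (normal_prob 0 s) (fun z=> sin (b*z)).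
 rewrite -mulN1r -ExZ//; congr Ex; apply/funext=> z; rewrite mulrN sinN mulN1r//.
by apply: eq_opp0; rewrite {1}h.
Qed.

Lemma gauss_cos0 : gauss_cos 0 = 1.
rewrite /gauss_cos (_ : (fun w=> _) = fun=> 1) ?Ex_cst//.
by apply/funext=> w; rewrite sqrtr0 mulr0 mul0r cos0.
Qed.

Section With_wiener.
Context {d : measure_display} {Omega : measurableType d}.
Variables (P : probability Omega R) (F : R -> set (set Omega)) (T : R).
Variable W : R -> Omega -> R.
Hypotheses (T0 : 0 < T) (hF : filtration F T) (hW : wiener P F T W).

(** Expand cos(U + c z) and integrate the increment first: the sine part vanishes by symmetry and
    the cosine part factors out. *)
Lemma wiener_cos (s t c : R) (U : Omega -> R) : 0 <= s -> s < t -> t <= T -> adapted F s U ->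
 Ex P (fun w=> cos (U w+c*(W t w-W s w))) =
 Ex P (fun w=> cos (U w))*gauss_cos (c^+2*(t-s)).
move=> s0 st tT aU; have sT : 0 <= s <= T by rewrite s0 (le_trans (ltW st)).
have sd0 : 0 < Num.sqrt (t-s) by rewrite sqrtr_gt0 subr_gt0.
have mU := adapted_measurable hF sT aU.
have mU' := adapted_fst aU.
have mD : mrv (fun w=> W t w-W s w).
 apply: measurable_funB; apply: (wiener_measurable hF hW)=> //.
 by rewrite tT (le_trans s0 (ltW st)).
(* The constant 1 makes the integrand nonnegative, as [freezing] demands; it cancels at the end. *)
have mphi : mrv (fun x : g_sigma_algebraType (F s) * measurableTypeR R=>
  (1+cos (U x.1+c*x.2))%:E).
 apply/measurable_EFinP; apply: measurable_funD=> //.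
 apply: (measurableT_comp (continuous_measurable_fun (@continuous_cos R))).
 by apply: measurable_funD=> //; apply: measurable_funM=> //; exact: measurable_snd.
have phi0 (x : g_sigma_algebraType (F s) * measurableTypeR R) : (0 <= (1+cos (U x.1+c*x.2))%:E)%E.
 by rewrite lee_fin; have := cos_geN1 (U x.1+c*x.2); lra.
have := @freezing _ _ _ P F T W hF hW s t s0 st tT _ phi0 mphi.
have bz (g : R -> R) : continuous g -> (forall y, `|g y| <= 1) -> bounded_rv (fun z : measurableTypeR R=> g (c*z)).
 move=> cg g1; apply: (bounded_rv_comp (g := fun z=> g (c*z)) (M := 1) mid)=> //.
 by apply: (cont_comp (contM (@cst_continuous _ _ c) ci)).
have inner w : (\int[normal_prob 0 (Num.sqrt (t-s))]_z (1+cos (U w+c*z))%:E)%E =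
  (1+gauss_cos (c^+2*(t-s))*cos (U w))%:E.
 have b1 : bounded_rv (fun z : measurableTypeR R=> cos (U w)*cos (c*z)).
  by apply: bounded_rvM; [exact: bounded_rv_cst|apply: bz; [exact: continuous_cos|]].
 have b2 : bounded_rv (fun z : measurableTypeR R=> sin (U w)*sin (c*z)).
  by apply: bounded_rvM; [exact: bounded_rv_cst|apply: bz; [exact: continuous_sin|]].
 rewrite (_ : (fun z=> _) = (fun z=> (1+(cos (U w)*cos (c*z)-sin (U w)*sin (c*z)))%:E)); last first.
  by apply/funext=> z; rewrite cosD.
 have b3 : bounded_rv (fun z : measurableTypeR R=> cos (U w)*cos (c*z)-sin (U w)*sin (c*z)).
  under eq_fun do rewrite -cosD; apply: (bounded_rv_comp (g := fun z=> cos (U w+c*z)) (M := 1) mid)=> //.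
  apply: (cont_comp (contD (@cst_continuous _ _ (U w)) (contM (@cst_continuous _ _ c) ci))).
  exact: continuous_cos.
 rewrite -ExE; last by apply: bounded_rvD=> //; exact: bounded_rv_cst.
 rewrite ExD//; last exact: bounded_rv_cst.
 rewrite Ex_cst ExB// ExZ; last by apply: bz; [exact: continuous_cos|].
 rewrite ExZ; last by apply: bz; [exact: continuous_sin|].
 rewrite normal_cos// normal_sin// mulr0 subr0 sqr_sqrtr ?subr_ge0 ?(ltW st)//.
 by rewrite mulrC.
under [X in _ = X -> _]eq_integral do rewrite inner.
have bU : bounded_rv (fun w=> cos (U w)) by apply: (bounded_rv_comp (M := 1))=> //; exact: continuous_cos.
have bUD : bounded_rv (fun w=> cos (U w+c*(W t w-W s w))).
 apply: (bounded_rv_comp (M := 1))=> //; last exact: continuous_cos.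
 by apply: measurable_funD=> //; exact: measurable_funM.
rewrite -ExE; last by apply: bounded_rvD=> //; exact: bounded_rv_cst.
rewrite -ExE; last by apply: bounded_rvD; [exact: bounded_rv_cst|apply: bounded_rvM=> //; exact: bounded_rv_cst].
case=> /=; rewrite !ExD ?Ex_cst ?ExZ//; try exact: bounded_rv_cst; last first.
 by apply: bounded_rvM=> //; exact: bounded_rv_cst.
by move=> /addrI ->; rewrite mulrC.
Qed.

(** A scaled Wiener increment over [0, T] of variance u + v is cut at the time that splits the
    variance into u and v; [wiener_cos] computes its cosine in one step and in two. *)
Lemma gauss_cosD (u v : R) : 0 <= u -> 0 <= v -> gauss_cos (u+v) = gauss_cos u*gauss_cos v.
rewrite le_eqVlt=> /predU1P[<-|u0]; first by rewrite add0r gauss_cos0 mul1r.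
rewrite le_eqVlt=> /predU1P[<-|v0]; first by rewrite addr0 gauss_cos0 mulr1.
have uv : 0 < u+v by rewrite addr_gt0.
pose b := Num.sqrt ((u+v)/T); pose s := u*T/(u+v).
have b2 : b^+2 = (u+v)/T by rewrite sqr_sqrtr// divr_ge0// ltW.
have s0 : 0 < s by rewrite divr_gt0// mulr_gt0.
have sT : s < T by rewrite ltr_pdivrMr// mulrC ltr_pM2l// ltrDl.
have W00 w : W 0 w = 0 by case: hW.
have z0 : adapted F 0 (fun=> 0 : R) by exact: measurable_cst.
have h1 := wiener_cos b (lexx 0) T0 (lexx T) z0.
have h2 := wiener_cos b (lexx 0) s0 (ltW sT) z0.
have aU : adapted F s (fun w=> b*(W s w-W 0 w)).
 have a0 : adapted F s (W s) by apply: (wiener_adapted hF hW); rewrite ltW//= ltW.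
 by under eq_fun do rewrite W00 subr0; apply: measurable_funM=> //; exact: measurable_cst.
have h3 := wiener_cos b (ltW s0) sT (lexx T) aU.
have one : Ex P (fun=> cos (0 : R)) = 1 by rewrite cos0 Ex_cst.
move: h1 h2 h3; rewrite !subr0 one !mul1r.
have -> : b^+2*T = u+v by rewrite b2 divfK// gt_eqF.
have -> : b^+2*s = u by rewrite b2 /s; field; rewrite !gt_eqF.
have -> : b^+2*(T-s) = v by rewrite b2 /s; field; rewrite !gt_eqF.
rewrite (_ : (fun w=> cos (b*(W s w-W 0 w)+b*(W T w-W s w))) = (fun w=> cos (0+b*(W T w-W 0 w)))); last first.
 by apply/funext=> w; congr cos; ring.
move=> -> h2 ->; congr (_*_); rewrite -h2.
by congr Ex; apply/funext=> w; rewrite add0r.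
Qed.

Lemma wiener_sum_cos (n k : nat) (c : nat -> R) : (0 < n)%N -> (k <= n)%N ->
 Ex P (fun w=> cos (\sum_(j < k) c j*(W (grid T n j.+1) w-W (grid T n j) w))) =
 gauss_cos (\sum_(j < k) c j^+2*(T/n%:R)).
move=> n0; elim: k=> [|k IH] kn.
 rewrite big_ord0 gauss_cos0 (_ : (fun w=> _) = fun=> 1) ?Ex_cst//.
 by apply/funext=> w; rewrite big_ord0 cos0.
have h0 : 0 <= T/n%:R by rewrite ltW// mesh_gt0.
have /andP[k0 kT] := grid_itv T0 n0 (ltnW kn); have /andP[_ kT'] := grid_itv T0 n0 kn.
have aU : adapted F (grid T n k) (fun w=> \sum_(j < k) c j*(W (grid T n j.+1) w-W (grid T n j) w)).
 apply: (@sum_adapted _ _ _ P F T W hF hW n (grid T n) _ (fun i _=> grid_ltS T0 i n0) _ (fun j _=> c j)).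
 - by rewrite grid0.
 - by rewrite gridT.
 - exact: ltnW.
 - by move=> i _; exact: measurable_cst.
under eq_fun do rewrite big_ord_recr /=.
rewrite (wiener_cos _ k0 (grid_ltS T0 k n0) kT' aU) IH; last exact: ltnW.
rewrite gridS big_ord_recr /= gauss_cosD//; last by rewrite mulr_ge0 ?sqr_ge0.
by apply: sumr_ge0=> j _; rewrite mulr_ge0 ?sqr_ge0.
Qed.

End With_wiener.
End Bridge.

(** * The discrete score has the covariance of a bridge *)

Section Covariance.
Context {R : realType}.
Variables (n : nat) (p a : nat -> R).
Hypotheses (p0 : forall j, 0 <= p j) (p1 : \sum_(j < n) p j = 1).
Let H k : R := \sum_(j < k) p j.

Lemma partial_sum_mono k l : (k <= l)%N -> H k <= H l.
move=> /subnKC <-; elim: (l-k)%N=> [|m IH]; first by rewrite addn0.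
by rewrite addnS /H big_ord_recr /= (le_trans IH)// lerDl.
Qed.

Lemma partial_sum_itv k : (k <= n)%N -> 0 <= H k <= 1.
by move=> kn; rewrite sumr_ge0//= -p1 partial_sum_mono. Qed.

Let sum_lt k : (k <= n)%N -> \sum_(j < n) p j*(j < k)%N%:R = H k.
move=> kn; rewrite /H (big_ord_widen n p kn) [RHS]big_mkcond /=; apply: eq_bigr=> j _.
by case: (j < k)%N; rewrite ?mulr1 ?mulr0.
Qed.

Let sum_min k l : (k <= n)%N -> (l <= n)%N ->
 \sum_(j < n) p j*((j < k)%N%:R*(j < l)%N%:R) = Num.min (H k) (H l).
wlog kl : k l/(k <= l)%N.
 move=> h kn ln; case: (leqP k l)=> [|/ltnW] kl; first exact: h.
 by rewrite minC -h//; apply: eq_bigr=> j _; rewrite (mulrC _ (j < l)%N%:R).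
move=> kn ln; rewrite (min_idPl (partial_sum_mono kl)) -(sum_lt kn); apply: eq_bigr=> j _; congr (_*_).
by case: (ltnP j k)=> [jk|]; rewrite ?mul0r// mul1r (leq_trans jk kl).
Qed.

(** For an index j drawn with weights p, min(H k, H l) - H k H l is the covariance of the indicators
    of j < k and j < l. The right-hand side, visibly nonnegative, is the variance of the same linear
    combination of centred indicators. *)
Lemma bridge_covariance :
 \sum_(k < n) \sum_(l < n) a k*a l*(Num.min (H k) (H l)-H k*H l) =
 \sum_(j < n) p j*(\sum_(k < n) a k*((j < k)%N%:R-H k))^+2.
transitivity (\sum_(k < n) \sum_(l < n) \sum_(j < n)
  p j*((a k*((j < k)%N%:R-H k))*(a l*((j < l)%N%:R-H l)))).
 apply: eq_bigr=> k _; apply: eq_bigr=> l _; have kn := ltnW (ltn_ord k); have ln := ltnW (ltn_ord l).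
 rewrite -(sum_min kn ln).
 transitivity (a k*a l*(\sum_(j < n) p j*((j < k)%N%:R*(j < l)%N%:R)
   - H l*\sum_(j < n) p j*(j < k)%N%:R-H k*\sum_(j < n) p j*(j < l)%N%:R+H k*H l*\sum_(j < n) p j)).
  by rewrite !sum_lt// p1; ring.
 move: (H k) (H l)=> hk hl; rewrite !mulr_sumr -!sumrB -big_split /= mulr_sumr; apply: eq_bigr=> j _.
 by move: ((j < k)%N%:R : R) ((j < l)%N%:R : R)=> u v; ring.
under eq_bigr do rewrite exchange_big; rewrite exchange_big /=; apply: eq_bigr=> j _.
rewrite expr2 mulr_suml mulr_sumr; apply: eq_bigr=> k _.
by rewrite [in RHS]mulr_sumr [RHS]mulr_sumr; apply: eq_bigr.
Qed.

End Covariance.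

Section Bridge_sums.
Context {R : realType} {d' : measure_display} {Omega' : measurableType d'}.
Variables (P' : probability Omega' R) (B : R -> Omega' -> R).
Hypothesis hB : brownian_bridge P' B.

Lemma bridge_sum_cos (n : nat) (p a : nat -> R) (H := fun k=> \sum_(j < k) p j) :
 (forall j, 0 <= p j) -> \sum_(j < n) p j = 1 ->
 Ex P' (fun w=> cos (\sum_(k < n) a k*B (H k) w)) =
 gauss_cos P' B (\sum_(j < n) p j*(\sum_(k < n) a k*((j < k)%N%:R-H k))^+2).
move=> p0 p1; rewrite -(bridge_covariance a p0 p1).
apply: (@bridge_cos _ _ _ _ _ hB n (fun k=> H k) (fun k=> a k)).
- by move=> k; apply: (partial_sum_itv p0 p1); exact: ltnW.
- by rewrite (bridge_covariance a p0 p1) sumr_ge0// => j _; rewrite mulr_ge0 ?sqr_ge0.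
Qed.

Section With_wiener.
Context {d : measure_display} {Omega : measurableType d}.
Variables (P : probability Omega R) (F : R -> set (set Omega)) (T : R).
Variable W : R -> Omega -> R.
Hypotheses (T0 : 0 < T) (hF : filtration F T) (hW : wiener P F T W).
Variables (n : nat) (f : nat -> R).
Hypothesis n0 : (0 < n)%N.
Let dW j w : R := W (grid T n j.+1) w-W (grid T n j) w.
Let score k w : R := \sum_(j < k) f j*dW j w.
Let I : R := \sum_(j < n) f j^+2*(T/n%:R).
Hypothesis I0 : 0 < I.
Let p j : R := f j^+2*(T/n%:R)/I.
Let H k : R := \sum_(j < k) p j.
Let h0 : 0 <= T/n%:R. by rewrite ltW// mesh_gt0. Qed.
Let p0 j : 0 <= p j. by apply: divr_ge0; [apply: mulr_ge0=> //; exact: sqr_ge0|exact: ltW]. Qed.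
Let p1 : \sum_(j < n) p j = 1.
by rewrite -mulr_suml divff// gt_eqF. Qed.

Let mdW j : (j < n)%N -> mrv (dW j).
by move=> jn; apply: measurable_funB; apply: (wiener_measurable hF hW); apply: grid_itv=> //; exact: ltnW. Qed.

Let mscore k : (k <= n)%N -> mrv (score k).
move=> kn; apply: measurable_sum=> j; apply: measurable_funM=> //; apply: mdW.
by apply: leq_trans kn.
Qed.

(** The normalised score bridge and B at the partial sums of the information shares have the same
    cosines of linear combinations, whence [quadratic_same_law]. The equality is exact for every
    grid. *)
Lemma score_same_law (phi : R -> R) (M : R) : continuous phi -> (forall x, `|phi x| <= M) ->
 Ex P (fun w=> phi (\sum_(k < n) p k*((score k w-H k*score n w)/Num.sqrt I)^+2)) =
 Ex P' (fun w=> phi (\sum_(k < n) p k*B (H k) w^+2)).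
move=> cphi phiM.
apply: (quadratic_same_law (Z := fun k w=> (score k w-H k*score n w)/Num.sqrt I) (Z' := fun k=> B (H k)) _ _ _ p0 cphi phiM).
- move=> k kn; apply: measurable_funM=> //; apply: measurable_funB; first exact: mscore (ltnW kn).
 by apply: measurable_funM=> //; exact: mscore.
- by move=> k kn; apply: (bridge_measurable hB); exact: partial_sum_itv p0 p1 _ (ltnW kn).
move=> a; rewrite (bridge_sum_cos a p0 p1).
(* The coefficient of the j-th Wiener increment after exchanging sums; c_j^2 times the mesh is p_j
   times the square in [bridge_covariance]. *)
pose c (j : nat) : R := f j*(\sum_(k < n) a k*((j < k)%N%:R-H k))/Num.sqrt I.
transitivity (Ex P (fun w=> cos (\sum_(j < n) c j*dW j w))).
 congr Ex; apply/funext=> w; congr cos.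
 have sk (k : 'I_n) : score k w = \sum_(j < n) f j*dW j w*(j < k)%N%:R.
  rewrite /score (big_ord_widen n (fun j=> f j*dW j w) (ltnW (ltn_ord k))) big_mkcond /=.
  by apply: eq_bigr=> j _; case: (j < k)%N; rewrite ?mulr1 ?mulr0.
 transitivity (\sum_(k < n) \sum_(j < n) f j*dW j w/Num.sqrt I*(a k*((j < k)%N%:R-H k))).
  apply: eq_bigr=> k _; rewrite sk /score mulr_sumr -sumrB mulr_suml mulr_sumr; apply: eq_bigr=> j _.
  by move: ((j < k)%N%:R : R)=> u; ring.
 rewrite exchange_big /=; apply: eq_bigr=> j _; rewrite -mulr_sumr /c; ring.
rewrite (wiener_sum_cos hB T0 hF hW c n0 (leqnn n)); congr gauss_cos; apply: eq_bigr=> j _.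
by rewrite /c /p !exprMn exprVn sqr_sqrtr ?(ltW I0)//; ring.
Qed.

End With_wiener.
End Bridge_sums.

(** * Riemann sums of the integrated squared path *)

Section Path_functional.
Context {R : realType} {d : measure_display} {Omega : measurableType d}.
Variables (P : probability Omega R) (Y : R -> Omega -> R).
Hypothesis mY : forall s, 0 <= s <= 1 -> mrv (Y s).
Hypothesis cY : forall w, {within `[0, 1], continuous (fun s=> Y s w)}.
Let Yc s w : R := Y (clamp 1 s) w.
Let Yc_cont w : continuous (fun s=> Yc s w^+2).
by apply: contX; apply: (@continuous_clamp R 1 ler01 (fun s=> Y s w)); exact: cY. Qed.

Lemma functionalE w : bridge_functional Y w = Int 0 1 (fun s=> Yc s w^+2).
by apply: eq_Int=> s hs; rewrite /Yc clamp_id. Qed.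

Lemma functional_measurable : mrv (bridge_functional Y).
rewrite (_ : bridge_functional Y = fun w=> Int 0 1 (fun s=> Yc s w^+2)); last by apply/funext=> w; exact: functionalE.
apply: (Int_measurable ler01 Yc_cont)=> s _.
by apply: measurable_funX; apply: mY; exact: (clamp_itv ler01).
Qed.

(** Uniformity over partitions is essential, as the weights depend on eps. Otherwise there would be
    bad partitions with meshes 1/(m+1); along them the Riemann sums converge for every path and
    dominated convergence gives a contradiction. *)
Lemma functional_partition (phi : R -> R) (M : R) : continuous phi -> (forall x, `|phi x| <= M) ->
 forall e, 0 < e -> exists2 r, 0 < r & forall n (p : nat -> R), (forall j, 0 <= p j) ->
  (forall j, (j < n)%N -> p j <= r) -> \sum_(j < n) p j = 1 ->
  `|Ex P (fun w=> phi (\sum_(k < n) p k*Y (\sum_(j < k) p j) w^+2))-Ex P (fun w=> phi (bridge_functional Y w))| <= e.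
move=> cphi phiM e e0; apply: contrapT=> /forall2NP hr.
pose bad r n (p : nat -> R) := [/\ forall j, 0 <= p j, forall j, (j < n)%N -> p j <= r, \sum_(j < n) p j = 1 &
  e < `|Ex P (fun w=> phi (\sum_(k < n) p k*Y (\sum_(j < k) p j) w^+2))-Ex P (fun w=> phi (bridge_functional Y w))|].
have /choice [np hnp] : forall m : nat, exists np : nat*(nat -> R), bad m.+1%:R^-1 np.1 np.2.
 move=> m; apply: contrapT=> /forallNP hm.
 case: (hr m.+1%:R^-1)=> [/negP|]; first by rewrite invr_gt0 ltr0n.
 apply=> n p p0 pr p1; case: leP=> // he; case: (hm (n, p)); split=> //.
pose n m := (np m).1; pose p m := (np m).2; pose H m k := \sum_(j < k) p m j.
have H01 m k : (k <= n m)%N -> 0 <= H m k <= 1.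
 by case: (hnp m)=> p0 _ p1 _; exact: partial_sum_itv p0 p1 _.
have : Ex P (fun w=> phi (\sum_(k < n m) p m k*Y (H m k) w^+2)) @[m --> \oo] --> Ex P (fun w=> phi (bridge_functional Y w)).
 apply: (Ex_cvg (M := M))=> //.
 - move=> m; apply: (measurableT_comp (continuous_measurable_fun cphi)).
  apply: measurable_sum=> k; apply: measurable_funM=> //; apply: measurable_funX; apply: mY.
  by apply: H01; exact: ltnW.
 - by apply: (measurableT_comp (continuous_measurable_fun cphi)); exact: functional_measurable.
 move=> w; suff cv : \sum_(k < n m) p m k*Y (H m k) w^+2 @[m --> \oo] --> bridge_functional Y w.
  exact: (cvg_comp _ _ cv (cphi _)).
 rewrite functionalE.
 apply/(@cvgrPdist_le _ R)=> eta eta0.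
 have [r r0 hr'] := @heine_itv _ 1 _ (Yc_cont (w := w)) _ eta0.
 near=> m; case: (hnp m)=> p0 pr p1 _.
 have pm j : H m j.+1-H m j = p m j by rewrite /H big_ord_recr /= addrAC subrr add0r.
 have Hle j : H m j <= H m j.+1 by rewrite -subr_ge0 pm; exact: p0.
 have mr : m.+1%:R^-1 <= r by apply: ltW; near: m; exact: (near_infty_natSinv_lt (PosNum r0)).
 have := riemann_cell (k := n m) (e := eta) (Yc_cont (w := w)) Hle.
 have -> : H m 0%N = 0 by rewrite /H big_ord0.
 rewrite [H m (n m)]p1 subr0 mulr1 (_ : \sum_(j < n m) _ = \sum_(k < n m) p m k*Y (H m k) w^+2); last first.
  by apply: eq_bigr=> k _; rewrite pm mulrC /Yc clamp_id//; apply: H01; exact: ltnW.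
 apply=> j s jn /andP[sl su].
 have /andP[h1 h2] := H01 m j (ltnW jn); have /andP[h3 h4] := H01 m j.+1 jn.
 apply: hr'=> //; [by rewrite (le_trans h1)//= (le_trans su)|by rewrite h1|].
 rewrite ger0_norm ?subr_ge0//; apply: le_trans mr; apply: le_trans (pr j jn).
 by apply: le_trans (_ : H m j.+1-H m j <= _); [rewrite lerB|rewrite pm].
move=> /(@cvgrPdist_lt _ R) /(_ e e0) [m _ /(_ m)] /(_ (leqnn m)) /=.
by case: (hnp m)=> _ _ _ he /ltW; rewrite distrC leNgt he.
Unshelve. all: by end_near.
Qed.

Lemma functional_riemann_sum (phi : R -> R) (M : R) : continuous phi -> (forall x, `|phi x| <= M) ->
 Ex P (fun w=> phi (\sum_(k < m.+1) m.+1%:R^-1*Y (\sum_(j < k) m.+1%:R^-1) w^+2)) @[m --> \oo]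
  --> Ex P (fun w=> phi (bridge_functional Y w)).
move=> cphi phiM; apply/(@cvgrPdist_le _ R)=> e e0.
have [r r0 hr] := functional_partition cphi phiM e0.
near=> m; rewrite distrC; apply: (hr m.+1 (fun=> m.+1%:R^-1)).
- by move=> j; rewrite invr_ge0.
- by move=> j _; apply: ltW; near: m; exact: (near_infty_natSinv_lt (PosNum r0)).
- by rewrite sumr_const card_ord -[X in X = _]mulr_natl mulfV.
Unshelve. all: by end_near.
Qed.

End Path_functional.

Lemma seq_limit_unique {R : realType} (u v : nat -> R) (a b : R) : u n @[n --> \oo] --> a ->
 v n @[n --> \oo] --> b -> (forall n, u n = v n) -> a = b.
move=> ua vb uv; rewrite -(cvg_lim (@Rhausdorff R) ua) -(cvg_lim (@Rhausdorff R) vb).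
by congr lim; under eq_fun do rewrite uv.
Qed.

Section Same_functional_law.
Context {R : realType} {d1 d2 : measure_display} {O1 : measurableType d1} {O2 : measurableType d2}.
Variables (P1 : probability O1 R) (P2 : probability O2 R).

(** Both functionals are limits of uniform Riemann sums, whose laws agree by
    [quadratic_same_law]. *)
Lemma functional_same_law (Y1 : R -> O1 -> R) (Y2 : R -> O2 -> R) :
 (forall s, 0 <= s <= 1 -> mrv (Y1 s)) ->
 (forall w, {within `[0, 1], continuous (fun s=> Y1 s w)}) ->
 (forall s, 0 <= s <= 1 -> mrv (Y2 s)) ->
 (forall w, {within `[0, 1], continuous (fun s=> Y2 s w)}) ->
 (forall n (p a : nat -> R), (forall j, 0 <= p j) -> \sum_(j < n) p j = 1 ->
  Ex P1 (fun w=> cos (\sum_(k < n) a k*Y1 (\sum_(j < k) p j) w)) =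
  Ex P2 (fun w=> cos (\sum_(k < n) a k*Y2 (\sum_(j < k) p j) w))) ->
 forall (phi : R -> R) (M : R), continuous phi -> (forall x, `|phi x| <= M) ->
 Ex P1 (fun w=> phi (bridge_functional Y1 w)) = Ex P2 (fun w=> phi (bridge_functional Y2 w)).
move=> m1 c1 m2 c2 hcos phi M cphi phiM.
have s1 := functional_riemann_sum (P := P1) m1 c1 cphi phiM.
have s2 := functional_riemann_sum (P := P2) m2 c2 cphi phiM.
apply: (seq_limit_unique s1 s2)=> m.
pose p (j : nat) : R := m.+1%:R^-1.
have p0 j : 0 <= p j by rewrite invr_ge0.
have p1 : \sum_(j < m.+1) p j = 1 by rewrite sumr_const card_ord -[LHS]mulr_natl mulfV.
have H01 k : (k < m.+1)%N -> 0 <= \sum_(j < k) p j <= 1 by move=> km; exact: partial_sum_itv p0 p1 _ (ltnW km).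
apply: (quadratic_same_law (Z := fun k=> Y1 (\sum_(j < k) p j)) (Z' := fun k=> Y2 (\sum_(j < k) p j)) _ _ _ p0 cphi phiM).
- by move=> k km; apply: m1; exact: H01.
- by move=> k km; apply: m2; exact: H01.
- by move=> a; exact: hcos.
Qed.

(** Continuous approximation of the indicator of the single point c, used to transfer atoms between
    equal laws. *)
Definition tent (c : R) (m : nat) (x : R) : R := pospart (1-m.+1%:R * `|x-c|).

Lemma tent_continuous c m : continuous (tent c m).
apply: cont_pospart.
apply: contB; first exact: cst_continuous.
apply: contM; first exact: cst_continuous.
by apply: contA; apply: contB; [move=> x; exact: cvg_id|exact: cst_continuous].
Qed.

Lemma tent_itv c m x : 0 <= tent c m x <= 1.
rewrite pospart_ge0 /tent /pospart /=.
have : 0 <= m.+1%:R * `|x-c| by rewrite mulr_ge0.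
move: (m.+1%:R * `|x-c|)=> u u0; have : `|1-u| <= 1+u by rewrite ler_norml; apply/andP; split; lra.
lra.
Qed.

Lemma tent_cvg c x : tent c m x @[m --> \oo] --> ((x == c)%:R : R).
case: eqVneq=> [->|xc].
 apply: cvg_near_cst; apply: nearW=> m; rewrite /tent subrr normr0 mulr0 subr0.
 by rewrite pospart_id.
have d0 : 0 < `|x-c| by rewrite normr_gt0 subr_eq0.
apply: cvg_near_cst; near=> m; rewrite /tent pospart_eq0// subr_le0 -ler_pdivrMr// div1r.
have h : m.+1%:R^-1 <= `|x-c| by apply: ltW; near: m; exact: (near_infty_natSinv_lt (PosNum d0)).
by rewrite -[leRHS]invrK lef_pV2 ?posrE ?invr_gt0 ?ltr0n.
Unshelve. all: by end_near.
Qed.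

Lemma same_atom (U1 : O1 -> R) (U2 : O2 -> R) (c : R) :
 mrv U1 -> mrv U2 ->
 (forall (phi : R -> R) (M : R), continuous phi -> (forall x, `|phi x| <= M) ->
   Ex P1 (fun w=> phi (U1 w)) = Ex P2 (fun w=> phi (U2 w))) ->
 Ex P1 (fun w=> (U1 w == c)%:R) = Ex P2 (fun w=> (U2 w == c)%:R).
move=> m1 m2 h.
have t1 m y : `|tent c m y| <= 1 by rewrite ger0_norm; have /andP[] := tent_itv c m y.
have lim d0 (O : measurableType d0) (Q : probability O R) (U : O -> R) : mrv U ->
  Ex Q (fun w=> tent c m (U w)) @[m --> \oo] --> Ex Q (fun w=> (U w == c)%:R).
 move=> mU; apply: (Ex_cvg (M := 1))=> //.
 - by move=> m; apply: (measurableT_comp _ mU); apply: continuous_measurable_fun; exact: tent_continuous.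
 - apply: (measurable_fun_cvg (h := fun m w=> tent c m (U w)))=> [m|w _]; last exact: tent_cvg.
  by apply: (measurableT_comp _ mU); apply: continuous_measurable_fun; exact: tent_continuous.
 - by move=> w; exact: tent_cvg.
apply: (seq_limit_unique (lim _ _ P1 U1 m1) (lim _ _ P2 U2 m2))=> m.
by apply: (h _ 1)=> //; exact: tent_continuous.
Qed.

End Same_functional_law.

Lemma bounded_rv_eq {R : realType} {d : measure_display} {O : measurableType d} (U : O -> R) (c : R) :
 mrv U -> bounded_rv (fun w=> (U w == c)%:R : R).
move=> mU; split; last by exists 1=> w; case: (_ == _); rewrite ?normr1 ?normr0.
apply: (measurable_fun_cvg (h := fun m w=> tent c m (U w)))=> [m|w _]; last exact: tent_cvg.
by apply: (measurableT_comp _ mU); apply: continuous_measurable_fun; exact: tent_continuous.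
Qed.

(** A nonzero polynomial of degree at most two has at most two roots; when u and w both vanish the
    right-hand side exceeds N anyway. *)
Lemma quadratic_roots {R : realFieldType} (u v w : R) (N : nat) :
 \sum_(t < N) (u+t.+1%:R*v+t.+1%:R^+2*w == 0)%:R <= 2+N%:R*((u == 0)%:R*(w == 0)%:R) :> R.
have le1 (b : bool) : (b%:R : R) <= 1 by case: b.
case: (boolP ((u == 0) && (w == 0)))=> [/andP[-> ->]|uw].
 rewrite !mulr1 (le_trans (y := N%:R))// ?lerDr// -[in leRHS](card_ord N) -sumr_const.
 by apply: ler_sum=> t _; exact: le1.
rewrite (_ : _*(_*_) = 0) ?addr0; last by rewrite -natrM mulnb (negbTE uw) mulr0.
pose p : {poly R} := Poly [:: u; v; w].
have pN : p != 0.
 apply: contra uw=> /eqP p0.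
 have := congr1 (fun q : {poly R} => q`_0) p0; have := congr1 (fun q : {poly R} => q`_2) p0.
 by rewrite !coef_Poly !coef0 /= => -> ->; rewrite eqxx.
have rp t : (u+t.+1%:R*v+t.+1%:R^+2*w == 0) = root p (t.+1%:R).
 rewrite /root horner_Poly /= mul0r add0r; congr (_ == 0); ring.
pose rs := [seq (nat_of_ord t).+1%:R : R | t <- enum 'I_N & u+(nat_of_ord t).+1%:R*v+(nat_of_ord t).+1%:R^+2*w == 0].
have := max_poly_roots (p := p) (rs := rs) pN.
have -> : all (root p) rs.
 by apply/allP=> _ /mapP[t + ->]; rewrite mem_filter=> /andP[+ _]; rewrite rp.
rewrite map_inj_uniq; last first.
 by move=> s t /eqP; rewrite eqr_nat=> /eqP[]; exact: val_inj.
move=> /(_ isT (filter_uniq _ (enum_uniq _))) hs; have : (size rs <= 2)%N by rewrite -ltnS (leq_trans hs)// size_Poly.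
rewrite size_map size_filter -sum1_count -(ler_nat R); apply: le_trans.
rewrite natr_sum big_enum_cond /= [leRHS]big_mkcond /=; apply: ler_sum=> t _.
by case: (_ == _).
Qed.

(** * The bridge functional has no atom below its essential supremum *)

Section No_atom.
Context {R : realType} {d' : measure_display} {Omega' : measurableType d'}.
Variables (P' : probability Omega' R) (B : R -> Omega' -> R).
Hypothesis hB : brownian_bridge P' B.
Hypothesis gaussD : forall u v, 0 <= u -> 0 <= v ->
 gauss_cos P' B (u+v) = gauss_cos P' B u*gauss_cos P' B v.
Let PP : probability (Omega'*Omega')%type R := (P' \x P')%E.

Let mB s : 0 <= s <= 1 -> mrv (B s). exact: (bridge_measurable hB). Qed.
Let cB w : {within `[0, 1], continuous (fun s=> B s w)}. by case: hB. Qed.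
Let m1 (f : Omega' -> R) : mrv f -> mrv (fun w : Omega'*Omega'=> f w.1).
by move=> mf; exact: (measurableT_comp mf measurable_fst). Qed.
Let m2 (f : Omega' -> R) : mrv f -> mrv (fun w : Omega'*Omega'=> f w.2).
by move=> mf; exact: (measurableT_comp mf measurable_snd). Qed.

Lemma bounded_rv_prod (f g : Omega' -> R) : bounded_rv f -> bounded_rv g ->
 bounded_rv (fun w : Omega'*Omega'=> f w.1*g w.2).
move=> [mf [M hM]] [mg [N hN]]; split; first by apply: measurable_funM; [exact: m1|exact: m2].
by exists (M*N)=> w; rewrite normrM; apply: ler_pM.
Qed.

Lemma Ex_prod (f g : Omega' -> R) : bounded_rv f -> bounded_rv g ->
 Ex PP (fun w=> f w.1*g w.2) = Ex P' f*Ex P' g.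
move=> bf bg; have bfg := bounded_rv_prod bf bg; apply: EFin_inj.
rewrite (ExE PP bfg) -integral12_prod_meas1; last exact: bounded_rv_integrable.
rewrite (_ : (fun x=> _) = (fun x=> (f x*Ex P' g)%:E)); last first.
 apply/funext=> x; rewrite /fubini_F /= -ExZ// ExE//.
 by apply: bounded_rvM=> //; exact: bounded_rv_cst.
rewrite -ExE; last by apply: bounded_rvM=> //; exact: bounded_rv_cst.
by rewrite mulrC -ExZ//; congr (Ex _ _)%:E; apply/funext=> w; rewrite mulrC.
Qed.

Let cos1 (y : R) : `|cos y| <= 1. by rewrite ler_norml cos_geN1 cos_le1. Qed.
Let sin1 (y : R) : `|sin y| <= 1. by rewrite ler_norml sin_geN1 sin_le1. Qed.

Section Comb.
Variables (n : nat) (p a : nat -> R).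
Hypotheses (p0 : forall j, 0 <= p j) (p1 : \sum_(j < n) p j = 1).
Let H k : R := \sum_(j < k) p j.
Let Q : R := \sum_(j < n) p j*(\sum_(k < n) a k*((j < k)%N%:R-H k))^+2.
Let L w : R := \sum_(k < n) a k*B (H k) w.

Let mL : mrv L.
apply: measurable_sum=> k; apply: measurable_funM=> //; apply: mB.
exact: partial_sum_itv p0 p1 _ (ltnW (ltn_ord k)).
Qed.

Let cos_scale (c : R) : Ex P' (fun w=> cos (c*L w)) = gauss_cos P' B (c^+2*Q).
have := bridge_sum_cos hB (fun k=> c*a k) p0 p1; rewrite (_ : \sum_(j < n) _ = c^+2*Q)=> [<-|].
 congr Ex; apply/funext=> w; congr cos; rewrite /L mulr_sumr.
 by apply: eq_bigr=> k _; rewrite mulrA.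
rewrite /Q mulr_sumr; apply: eq_bigr=> j _; rewrite [RHS]mulrCA -[in RHS]exprMn; congr (_*_^+2).
by rewrite [in RHS]mulr_sumr; apply: eq_bigr=> k _; rewrite mulrA.
Qed.

Let sin_scale (c : R) : Ex P' (fun w=> sin (c*L w)) = 0.
have mcL : mrv (fun w=> c*L w) by exact: measurable_funM.
have bs : bounded_rv (fun w=> sin (c*L w)) by apply: (bounded_rv_comp (M := 1) mcL)=> //; exact: continuous_sin.
have e : Ex P' (fun w=> sin (c*L w)) = Ex P' (fun w=> sin (- (c*L w))).
 apply: (@Ex_same_law _ _ _ _ _ P' P' (fun w=> c*L w) (fun w=> - (c*L w)) sin 1)=> //.
 - exact: measurableT_comp.
 - exact: continuous_sin.
 have [_ _ law] := hB.
 have H01 (i : 'I_n) : 0 <= H i <= 1 by exact: partial_sum_itv p0 p1 _ (ltnW (ltn_ord i)).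
 move=> A mA; have := law n (fun k=> H k) (fun k=> c*a k) H01 A mA.
 have := law n (fun k=> H k) (fun k=> - (c*a k)) H01 A mA.
 rewrite (_ : \sum_(i < n) \sum_(j < n)-(c*a i) * - (c*a j)*_ = \sum_(i < n) \sum_(j < n) (c*a i)*(c*a j)*(Num.min (H i) (H j)-H i*H j)); last first.
  by apply: eq_bigr=> i _; apply: eq_bigr=> j _; rewrite mulrNN.
 move=> e1 e2; have e0 := etrans e2 (esym e1).
 rewrite (_ : (fun w=> c*L w) = fun w=> \sum_(i < n) (c*a i)*B (H i) w); last first.
  by apply/funext=> w; rewrite /L mulr_sumr; apply: eq_bigr=> k _; rewrite mulrA.
 rewrite (_ : (fun w=> - (c*L w)) = fun w=> \sum_(i < n)-(c*a i)*B (H i) w); first exact: e0.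
 by apply/funext=> w; rewrite /L mulr_sumr -sumrN; apply: eq_bigr=> k _; rewrite mulNr mulrA.
apply: eq_opp0; rewrite {1}e -mulN1r -ExZ//; congr Ex; apply/funext=> w; by rewrite sinN mulN1r.
Qed.

(** For independent copies the cosine of the sum factors, the sine terms vanish by symmetry, and
    [gaussD] recombines the variances x^2 Q + y^2 Q = Q. *)
Lemma rotation_cos (x y : R) : x^+2+y^+2 = 1 ->
 Ex PP (fun w=> cos (\sum_(k < n) a k*(x*B (H k) w.1+y*B (H k) w.2))) =
 Ex P' (fun w=> cos (\sum_(k < n) a k*B (H k) w)).
move=> xy.
have bc c : bounded_rv (fun w=> cos (c*L w)).
 by apply: (bounded_rv_comp (M := 1))=> //; [exact: measurable_funM|exact: continuous_cos].
have bs c : bounded_rv (fun w=> sin (c*L w)).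
 by apply: (bounded_rv_comp (M := 1))=> //; [exact: measurable_funM|exact: continuous_sin].
rewrite (_ : (fun w=> _) = (fun w=> cos (x*L w.1)*cos (y*L w.2)-sin (x*L w.1)*sin (y*L w.2))); last first.
 apply/funext=> w; rewrite -cosD; congr cos; rewrite /L !mulr_sumr -big_split /=.
 by apply: eq_bigr=> k _; ring.
rewrite ExB; [|by apply: (bounded_rv_prod (bc _) (bc _))|by apply: (bounded_rv_prod (bs _) (bs _))].
rewrite (Ex_prod (bc x) (bc y)) (Ex_prod (bs x) (bs y)) !sin_scale mul0r subr0 !cos_scale.
have Q0 : 0 <= Q by rewrite sumr_ge0// => j _; rewrite mulr_ge0 ?sqr_ge0.
rewrite -gaussD; [|by rewrite mulr_ge0 ?sqr_ge0..].
rewrite -mulrDl xy mul1r.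
rewrite (_ : Q = 1^+2*Q); last by rewrite expr1n mul1r.
by rewrite -cos_scale; congr Ex; apply/funext=> w; rewrite mul1r.
Qed.

End Comb.

Let bf := bridge_functional B.
Let mbf : mrv bf. exact: functional_measurable. Qed.
Let mix (x y s : R) (w : Omega'*Omega') : R := x*B s w.1+y*B s w.2.

Let mix_measurable x y s : 0 <= s <= 1 -> mrv (mix x y s).
by move=> hs; apply: measurable_funD; apply: measurable_funM=> //; [apply: m1|apply: m2]; exact: mB.
Qed.

Let mix_cont x y w : {within `[0, 1], continuous (fun s=> mix x y s w)}.
move=> s; have c0 (c : R) : {within `[0, 1 : R], continuous (fun _ : R=> c)}.
 by apply: continuous_subspaceT; exact: cst_continuous.
by apply: cvgD; apply: cvgM; [exact: c0|exact: cB|exact: c0|exact: cB].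
Qed.

Let mix_functional x y w : bridge_functional (mix x y) w =
 x^+2*bf w.1+2*x*y*Int 0 1 (fun s=> B (clamp 1 s) w.1*B (clamp 1 s) w.2)+y^+2*bf w.2.
have cc w1 : continuous (fun s=> B (clamp 1 s) w1).
 by apply: (@continuous_clamp R 1 ler01 (fun s=> B s w1)); exact: cB.
have c2 w1 : continuous (fun s=> B (clamp 1 s) w1^+2) by exact: contX.
have c12 : continuous (fun s=> B (clamp 1 s) w.1*B (clamp 1 s) w.2) by exact: contM.
have cZ c (f : R -> R) : continuous f -> continuous (fun s=> c*f s).
 by move=> cf; apply: contM=> //; exact: cst_continuous.
rewrite /bf !functionalE -!IntZ// -!IntD//.
- by apply: eq_Int=> s _; rewrite /mix; ring.
all: by [exact: cZ | apply: contD; exact: cZ].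
Qed.

                                                                                 
                                                                            
                                                                            
                                                        
(** For two independent bridges, the rotation with tangent t = 1, ..., N has functional equal to c
    exactly when t solves a quadratic equation, nonzero unless both given functionals equal c.
    Counting solutions and taking means gives N p <= 2 + N p^2, hence p (1 - p) <= 0. Since values
    above c have positive probability, p < 1 and so p = 0. *)
Theorem bridge_no_atom (c : R) : 0 < Ex P' (fun w=> (c < bf w)%R%:R : R) -> mrv (fun w=> (c < bf w)%R%:R : R) ->
 Ex P' (fun w=> (bf w == c)%:R : R) = 0.
move=> pos mc; set p := Ex _ _.
have be := bounded_rv_eq c mbf.
have bc : bounded_rv (fun w=> (c < bf w)%R%:R : R).
 by split=> //; exists 1=> w; case: (_ < _); rewrite ?normr1 ?normr0.
have p0 : 0 <= p.
 rewrite -(Ex_cst P' 0); apply: Ex_le=> //; first exact: bounded_rv_cst.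
have p1 : p < 1.
 suff : p+Ex P' (fun w=> (c < bf w)%R%:R : R) <= 1 by lra.
 rewrite /p -ExD//; apply: (@le_trans _ _ (Ex P' (fun=> 1))); last by rewrite Ex_cst.
 apply: Ex_le; [exact: bounded_rvD|exact: bounded_rv_cst|].
 by move=> w; case: ltgtP=> _; rewrite ?addr0 ?add0r.
have key N : N%:R * p <= 2+N%:R*(p * p).
 pose E (t : 'I_N) (w : Omega'*Omega') : R :=
  (bridge_functional (mix (Num.sqrt (1+t.+1%:R^+2))^-1 (t.+1%:R/Num.sqrt (1+t.+1%:R^+2))) w == c)%:R.
 have s0 (t : 'I_N) : Num.sqrt (1+t.+1%:R^+2)^+2 = 1+t.+1%:R^+2 :> R by rewrite sqr_sqrtr// ltW.
 have mE t : mrv (bridge_functional (mix (Num.sqrt (1+t.+1%:R^+2))^-1 (t.+1%:R/Num.sqrt (1+t.+1%:R^+2)))).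
  by apply: functional_measurable; [move=> s; exact: mix_measurable|exact: mix_cont].
 have bE t : bounded_rv (E t) by exact: bounded_rv_eq (mE t).
 have EE t : Ex PP (E t) = p.
  apply: same_atom=> // phi M; apply: functional_same_law=> //.
  - by move=> s; exact: mix_measurable.
  - move=> n q a q0 q1; apply: rotation_cos=> //.
   by rewrite exprMn exprVn s0; field; rewrite gt_eqF.
 have -> : N%:R * p = Ex PP (fun w=> \sum_(t < N) E t w).
  by rewrite Ex_sum// (eq_bigr (fun=> p)) ?sumr_const ?card_ord ?mulr_natl.
 have bpp := bounded_rv_prod be be.
 rewrite -(Ex_prod be be) -(Ex_cst PP 2) -ExZ// -ExD; [|exact: bounded_rv_cst|].
  apply: Ex_le; first exact: bounded_rv_sum.
   apply: bounded_rvD; first exact: bounded_rv_cst.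
   by apply: bounded_rvM=> //; exact: bounded_rv_cst.
  (* Multiplying the rotated functional by 1 + t^2 turns the equation into (U1 - c) + 2 t int B1 B2
     + t^2 (U2 - c) = 0. *)
  move=> w; have := quadratic_roots (bf w.1-c) (2*Int 0 1 (fun s=> B (clamp 1 s) w.1*B (clamp 1 s) w.2)) (bf w.2-c) N.
  rewrite !subr_eq0; apply: le_trans; apply: ler_sum=> t _; rewrite /E mix_functional.
  set b := Int _ _ _; case: eqP=> [h|_]; last by case: (_ == _).
  suff -> : bf w.1-c+t.+1%:R*(2*b)+t.+1%:R^+2*(bf w.2-c) = 0 by rewrite eqxx.
  have -> : bf w.1-c+t.+1%:R*(2*b)+t.+1%:R^+2*(bf w.2-c) =
    (bf w.1+t.+1%:R*(2*b)+t.+1%:R^+2*bf w.2)-(1+t.+1%:R^+2)*c by ring.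
  rewrite -h -[X in _ - X*_]s0; have := s0 t; have : Num.sqrt (1+t.+1%:R^+2) != 0 :> R by pos.
  by move: (Num.sqrt _)=> s sn0 _; field.
 by apply: bounded_rvM=> //; exact: bounded_rv_cst.
have : p*(1-p) <= 0.
 rewrite leNgt; apply/negP=> q0.
 have := key (Num.truncn (2/(p*(1-p)))).+1.
 have := truncnS_gt (2/(p*(1-p))); rewrite ltr_pdivrMr//.
 by set N := (_.+1)%:R; lra.
by rewrite pmulr_lle0 ?subr_gt0// => p00; apply/eqP; rewrite eq_le p00 p0.
Qed.

End No_atom.

(** * Calculus on a closed time interval *)

Section Relative_derivative.
Context {R : realType}.
Variable T : R.
Hypothesis T0 : 0 < T.

Lemma slopeP (f : R -> R) t l : slope f t @ rel_nbhs T t --> l ->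
 forall e, 0 < e -> exists2 r, 0 < r & forall s, 0 <= s <= T -> s != t -> `|s-t| < r -> `|l-slope f t s| < e.
move=> /(@cvgrPdist_lt _ R) h e /h; rewrite /rel_nbhs !nearE /within /= => -[r /= r0 hr].
exists r=> // s hs st sr; apply: hr=> //; first by rewrite /ball_ /= distrC.
Qed.

Lemma slope_is_derive (f : R -> R) t l : 0 < t < T -> slope f t @ rel_nbhs T t --> l -> is_derive t 1 f l.
move=> /andP[t0 tT] /slopeP h.
have cv : h^-1 *: ((f \o shift t) (h *: (1 : R))-f t) @[h --> 0^'] --> l.
 apply/(@cvgrPdist_lt _ R)=> e /h[r r0 hr]; near=> k.
 have k0 : k != 0 by near: k; exact: nbhs_dnbhs_neq.
 have kr : `|k| < Num.min r (Num.min t (T-t)).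
  near: k; apply: dnbhs0_lt; by rewrite !lt_min r0 t0 subr_gt0.
 move: kr; rewrite !lt_min=> /and3P[kr kt kT].
 have /andP[k1 _] : - t < k < t by rewrite -ltr_norml.
 have /andP[_ k4] : - (T-t) < k < T-t by rewrite -ltr_norml.
 have := hr (k+t); rewrite /slope addrK=> hk.
 rewrite /= -[k *: _]/(k*1) mulr1 -[_ *: _]/(k^-1*_) mulrC; apply: hk=> //.
 - by apply/andP; split; lra.
 - by rewrite -subr_eq0 addrK.
by apply: DeriveDef; [apply/cvg_ex; exists l|exact/cvg_lim].
Unshelve. all: by end_near. Qed.

Lemma slope_continuous (f : R -> R) : (forall t, 0 <= t <= T -> rel_derivable T f t) ->
 {within `[0, T], continuous f}.
move=> h; apply/within_continuousP=> t; rewrite /= in_itv /= => ht e e0.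
have /cvg_ex[l /slopeP/(_ 1 ltr01)[r r0 hr]] := h _ ht.
have l1 : 0 < `|l| + 1 by rewrite ltr_wpDl.
exists (Num.min r (e/(`|l| + 1))); first by rewrite lt_min r0 divr_gt0.
move=> s; rewrite /= in_itv /= => hs; rewrite /ball /= lt_min distrC=> /andP[sr se].
case: (eqVneq s t)=> [->|st]; first by rewrite subrr normr0.
have := hr _ hs st sr; rewrite /slope=> hl.
have st0 : 0 < `|s-t| by rewrite normr_gt0 subr_eq0.
rewrite distrC (_ : f s-f t = (f s-f t)/(s-t)*(s-t)); last by rewrite divfK// subr_eq0.
rewrite normrM; apply: le_lt_trans (_ : (`|l| + 1) * `|s-t| < e); last by rewrite mulrC -ltr_pdivlMr.
rewrite ler_wpM2r//; have := ler_normD l ((f s-f t)/(s-t)-l).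
by rewrite addrC subrK distrC; lra.
Qed.

Lemma rel_mvt (f df : R -> R) u v : {within `[0, T], continuous f} ->
 (forall t, 0 < t < T -> is_derive t 1 f (df t)) -> 0 <= u -> u < v -> v <= T ->
 exists2 c, u < c < v & f v-f u = df c*(v-u).
move=> cf hf u0 uv vT; have [||c] := @MVT R f df u v uv.
- move=> x; rewrite in_itv /= => /andP[x1 x2]; apply: hf.
 by rewrite (le_lt_trans u0 x1) (lt_le_trans x2 vT).
- apply: continuous_subspaceW cf=> x; rewrite /= !in_itv /= => /andP[x1 x2].
 by rewrite (le_trans u0 x1) (le_trans x2 vT).
by rewrite in_itv /= => hc e; exists c.
Qed.

Lemma rel_deriveP (f : R -> R) t : 0 < t < T -> rel_derivable T f t -> is_derive t 1 f (rel_derive T f t).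
by move=> ht h; apply: slope_is_derive. Qed.

                                                                                            
(** By the mean value theorem and uniform continuity of [df], the defect on a short interval is
    small relative to its length; [additive_small_zero] concludes. The derivative is required only
    in the open interval, so one-sided derivatives at the ends do no harm. *)
Lemma rel_ftc (f df : R -> R) : {within `[0, T], continuous f} ->
 (forall t, 0 < t < T -> is_derive t 1 f (df t)) -> continuous df ->
 forall u v, 0 <= u -> u <= v -> v <= T -> f v-f u = Int u v df.
move=> cf hf cdf u v u0 uv vT; apply/eqP; rewrite -subr_eq0; apply/eqP.
apply: (@additive_small_zero _ (fun u v=> f v-f u-Int u v df) _ _ uv)=> [p q r h1 h2 h3 h4|e e0].
 rewrite (@Int_split _ p q r)//; ring.
have [r r0 hr] := @heine_itv _ T _ cdf _ e0; exists r=> // p q h1 h2 h3 h4.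
have p0 : 0 <= p by lra. have qT : q <= T by lra.
move: (h2); rewrite le_eqVlt=> /predU1P[<-|pq]; first by rewrite Int_xx !subrr normr0 mulr0.
have [c /andP[c1 c2] ->] := rel_mvt cf hf p0 pq qT.
rewrite -Int_cst// -IntB//; last exact: cst_continuous.
apply: Int_bound=> //; first by apply: contB=> //; exact: cst_continuous.
move=> s /andP[s1 s2]; apply: hr; [apply/andP; split; lra..|].
by rewrite ler_norml; apply/andP; split; lra.
Qed.

Lemma rel_lipschitz (f df : R -> R) M : {within `[0, T], continuous f} ->
 (forall t, 0 < t < T -> is_derive t 1 f (df t)) -> (forall t, 0 <= t <= T -> `|df t| <= M) ->
 forall s t, `|f (clamp T s)-f (clamp T t)| <= M * `|s-t|.
move=> cf hf M1; have M0 : 0 <= M by apply: le_trans (M1 0 _)=> //; rewrite lexx ltW.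
have key s t : 0 <= s -> s < t -> t <= T -> `|f s-f t| <= M * `|s-t|.
 move=> s0 st tT; have [c /andP[c1 c2] e] := rel_mvt cf hf s0 st tT.
 by rewrite distrC e normrM (distrC s) ler_wpM2r// M1//; apply/andP; split; lra.
move=> s t; apply: le_trans (_ : M * `|clamp T s-clamp T t| <= _); last by rewrite ler_wpM2l// clamp_lip.
have /andP[s1 s2] := clamp_itv (ltW T0) s; have /andP[t1 t2] := clamp_itv (ltW T0) t.
case: (ltgtP (clamp T s) (clamp T t))=> [h|h|->]; first exact: key.
 by rewrite distrC (distrC (clamp T s)); exact: key.
by rewrite !subrr normr0 mulr0.
Qed.

End Relative_derivative.

Section Mean_value.
Context {R : realType}.

Lemma mvt_between (f : R -> R) u v : (forall z, (u <= z <= v) || (v <= z <= u) -> derivable f z 1) ->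
 exists2 c, (u <= c <= v) || (v <= c <= u) & f v-f u = derive1 f c*(v-u).
wlog uv : u v/u <= v.
 move=> h hd; case: (leP u v)=> [|/ltW] uv; first exact: h.
 have [z|c hc e] := h v u uv; first by rewrite orbC; exact: hd.
 by exists c; [rewrite orbC|rewrite -opprB e -mulrN opprB].
move=> hd; have hz z : u <= z <= v -> derivable f z 1 by move=> h; apply: hd; rewrite h.
move: uv; rewrite le_eqVlt=> /predU1P[e|uv].
 by exists u; rewrite -?e ?lexx// !subrr mulr0.
have [||c] := @MVT R f (derive1 f) u v uv.
- move=> x; rewrite in_itv /= => /andP[x1 x2]; rewrite derive1E; apply: derivableP.
 by apply: hz; rewrite !ltW.
- by apply: derivable_within_continuous=> z; rewrite in_itv /=; exact: hz.
by rewrite in_itv /= => /andP[c1 c2] e; exists c; rewrite ?(ltW c1) ?(ltW c2).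
Qed.

Lemma lip_mul (A B a b a' b' da db : R) : `|a| <= A -> `|b'| <= B -> `|a-a'| <= da -> `|b-b'| <= db ->
 `|a*b-a'*b'| <= A*db+B*da.
move=> ha hb h1 h2; rewrite (_ : a*b-a'*b' = a*(b-b')+b'*(a-a')); last by ring.
by apply: le_trans (ler_normD _ _) _; rewrite !normrM lerD// ler_pM.
Qed.

Lemma lip_inv (M a b : R) : 0 < M -> M^-1 <= a -> M^-1 <= b -> `|a^-1-b^-1| <= M^+2 * `|a-b|.
move=> M0 ha hb; have Mi : 0 < M^-1 by rewrite invr_gt0.
have a0 : 0 < a by exact: lt_le_trans ha. have b0 : 0 < b by exact: lt_le_trans hb.
have le_inv c : 0 < c -> M^-1 <= c -> c^-1 <= M by move=> c0 hc; rewrite -[leRHS]invrK lef_pV2.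
rewrite (_ : a^-1-b^-1 = (a^-1*b^-1)*(b-a)); last by field; rewrite !gt_eqF.
rewrite normrM distrC ler_wpM2r// gtr0_norm ?mulr_gt0 ?invr_gt0// expr2.
by apply: ler_pM; rewrite ?invr_ge0 ?(ltW a0) ?(ltW b0) ?le_inv.
Qed.

End Mean_value.

Section Oriented_integral.
Context {R : realType}.
Implicit Types (u v : R) (f g : R -> R).

Lemma oiE u v f : oriented_integral u v f = if u <= v then Int u v f else-Int v u f.
by []. Qed.

Lemma oi_xx u f : oriented_integral u u f = 0.
by rewrite oiE lexx Int_xx. Qed.

Lemma eq_oi u v f g : (forall y, f y = g y) -> oriented_integral u v f = oriented_integral u v g.
by move=> fg; congr oriented_integral; apply/funext. Qed.

Lemma oi_diff u v w f : continuous f ->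
 oriented_integral u w f - oriented_integral u v f = oriented_integral v w f.
move=> cf; have S a b c : a <= b -> b <= c -> Int a c f = Int a b f+Int b c f by exact: Int_split.
rewrite !oiE; case: (leP u w)=> uw; case: (leP u v)=> uv; case: (leP v w)=> vw.
- by rewrite (S u v w)//; ring.
- by rewrite (S u w v uw (ltW vw)); ring.
- by rewrite (S v u w) ?(ltW uv)//; ring.
- by exfalso; move: (lt_trans vw uv); rewrite ltNge uw.
- by exfalso; move: (lt_le_trans uw uv); rewrite ltNge vw.
- by rewrite (S w u v) ?(ltW uw)//; ring.
- by rewrite (S v w u) ?(ltW uw)//; ring.
- by rewrite (S w v u) ?(ltW uv) ?(ltW vw)//; ring.
Qed.

Lemma oiB u v f g : continuous f -> continuous g ->
 oriented_integral u v f - oriented_integral u v g = oriented_integral u v (fun y=> f y-g y).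
by move=> cf cg; rewrite !oiE !IntB//; case: ifP=> _ //; ring. Qed.

Lemma oiZ u v f (r : R) : continuous f ->
 oriented_integral u v (fun y=> r*f y) = r * oriented_integral u v f.
by move=> cf; rewrite !oiE !IntZ//; case: ifP=> _ //; ring. Qed.

Lemma oi_cst u v (r : R) : oriented_integral u v (fun=> r) = r*(v-u).
by rewrite oiE; case: leP=> uv; rewrite Int_cst; [ring|by []|ring|exact: ltW]. Qed.

Lemma oi_bound u v f (M : R) : continuous f ->
 (forall y, (u <= y <= v) || (v <= y <= u) -> `|f y| <= M) -> `|oriented_integral u v f| <= M * `|v-u|.
move=> cf hM; rewrite oiE; case: (leP u v)=> uv.
 by rewrite (ger0_norm (_ : 0 <= v-u)) ?subr_ge0// Int_bound// => y hy; apply: hM; rewrite hy.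
by rewrite normrN distrC (gtr0_norm (_ : 0 < u-v)) ?subr_gt0// Int_bound ?ltW// => y hy; apply: hM; rewrite hy orbT.
Qed.

Let between_norm x c y (K : R) : `|x| <= K -> `|c| <= K -> (x <= y <= c) || (c <= y <= x) -> `|y| <= K.
rewrite !ler_norml=> /andP[h1 h2] /andP[h3 h4] /orP[] /andP[h5 h6]; apply/andP; split; lra.
Qed.

Variables (T x0 : R).
Hypothesis T0 : 0 < T.

Lemma oi_joint (g : R -> R -> R) (C : R) : cont2 g ->
 (forall s y, g (clamp T s) y = g s y) -> (forall s y, `|g s y| <= C) ->
 continuous (fun p : R*R=> oriented_integral x0 p.2 (g p.1)).
move=> cg gT gC [s c]; have cgs t : continuous (g t) by exact: cont_section.
apply/(@cvgrPdist_le _ R)=> e e0 /=.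
have C0 : 0 <= C := le_trans (normr_ge0 _) (gC 0 0).
have k0 : 0 < 2*(`|c-x0| + 1) by rewrite mulr_gt0 ?ltr_wpDl.
have l0 : 0 < 2*(C+1) by rewrite mulr_gt0 ?ltr_wpDl.
have [r r0 hr] := @heine_rect _ T (`|x0| + `|c|) _ cg _ (divr_gt0 e0 k0).
have m0 : 0 < Num.min r (e/(2*(C+1))) by rewrite lt_min r0 divr_gt0.
near=> p; have [hs hc] : `|s-p.1| <= r /\ `|c-p.2| <= e/(2*(C+1)).
 have : ball (s, c) (Num.min r (e/(2*(C+1)))) p.
  by near: p; exact: (nbhsx_ballx (s, c) _ m0).
 by case=> /=; rewrite /ball /= !lt_min=> /andP[/ltW ? _] /andP[_ /ltW ?].
move: p.1 p.2 hs hc=> s' c' hs hc.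
rewrite distrC -(subrKA (oriented_integral x0 c (g s'))) (oi_diff _ _ _ (cgs s')) oiB//.
apply: le_trans (ler_normD _ _) _.
have h1 : `|oriented_integral c c' (g s')| <= C * `|c'-c| by apply: oi_bound.
have h2 : `|oriented_integral x0 c (fun y=> g s' y-g s y)| <= e/(2*(`|c-x0| + 1)) * `|c-x0|.
 apply: oi_bound; first exact: contB.
 move=> y hy; rewrite -(gT s') -(gT s); have yK : `|y| <= `|x0| + `|c|.
  by apply: between_norm hy; rewrite ?lerDl ?lerDr.
 apply: hr=> //; [exact: clamp_itv (ltW T0) _|exact: clamp_itv (ltW T0) _| |by rewrite subrr normr0 ltW].
 by apply: le_trans (clamp_lip T _ _) _; rewrite distrC.
have h3 : e/(2*(`|c-x0| + 1)) * `|c-x0| <= e/2.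
 rewrite mulrAC ler_pdivrMr//; have := normr_ge0 (c-x0); nra.
have h4 : C * `|c'-c| <= e/2.
 apply: le_trans (_ : C*(e/(2*(C+1))) <= _); first by rewrite ler_wpM2l// distrC.
 rewrite mulrA ler_pdivrMr//; nra.
lra.
Unshelve. all: by end_near. Qed.

(** Differentiation in t under the integral in y, in integrated form. On a short time interval both
    sides are compared with the length times the integral of g at its left end. *)
Lemma oi_time (G g : R -> R -> R) : cont2 g ->
 (forall s, continuous (G s)) -> (forall t, continuous (fun s=> oriented_integral x0 t (g s))) ->
 (forall u v y, 0 <= u -> u < v -> v <= T -> exists2 c, u < c < v & G v y-G u y = g c y*(v-u)) ->
 forall u v c, 0 <= u -> u <= v -> v <= T ->
 oriented_integral x0 c (G v) - oriented_integral x0 c (G u) = Int u v (fun s=> oriented_integral x0 c (g s)).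
move=> cg cG cV hG u v c u0 uv vT; have cgs t : continuous (g t) by exact: cont_section.
apply/eqP; rewrite -subr_eq0; apply/eqP.
apply: (@additive_small_zero _ (fun u v=> oriented_integral x0 c (G v) - oriented_integral x0 c (G u)
 - Int u v (fun s=> oriented_integral x0 c (g s))) _ _ uv)=> [p q r h1 h2 h3 h4|e e0].
 rewrite (@Int_split _ p q r)//; ring.
have k0 : 0 < 2*(`|c-x0| + 1) by rewrite mulr_gt0 ?ltr_wpDl.
have [r r0 hr] := @heine_rect _ T (`|x0| + `|c|) _ cg _ (divr_gt0 e0 k0).
exists r=> // p q h1 h2 h3 h4; have p0 : 0 <= p by lra. have qT : q <= T by lra.
move: (h2); rewrite le_eqVlt=> /predU1P[<-|pq]; first by rewrite Int_xx !subrr normr0 mulr0.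
have h s y : p <= s <= q -> (x0 <= y <= c) || (c <= y <= x0) -> `|g s y-g p y| <= e/(2*(`|c-x0| + 1)).
 move=> /andP[s1 s2] hy; have yK : `|y| <= `|x0| + `|c| by apply: between_norm hy; rewrite ?lerDl ?lerDr.
 by apply: hr; rewrite ?subrr ?normr0 ?(ltW r0)// ?ler_norml; apply/andP; split; lra.
rewrite oiB// -(subrKA ((q-p) * oriented_integral x0 c (g p))) -oiZ// oiB; [|exact: contB|by apply: contM=> //; exact: cst_continuous].
have b1 : `|oriented_integral x0 c (fun y=> G q y-G p y-(q-p)*g p y)| <= e/(2*(`|c-x0| + 1))*(q-p) * `|c-x0|.
 apply: oi_bound; first by apply: contB; [exact: contB|apply: contM=> //; exact: cst_continuous].
 move=> y hy; have [xi /andP[x1 x2] ->] := hG p q y p0 pq qT.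
 rewrite mulrC -mulrBr normrM (ger0_norm (_ : 0 <= q-p)) ?subr_ge0// mulrC ler_wpM2r ?subr_ge0//.
 by apply: h=> //; rewrite !ltW.
have b2 : `|(q-p) * oriented_integral x0 c (g p)-Int p q (fun s=> oriented_integral x0 c (g s))| <= e/(2*(`|c-x0| + 1)) * `|c-x0|*(q-p).
 rewrite mulrC -Int_cst// -IntB//; last exact: cst_continuous.
 apply: Int_bound=> //; first by apply: contB=> //; exact: cst_continuous.
 move=> s hs; rewrite distrC oiB//; apply: oi_bound; first exact: contB.
 by move=> y; exact: h.
rewrite oiZ//; apply: le_trans (ler_normD _ _) _; apply: le_trans (lerD b1 b2) _.
have -> : e/(2*(`|c-x0| + 1))*(q-p) * `|c-x0| + e/(2*(`|c-x0| + 1)) * `|c-x0|*(q-p)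
 = e*(q-p)*(`|c-x0| / (`|c-x0| + 1)) by field; rewrite gt_eqF// ltr_wpDl.
rewrite -[leRHS]mulr1 ler_wpM2l ?mulr_ge0 ?subr_ge0 ?(ltW e0)// ler_pdivrMr ?ltr_wpDl//; lra.
Qed.

End Oriented_integral.

Lemma second_order {R : realType} (f : R -> R) (M u v : R) :
 (forall z, (u <= z <= v) || (v <= z <= u) -> derivable f z 1 /\ derivable (derive1 f) z 1) ->
 (forall z, (u <= z <= v) || (v <= z <= u) -> `|derive1 (derive1 f) z| <= M) ->
 `|f v-f u-derive1 f u*(v-u)| <= M * `|v-u|^+2.
move=> hd hM; have [z hz|c hc ->] := @mvt_between _ f u v; first by case: (hd z hz).
have sub z : (u <= z <= c) || (c <= z <= u) -> (u <= z <= v) || (v <= z <= u).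
 by move: hc=> /orP[] /andP[c1 c2] /orP[] /andP[z1 z2]; apply/orP; (left+right); apply/andP; split; lra.
have [z hz|z hz e] := @mvt_between _ (derive1 f) u c; first by case: (hd z (sub z hz)).
rewrite -mulrBl e !normrM expr2 mulrA ler_wpM2r// ler_pM//; first exact/hM/sub.
move: hc=> /orP[] /andP[c1 c2].
 by rewrite !ger0_norm; lra.
by rewrite !ler0_norm; lra.
Qed.

Lemma lipschitz_continuous2 {R : realType} (g : R -> R -> R) (A : R) :
 (forall s s' y, `|g s y-g s' y| <= A * `|s-s'|) -> (forall s y y', `|g s y-g s y'| <= A * `|y-y'|) ->
 cont2 g.
move=> h1 h2 p; apply/(@cvgrPdist_le _ R)=> e e0.
have A0 : 0 <= A by have := h1 1 0 0; rewrite subr0 normr1 mulr1; apply: le_trans.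
have r0 : 0 < e/(2*(A+1)) by pos.
near=> q; have [/= hs hy] : ball p (e/(2*(A+1))) q by near: q; exact: (nbhsx_ballx p _ r0).
rewrite -(subrKA (g q.1 p.2)); apply: le_trans (ler_normD _ _) _.
have -> : e = A*(e/(2*(A+1)))+A*(e/(2*(A+1)))+e/(A+1) by field; rewrite gt_eqF// ltr_wpDl.
have g1 : `|g p.1 p.2-g q.1 p.2| <= A*(e/(2*(A+1))) by apply: le_trans (h1 _ _ _) _; rewrite ler_wpM2l// ltW.
have g2 : `|g q.1 p.2-g q.1 q.2| <= A*(e/(2*(A+1))) by apply: le_trans (h2 _ _ _) _; rewrite ler_wpM2l// ltW.
lra.
Unshelve. all: by end_near. Qed.

(** * The conditions of the model yield the analytic hypotheses *)

Section Model.
Context {R : realType}.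
Variables (T x0 a b : R) (S : R -> R -> R -> R) (sigma : R -> R -> R) (xs : R -> R -> R) (th0 : R).
Let Th : set R := [set th | a < th < b].
Hypotheses (T0 : 0 < T) (spos : forall t x, 0 <= t <= T -> 0 < sigma t x).
Hypothesis hode : forall th, Th th -> ode_solution T x0 (S th) (xs th).
Hypotheses (hC1 : condC1 T Th S sigma) (hC2 : condC2 T sigma) (hC3 : condC3 T Th S sigma xs) (hC4 : condC4 T Th S sigma).
Hypothesis hth0 : Th th0.
Let cl := clamp T.
Let clT t : 0 <= cl t <= T. exact: clamp_itv (ltW T0) t. Qed.

(** One constant M >= 1 bounds all derivatives in the conditions as well as 1/sigma, so that later
    bounds are powers of M. *)
Let hyps M := 1 <= M /\ forall th t x, Th th -> 0 <= t <= T ->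
 [/\ `|d_x S th t x| <= M, `|d_x (d_x S) th t x| <= M, `|d_theta S th t x| <= M & `|d_theta (d_theta S) th t x| <= M] /\
 [/\ `|d_t T S th t x| <= M, `|d_t T (d_theta S) th t x| <= M,
   `|d_t T (fun=> sigma) th t x| <= M, `|d_x (fun=> sigma) th t x| <= M & M^-1 <= sigma t x].

Let exM : exists M, hyps M.
case: hC3=> -[[_ [_ [m1 h1]]] [_ [_ [m2 h2]]]] [[_ [_ [m3 h3]]] _] [[_ [_ [m4 h4]]] [_ [_ [m5 h5]]]] _ _.
case: hC4=> -[_ [_ [m6 h6]]] [_ [_ [m7 h7]]] [_ [_ [m8 h8]]].
have [s0 s00 hs] : exists2 s0, 0 < s0 & forall t x, 0 <= t <= T -> s0 <= sigma t x.
 move: hC2; rewrite /condC2; set E := ereal_inf _=> hE.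
 have [c [c0 cE]] : exists c : R, 0 < c /\ (c%:E <= E)%E.
  by case: E hE=> [c|_|//]; [rewrite lte_fin; exists c|exists 1; rewrite leey].
 exists (Num.sqrt c); first by pos.
 move=> t x ht; have sg0 := spos x ht; rewrite -(ler_pXn2r (n := 2)) ?nnegrE ?sqrtr_ge0 ?(ltW sg0)// sqr_sqrtr ?(ltW c0)//.
 by rewrite -lee_fin; apply: le_trans cE _; apply: ereal_inf_lbound; exists (t, x).
have i0 : 0 < s0^-1 by rewrite invr_gt0.
exists (1+`|m1| + `|m2| + `|m3| + `|m4| + `|m5| + `|m6| + `|m7| + `|m8| + s0^-1).
set M := (X in hyps X).
have big m : `|m| <= M -> forall z : R, z <= m -> z <= M by move=> mM z zm; apply: le_trans mM; apply: le_trans zm (ler_norm m).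
have [n1 n2 n3 n4] : [/\ 0 <= `|m1|, 0 <= `|m2|, 0 <= `|m3| & 0 <= `|m4|] by [].
have [n5 n6 n7 n8] : [/\ 0 <= `|m5|, 0 <= `|m6|, 0 <= `|m7| & 0 <= `|m8|] by [].
have M1 : 1 <= M by rewrite /M; lra.
have [l1 l2 l3 l4] : [/\ `|m1| <= M, `|m2| <= M, `|m3| <= M & `|m4| <= M] by rewrite /M; split; lra.
have [l5 l6 l7 l8] : [/\ `|m5| <= M, `|m6| <= M, `|m7| <= M & `|m8| <= M] by rewrite /M; split; lra.
split=> // th t x hth ht; split.
 by split; [exact: big l1 _ (h1 _ _ _ hth ht)|exact: big l2 _ (h2 _ _ _ hth ht)|exact: big l4 _ (h4 _ _ _ hth ht)|
   exact: big l5 _ (h5 _ _ _ hth ht)].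
split; [exact: big l6 _ (h6 _ _ _ hth ht)|exact: big l7 _ (h7 _ _ _ hth ht)|exact: big l8 _ (h8 _ _ _ hth ht)|
 exact: big l3 _ (h3 _ _ _ hth ht)|].
apply: le_trans (hs t x ht); rewrite -[leRHS]invrK lef_pV2 ?posrE//; last by rewrite (lt_le_trans _ M1).
by rewrite /M; lra.
Qed.

Let M : R := projT1 (cid exM).
Let hM : hyps M. exact: projT2 (cid exM). Qed.
Let M1 : 1 <= M. by case: hM. Qed.
Let M0 : 0 < M. exact: lt_le_trans ltr01 M1. Qed.

Let Thb u v z : Th u -> Th v -> (u <= z <= v) || (v <= z <= u) -> Th z.
by move=> /andP[u1 u2] /andP[v1 v2] /orP[] /andP[z1 z2]; apply/andP; split; lra. Qed.

Let th_lip (g : R -> R -> R -> R) : smooth_theta T Th g ->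
 (forall th t y, Th th -> 0 <= t <= T -> `|d_theta g th t y| <= M) ->
 forall th th' t y, Th th -> Th th' -> 0 <= t <= T -> `|g th t y-g th' t y| <= M * `|th-th'|.
move=> [hd _] hb th th' t y h h' ht.
have [z hz|c hc e] := @mvt_between _ (fun u=> g u t y) th' th; first by apply: hd=> //; exact: Thb hz.
by rewrite e normrM ler_wpM2r//; apply: (hb c)=> //; exact: Thb hc.
Qed.

Let x_lip (g : R -> R -> R -> R) th : Th th -> smooth_x T Th g ->
 (forall t y, 0 <= t <= T -> `|d_x g th t y| <= M) ->
 forall t y y', 0 <= t <= T -> `|g th t y-g th t y'| <= M * `|y-y'|.
move=> h [hd _] hb t y y' ht.
have [z hz|c hc e] := @mvt_between _ (g th t) y' y; first exact: hd.
by rewrite e normrM ler_wpM2r//; exact: hb.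
Qed.

Let t_lip (g : R -> R -> R -> R) th : Th th -> smooth_t T Th g ->
 (forall t y, 0 <= t <= T -> `|d_t T g th t y| <= M) ->
 forall s t y, `|g th (cl s) y-g th (cl t) y| <= M * `|s-t|.
move=> h [hd _] hb s t y; apply: (rel_lipschitz T0 (f := fun s=> g th s y) (df := fun s=> d_t T g th s y)).
- by apply: slope_continuous=> r hr; exact: hd.
- by move=> r hr; apply: rel_deriveP=> //; apply: hd=> //; case/andP: hr=> *; rewrite !ltW.
- by move=> r hr; exact: hb.
Qed.

Let cb_cont (g : R -> R -> R -> R) th : Th th -> cont_bounded T Th g ->
 continuous (fun p : R*R=> g th (cl p.1) p.2).
move=> h [/within_continuousP cg _] p; apply/(@cvgrPdist_lt _ R)=> e e0.
have [|r r0 hr] := cg (th, cl p.1, p.2) _ e e0; first by split=> //; exact: clT.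
near=> q; have [/= hs hy] : ball p r q by near: q; exact: (nbhsx_ballx p _ r0).
apply: (hr (th, cl q.1, q.2)); first by split=> //; exact: clT.
split=> //; split=> /=; first exact: ballxx.
by rewrite /ball /=; apply: le_lt_trans hs; exact: clamp_lip.
Unshelve. all: by end_near. Qed.

Let theta_modulus (g : R -> R -> R -> R) lo hi K : cont_bounded T Th g -> a < lo -> hi < b ->
 forall e, 0 < e -> exists2 r, 0 < r & forall th th' t y, lo <= th <= hi -> lo <= th' <= hi -> 0 <= t <= T ->
  `|y| <= K -> `|th-th'| <= r -> `|g th t y-g th' t y| <= e.
move=> [cg _] alo hib e e0.
have cA : compact (`[lo, hi]%classic `*` `[0, T]%classic `*` `[- K, K]%classic : set (R*R*R)).
 by apply: compact_setX; [apply: compact_setX|]; exact: segment_compact.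
have [|r r0 hr] := heine cA _ e0 (f := fun p=> g p.1.1 p.1.2 p.2).
 apply: continuous_subspaceW cg=> -[[th t] y] [[/= + +] _]; rewrite !in_itv /= => /andP[l1 l2] ht.
 by split=> //; apply/andP; split; lra.
exists (r/2); first by rewrite divr_gt0.
move=> th th' t y h h' ht hy d; apply: (hr (th, t, y) (th', t, y)).
- by split; [split|]; rewrite /= in_itv /=// -ler_norml.
- by split; [split|]; rewrite /= in_itv /=// -ler_norml.
by split; [split|]; rewrite /=; [apply: le_lt_trans d _; lra|exact: ballxx..].
Qed.

Let C1S : smooth_x T Th S. by case: hC3=> -[]. Qed.
Let C1Sx : smooth_x T Th (d_x S). by case: hC3=> -[]. Qed.
Let C1sg : smooth_x T Th (fun=> sigma). by case: hC3=> _ []. Qed.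
Let C1th : smooth_theta T Th S. by case: hC3=> _ _ []. Qed.
Let C1thth : smooth_theta T Th (d_theta S). by case: hC3=> _ _ []. Qed.
Let C1t : smooth_t T Th S. by case: hC4. Qed.
Let C1tth : smooth_t T Th (d_theta S). by case: hC4. Qed.
Let C1tsg : smooth_t T Th (fun=> sigma). by case: hC4. Qed.
Let bnd th t x : Th th -> 0 <= t <= T ->
 [/\ `|d_x S th t x| <= M, `|d_x (d_x S) th t x| <= M, `|d_theta S th t x| <= M & `|d_theta (d_theta S) th t x| <= M] /\
 [/\ `|d_t T S th t x| <= M, `|d_t T (d_theta S) th t x| <= M,
   `|d_t T (fun=> sigma) th t x| <= M, `|d_x (fun=> sigma) th t x| <= M & M^-1 <= sigma t x].
by case: hM=> _; exact. Qed.

Let Sf th t y := S th (cl t) y.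
Let Sx th t y := d_x S th (cl t) y.
Let Sd th t y := d_theta S th (cl t) y.
Let Sdd th t y := d_theta (d_theta S) th (cl t) y.
Let sg t y := sigma (cl t) y.
Let iv t y := (sg t y)^-1.

Let sg_lo t y : M^-1 <= sg t y. by have [_ []] := bnd y hth0 (clT t). Qed.
Let sg_gt0 t y : 0 < sg t y. exact: spos. Qed.
Let sg_neq0 t y : sg t y != 0. by rewrite gt_eqF. Qed.
Let iv_gt0 t y : 0 < iv t y. by rewrite invr_gt0. Qed.
Let iv_le t y : iv t y <= M. by rewrite -[leRHS]invrK lef_pV2 ?posrE ?invr_gt0. Qed.
Let iv_abs t y : `|iv t y| <= M. by rewrite gtr0_norm. Qed.
Let iv2_abs t y : `|iv t y^+2| <= M^+2. by rewrite normrX lerXn2r ?nnegrE// ltW. Qed.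

Let Sf_th th th' t y : Th th -> Th th' -> `|Sf th t y-Sf th' t y| <= M * `|th-th'|.
by move=> h h'; apply: (th_lip C1th _ y h h' (clT t))=> u s q hu ht; have [[]] := bnd q hu ht. Qed.
Let Sd_th th th' t y : Th th -> Th th' -> `|Sd th t y-Sd th' t y| <= M * `|th-th'|.
by move=> h h'; apply: (th_lip C1thth _ y h h' (clT t))=> u s q hu ht; have [[]] := bnd q hu ht. Qed.
Let Sf_x th t y y' : Th th -> `|Sf th t y-Sf th t y'| <= M * `|y-y'|.
by move=> h; apply: (x_lip h C1S)=> // ? z ht; have [[]] := bnd z h ht. Qed.
Let sg_x t y y' : `|sg t y-sg t y'| <= M * `|y-y'|.
by apply: (x_lip hth0 C1sg)=> // ? z ht; have [_ []] := bnd z hth0 ht. Qed.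
Let Sf_t th s t y : Th th -> `|Sf th s y-Sf th t y| <= M * `|s-t|.
by move=> h; apply: (t_lip h C1t)=> // ? z ht; have [_ []] := bnd z h ht. Qed.
Let sg_t s t y : `|sg s y-sg t y| <= M * `|s-t|.
by apply: (t_lip hth0 C1tsg)=> // ? z ht; have [_ []] := bnd z hth0 ht. Qed.

Let cSf th : Th th -> cont2 (Sf th).
by move=> h; apply: (lipschitz_continuous2 (A := M))=> [s s' y|s y y']; [exact: Sf_t|exact: Sf_x]. Qed.
Let csg : cont2 sg.
by apply: (lipschitz_continuous2 (A := M))=> [s s' y|s y y']; [exact: sg_t|exact: sg_x]. Qed.
Let civ : cont2 iv.
by apply: contV=> // p; exact: sg_neq0. Qed.
Let cSx th : Th th -> cont2 (Sx th).
by move=> h; apply: (cb_cont h); case: C1S. Qed.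
Let cSd th : Th th -> cont2 (Sd th).
by move=> h; apply: (cb_cont h); case: C1th. Qed.
Let cSdd th : Th th -> cont2 (Sdd th).
by move=> h; apply: (cb_cont h); case: C1thth. Qed.

Let cl_id t : 0 <= t <= T -> cl t = t. exact: clamp_id. Qed.
Let cl_cl t : cl (cl t) = cl t. exact: cl_id (clT t). Qed.

Let Sd_abs th t y : Th th -> `|Sd th t y| <= M.
by move=> h; have [[]] := bnd y h (clT t). Qed.
Let Sdd_abs th t y : Th th -> `|Sdd th t y| <= M.
by move=> h; have [[]] := bnd y h (clT t). Qed.

Let G th t y := Sd th t y/sg t y^+2.
Let g th t y := (d_t T (d_theta S) th (cl t) y*sg t y-2*Sd th t y*d_t T (fun=> sigma) 0 (cl t) y)/sg t y^+3.

Let GE th t y : G th t y = Sd th t y*iv t y^+2.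
by rewrite /G /iv exprVn. Qed.

Let Mpow n : 1 <= M^+n. exact: exprn_ege1. Qed.
Let G_abs th t y : Th th -> `|G th t y| <= M^+3.
by move=> h; rewrite GE exprS normrM; apply: ler_pM=> //; [exact: Sd_abs|exact: iv2_abs]. Qed.
Let g_abs th t y : Th th -> `|g th t y| <= 3*M^+5.
move=> h; have [_ [_ q1 q2 _ _]] := bnd y h (clT t).
rewrite /g (_ : _/_ = d_t T (d_theta S) th (cl t) y*iv t y^+2-2*(Sd th t y*d_t T (fun=> sigma) 0 (cl t) y*iv t y^+3)); last first.
 by rewrite /iv; field; exact: sg_neq0.
apply: le_trans (ler_normB _ _) _; rewrite [X in _ + X]normrM (ger0_norm (_ : 0 <= 2 :> R))//.
have h1 : `|d_t T (d_theta S) th (cl t) y*iv t y^+2| <= M^+3.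
 by rewrite exprS normrM ler_pM// iv2_abs.
have h2 : `|Sd th t y*d_t T (fun=> sigma) 0 (cl t) y*iv t y^+3| <= M^+5.
 rewrite (_ : M^+5 = M*M*M^+3); last by ring.
 rewrite normrM; apply: ler_pM=> //; first by rewrite normrM; apply: ler_pM=> //; exact: Sd_abs.
 by rewrite normrX lerXn2r ?nnegrE// ltW.
have : M^+3 <= M^+5 by apply: ler_weXn2l.
lra.
Qed.

Let cG th : Th th -> cont2 (G th).
move=> h; rewrite (_ : (fun p=> _) = (fun p=> Sd th p.1 p.2*iv p.1 p.2^+2)); last by apply/funext=> p; rewrite GE.
by apply: contM; [exact: cSd|exact: contX].
Qed.

Let cg th : Th th -> cont2 (g th).
move=> h; have c2 : continuous (fun _ : R*R=> 2 : R) by exact: cst_continuous.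
apply: contM; last by apply: contV; [move=> p; rewrite expf_neq0//|exact: contX].
apply: contB; first by apply: contM=> //; apply: (cb_cont h); case: C1tth.
by apply: contM; [apply: contM=> //; exact: cSd|exact: (@cb_cont (d_t T (fun=> sigma)) th0 hth0 (proj2 C1tsg))].
Qed.

Let cG' th : Th th -> continuous (fun p : R*R=> G th p.2 p.1).
move=> h; apply: (@cont_comp _ _ _ (fun p=> (p.2, p.1)) (fun p=> G th p.1 p.2)); last exact: cG.
by apply: cont_pair=> p; [exact: cvg_snd|exact: cvg_fst].
Qed.

Let G_mvt th u v y : Th th -> 0 <= u -> u < v -> v <= T ->
 exists2 c, u < c < v & G th v y-G th u y = g th c y*(v-u).
move=> h u0 uv vT.
pose f s := d_theta S th s y/sigma s y^+2.
have fG s : 0 <= s <= T -> G th s y = f s by move=> hs; rewrite /G /Sd /sg cl_id.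
rewrite !fG; [|apply/andP; split; lra..].
apply: (@rel_mvt _ T f (fun c=> g th c y))=> // [|s hs].
 have /within_continuousP ct := continuous_subspaceT (A := `[0, T]%classic) (cont_section (t := y) (g := fun y s=> G th s y) (cG' h)).
 apply/within_continuousP=> s hs e e0; have [r r0 hr] := ct s hs e e0; exists r=> // s' hs' d.
 by move: (hs) (hs'); rewrite /= !in_itv /= => k k'; rewrite -!fG//; exact: hr.
have hs' : 0 <= s <= T by case/andP: hs=> *; rewrite !ltW.
have d1 : is_derive s 1 (fun s=> d_theta S th s y) (d_t T (d_theta S) th s y).
 by apply: rel_deriveP=> //; case: C1tth=> hd _; exact: hd.
have d2 : is_derive s 1 (fun s=> sigma s y) (d_t T (fun=> sigma) 0 s y).
 by apply: (@rel_deriveP _ T)=> //; case: C1tsg=> hd _; exact: (hd th).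
have s0 : sigma s y != 0 by rewrite gt_eqF ?spos.
have d4 := @is_deriveV R (fun r=> sigma r y*sigma r y) s _ 1 (mulf_neq0 s0 s0) (is_deriveM d2 d2).
apply: (is_derive_eq (is_deriveM d1 d4)).
rewrite -![_ *: _]/(_*_) /g /Sd /sg cl_id//=; by field.
Qed.

Let exL : exists L, M <= L /\ forall th t y, Th th -> `|Sf th t y| <= L*(1+`|y|) /\ `|sg t y| <= L*(1+`|y|).
case: hC1=> L [_ hL]; exists (`|L| + M); split=> [|th t y h]; first by rewrite lerDr.
have := hL th (cl t) y h (clT t); have L1 : L*(1+`|y|) <= (`|L| + M)*(1+`|y|).
 by rewrite ler_wpM2r ?addr_ge0//; have := ler_norm L; have := M0; lra.
have := normr_ge0 (Sf th t y); have := normr_ge0 (sg t y); rewrite /Sf /sg; split; lra.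
Qed.
Let L : R := projT1 (cid exL).
Let ML : M <= L. by case: (projT2 (cid exL)). Qed.
Let L0 : 0 < L. exact: lt_le_trans ML. Qed.
Let growS th t y : Th th -> `|Sf th t y| <= L*(1+`|y|).
by move=> h; case: (projT2 (cid exL))=> _ /(_ th t y h)[]. Qed.
Let growsg t y : `|sg t y| <= L*(1+`|y|).
by case: (projT2 (cid exL))=> _ /(_ th0 t y hth0)[]. Qed.
Let lipS th t y z : Th th -> `|Sf th t y-Sf th t z| <= L * `|y-z|.
by move=> h; apply: le_trans (Sf_x _ _ _ h) _; rewrite ler_wpM2r. Qed.

Let xc th s := xs th (cl s).
Let xs0 th : Th th -> xs th 0 = x0. by move=> /hode[]. Qed.
Let xs_cont th : Th th -> {within `[0, T], continuous (xs th)}.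
by move=> /hode[_ h]; apply: slope_continuous=> t ht; apply/cvg_ex; eexists; exact: h. Qed.
Let xc_cont th : Th th -> continuous (xc th).
by move=> h; apply: (@continuous_clamp _ _ (ltW T0)); exact: xs_cont. Qed.
Let cSx_path th : Th th -> continuous (fun s=> Sf th s (xc th s)).
move=> h; apply: (@cont_comp _ _ _ (fun s=> (s, xc th s)) (fun p=> Sf th p.1 p.2)); last exact: cSf.
by apply: cont_pair; [move=> s; exact: cvg_id|exact: xc_cont].
Qed.
Let xs_derive th t : Th th -> 0 < t < T -> is_derive t 1 (xs th) (Sf th t (xc th t)).
move=> h ht; have ht' : 0 <= t <= T by case/andP: ht=> *; rewrite !ltW.
by rewrite /Sf /xc cl_id//; apply: (slope_is_derive ht); case: (hode h)=> _ /(_ t ht').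
Qed.

Let xE t : 0 <= t <= T -> xc th0 t = x0+Int 0 t (fun s=> Sf th0 s (xc th0 s)).
move=> ht; have /andP[t0 tT] := ht; rewrite /xc cl_id//.
have <- := rel_ftc (xs_cont hth0) (fun t=> xs_derive hth0) (cSx_path hth0) (lexx 0) t0 tT.
by rewrite xs0// addrC subrK.
Qed.

Let sqn (z : R) : `|z|^+2 = z^+2. exact: real_normK (num_real z). Qed.

                                                                                 
                                                      
(** Lipschitz constant of the limit path in theta, from a Gronwall estimate for the squared
    difference; the summand 1 makes it at least 1, so that cx - 1 <= cx^2. *)
Let cx : R := expR (3*M*T)*M*T+1.
Let cx1 : 1 <= cx. by rewrite lerDr !mulr_ge0 ?expR_ge0 ?ltW. Qed.

Let gronwall_ineq (D d z e : R) : 0 <= e -> e <= 1 -> `|z| <= M * `|D| + M*d -> 0 <= d ->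
 e*(2*D*z-3*M*D^+2)-M*d^+2 <= 0.
move=> e0 e1 hz d0; have h : 2*D*z-3*M*D^+2 <= M*d^+2.
 have : D*z <= `|D|*(M * `|D| + M*d) by apply: le_trans (ler_norm _) _; rewrite normrM ler_wpM2l.
 have := mulr_ge0 (ltW M0) (sqr_ge0 (`|D| - d)); rewrite -(sqn D); move: `|D| => q; nra.
have : e*(2*D*z-3*M*D^+2) <= e*(M*d^+2) by rewrite ler_wpM2l.
have : e*(M*d^+2) <= M*d^+2 by rewrite ler_piMl// mulr_ge0 ?sqr_ge0// ltW.
lra.
Qed.

Let xc_th th s : Th th -> `|xc th s-xc th0 s| <= cx * `|th-th0|.
move=> h; set d := `|th-th0|; have d0 : 0 <= d by exact: normr_ge0.
have /andP[s0 sT] := clT s; rewrite /xc; move: (cl s) s0 sT=> t t0 tT.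
pose D r := xs th r-xs th0 r; pose D' r := Sf th r (xc th r)-Sf th0 r (xc th0 r).
suff : D t^+2 <= (cx*d)^+2.
 by rewrite -(sqn (D t)) ler_pXn2r ?nnegrE// mulr_ge0// (le_trans ler01).
move: t0; rewrite le_eqVlt=> /predU1P[<-|t0].
 by rewrite /D !xs0// subrr expr0n /= sqr_ge0.
(* [phi] vanishes at 0 and has a nonpositive derivative by [gronwall_ineq], so D^2 <= M d^2 t exp(3
   M t). *)
pose e r := expR (- (3*M)*r); pose phi r := D r*D r*e r-M*d^+2*r.
have cD : {within `[0, T], continuous D} by move=> r; apply: cvgB; exact: xs_cont.
have ce : {within `[0, T], continuous e}.
 apply: continuous_subspaceT; apply: (@cont_comp _ _ _ (fun r=> - (3*M)*r) expR); last exact: continuous_expR.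
 by move=> r; apply: cvgM; [exact: cvg_cst|exact: cvg_id].
have cphi : {within `[0, T], continuous phi}.
 move=> r; apply: cvgB; first by apply: cvgM; [apply: cvgM; exact: cD|exact: ce].
 have clin : continuous (fun r : R=> M*d^+2*r) by move=> q; apply: cvgM; [exact: cvg_cst|exact: cvg_id].
 exact: (continuous_subspaceT clin).
pose dphi r := e r*(2*D r*D' r-3*M*D r^+2)-M*d^+2.
have dp r : 0 < r < T -> is_derive r 1 phi (dphi r).
 move=> hr; have k1 : is_derive r 1 D (D' r) by apply: is_deriveB; exact: xs_derive.
 have k2 : is_derive r 1 e (- (3*M)*e r).
  have k : is_derive r 1 (fun r=> - (3*M)*r) (- (3*M)).
   by apply: is_derive_eq; rewrite -[_ *: _]/(_*_) mulr1.
  by apply: (is_derive_eq (is_derive1_comp (is_derive_expR _) k)); rewrite -?[_ *: _]/(_*_) mulrC.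
 have k3 : is_derive r 1 (fun r=> M*d^+2*r) (M*d^+2).
  by apply: is_derive_eq; rewrite -[_ *: _]/(_*_) mulr1.
 apply: (is_derive_eq (is_deriveB (is_deriveM (is_deriveM k1 k1) k2) k3)).
 rewrite -![_ *: _]/(_*_) -[(D*D) r]/(D r*D r) /dphi; ring.
have [r /andP[r1 r2] hphi] := rel_mvt cphi dp (lexx 0) t0 tT.
have e1 q : 0 <= q -> e q <= 1 by move=> q0; rewrite -expR0 ler_expR mulNr oppr_le0 !mulr_ge0// ltW.
have dphi0 : dphi r <= 0.
 apply: gronwall_ineq=> //; [exact: expR_ge0|exact/e1/ltW|].
 have hr : 0 <= r <= T by apply/andP; split; lra.
 rewrite /D' /D -(cl_id hr) -!/(xc _ _) -(subrKA (Sf th r (xc th0 r))).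
 apply: le_trans (ler_normD _ _) _; rewrite cl_id// lerD ?Sf_x//; exact: Sf_th.
have : phi t <= 0.
 have p0 : phi 0 = 0 by rewrite /phi /D !xs0// !subrr !mul0r mulr0 subr0.
 have : dphi r*(t-0) <= 0 by rewrite subr0 mulr_le0_ge0// ltW.
 by rewrite -hphi p0 subr0.
rewrite /phi subr_le0=> h1.
have et : e t*expR (3*M*t) = 1 by rewrite -expRD mulNr addNr expR0.
have -> : D t^+2 = D t*D t*e t*expR (3*M*t) by rewrite -mulrA et mulr1.
have g1 : expR (3*M*t) <= expR (3*M*T) by rewrite ler_expR ler_wpM2l ?mulr_ge0// ltW.
apply: le_trans (_ : M*d^+2*t*expR (3*M*t) <= _); first by rewrite ler_wpM2r.
apply: le_trans (_ : M*d^+2*T*expR (3*M*T) <= _).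
 by apply: ler_pM=> //; rewrite ?mulr_ge0 ?sqr_ge0 ?(ltW t0) ?(ltW M0)// ler_wpM2l// mulr_ge0 ?sqr_ge0// ltW.
rewrite (_ : M*d^+2*T*expR (3*M*T) = (cx-1)*d^+2); last by rewrite /cx; ring.
rewrite exprMn ler_wpM2r ?sqr_ge0//; have := cx1; nra.
Qed.

Let exK : exists K, forall s, `|xc th0 s| + 2 <= K.
have ca : {within `[0, T], continuous (fun s=> `|xc th0 s|)} by apply: continuous_subspaceT; apply: contA; exact: xc_cont.
have [c hc hm] := EVT_max (ltW T0) ca; exists (`|xc th0 c| + 2)=> s; rewrite lerD2r.
by rewrite (_ : xc th0 s = xc th0 (cl s)); [apply: hm; rewrite in_itv; exact: clT|rewrite /xc cl_cl].
Qed.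
Let K : R := projT1 (cid exK).
Let xK s : `|xc th0 s| + 2 <= K. exact: (projT2 (cid exK)). Qed.
Let K0 : 0 <= K. by apply: le_trans (xK 0); rewrite addr_ge0. Qed.

Let C : R := K+L*(1+K)+3*M^+5+M*(1+cx)^+2.
Let exC : [/\ K <= C, L*(1+K) <= C, 3*M^+5 <= C & M*(1+cx)^+2 <= C].
have LK : 0 <= L*(1+K) by pos.
have := Mpow 5; have : 0 <= M*(1+cx)^+2 by pos.
by have := K0; split; rewrite /C; lra.
Qed.
Let KC : K <= C. by case: exC. Qed.
Let M5C : 3*M^+5 <= C. by case: exC. Qed.
Let MC n : (n <= 5)%N -> M^+n <= C.
move=> n5; have : M^+n <= M^+5 by exact: ler_weXn2l.
by have := M5C; have := Mpow 5; lra.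
Qed.
Let C1 : 1 <= C. by have := MC (leqnSn 4); have := Mpow 4; lra. Qed.
Let C0 : 0 <= C. exact: le_trans ler01 C1. Qed.

(** Half the distance to the boundary, so that parameters within 3 rho/2 of [th0] still lie in Theta
    ([near2]); the extra room is for the difference quotient in [Sd_modulus]. *)
Let rho : R := Num.min (th0-a) (b-th0)/2.
Let rho0 : 0 < rho.
by case/andP: hth0=> h1 h2; rewrite divr_gt0// lt_min !subr_gt0 h1 h2. Qed.
Let near2 th : `|th-th0| <= rho+rho/2 -> Th th.
have : rho <= (th0-a)/2 /\ rho <= (b-th0)/2.
 by split; rewrite ler_wpM2r// ge_min lexx ?orbT.
have := rho0; move=> r0 [h1 h2]; rewrite ler_norml=> /andP[h3 h4]; apply/andP; split; lra.
Qed.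
Let nearT th : `|th-th0| <= rho -> Th th.
by move=> h; apply: near2; have := rho0; lra. Qed.

Let D th s y := S th (cl s) (xc th s)+d_x S th (cl s) y*(y-xc th s).
Let cD th : Th th -> cont2 (D th).
have c1 : continuous (fst : R*R -> R) by move=> p; exact: cvg_fst.
have c2 : continuous (snd : R*R -> R) by move=> p; exact: cvg_snd.
move=> h; have cp : continuous (fun p : R*R=> xc th p.1) by apply: cont_comp c1 _; exact: xc_cont.
apply: contD; last by apply: contM; [exact: cSx|exact: contB].
by apply: (@cont_comp _ _ _ (fun p=> p.1) (fun s=> Sf th s (xc th s)))=> //; exact: cSx_path.
Qed.

Let Taylor_theta th t y : Th th -> `|Sf th t y-Sf th0 t y-(th-th0)*Sd th t y| <= M * `|th-th0|^+2.
move=> h; have q : `|Sf th0 t y-Sf th t y-Sd th t y*(th0-th)| <= M * `|th0-th|^+2.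
 apply: (@second_order _ (fun u=> Sf u t y))=> z hz; have hz' := Thb h hth0 hz; last exact: Sdd_abs.
 by split; [case: C1th=> hd _|case: C1thth=> hd _]; exact: hd.
rewrite -[leLHS]normrN (distrC th) (_ : - (Sf th t y-Sf th0 t y-(th-th0)*Sd th t y) = Sf th0 t y-Sf th t y-Sd th t y*(th0-th)) //; ring.
Qed.

(** D is the first-order expansion of S(th) from y to the limit path at th, taken with the sign that
    returns S(th, y) up to a quadratic error; a second expansion goes from th to [th0]. The two
    paths are compared by [xc_th]. *)
Let hDS th s y : Th th -> `|D th s y-(Sf th0 s y+(th-th0)*Sd th s y)| <= C*(`|y-xc th0 s| + `|th-th0|)^+2.
move=> h; have q1 := Taylor_theta s y h.
have q2 : `|Sf th s (xc th s)-Sf th s y-Sx th s y*(xc th s-y)| <= M * `|xc th s-y|^+2.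
 apply: second_order=> z _; first by split; [case: C1S=> hd _|case: C1Sx=> hd _]; exact: hd.
 by case: (bnd z h (clT s))=> -[_ q _ _] _; exact: q.
have q3 : `|xc th s-y| <= `|y-xc th0 s| + cx * `|th-th0|.
 rewrite -(subrKA (xc th0 s)) (distrC y); apply: le_trans (ler_normD _ _) _; rewrite addrC lerD2l; exact: xc_th.
rewrite (_ : D th s y - _ = (Sf th s (xc th s)-Sf th s y-Sx th s y*(xc th s-y))+(Sf th s y-Sf th0 s y-(th-th0)*Sd th s y)); last first.
 by rewrite /D /Sf /Sx; ring.
apply: le_trans (ler_normD _ _) _; apply: le_trans (lerD q2 q1) _.
have n1 := normr_ge0 (y-xc th0 s); have n2 := normr_ge0 (th-th0); have n3 := normr_ge0 (xc th s-y).
apply: le_trans (_ : M*(1+cx)^+2*(`|y-xc th0 s| + `|th-th0|)^+2 <= _); last first.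
 by rewrite ler_wpM2r ?sqr_ge0//; case: exC.
rewrite -mulrDr -mulrA ler_wpM2l ?(ltW M0)// -exprMn.
move: q3 n1 n2 n3 cx1; move: `|xc th s-y| `|y-xc th0 s| `|th-th0| cx=> p q r k h1 h2 h3 h4 h5.
have : 0 <= k*k*(q*r) by rewrite !mulr_ge0// (le_trans ler01).
nra.
Qed.

Let iv_x t y y' : `|iv t y-iv t y'| <= M^+3 * `|y-y'|.
apply: le_trans (lip_inv M0 (sg_lo t y) (sg_lo t y')) _.
by rewrite (exprSr M 2) -mulrA ler_wpM2l ?exprn_ge0 ?(ltW M0).
Qed.
Let iv2_x t y y' : `|iv t y^+2-iv t y'^+2| <= 2*M^+4 * `|y-y'|.
have := lip_mul (iv_abs t y) (iv_abs t y') (iv_x t y y') (iv_x t y y').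
by rewrite -!expr2 (_ : M*(M^+3 * `|y-y'|)+M*(M^+3 * `|y-y'|) = 2*M^+4 * `|y-y'|)//; ring.
Qed.

Let G_t th s s' y : Th th -> `|G th s y-G th s' y| <= C * `|s-s'|.
move=> h; have key u v : 0 <= u -> u <= v -> v <= T -> `|G th v y-G th u y| <= C * `|v-u|.
 move=> u0; rewrite le_eqVlt=> /predU1P[<-|uv] vT; first by rewrite !subrr normr0 mulr0.
 have [c _ ->] := G_mvt y h u0 uv vT; rewrite normrM ler_wpM2r//.
 by apply: le_trans M5C; exact: g_abs.
have /andP[s0 sT] := clT s; have /andP[s0' sT'] := clT s'.
have cc u : G th u y = G th (cl u) y by rewrite /G /Sd /sg cl_cl.
rewrite (cc s) (cc s'); apply: le_trans (_ : C * `|cl s-cl s'| <= _); last by rewrite ler_wpM2l// clamp_lip.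
by case: (leP (cl s) (cl s'))=> [|/ltW] le; [rewrite distrC (distrC (cl s))|]; exact: key.
Qed.

                                                                                        
(** Interpolation. A theta-difference quotient of step k = eta eps/(2M) approximates Sdot with error
    M k at each of the two points, and the x-increment of the quotient is controlled by the
    continuity of S' in theta. The total is eta (eps + |c - c'|/eps). *)
Let Sd_modulus eta : 0 < eta -> small (fun eps=> forall th s c c', `|th-th0| <= rho -> `|c| <= C -> `|c'| <= C ->
 `|Sd th s c-Sd th s c'| <= eta*(eps+`|c-c'| / eps)).
move=> eta0; pose k0 := eta/(2*M); have k00 : 0 < k0 by rewrite divr_gt0// mulr_gt0.
have [alo hib] : a < th0-rho-rho/2 /\ th0+rho+rho/2 < b.
 have q : 0 <= rho+rho/2 by have := rho0; lra.
 have : Th (th0-(rho+rho/2)) by apply: near2; rewrite addrC addKr normrN ger0_norm.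
 have : Th (th0+(rho+rho/2)) by apply: near2; rewrite addrC addKr ger0_norm.
 by move=> /andP[_ h1] /andP[h2 _]; split; lra.
have [r r0 hr] := theta_modulus C (proj2 C1S) alo hib (mulr_gt0 eta0 k00).
have m0 : 0 < Num.min r (rho/2) by pos.
apply: small_mono (small_lt (divr_gt0 m0 k00)) _=> eps e0; rewrite ltr_pdivlMr// lt_min=> /andP[/ltW kr /ltW krho].
move=> th s c c' hn hc hc'; pose k := eps*k0; have kp : 0 < k by rewrite mulr_gt0.
have h := nearT hn; have hk : Th (th+k).
 apply: near2; rewrite addrAC; apply: le_trans (ler_normD _ _) _; rewrite lerD// gtr0_norm//.
have q y : `|Sf (th+k) s y-Sf th s y-Sd th s y*k| <= M*k^+2.
 have := @second_order _ (fun u=> Sf u s y) M th (th+k); have -> : th+k-th = k by ring.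
 rewrite (gtr0_norm kp); apply=> z hz.
  have hz' : Th z by exact: Thb h hk hz.
  by split; [case: C1th=> hd _|case: C1thth=> hd _]; exact: hd.
 by apply: Sdd_abs; exact: Thb h hk hz.
have sx : `|(Sf (th+k) s c-Sf th s c)-(Sf (th+k) s c'-Sf th s c')| <= eta*k0 * `|c-c'|.
 have hdz z : derivable (fun y=> Sf (th+k) s y-Sf th s y) z 1.
  by apply: derivableB; case: C1S=> hd _; exact: hd.
 have [z _|z hz e] := @mvt_between _ (fun y=> Sf (th+k) s y-Sf th s y) c' c; first exact: hdz.
 rewrite e normrM ler_wpM2r//.
 have -> : derive1 (fun y=> Sf (th+k) s y-Sf th s y) z = Sx (th+k) s z-Sx th s z.
  by rewrite /Sx /d_x !derive1E deriveB//; case: C1S=> hd _; exact: hd.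
 apply: hr.
 - by move: hn; rewrite ler_norml=> /andP[h1 h2]; apply/andP; split; move: krho rho0; rewrite -/k; lra.
 - by move: hn rho0; rewrite ler_norml=> /andP[h1 h2] r1; apply/andP; split; lra.
 - exact: clT.
 - move: hz hc hc'; rewrite !ler_norml=> /orP[] /andP[z1 z2] /andP[c1 c2] /andP[c3 c4]; apply/andP; split; lra.
 - by rewrite addrC addKr gtr0_norm.
have : `|(Sd th s c-Sd th s c')*k| <= 2*(M*k^+2)+eta*k0 * `|c-c'|.
 have := q c; have := q c'; move: sx; rewrite !ler_norml=> /andP[? ?] /andP[? ?] /andP[? ?]; apply/andP; split; lra.
rewrite normrM (gtr0_norm kp) -ler_pdivlMr//; move/le_trans; apply.
rewrite le_eqVlt; apply/orP; left; apply/eqP; rewrite /k /k0; field.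
by rewrite !gt_eqF.
Qed.

Let hGmod eta : 0 < eta -> small (fun eps=> forall th s s' c c', `|th-th0| <= rho ->
 0 <= s <= T -> 0 <= s' <= T -> `|c| <= C -> `|c'| <= C ->
 `|G th s c-G th s' c'| <= C * `|s-s'| + eta*(eps+`|c-c'| / eps)).
move=> eta0; have e1 : 0 < eta/(2*M^+2) by pos.
have e2 : 0 < eta/(4*M^+5) by pos.
apply: small_mono (small_and (Sd_modulus e1) (small_lt e2)) _=> eps e0 [hS hlt].
move=> th s s' c c' hn _ _ hc hc'; have h := nearT hn.
rewrite -(subrKA (G th s c')) addrC; apply: le_trans (ler_normD _ _) _; apply: lerD; first exact: G_t.
rewrite !GE; apply: le_trans (lip_mul (Sd_abs s c h) (iv2_abs s c') (hS th s c c' hn hc hc') (iv2_x s c c')) _.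
have n0 := normr_ge0 (c-c'); move: `|c-c'| n0=> q q0.
have -> : M^+2*(eta/(2*M^+2)*(eps+q/eps)) = eta/2*(eps+q/eps).
 by field; rewrite !gt_eqF.
have : M*(2*M^+4*q) <= eta/2*(q/eps).
 rewrite (_ : M*_ = 2*M^+5*q); last by ring.
 rewrite (_ : eta/2*(q/eps) = eta/2/eps*q); last by ring.
 rewrite ler_wpM2r// ler_pdivlMr//.
 move: hlt; rewrite ltr_pdivlMr ?mulr_gt0 ?exprn_gt0// => /ltW; lra.
have : 0 <= eta/2*eps by pos.
lra.
Qed.

Let V th t c := oriented_integral x0 c (G th t).
Let V' th t c := oriented_integral x0 c (g th t).
Let cGs th t : Th th -> continuous (G th t). by move=> h; apply: cont_section; exact: cG. Qed.
Let cgs th t : Th th -> continuous (g th t). by move=> h; apply: cont_section; exact: cg. Qed.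
Let G_absC th t y : Th th -> `|G th t y| <= C.
by move=> h; apply: le_trans (G_abs _ _ h) (MC _). Qed.
Let g_absC th t y : Th th -> `|g th t y| <= C.
by move=> h; apply: le_trans (g_abs _ _ h) M5C. Qed.
Let cV th : Th th -> cont2 (V th).
move=> h; apply: (oi_joint T0 (g := G th) (C := C))=> [|s y|s y]; [exact: cG|by rewrite /G /Sd /sg cl_cl|exact: G_absC].
Qed.
Let cV' th : Th th -> cont2 (V' th).
move=> h; apply: (oi_joint T0 (g := g th) (C := C))=> [|s y|s y]; [exact: cg|by rewrite /g /Sd /sg cl_cl|exact: g_absC].
Qed.
Let V_lip th t c c' : Th th -> `|V th t c'-V th t c| <= C * `|c'-c|.
by move=> h; rewrite oi_diff; [apply: oi_bound; [exact: cGs|move=> y _; exact: G_absC]|exact: cGs]. Qed.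
Let V'_lip th t c c' : Th th -> `|V' th t c'-V' th t c| <= C * `|c'-c|.
by move=> h; rewrite oi_diff; [apply: oi_bound; [exact: cgs|move=> y _; exact: g_absC]|exact: cgs]. Qed.
Let V_time th t t' c : Th th -> 0 <= t -> t <= t' -> t' <= T -> V th t' c-V th t c = Int t t' (fun s=> V' th s c).
move=> h; apply: (oi_time (T := T))=> [|s|s|u v y u0 uv vT]; [exact: cg|exact: cGs| |exact: G_mvt].
by move=> s'; apply: (@cont_comp _ _ _ (fun s=> (s, s)) (fun p=> V' th p.1 s)) s'; [apply: cont_pair=> p; exact: cvg_id|];
 apply: (@cont_comp _ _ _ (fun p : R*R=> (p.1, s)) (fun p=> V' th p.1 p.2)); [apply: cont_pair=> p; [exact: cvg_fst|exact: cvg_cst]|exact: cV'].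
Qed.

(** The remainder is the integral of G(y) - G(c) for y between c and c', so the modulus of G gains
    one factor |c' - c|. *)
Let hV eta : 0 < eta -> small (fun eps=> forall th t c c', `|th-th0| <= rho ->
 0 <= t <= T -> `|c| <= C -> `|c'| <= C ->
 `|V th t c'-V th t c-G th t c*(c'-c)| <= eta*(eps * `|c'-c| + (c'-c)^+2/eps)).
move=> eta0; apply: small_mono (hGmod eta0) _=> eps e0 hg th t c c' hn ht hc hc'; have h := nearT hn.
rewrite oi_diff; last exact: cGs.
rewrite -(oi_cst c c' (G th t c)) oiB; [|exact: cGs|exact: cst_continuous].
rewrite -(sqn (c'-c)) (_ : eta*_ = eta*(eps+`|c'-c| / eps) * `|c'-c|); last by ring.
apply: oi_bound; first by apply: contB; [exact: cGs|exact: cst_continuous].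
move=> y hy; have [yC yc] : `|y| <= C /\ `|y-c| <= `|c'-c|.
 move: hy hc hc'; rewrite !ler_norml=> /orP[] /andP[y1 y2] /andP[c1 c2] /andP[c3 c4].
  by split; [|rewrite (ger0_norm (_ : 0 <= c'-c))]; try (apply/andP; split); lra.
 by split; [|rewrite (ler0_norm (_ : c'-c <= 0))]; try (apply/andP; split); lra.
apply: le_trans (hg th t t y c hn ht ht yC hc) _; rewrite subrr normr0 mulr0 add0r ler_wpM2l ?(ltW eta0)//.
by rewrite lerD2l ler_wpM2r// invr_ge0 ltW.
Qed.

Let Gd t y := Sdd th0 t y/sg t y^+2.
Let cGd : cont2 Gd.
apply: contM; first exact: cSdd.
by apply: contV; [move=> p; rewrite expf_neq0|exact: contX].
Qed.
Let Gd_abs t y : `|Gd t y| <= C.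
apply: le_trans (MC (n := 3) isT); rewrite /Gd -exprVn exprS normrM.
by apply: ler_pM=> //; [exact: Sdd_abs|exact: iv2_abs].
Qed.

Let Gtaylor eta : 0 < eta -> exists2 r, 0 < r & forall th s y,
 `|th-th0| <= r -> 0 <= s <= T -> `|y| <= K -> `|G th s y-G th0 s y-(th-th0)*Gd s y| <= eta * `|th-th0|.
move=> eta0; have M2 : 0 < M^+2 by pos.
have [alo hib] : a < th0-rho /\ th0+rho < b.
 have : Th (th0-rho) by apply: nearT; rewrite addrC addKr normrN gtr0_norm.
 have : Th (th0+rho) by apply: nearT; rewrite addrC addKr gtr0_norm.
 by move=> /andP[_ h1] /andP[h2 _].
have [r r0 hr] := theta_modulus K (proj2 C1thth) alo hib (divr_gt0 eta0 M2).
exists (Num.min r rho); first by pos.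
move=> th s y; rewrite le_min=> /andP[hr1 hr2] hs hy; have h := nearT hr2.
have [z hz|z hz e] := @mvt_between _ (fun u=> Sd u s y) th0 th.
 by case: C1thth=> hd _; apply: hd=> //; exact: Thb hth0 h hz.
rewrite (_ : G th s y - _ - _ = (Sd th s y-Sd th0 s y-(th-th0)*Sdd th0 s y)*iv s y^+2); last by rewrite /Gd -exprVn !GE /iv; ring.
rewrite e (mulrC (th-th0)) -mulrBl -mulrA normrM.
rewrite (_ : eta*_ = eta/M^+2*(`|th-th0|*M^+2)); last by field; rewrite gt_eqF.
apply: ler_pM=> //; last by rewrite normrM ler_wpM2l// iv2_abs.
have hz' : `|z-th0| <= `|th-th0|.
 move: hz=> /orP[] /andP[z1 z2]; first by rewrite !ger0_norm; lra.
 by rewrite !ler0_norm; lra.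
apply: (hr z th0)=> //; last exact: le_trans hz' hr1.
 by move: (le_trans hz' hr2); rewrite ler_norml=> /andP[? ?]; apply/andP; split; lra.
by have := rho0=> ?; apply/andP; split; lra.
Qed.

Let f s := G th0 s (xc th0 s)*sg s (xc th0 s).
Let H th s y := G th s y*Sd th s y.
Let HE th s y : H th s y = (Sd th s y*iv s y)^+2.
by rewrite /H GE; ring. Qed.
Let fE s : f s^+2 = H th0 s (xc th0 s).
by rewrite /f GE HE /iv; field; exact: sg_neq0. Qed.
Let cH th : Th th -> cont2 (H th).
by move=> h; apply: contM; [exact: cG|exact: cSd]. Qed.
Let H_th th s y : Th th -> `|H th s y-H th0 s y| <= 2*M^+4 * `|th-th0|.
move=> h; have d : `|Sd th s y*iv s y-Sd th0 s y*iv s y| <= M^+2 * `|th-th0|.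
 rewrite -mulrBl normrM mulrC -mulrA; apply: ler_pM=> //; exact: Sd_th.
have au u : Th u -> `|Sd u s y*iv s y| <= M^+2 by move=> hu; rewrite normrM; apply: ler_pM=> //; exact: Sd_abs.
rewrite !HE !expr2; apply: le_trans (lip_mul (au _ h) (au _ hth0) d d) _.
by rewrite le_eqVlt; apply/orP; left; apply/eqP; ring.
Qed.

Let H_near eta : 0 < eta -> exists2 r, 0 < r & forall th s s' y,
 `|th-th0| <= r -> 0 <= s <= T -> 0 <= s' <= T -> `|s-s'| <= r -> `|y-xc th0 s| <= r -> `|H th s y-f s'^+2| <= eta.
move=> eta0; have M4 : 0 < 4*M^+4 by pos.
have [r r0 hr] := @heine_rect _ T K _ (cH hth0) _ (divr_gt0 eta0 (ltr0n _ 2)).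
have r2 : 0 < r/2 by rewrite divr_gt0.
have [r' r'0 hr'] := @heine_itv _ T _ (xc_cont hth0) _ r2.
exists (Num.min (Num.min (Num.min r' (r/2)) 1) (Num.min rho (eta/(4*M^+4)))).
 by pos.
move=> th s s' y; rewrite !le_min=> /andP[_ /andP[hn h4]] hs hs' /andP[/andP[/andP[ss sr] _] _] /andP[/andP[/andP[_ yr] y1] _].
have h := nearT hn; rewrite fE -(subrKA (H th0 s y)); apply: le_trans (ler_normD _ _) _.
have q1 : `|H th s y-H th0 s y| <= eta/2.
 apply: le_trans (H_th s y h) _; move: h4; rewrite ler_pdivlMr//; lra.
have q2 : `|H th0 s y-H th0 s' (xc th0 s')| <= eta/2.
 apply: hr=> //; [|by have := xK s'; lra|by lra|].
  by have := ler_normD (y-xc th0 s) (xc th0 s); rewrite subrK; have := xK s; lra.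
 rewrite -(subrKA (xc th0 s)); apply: le_trans (ler_normD _ _) _.
 by have := hr' s s' hs hs' ss; lra.
lra.
Qed.

Let fi th := fisher T S sigma xs th.
Let fiE th : fi th = Int 0 T (fun s=> H th s (xc th s)).
by apply: eq_Int=> s hs; rewrite HE /Sd /iv /sg /xc cl_id// exprMn exprVn.
Qed.
Let fi_f : fi th0 = Int 0 T (fun s=> f s^+2).
by rewrite fiE; apply: eq_Int=> s _; rewrite fE. Qed.
Let cH_path th (z : R -> R) : Th th -> continuous z -> continuous (fun s=> H th s (z s)).
move=> h cz; apply: (@cont_comp _ _ _ (fun s=> (s, z s)) (fun p=> H th p.1 p.2)); last exact: cH.
by apply: cont_pair=> // s; exact: cvg_id.
Qed.
Let fi0 : 0 < fi th0.
case: hC3=> _ _ _ _; set E := ereal_inf _=> E0; rewrite -lte_fin; apply: lt_le_trans E0 _.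
by apply: ereal_inf_lbound; exists th0.
Qed.
Let fi_near eta : 0 < eta -> exists2 r, 0 < r & forall th, `|th-th0| <= r -> `|fi th-fi th0| <= eta.
move=> eta0; have [r r0 hr] := H_near (divr_gt0 eta0 T0).
have cx0 : 0 < cx := lt_le_trans ltr01 cx1.
exists (Num.min (Num.min rho r) (r/cx)); first by pos.
move=> th; rewrite !le_min=> /andP[/andP[hn tr] tc]; have h := nearT hn.
rewrite fi_f fiE -IntB; [|exact: cH_path (xc_cont h)|by under eq_fun do rewrite fE; exact: cH_path (xc_cont hth0)].
rewrite (_ : eta = eta/T*(T-0)); last by field; rewrite gt_eqF.
apply: Int_bound; [|exact: ltW|].
 by apply: contB; [exact: cH_path (xc_cont h)|under eq_fun do rewrite fE; exact: cH_path (xc_cont hth0)].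
move=> s hs; apply: hr=> //; first by rewrite subrr normr0 ltW.
by apply: le_trans (xc_th s h) _; rewrite mulrC -ler_pdivlMr.
Qed.

Let psi := slope_drift th0 Sf sg.
Let psiE th t y : psi th t y = (Sf th t y-Sf th0 t y)/(th-th0)*iv t y^+2.
by rewrite /psi /slope_drift invfM /iv exprVn mulrA. Qed.
Let quot th t y : Th th -> th != th0 -> exists z, [/\ Th z, `|z-th0| <= `|th-th0|,
 (th0 <= z <= th) || (th <= z <= th0) & (Sf th t y-Sf th0 t y)/(th-th0) = Sd z t y].
move=> h hne; have [z hz|z hz e] := @mvt_between _ (fun u=> Sf u t y) th0 th.
 by case: C1th=> hd _; apply: hd=> //; exact: Thb hth0 h hz.
exists z; split=> //; [exact: Thb hth0 h hz| |by rewrite e mulfK// subr_eq0].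
move: hz=> /orP[] /andP[z1 z2]; first by rewrite !ger0_norm; lra.
by rewrite !ler0_norm; lra.
Qed.
Let psiC th t y : Th th -> `|psi th t y| <= C.
move=> h; apply: le_trans (MC (n := 3) isT); rewrite psiE (exprS M) normrM; apply: ler_pM=> //.
case: (eqVneq th th0)=> [->|hne]; first by rewrite subrr mul0r normr0 ltW.
by have [z [hz _ _ ->]] := quot t y h hne; exact: Sd_abs.
Qed.
Let psi_G0 th t y : Th th -> th != th0 -> `|psi th t y-G th0 t y| <= C * `|th-th0|.
move=> h hne; apply: le_trans (_ : M^+3 * `|th-th0| <= _); last by rewrite ler_wpM2r// MC.
have [z [hz zt _ e]] := quot t y h hne; rewrite psiE GE e -mulrBl normrM (exprSr M 2) -mulrA mulrC.
apply: ler_pM=> //; apply: le_trans (Sd_th _ _ hz hth0) _; by rewrite ler_wpM2l// ltW.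
Qed.
(** Let th be the farther from [th0]. The two slopes differ by (Sdot(v) - Sdot(z))(th - th')/(th -
    th0) with v between th' and th, z between [th0] and th'. On one side |v - z| <= |th - th0|,
    which cancels the denominator. *)
Let psi_lip th th' t y : Th th -> Th th' -> 0 < (th-th0)*(th'-th0) -> `|psi th t y-psi th' t y| <= C * `|th-th'|.
wlog le : th th' / `|th'-th0| <= `|th-th0|.
 move=> W h h' s0; case: (leP `|th'-th0| `|th-th0|)=> [|/ltW] le; first exact: W.
 by rewrite distrC (distrC th); apply: W=> //; rewrite mulrC.
move=> h h' s0; have n1 : th-th0 != 0 by apply: contraTneq s0=> ->; rewrite mul0r ltxx.
have n2 : th'-th0 != 0 by apply: contraTneq s0=> ->; rewrite mulr0 ltxx.
apply: le_trans (_ : M^+3 * `|th-th'| <= _); last by rewrite ler_wpM2r// MC.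
have n3 : th' != th0 by rewrite -subr_eq0.
have [z [hz zt zb e]] := quot t y h' n3.
have [v hv|v hv e'] := @mvt_between _ (fun u=> Sf u t y) th' th.
 by case: C1th=> hd _; apply: hd=> //; exact: Thb h' h hv.
have k : (Sf th t y-Sf th0 t y)/(th-th0)-(Sf th' t y-Sf th0 t y)/(th'-th0) = (Sd v t y-Sd z t y)*(th-th')/(th-th0).
 rewrite e; have e2 : Sf th' t y-Sf th0 t y = Sd z t y*(th'-th0) by rewrite -e divfK.
 have e1 : Sf th t y-Sf th0 t y = Sd v t y*(th-th')+Sd z t y*(th'-th0) by rewrite -e2 -(e' : _ = Sd v t y*_); ring.
 by rewrite e1; field.
rewrite !psiE -mulrBl k normrM (_ : M^+3 * `|th-th'| = M * `|th-th'|*M^+2); last by ring.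
apply: ler_pM=> //.
have vz : `|v-z| <= `|th-th0|.
 move: s0 le zb hv; case: (ltgtP th th0) n1=> [t1|t1|->]; last by rewrite subrr eqxx.
  have t2 : th-th0 < 0 by rewrite subr_lt0.
  move=> _; rewrite (nmulr_rgt0 _ t2)=> t3; rewrite (ltr0_norm t2) (ltr0_norm t3)=> le.
  by move=> /orP[] /andP[? ?] /orP[] /andP[? ?]; rewrite ler_norml; apply/andP; split; lra.
 have t2 : 0 < th-th0 by rewrite subr_gt0.
 move=> _; rewrite (pmulr_rgt0 _ t2)=> t3; rewrite (gtr0_norm t2) (gtr0_norm t3)=> le.
 by move=> /orP[] /andP[? ?] /orP[] /andP[? ?]; rewrite ler_norml; apply/andP; split; lra.
rewrite normrM normfV ler_pdivrMr ?normr_gt0// normrM mulrAC; apply: ler_pM=> //.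
by apply: le_trans (Sd_th _ _ (Thb h' h hv) hz) _; rewrite ler_wpM2l// ltW.
Qed.

Let Int_close (u v : R -> R) e : continuous u -> continuous v -> (forall s, 0 <= s <= T -> `|u s-v s| <= e) ->
 Int 0 T v-e*T <= Int 0 T u.
move=> cu cv h; have := Int_bound (contB cu cv) (ltW T0) h; rewrite IntB// subr0 ler_norml=> /andP[h1 _]; lra.
Qed.

Let eq_ler (u v : R) : u = v -> u <= v. by move=> ->. Qed.
Let w th s y := (Sf th s y-Sf th0 s y)*iv s y.
Let w_cont th (z : R -> R) : Th th -> continuous z -> continuous (fun s=> w th s (z s)^+2).
move=> h cz; apply: contX; apply: (@cont_comp _ _ _ (fun s=> (s, z s)) (fun p=> w th p.1 p.2)).
 by apply: cont_pair=> // s; exact: cvg_id.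
by apply: contM=> //; apply: contB; exact: cSf.
Qed.
Let psi_w th s y : psi th s y*sg s y = w th s y/(th-th0).
by rewrite psiE /w /iv; set k := _ - _; set k' := _ - _; rewrite expr2 mulrACA -!mulrA mulVf ?sg_neq0// mulr1; ring. Qed.

(** Near [th0] the slope is Sdot at an intermediate parameter, and the integral is close to the
    Fisher information; away from [th0], identifiability bounds it along the limit path. In both
    regimes a small perturbation of the path costs at most half of the bound. *)
Let Phi_low : exists c r : R, [/\ 0 < c, 0 < r & forall th, Th th -> th != th0 ->
 forall z : R -> R, continuous z -> (forall s, 0 <= s <= T -> `|z s-xc th0 s| <= r) ->
 c <= Int 0 T (fun s=> (psi th s (z s)*sg s (z s))^+2)].
have T2 : 0 < 2*T by rewrite mulr_gt0.
have [r1 r10 hr1] := H_near (divr_gt0 fi0 T2).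
have [c1 c10 hc1] : exists2 c1, 0 < c1 & forall th, Th th -> r1 < `|th-th0| -> c1 <= Int 0 T (fun s=> w th s (xc th0 s)^+2).
 case: hC3=> _ _ _ /(_ r1 r10) + _; set E := ereal_inf _=> hE.
 have [c [c0 cE]] : exists c : R, 0 < c /\ (c%:E <= E)%E.
  by case: E hE=> [c|_|//]; [rewrite lte_fin; exists c|exists 1; rewrite leey].
 exists c=> // th h hr; rewrite -lee_fin; apply: le_trans cE _.
 rewrite (_ : Int _ _ _ = \int[lebesgue_measure]_(t in `[0, T]) ((S th t (xs th0 t)-S th0 t (xs th0 t))/sigma t (xs th0 t))^+2); last first.
  by apply: eq_Int=> s hs; rewrite /w /Sf /iv /sg /xc cl_id.
 by apply: le_trans (ereal_inf_lbound (imageP _ hth0)) _; apply: ereal_inf_lbound; exists th.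
pose A := M*(b-a)*M; pose B := M*(b-a)*M^+3+M*(2*M).
have ab : 0 < b-a by case/andP: hth0=> ? ?; lra.
have A0 : 0 < A by rewrite !mulr_gt0.
have B0 : 0 < B by rewrite addr_gt0// !mulr_gt0// exprn_gt0.
have dist th : Th th -> `|th-th0| <= b-a.
 by move: hth0=> /andP[? ?] /andP[? ?]; rewrite ler_norml; apply/andP; split; lra.
have wA th s y : Th th -> `|w th s y| <= A.
 move=> h; rewrite normrM; apply: ler_pM=> //; apply: le_trans (Sf_th s y h hth0) _.
 by rewrite ler_wpM2l ?(ltW M0)// dist.
have wB th s y y' : Th th -> `|w th s y-w th s y'| <= B * `|y-y'|.
 move=> h; apply: le_trans (lip_mul (A := M*(b-a)) (B := M) (db := M^+3 * `|y-y'|) (da := 2*M * `|y-y'|) _ _ _ _) _=> //.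
 - by apply: le_trans (Sf_th s y h hth0) _; rewrite ler_wpM2l ?(ltW M0)// dist.
 - rewrite (_ : _ - _ - _ = (Sf th s y-Sf th s y')-(Sf th0 s y-Sf th0 s y')); last by ring.
  by apply: le_trans (ler_normB _ _) _; have := Sf_x s y y' h; have := Sf_x s y y' hth0; lra.
 - by rewrite /B; apply: eq_ler; ring.
(* Chosen so that replacing the limit path by z changes the integral of w^2 by at most 2 A B r2 T =
   c1/2. *)
pose r2 := c1/(4*A*B*T); have r20 : 0 < r2 by rewrite divr_gt0// !mulr_gt0.
exists (Num.min (fi th0/2) (c1/(2*(b-a)^+2))), (Num.min r1 r2); split.
- by rewrite lt_min !divr_gt0// mulr_gt0// exprn_gt0.
- by rewrite lt_min r10.
move=> th h hne z cz hz; have t0 : 0 < (th-th0)^+2 by rewrite exprn_even_gt0// subr_eq0.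
under [in X in _ <= X]eq_fun do rewrite psi_w expr_div_n mulrC.
have cwz := w_cont h cz; have cwx := w_cont h (xc_cont hth0).
case: (leP `|th-th0| r1)=> hr.
 rewrite ge_min; apply/orP; left.
 have cf : continuous (fun s=> f s^+2) by under eq_fun do rewrite fE; exact: cH_path (xc_cont hth0).
 have := @Int_close (fun s=> ((th-th0)^+2)^-1*w th s (z s)^+2) (fun s=> f s^+2) (fi th0/(2*T)).
 rewrite -fi_f (_ : fi th0/(2*T)*T = fi th0/2); last by field; rewrite gt_eqF.
 rewrite (_ : fi th0 - _ = fi th0/2); last by field.
 apply=> //; first by apply: contM=> //; exact: cst_continuous.
 move=> s hs; have [v [hv vt _ e]] := quot s (z s) h hne.
 have -> : ((th-th0)^+2)^-1*w th s (z s)^+2 = H v s (z s).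
  by rewrite HE -e /w; field; rewrite subr_eq0.
 apply: hr1=> //; [exact: le_trans hr|by rewrite subrr normr0 ltW|].
 by have := hz s hs; rewrite le_min=> /andP[].
rewrite ge_min; apply/orP; right; rewrite IntZ//.
apply: le_trans (_ : ((th-th0)^+2)^-1*(c1/2) <= _).
 rewrite invfM mulrA mulrC ler_wpM2r ?divr_ge0 ?(ltW c10)// lef_pV2 ?posrE ?t0 ?exprn_gt0//.
 by rewrite -(sqn (th-th0)) ler_pXn2r ?nnegrE ?(ltW ab)// dist.
rewrite ler_wpM2l ?invr_ge0 ?(ltW t0)//.
have := @Int_close (fun s=> w th s (z s)^+2) (fun s=> w th s (xc th0 s)^+2) (2*A*B*r2) cwz cwx.
rewrite (_ : 2*A*B*r2*T = c1/2); last by rewrite /r2; field; rewrite !gt_eqF.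
have q := hc1 th h hr; move=> ic; apply: le_trans (ic _); first lra.
move=> s hs; have := hz s hs; rewrite le_min=> /andP[_ hz2].
have d : `|w th s (z s)-w th s (xc th0 s)| <= B*r2 by apply: le_trans (wB _ _ _ _ h) _; rewrite ler_wpM2l// ltW.
by rewrite !expr2; apply: le_trans (lip_mul (wA _ _ _ h) (wA _ _ _ h) d d) _; apply: eq_ler; ring.
Qed.

(** * The limit law of the observed statistic *)

Section Observation.
Context {d : measure_display} {Omega : measurableType d}.
Variables (P : probability Omega R) (F : R -> set (set Omega)) (W : R -> Omega -> R).
Hypotheses (hF : filtration F T) (hW : wiener P F T W).
Variable X : R -> R -> Omega -> R.
Hypothesis hX : forall eps, 0 < eps < 1 -> sde_solution P F T x0 (S th0) sigma eps W (X eps).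
Variables (J : R -> R -> Omega -> R) (th : R -> Omega -> R).
Hypothesis hJ : forall eps, 0 < eps < 1 -> likelihood_integral P F T Th S sigma eps (X eps) (J eps).
Hypothesis hth : forall eps, 0 < eps < 1 -> mle P T Th S sigma eps (X eps) (J eps) (th eps).
Hypothesis normal_sym : forall s : R, 0 < s -> forall A : set R, measurable A ->
 normal_prob 0 s (-%R @^-1` A) = normal_prob 0 s A.
Let Xc eps s w := X eps (cl s) w.
Let H0 eps s w := sigma s (X eps s w).

Let cX eps : 0 < eps < 1 -> forall w, continuous (fun s=> Xc eps s w).
by move=> /hX[_ c _] w'; exact: (continuous_clamp (ltW T0) (c w')). Qed.
Let aX eps : 0 < eps < 1 -> forall s, 0 <= s <= T -> adapted F s (Xc eps s).
by move=> /hX[m _ _] s hs; rewrite /Xc cl_id//; apply/(adaptedP hF)=> //; exact: m. Qed.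
Let H0E eps : 0 < eps < 1 -> forall s w, 0 <= s <= T -> H0 eps s w = sg s (Xc eps s w).
by move=> _ s w' hs; rewrite /H0 /sg /Xc cl_id. Qed.
Let hMart eps : 0 < eps < 1 -> forall t, 0 <= t <= T -> exists I, stoch_integral P F t (H0 eps) W I /\
 {ae P, forall w, I w = mart (Sf th0) x0 eps (Xc eps) t w}.
move=> he t ht; have [_ _ /(_ t ht)[I [hI hae]]] := hX he; exists I; split=> //.
have e0 : eps != 0 by case/andP: he=> e0 _; rewrite gt_eqF.
apply: filterS hae=> w' e; rewrite /mart /Xc cl_id// e.
rewrite (_ : Int 0 t _ = \int[lebesgue_measure]_(s in `[0, t]) S th0 s (X eps s w')).
 by set A := \int[_]_(_ in _) _; rewrite (_ : _ - A = eps*I w') ?mulKf//; ring.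
by apply: eq_Int=> s /andP[s0 st]; rewrite /Sf /Xc cl_id// s0 (le_trans st)//; case/andP: ht.
Qed.

Let gridJ eps : 0 < eps < 1 -> forall v, Th v -> forall n, (0 < n)%N ->
 grid_integral P T (Xc eps) n (fun t y=> Sf v t y/(eps^+2*sg t y^+2)) (J eps v).
move=> he v hv n n0; have [/(_ v hv) hs _] := hJ he.
apply: (@stoch_grid_integral _ _ _ P F T T0 hF (Xc eps) (cX he) (aX he) n n0 _ _ _ _ _ _ _ hs).
- apply: contM; first exact: cSf.
 apply: contV; last by apply: contM; [exact: cst_continuous|exact: contX].
 by move=> p; rewrite mulf_neq0 ?expf_neq0//; case/andP: he=> e0 _; rewrite gt_eqF.
- by move=> s w' hs'; rewrite /Sf /sg /Xc cl_id.
- by move=> s w' hs'; rewrite /Xc cl_id.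
Qed.

Let contJ eps : 0 < eps < 1 -> forall w v, Th v -> {for v, continuous (fun u=> J eps u w)}.
move=> he w' v hv; have [_ /(_ w')/within_continuousP/(_ v hv) h] := hJ he.
apply/(@cvgrPdist_lt _ R)=> e e0; have [r r0 hr] := h e e0; have /andP[v1 v2] := hv.
near=> u; apply: hr; last by near: u; exact: (nbhsx_ballx v r r0).
by apply/andP; split; near: u; [exact: lt_nbhsr|exact: lt_nbhsl].
Unshelve. all: by end_near. Qed.

Let thT eps : 0 < eps < 1 -> forall w, Th (th eps w). by case/hth. Qed.

Let likelihoodE eps v w' : likelihood T S sigma eps (X eps) (J eps) v w' =
 expR (log_likelihood T Sf sg Xc J eps v w').
congr expR; congr (_ - _); apply: eq_Int=> s hs; by rewrite /Sf /sg /Xc cl_id.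
Qed.

Let th_max eps : 0 < eps < 1 -> {ae P, forall w,
 (exists2 v, a < v < b & forall v', a < v' < b ->
  expR (log_likelihood T Sf sg Xc J eps v' w) <= expR (log_likelihood T Sf sg Xc J eps v w)) ->
 expR (log_likelihood T Sf sg Xc J eps (th eps w) w) =
 sup [set expR (log_likelihood T Sf sg Xc J eps v w) | v in [set v | a < v < b]]}.
move=> /hth[_ _]; apply: filterS=> w' h; rewrite -likelihoodE=> -[v hv hmax].
rewrite h; last by exists v=> // v' hv'; rewrite !likelihoodE; exact: hmax.
by congr sup; apply: eq_imagel=> u _; rewrite likelihoodE.
Qed.

Let mJ eps : 0 < eps < 1 -> forall v, Th v -> mrv (J eps v).
by move=> he v hv; have [/(_ v hv)[]] := hJ he. Qed.
Let info_pos : 0 < Int 0 T (fun s=> f s^+2). by rewrite -fi_f. Qed.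
Let S_lip u v t y : Th u -> Th v -> `|Sf u t y-Sf v t y| <= C * `|u-v|.
by move=> hu hv; apply: le_trans (Sf_th t y hu hv) _; rewrite ler_wpM2r// (MC (n := 1)). Qed.

Let S0C s y : 0 <= s <= T -> `|y| <= K -> `|Sf th0 s y| <= C.
move=> _ hy; apply: le_trans (growS s y hth0) _; apply: le_trans (_ : L*(1+K) <= C); last by case: exC.
by rewrite ler_wpM2l ?(ltW L0)// lerD2l.
Qed.
Let sd_abs v s y : `|v-th0| <= rho -> `|Sd v s y| <= C.
by move=> /nearT h; apply: le_trans (Sd_abs s y h) (MC (n := 1) isT). Qed.
Let D_near v s y : `|v-th0| <= rho -> 0 <= s <= T ->
 `|D v s y-(Sf th0 s y+(v-th0)*Sd v s y)| <= C*(`|y-xc th0 s| + `|v-th0|)^+2.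
by move=> /nearT h _; exact: hDS. Qed.
Let V00 v t : V v t x0 = 0. exact: oi_xx. Qed.

Let u_OP := mle_OP T0 hF hW normal_sym hth0 L0 cSf (cSd hth0) csg (fun t y z=> lipS t y z hth0)
 (fun t y=> growS t y hth0) growsg sg_neq0 (xc_cont hth0) xE (fun s _=> xK s) cX aX H0E hMart C0 psiC
 (fun t y=> G_absC t y hth0) psi_lip psi_G0 mJ gridJ contJ S_lip Phi_low thT th_max.
Let u_score := mle_score T0 hF hW normal_sym hth0 L0 cSf (cSd hth0) csg (fun t y z=> lipS t y z hth0)
 (fun t y=> growS t y hth0) growsg sg_neq0 (xc_cont hth0) xE (fun s _=> xK s) cX aX H0E hMart C0 psiC
 (fun t y=> G_absC t y hth0) psi_lip psi_G0 mJ gridJ contJ S_lip Phi_low info_pos thT th_max.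
Let limit := statistic_limit T0 hF hW normal_sym L0 (cSf hth0) csg (fun t y z=> lipS t y z hth0)
 (fun t y=> growS t y hth0) growsg (xc_cont hth0) xE (fun s _=> xK s) cX aX H0E hMart
 rho0 C1 KC fi0 (fun v h=> cG (nearT h)) (fun v h=> cD (nearT h)) (fun v h=> cSd (nearT h))
 (fun v h=> cV (nearT h)) (fun v h=> cV' (nearT h)) cGd (fun v s y h=> G_absC s y (nearT h)) Gd_abs
 sd_abs S0C D_near hGmod hV (fun v t c c' h _ _ _=> V_lip t c c' (nearT h))
 (fun v t c c' h _ _ _=> V'_lip t c c' (nearT h)) (fun v t t' c h h1 h2 h3 _=> V_time c (nearT h) h1 h2 h3)
 V00 Gtaylor H_near fi_near fi_f u_OP u_score.

Let fi_pos v : Th v -> 0 < fi v.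
move=> hv; case: hC3=> _ _ _ _; set E := ereal_inf _=> E0; rewrite -lte_fin; apply: lt_le_trans E0 _.
by apply: ereal_inf_lbound; exists v.
Qed.

Let stat eps w' := stat_delta T x0 S sigma xs eps (th eps w') (fun t=> X eps t w').
Let wstat := weighted_stat T Xc G D Sd V V' fi th.
Let qform := quadratic_form T W sg (xc th0) th0 G.

(** All evaluations occur at times in [0, T], where clamping does nothing; the powers of sqrt(I) in
    R, Q and h collect into the 1/I^2 of the weight. *)
Let statE eps w' : 0 < eps < 1 -> stat eps w' = wstat eps w'.
move=> he; have hv := thT he w'; rewrite /stat /wstat /weighted_stat; set v := th eps w' in hv *.
have e0 : eps != 0 by case/andP: he=> e0 _; rewrite gt_eqF.
have q0 : Num.sqrt (fi v) != 0 by rewrite gt_eqF// sqrtr_gt0 fi_pos.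
have q2 : Num.sqrt (fi v)^+2 = fi v by rewrite sqr_sqrtr// ltW// fi_pos.
have oiS c (k k' : R -> R) : continuous k' -> (forall y, k y = (Num.sqrt (fi v))^-1*k' y) ->
  oriented_integral x0 c k = (Num.sqrt (fi v))^-1 * oriented_integral x0 c k'.
 by move=> ck hk; rewrite -oiZ//; apply: eq_oi.
have cXe : continuous (fun s=> Xc eps s w') := cX he (w := w').
have cpath (k : R -> R -> R) : cont2 k -> continuous (fun s=> k s (Xc eps s w')).
 by move=> ck; apply: (@cont_comp _ _ _ (fun s=> (s, Xc eps s w')) (fun p=> k p.1 p.2)) ck; apply: cont_pair=> // s; exact: cvg_id.
apply: eq_Int=> t ht; have Xt : X eps t w' = Xc eps t w' by rewrite /Xc cl_id.
have sub s : 0 <= s <= t -> 0 <= s <= T by case/andP: ht=> _ tT /andP[s0 st]; rewrite s0 (le_trans st).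
have sgE s y : 0 <= s <= T -> sigma s y = sg s y by move=> hs; rewrite /sg cl_id.
have SdE s y : 0 <= s <= T -> d_theta S v s y = Sd v s y by move=> hs; rewrite /Sd cl_id.
have RE : stat_R T x0 S sigma xs v t (fun t=> X eps t w') =
  (Num.sqrt (fi v))^-1*(V v t (Xc eps t w')-Int 0 t (fun s=> V' v s (Xc eps s w'))).
 rewrite mulrBr -IntZ; last by apply: (cpath (V' v)); exact: cV'.
 congr (_ - _).
  rewrite Xt; apply: oiS=> [|y]; first exact: cGs.
  by rewrite SdE// sgE// /G; field; rewrite sg_neq0.
 apply: eq_Int=> s /sub hs; rewrite {1}/Xc cl_id//; apply: oiS=> [|y]; first exact: cgs.
 by rewrite /g /Sd /sg cl_id//; field; rewrite q0 gt_eqF// spos.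
have QE : stat_Q T S sigma xs v t (fun t=> X eps t w') =
  (Num.sqrt (fi v))^-1*Int 0 t (fun s=> G v s (Xc eps s w')*D v s (Xc eps s w')).
 rewrite -IntZ; last by apply: contM; [apply: (cpath (G v)); exact: cG|apply: (cpath (D v)); exact: cD].
 apply: eq_Int=> s /sub hs; rewrite SdE// sgE// /G /D /stat_D /xc /Xc cl_id//.
 by rewrite /Sd /sg cl_id//; field; rewrite q0 gt_eqF// spos.
rewrite /stat_K RE QE /stat_h Xt SdE// sgE// /path_stat -/(fi v).
have q4 : fi v^+2 = Num.sqrt (fi v)^+4 by rewrite -[in LHS]q2 -exprM.
rewrite q4 {1}/G; move: (Num.sqrt (fi v)) (Int _ _ _) (Int _ _ _) q0=> s A1 A2 q0.
by rewrite /G; field; rewrite q0 sg_neq0 e0.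
Qed.

Let n := @ncell R.
Let tt eps j : R := grid T (n eps) j.
Let I_n eps := partial_info T sg (xc th0) th0 G eps (n eps).
Let p eps j : R := f (tt eps j)^+2*(T/(n eps)%:R)/I_n eps.

(** The form is a sum over cells of information shares p_k times squares of the normalised bridge,
    the shape treated by [score_same_law]. *)
Let qformE eps w' : 0 < I_n eps -> qform eps w' = \sum_(k < n eps) p eps k *
 ((score T W sg (xc th0) th0 G eps k w'-(\sum_(j < k) p eps j)*score T W sg (xc th0) th0 G eps (n eps) w')
  / Num.sqrt (I_n eps))^+2.
move=> I0; apply: eq_bigr=> k _; have i0 : I_n eps != 0 by rewrite gt_eqF.
have -> : \sum_(j < k) p eps j = partial_info T sg (xc th0) th0 G eps k/I_n eps by rewrite -mulr_suml.
rewrite [in RHS]exprMn exprVn sqr_sqrtr ?(ltW I0)// /p -/(f (tt eps k)) -/(n eps) -/(I_n eps).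
by move: (T/_)=> hh; field.
Qed.

Let f_abs s : f s^+2 <= M^+4.
rewrite fE HE -(sqn (_*_)) (_ : M^+4 = (M^+2)^+2); last by rewrite -exprM.
by rewrite ler_pXn2r ?nnegrE ?exprn_ge0 ?(ltW M0)// normrM; apply: ler_pM=> //; exact: Sd_abs.
Qed.

Context {d' : measure_display} {Omega' : measurableType d'}.
Variables (P' : probability Omega' R) (B : R -> Omega' -> R).
Hypothesis hB : brownian_bridge P' B.

(** The measurable quadratic form serves as an intermediary: the statistic is close to it in
    probability, and its law is that of a Riemann sum of the squared bridge. *)
Theorem statistic_law : exists Q : R -> Omega -> R,
 [/\ forall eps, 0 < eps < 1 -> mrv (Q eps),
   forall eps w, 0 < eps < 1 -> 0 <= Q eps w /\ 0 <= stat eps w,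
   oP P (fun eps w=> stat eps w-Q eps w) &
   forall (phi : R -> R) (m : R), continuous phi -> (forall x, `|phi x| <= m) ->
    forall e, 0 < e -> small (fun eps=>
     `|Ex P (fun w=> phi (Q eps w))-Ex P' (fun w=> phi (bridge_functional B w))| <= e)].
exists qform; split=> [eps he|eps w' he|eta eta0 e e0|phi m cphi phim e e0].
- have n0 : (0 < n eps)%N by [].
 have ms k : (k <= n eps)%N -> mrv (score T W sg (xc th0) th0 G eps k).
  move=> kn; apply: measurable_sum=> j; apply: measurable_funM=> //.
  by apply: measurable_funB; apply: (wiener_measurable hF hW); apply: grid_itv=> //; [|apply: ltnW]; exact: leq_trans (ltn_ord j) kn.
 apply: measurable_sum=> k; do 2!(apply: measurable_funM=> //); apply: measurable_funX.
 apply: measurable_funB; first exact/ms/ltnW.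
 by do 2!(apply: measurable_funM=> //); exact: ms.
- rewrite statE// /qform /wstat; split.
  apply: sumr_ge0=> k _; apply: mulr_ge0; last by rewrite divr_ge0// ltW.
  by apply: mulr_ge0; rewrite ?divr_ge0 ?sqr_ge0.
 by apply: Int_ge0=> s _; rewrite mulr_ge0 ?sqr_ge0// divr_ge0 ?sqr_ge0// -/(H _ s _) HE sqr_ge0.
- apply: small_mono (small_and (limit eta0 e0) (small_lt ltr01)) _=> eps e1 [h e2].
 apply: up_to_mono h=> // w'; rewrite statE// e1 e2//.
have [mB cB _] := hB; have [r r0 hr] := functional_partition P' mB cB cphi phim e0.
have fi2 : 0 < fi th0/2 by rewrite divr_gt0// fi0.
have M4 : 0 < M^+4 by rewrite exprn_gt0.
(* Every share is at most M^4 times the mesh over I_n >= fi/2, so this bound on the mesh makes all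
   shares at most r. *)
have q0 : 0 < r*(fi th0/2)/M^+4 by rewrite !(mulr_gt0, divr_gt0) ?invr_gt0// fi0.
have hi := info_near T0 csg (xc_cont hth0) rho0 (fun v h=> cG (nearT h)) fi_f fi2.
apply: small_mono (small_and hi (ncell_small T0 q0)) _=> eps e1 [].
rewrite -/(I_n eps) ler_norml=> /andP[i1 _] hm; have I2 : fi th0/2 <= I_n eps by lra.
have I0 : 0 < I_n eps by exact: lt_le_trans I2.
under [in X in `|X - _|]eq_fun do rewrite (qformE _ I0).
rewrite (score_same_law hB T0 hF hW (f := fun j=> f (tt eps j)) _ I0 cphi phim)//; apply: (hr (n eps) (p eps)).
- by move=> j; rewrite divr_ge0 ?(ltW I0)// mulr_ge0 ?sqr_ge0// divr_ge0// ltW.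
- move=> j _; rewrite ler_pdivrMr//; apply: le_trans (_ : M^+4*(r*(fi th0/2)/M^+4) <= _).
  by apply: ler_pM=> //; rewrite ?sqr_ge0 ?f_abs// divr_ge0// ltW.
 by rewrite mulrC divfK ?gt_eqF// ler_wpM2l// ltW.
- by rewrite -mulr_suml divff// gt_eqF.
Qed.

End Observation.
End Model.

(** * From closeness in probability to the size of the test *)

Section Sandwich.
Context {R : realType} {d : measure_display} {Omega : measurableType d}.
Variable P : probability Omega R.

                                                                                                         
(** The integral of a nonnegative function is a supremum over simple functions below it, hence
    monotone even without measurability. The measurability of the statistic in w is not established,
    so its expectations are bounded through measurable functions on either side. *)
Lemma le_lower_integral (f g : Omega -> \bar R) : (forall w, 0 <= f w)%E -> (forall w, f w <= g w)%E ->
 (\int[P]_w f w <= \int[P]_w g w)%E.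
move=> f0 fg; rewrite !ge0_integralTE//; last by move=> w; exact: le_trans (fg w).
apply: le_ereal_sup=> _ [h hf <-]; exists h=> // w; exact: le_trans (fg w).
Qed.

Lemma le_expectation (f g : Omega -> R) : (forall w, f w <= g w) -> ('E_P[f] <= 'E_P[g])%E.
move=> fg; have fgE w : ((f w)%:E <= (g w)%:E)%E by rewrite lee_fin.
rewrite unlock (integralE P setT (fun w=> (f w)%:E)) (integralE P setT (fun w=> (g w)%:E)); apply: leeB.
- apply: le_lower_integral=> w; first exact: funepos_ge0.
 by apply: (@funepos_le _ _ setT)=> [x _|]; [exact: fgE|rewrite inE].
- apply: le_lower_integral=> w; first exact: funeneg_ge0.
 by apply: (@funeneg_le _ _ setT)=> [x _|]; [exact: fgE|rewrite inE].
Qed.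

Lemma expectation_Ex (f : Omega -> R) : bounded_rv f -> 'E_P[f]%E = (Ex P f)%:E.
by move=> bf; rewrite unlock ExE. Qed.

Variables (N : set Omega) (e m : R) (f g : Omega -> R).
Hypotheses (mN : measurable N) (PN : (P N <= e%:E)%E) (m0 : 0 <= m) (bg : bounded_rv g).
Let bN : bounded_rv (\1_N : Omega -> R).
by split; [exact: measurable_indic|exists 1=> w; rewrite indicE; case: (_ \in _); rewrite ?normr1 ?normr0]. Qed.
Let bmN : bounded_rv (fun w=> m*\1_N w). by apply: bounded_rvM=> //; exact: bounded_rv_cst. Qed.
Let EN : Ex P (fun w=> m*\1_N w) <= m*e.
rewrite ExZ// ler_wpM2l// -lee_fin ExE//; apply: le_trans PN; rewrite integral_indic// setIT; exact: lexx.
Qed.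

Lemma expectation_upper : (forall w, ~ N w -> f w <= g w) -> (forall w, f w <= g w+m) ->
 ('E_P[f] <= (Ex P g+m*e)%:E)%E.
move=> h h'; apply: (@le_trans _ _ ('E_P[(fun w=> g w+m*\1_N w)%R])%E).
 apply: le_expectation=> w; rewrite indicE; case: (boolP (w \in N))=> hw; first by rewrite mulr1.
 by rewrite mulr0 addr0; apply: h; move: hw; rewrite notin_setE.
by rewrite expectation_Ex; [rewrite lee_fin ExD// lerD2l|exact: bounded_rvD].
Qed.

Lemma expectation_lower : (forall w, ~ N w -> g w <= f w) -> (forall w, g w-m <= f w) ->
 ((Ex P g-m*e)%:E <= 'E_P[f])%E.
move=> h h'; have bm : bounded_rv (fun w=> -1*(m*\1_N w)).
 by apply: bounded_rvM=> //; exact: bounded_rv_cst.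
apply: (@le_trans _ _ ('E_P[(fun w=> g w + -1*(m*\1_N w))%R])%E).
 rewrite expectation_Ex; last exact: bounded_rvD.
 by rewrite lee_fin ExD// lerD2l ExZ// mulN1r lerN2.
apply: le_expectation=> w; rewrite mulN1r indicE; case: (boolP (w \in N))=> hw; first by rewrite mulr1.
by rewrite mulr0 subr0; apply: h; move: hw; rewrite notin_setE.
Qed.

End Sandwich.

Lemma cvg_small {R : realType} (E : R -> \bar R) (l : R) :
 (forall e, 0 < e -> small (fun eps=> ((l-e)%:E <= E eps <= (l+e)%:E)%E)) -> E eps @[eps --> (0 : R)^'+] --> l%:E.
move=> h; have nr e : 0 < e -> \forall eps \near (0 : R)^'+, ((l-e)%:E <= E eps <= (l+e)%:E)%E.
 move=> /h[r r0 hr]; near=> eps; apply: hr; [by near: eps; exact: nbhs_right_gt|by near: eps; exact: nbhs_right_lt].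
apply/fine_cvgP; split.
 apply: filterS (nr 1 ltr01)=> eps /andP[]; by case: (E eps).
apply/(@cvgrPdist_le _ R)=> e /nr; apply: filterS=> eps /andP[] /=.
by case: (E eps)=> // x; rewrite /= !lee_fin=> h1 h2; rewrite ler_norml; apply/andP; split; lra.
Unshelve. all: by end_near. Qed.

Lemma indic_pred {R : realType} {O : Type} (q : O -> bool) w : \1_[set w' | q w'] w = (q w)%:R :> R.
by rewrite indicE; congr (nat_of_bool _)%:R; apply/idP/idP; rewrite inE. Qed.

Section Limit_in_law.
Context {R : realType} {d d' : measure_display} {Omega : measurableType d} {Omega' : measurableType d'}.
Variables (P : probability Omega R) (P' : probability Omega' R).
Variables (Y Q : R -> Omega -> R) (Z : Omega' -> R).
Hypothesis mZ : mrv Z.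
Hypothesis mQ : forall eps, 0 < eps < 1 -> mrv (Q eps).
Hypothesis QY0 : forall eps w, 0 < eps < 1 -> 0 <= Q eps w /\ 0 <= Y eps w.
Hypothesis YQ : oP P (fun eps w=> Y eps w-Q eps w).
Hypothesis QZ : forall (phi : R -> R) (m : R), continuous phi -> (forall x, `|phi x| <= m) ->
 forall e, 0 < e -> small (fun eps=> `|Ex P (fun w=> phi (Q eps w))-Ex P' (fun w=> phi (Z w))| <= e).

Let cut1 N x : `|cutoff N x| <= 1 :> R. by have /andP[? ?] := cutoff_itv N x; rewrite ger0_norm. Qed.
Let bQ (phi : R -> R) m eps : 0 < eps < 1 -> continuous phi -> (forall x, `|phi x| <= m) -> bounded_rv (fun w=> phi (Q eps w)).
by move=> he c b; exact: bounded_rv_comp (mQ he) c b. Qed.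
Let small1 : small (fun eps : R=> 0 < eps < 1). by exists 1=> // eps e0 e1; rewrite e0. Qed.

(** A Slutsky argument. As phi is uniformly continuous only on compact sets, the event that Q is
    large is paid for by 1 - cutoff(Q), whose mean is small because the law of Q approaches that of
    Z. *)
Lemma Ex_bounded_close (phi : R -> R) (m : R) : continuous phi -> (forall x, `|phi x| <= m) ->
 forall e, 0 < e -> small (fun eps=> ((Ex P' (fun w=> phi (Z w))-e)%:E <= 'E_P[fun w=> phi (Y eps w)] <=
  (Ex P' (fun w=> phi (Z w))+e)%:E)%E).
move=> cphi phim e0 e00; have m0 : 0 <= m := le_trans (normr_ge0 _) (phim 0).
(* The total error is 2e + 6 m e: one e from uniform continuity and one from the law of Q, 4 m e
   from the cut-off and 2 m e from the exceptional set. *)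
pose e := e0/(2+6 * m+1); have e1 : 0 < e by rewrite divr_gt0// ltr_wpDl// addr_ge0// mulr_ge0.
have eE : 2*e+6 * m*e <= e0.
 by rewrite -mulrDl mulrC /e -mulrA ler_piMr ?(ltW e00)// mulrC ler_pdivrMr ?ltr_wpDl ?addr_ge0 ?mulr_ge0//; lra.
have [N hN] : exists N : nat, 1-e <= Ex P' (fun w=> cutoff N%:R (Z w)).
 have : Ex P' (fun w=> cutoff n%:R (Z w)) @[n --> \oo] --> Ex P' (fun=> 1).
  apply: (Ex_cvg (M := 1))=> //.
   by move=> n; apply: (measurableT_comp _ mZ); apply: continuous_measurable_fun; exact: cutoff_continuous.
  move=> w; apply: cvg_near_cst; near=> n; apply: cutoff1.
  by near: n; exact: nbhs_infty_ger.
 by rewrite Ex_cst=> /(@cvgrPdist_le _ R)/(_ e e1)[N _ /(_ N (leqnn _))]; rewrite ler_norml=> /andP[? ?]; exists N; lra.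
have [r r0 hr] := @heine_itv _ (N%:R+2) _ cphi _ e1.
have m1 : 0 < Num.min r 1 by pos.
apply: small_mono (small_and (small_and (QZ cphi phim e1) (QZ (@cutoff_continuous _ N%:R) (cut1 N%:R) e1))
 (small_and (YQ m1 e1) small1)) _=> eps _ [[]].
rewrite !ler_norml=> /andP[p1 p2] /andP[c1 c2] [[B [mB PB hB]] he].
have b1 := bQ he cphi phim; have b2 := bQ he (@cutoff_continuous _ N%:R) (cut1 N%:R).
have bc c : bounded_rv (fun w=> c+2 * m*(-1+cutoff N%:R (Q eps w))).
 apply: bounded_rvD; first exact: bounded_rv_cst.
 by apply: bounded_rvM; [exact: bounded_rv_cst|apply: bounded_rvD=> //; exact: bounded_rv_cst].
have Ebc c : Ex P (fun w=> c+2 * m*(-1+cutoff N%:R (Q eps w))) = c+2 * m*(-1+Ex P (fun w=> cutoff N%:R (Q eps w))).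
 rewrite ExD; [|exact: bounded_rv_cst|by apply: bounded_rvM; [exact: bounded_rv_cst|apply: bounded_rvD=> //; exact: bounded_rv_cst]].
 rewrite Ex_cst ExZ; last by apply: bounded_rvD=> //; exact: bounded_rv_cst.
 by rewrite ExD ?Ex_cst//; exact: bounded_rv_cst.
(* Nonnegativity and |Y - Q| <= 1 keep both values in [0, N+2] when Q < N + 1; for larger Q the
   cut-off vanishes and the bound 2m suffices. *)
have key w : ~ B w -> `|phi (Y eps w)-phi (Q eps w)| <= e+2 * m*(1-cutoff N%:R (Q eps w)).
 move=> /hB; rewrite le_min=> /andP[d1 d2]; have [q0 y0] := QY0 w he.
 have /andP[k0 k1] := cutoff_itv N%:R (Q eps w).
 case: (leP (N%:R+1) (Q eps w))=> hq.
  rewrite cutoff0// subr0 mulr1; apply: le_trans (ler_normB _ _) _.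
  by have := phim (Y eps w); have := phim (Q eps w); lra.
 have /hr : `|Y eps w-Q eps w| <= r by [].
 move=> h; apply: le_trans (h _ _) _; [|by apply/andP; split; lra|by rewrite lerDl mulr_ge0 ?mulr_ge0// subr_ge0].
 by move: d2; rewrite ler_norml=> /andP[? ?]; apply/andP; split; lra.
have d01 w : 0 <= 2 * m*(1-cutoff N%:R (Q eps w)).
 by have /andP[? ?] := cutoff_itv N%:R (Q eps w); rewrite mulr_ge0 ?mulr_ge0// subr_ge0.
have mc : 2 * m*(1-Ex P (fun w=> cutoff N%:R (Q eps w))) <= 2 * m*(2*e).
 by rewrite ler_wpM2l ?mulr_ge0//; lra.
apply/andP; split.
 apply: le_trans (expectation_lower (g := fun w=> phi (Q eps w)+(- e+2 * m*(-1+cutoff N%:R (Q eps w)))) mB PB (mulr_ge0 (ler0n _ 2) m0) _ _ _).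
 - by rewrite lee_fin ExD// Ebc; lra.
 - exact: bounded_rvD.
 - by move=> w /key; rewrite ler_norml=> /andP[? ?]; lra.
 - move=> w; have := d01 w; move: (phim (Y eps w)) (phim (Q eps w)); rewrite !ler_norml=> /andP[? ?] /andP[? ?]; lra.
apply: le_trans (expectation_upper (g := fun w=> phi (Q eps w) + -1*(- e+2 * m*(-1+cutoff N%:R (Q eps w)))) mB PB (mulr_ge0 (ler0n _ 2) m0) _ _ _) _.
- by apply: bounded_rvD=> //; apply: bounded_rvM=> //; exact: bounded_rv_cst.
- by move=> w /key; rewrite ler_norml=> /andP[? ?]; lra.
- move=> w; have := d01 w; move: (phim (Y eps w)) (phim (Q eps w)); rewrite !ler_norml=> /andP[? ?] /andP[? ?]; lra.
rewrite lee_fin ExD//; last by apply: bounded_rvM=> //; exact: bounded_rv_cst.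
by rewrite ExZ// Ebc; lra.
Unshelve. all: by end_near. Qed.

Lemma cutoff_slope_continuous (c a u : R) : continuous (fun x=> cutoff 0 (a*(c-x)+u) : R).
apply: (@cont_comp _ _ _ (fun x=> a*(c-x)+u) (cutoff 0)); last exact: cutoff_continuous.
by move=> x; apply: cvgD; [apply: cvgM; [exact: cvg_cst|apply: cvgB; [exact: cvg_cst|exact: cvg_id]]|exact: cvg_cst].
Qed.

Let large (x : R) : 0 < x -> \forall n \near \oo, 3 <= n.+1%:R*x.
move=> x0; have x3 : 0 < x/3 by rewrite divr_gt0.
near=> n; rewrite mulrC -ler_pdivrMr ?ltr0n// -ler_pdivlMl// mulrC ltW//.
by near: n; exact: (near_infty_natSinv_lt (PosNum x3)).
Unshelve. all: by end_near. Qed.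

(** The ramps [lo] and [hi] enclose the indicator of x > c; as they steepen, their means under the
    limit law tend to P(Z > c) and P(Z >= c), which agree when c is not an atom. *)
Lemma indicator_cvg (c alpha : R) : 0 < alpha -> P' [set w | c < Z w] = alpha%:E ->
 (0 < Ex P' (fun w=> (c < Z w)%R%:R : R) -> mrv (fun w=> (c < Z w)%R%:R : R) ->
   Ex P' (fun w=> (Z w == c)%:R : R) = 0) ->
 ('E_P[(fun w=> \1_[set w' | c < Y eps w'] w : R)%R])%E @[eps --> (0 : R)^'+] --> alpha%:E.
move=> a0 hal noatom; pose lo n x : R := cutoff 0 (n.+1%:R*(c-x)+1); pose hi n x : R := cutoff 0 (n.+1%:R*(c-x)+0).
have clo n : continuous (lo n) by exact: cutoff_slope_continuous.
have chi n : continuous (hi n) by exact: cutoff_slope_continuous.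
have mc (g : R -> R) : continuous g -> mrv (fun w=> g (Z w)).
 by move=> cg; apply: (measurableT_comp _ mZ); exact: continuous_measurable_fun.
have lo0 n x : x <= c -> lo n x = 0.
 by move=> h; rewrite /lo cutoff0// lerD2r mulr_ge0// subr_ge0.
have hi1 n x : c <= x -> hi n x = 1.
 by move=> h; rewrite /hi cutoff1// addr0 mulr_ge0_le0// subr_le0.
have llim x : lo n x @[n --> \oo] --> ((c < x)%R%:R : R).
 apply: cvg_near_cst; case: (ltP c x)=> h; last by apply: nearW=> n; exact: lo0.
 have h0 : 0 < x-c by rewrite subr_gt0.
 near=> n; rewrite /lo cutoff1// -(opprB x c) mulrN.
 have : 3 <= n.+1%:R*(x-c) by near: n; exact: large h0.
 lra.
have hlim x : hi n x @[n --> \oo] --> ((c <= x)%R%:R : R).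
 apply: cvg_near_cst; case: (leP c x)=> h; first by apply: nearW=> n; exact: hi1.
 have h0 : 0 < c-x by rewrite subr_gt0.
 near=> n; rewrite /hi cutoff0//; have : 3 <= n.+1%:R*(c-x) by near: n; exact: large h0.
 lra.
have mlt : mrv (fun w=> (c < Z w)%R%:R : R).
 by apply: (measurable_fun_cvg (h := fun n w=> lo n (Z w)))=> [n|w _]; [exact: mc|exact: llim].
have blt : bounded_rv (fun w=> (c < Z w)%R%:R : R).
 by split=> //; exists 1=> w; case: (_ < _); rewrite ?normr1 ?normr0.
have Elt : Ex P' (fun w=> (c < Z w)%R%:R : R) = alpha.
 have mA : measurable [set w | c < Z w].
  rewrite (_ : [set w | _] = Z @^-1` `]c, +oo[); last by apply/seteqP; split=> w /=; rewrite in_itv /= andbT.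
  by rewrite -[X in measurable X]setTI; exact: mZ.
 apply: EFin_inj; rewrite ExE// -hal -[X in P' X]setIT -integral_indic//.
 by apply: eq_integral=> w _; rewrite indic_pred.
(* Since alpha > 0, the event Z > c has positive probability, as [noatom] requires. *)
have Ele : Ex P' (fun w=> (c <= Z w)%R%:R : R) = alpha.
 have e0 := noatom _ mlt; rewrite Elt in e0; have be := bounded_rv_eq c mZ.
 rewrite -[alpha]addr0 -(e0 a0) -Elt -ExD//.
 by congr Ex; apply/funext=> w; case: ltgtP=> _; rewrite ?addr0 ?add0r.
have near_lim (g : nat -> R -> R) l : (forall n, continuous (g n)) -> (forall n x, `|g n x| <= 1) ->
  (forall x, g n x @[n --> \oo] --> (l x)) -> forall e, 0 < e ->
  exists n, `|Ex P' (fun w=> l (Z w))-Ex P' (fun w=> g n (Z w))| <= e.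
 move=> cg g1 gl e e0; have : Ex P' (fun w=> g n (Z w)) @[n --> \oo] --> Ex P' (fun w=> l (Z w)).
  apply: (Ex_cvg (M := 1))=> //; first by move=> n; exact: mc.
  by apply: (measurable_fun_cvg (h := fun n w=> g n (Z w)))=> [n|w _]; [exact: mc|exact: gl].
 by move=> /(@cvgrPdist_le _ R)/(_ e e0)[n _ /(_ n (leqnn n))]; exists n.
apply: cvg_small=> e0 e00; have e1 : 0 < e0/2 by rewrite divr_gt0.
have [i] := near_lim hi (fun x=> (c <= x)%R%:R) chi (fun n x=> cut1 _ _) hlim _ e1.
have [k] := near_lim lo (fun x=> (c < x)%R%:R) clo (fun n x=> cut1 _ _) llim _ e1.
rewrite Ele Elt !ler_norml=> /andP[k1 k2] /andP[i1 i2].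
apply: small_mono (small_and (Ex_bounded_close (clo k) (fun x=> cut1 _ _) e1) (Ex_bounded_close (chi i) (fun x=> cut1 _ _) e1)) _.
move=> eps _ [/andP[l1 _] /andP[_ h1]]; apply/andP; split.
 apply: le_trans (_ : _ <= 'E_P[fun w=> lo k (Y eps w)])%E _.
  by apply: le_trans l1; rewrite lee_fin; lra.
 apply: le_expectation=> w; rewrite indic_pred; case: ltP=> [_|/lo0 ->//].
 by case/andP: (cutoff_itv 0 (k.+1%:R*(c-Y eps w)+1)).
apply: le_trans (_ : _ <= 'E_P[fun w=> hi i (Y eps w)])%E _; last by apply: le_trans h1 _; rewrite lee_fin; lra.
apply: le_expectation=> w; rewrite indic_pred; case: ltP=> [/ltW/hi1 ->//|_].
by case/andP: (cutoff_itv 0 (i.+1%:R*(c-Y eps w)+0)).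
Unshelve. all: by end_near. Qed.

End Limit_in_law.

Section Law.
Context {R : realType} {d : measure_display} {Omega : measurableType d}.
Variables (P : probability Omega R) (Z : Omega -> R).
Hypothesis mZ : mrv Z.

Let Zm : {mfun Omega >-> measurableTypeR R} := HB.pack Z (isMeasurableFun.Build _ _ Omega (measurableTypeR R) Z mZ).
Definition law : probability (measurableTypeR R) R := distribution P Zm.

Lemma law_integral (f : R -> R) (m : R) : continuous f -> (forall x, `|f x| <= m) ->
 (\int[law]_x (f x)%:E)%E = (Ex P (fun w=> f (Z w)))%:E.
move=> cf fm; have bf := bounded_rv_comp mZ cf fm; rewrite ExE//.
apply: (@integral_distribution _ _ _ _ _ P Zm (fun x=> (f x)%:E)).
 by apply/measurable_EFinP; exact: continuous_measurable_fun.
exact: bounded_rv_integrable.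
Qed.

End Law.

Theorem theorem1 (R : realType) (T x0 : R) (hT : 0 < T)
    (d' : measure_display) (Omega' : measurableType d')
    (P' : probability Omega' R) (B : R -> Omega' -> R)
    (hB : brownian_bridge P' B) :
  exists mu : probability (measurableTypeR R) R,
  forall (a b : R) (hab : a < b)
    (S : R -> R -> R -> R) (sigma : R -> R -> R) (xs : R -> R -> R),
  let Theta : set R := [set theta | a < theta < b] in
  (forall theta t x : R, Theta theta -> 0 <= t <= T -> 0 < S theta t x) ->
  (forall t x : R, 0 <= t <= T -> 0 < sigma t x) ->
  (forall theta : R, Theta theta -> ode_solution T x0 (S theta) (xs theta)) ->
  condC1 T Theta S sigma ->
  condC2 T sigma ->
  condC3 T Theta S sigma xs ->
  condC4 T Theta S sigma ->
  forall (d : measure_display) (Omega : measurableType d)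
    (P : probability Omega R) (F : R -> set (set Omega))
    (W : R -> Omega -> R),
  filtration F T ->
  wiener P F T W ->
  forall (theta : R) (X : R -> R -> Omega -> R),
  Theta theta ->
  (forall eps : R, 0 < eps < 1 ->
     sde_solution P F T x0 (S theta) sigma eps W (X eps)) ->
  forall (J : R -> R -> Omega -> R) (theta_hat : R -> Omega -> R),
  (forall eps : R, 0 < eps < 1 ->
     likelihood_integral P F T Theta S sigma eps (X eps) (J eps)) ->
  (forall eps : R, 0 < eps < 1 ->
     mle P T Theta S sigma eps (X eps) (J eps) (theta_hat eps)) ->
  let delta_eps := fun (eps : R) (w : Omega) =>
    stat_delta T x0 S sigma xs eps (theta_hat eps w) (fun t => X eps t w) in
  let psi_hat := fun (c eps : R) (w : Omega) =>
    (\1_[set w' | c < delta_eps eps w'] w : R) in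
  cvg_law P delta_eps mu /\
  forall alpha c : R, 0 < alpha < 1 ->
    P' [set w | c < bridge_functional B w] = alpha%:E ->
    ('E_P[psi_hat c eps])%E @[eps --> (0 : R)^'+] --> alpha%:E.
Proof.
have [mB cB _] := hB; pose bf := bridge_functional B.
have mbf : mrv bf := functional_measurable mB cB.
(* The limit law is built from the bridge alone, before the model is introduced; this is the
   distribution-freeness. *)
exists (law P' mbf) => a b hab S sigma xs Theta _ spos hode hC1 hC2 hC3 hC4 d Omega P F W hF hW
 theta X hth hX J theta_hat hJ hmle delta_eps psi_hat.
have [Q [mQ Q0 dQ QB]] := statistic_law hT spos hode hC1 hC2 hC3 hC4 hth hF hW hX hJ hmle (bridge_normal_sym hB) hB.
split=> [f cf [m fm]|alpha c /andP[a0 a1] hal].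
 rewrite (law_integral P' mbf cf fm); apply: cvg_small; exact: (Ex_bounded_close mbf mQ Q0 dQ QB cf fm).
apply: (indicator_cvg mbf mQ Q0 dQ QB a0 hal).
(* Multiplicativity of the Gaussian cosine is supplied by the Wiener process driving the
   observation. *)
exact: (bridge_no_atom hB (gauss_cosD hB hT hF hW)).
Qed.
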